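(* Let $N,\tilde N$ be two Lie groups, let $\mathcal G$ be a Lie group and let $\Xi:N\times\mathcal G\to\tilde N$, $(z,g)\mapsto\Xi_g(z)$, be smooth with $\Xi_g(1_N)=1_{\tilde N}$ for all $g\in\mathcal G$. Suppose that $(X,\tilde Z)$, where $X$ is a semimartingale on a manifold $M$ and $\tilde Z$ is a semimartingale on $\tilde N$, is a solution to the canonical SDE $\Psi_{K_t}$. If $Z$ is a semimartingale on $N$, $G_t$ is a predictable locally bounded process in $\mathcal G$ and $d\tilde Z_t=\Xi_{G_t}(dZ_t)$, then $(X,Z)$ is a solution to the canonical SDE $\hat\Psi_{K_t,G_t}$ defined by $$\hat\Psi_{k,g}(x,z)=\Psi_k(x,\Xi_g(z)),\qquad x\in M,\ z\in N.$$
   Context: A filtered probability space is fixed. A semimartingale on a smooth manifold $M$ is an adapted càdlàg $M$-valued process $X$ such that $f(X)$ is a real semimartingale for every $f\in C^\infty(M)$. Repeated indices are summed. Geometrical SDEs. Let $M,N$ be smooth manifolds, $\mathcal K$ a metric space, and $\overline\Psi:M\times N\times N\times\mathcal K\to M$, $(x,z',z,k)\mapsto\overline\Psi_k(x,z',z)$, with $\overline\Psi_k(x,z,z)=x$, smooth in the $M,N$ variables and such that $\overline\Psi$ and all its derivatives in the $M,N$ variables are continuous in all arguments. Let $K$ be a predictable locally bounded process in $\mathcal K$. If $M\subset\mathbb R^m$, $N\subset\mathbb R^n$ are open, $(X,Z)$ solves the geometrical SDE $dX_t=\overline\Psi_{K_t}(dZ_t)$ if for $t\ge0$ $$X^i_t-X^i_0=\int_0^t\partial_{z'^\alpha}\overline\Psi^i_{K_s}(X_{s_-},Z_{s_-},Z_{s_-})dZ^\alpha_s+\frac12\int_0^t\partial_{z'^\alpha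 z'^\beta}\overline\Psi^i_{K_s}(X_{s_-},Z_{s_-},Z_{s_-})d[Z^\alpha,Z^\beta]^c_s$$ $$+\sum_{0\le s\le t}\{\overline\Psi^i_{K_s}(X_{s_-},Z_s,Z_{s_-})-\overline\Psi^i_{K_s}(X_{s_-},Z_{s_-},Z_{s_-})-\partial_{z'^\alpha}\overline\Psi^i_{K_s}(X_{s_-},Z_{s_-},Z_{s_-})\Delta Z^\alpha_s\}.$$ For general manifolds, $(X,Z)$ is a solution if for any embeddings $i_1,i_2$ of $M,N$ in Euclidean spaces and any extension $\tilde\Psi_k$ of $\overline\Psi_k$ (i.e. $\tilde\Psi_k(i_1(x),i_2(z'),i_2(z))=i_1(\overline\Psi_k(x,z',z))$, same regularity), the Euclidean processes $\xi=i_1(X)$ and $\zeta=i_2(Z)$ satisfy, for $t\ge0$, $$\xi^i_t-\xi^i_0=\int_0^t\partial_{z'^\alpha}\tilde\Psi^i_{K_s}(\xi_{s_-},\zeta_{s_-},\zeta_{s_-})d\zeta^\alpha_s+\frac12\int_0^t\partial_{z'^\alpha z'^\beta}\tilde\Psi^i_{K_s}(\xi_{s_-},\zeta_{s_-},\zeta_{s_-})d[\zeta^\alpha,\zeta^\beta]^c_s$$ $$+\sum_{0\le s\le t}\{\tilde\Psi^i_{K_s}(\xi_{s_-},\zeta_s,\zeta_{s_-})-\tilde\Psi^i_{K_s}(\xi_{s_-},\zeta_{s_-},\zeta_{s_-})-\partial_{z'^\alpha}\tilde\Psi^i_{K_s}(\xi_{s_-},\zeta_{s_-},\zeta_{s_-})\Delta\zeta^\alpha_s\}.$$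 Canonical SDEs. If the driving manifold $N$ is a Lie group and $\Psi_k:M\times N\to M$ ($k\in\mathcal K$) has the corresponding regularity and $\Psi_k(x,1_N)=x$, then ''$(X,Z)$ is a solution to the canonical SDE $\Psi_{K_t}$'' (written $dX_t=\Psi_{K_t}(dZ_t)$) means that $(X,Z)$ solves the geometrical SDE with $\overline\Psi_k(x,z',z)=\Psi_k(x,z'\cdot z^{-1})$. Transformed noise. For $\Xi_g:N\to\tilde N$ with $\Xi_g(1_N)=1_{\tilde N}$ and a semimartingale $Z$ on $N$, $d\tilde Z_t=\Xi_{G_t}(dZ_t)$ means that $\tilde Z$ is the unique solution with $\tilde Z_0=1_{\tilde N}$ of the canonical SDE $d\tilde Z_t=\tilde\Psi_{G_t}(dZ_t)$ on $\tilde N$, where $\tilde\Psi_g(\tilde z,z)=\Xi_g(z)\cdot\tilde z$. *)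

(* Defs.v *)
From HB Require Import structures.
From mathcomp Require Import all_boot all_order all_algebra.
From mathcomp Require Import all_classical all_reals all_analysis.

Set Implicit Arguments.
Unset Strict Implicit.
Unset Printing Implicit Defensive.

Import Order.TTheory GRing.Theory Num.Theory.
Import numFieldNormedType.Exports.

Local Open Scope classical_set_scope.
Local Open Scope ring_scope.

(* [partials [:: i1; ...; ik] f] is the iterated partial derivative
   d/dx_i1 ( ... (d/dx_ik f)). *)
Definition partials (R : realType) (n : nat) (l : seq 'I_n)
    (f : 'rV[R]_n -> R) : 'rV[R]_n -> R :=
  foldr (fun i g x => 'D_(delta_mx 0 i) g x) f l.

Definition smooth_on (R : realType) (n : nat) (U : set 'rV[R]_n)
    (f : 'rV[R]_n -> R) : Prop :=
  forall (l : seq 'I_n) u, U u ->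
    (forall i, derivable (partials l f) u (delta_mx 0 i)) /\
    {for u, continuous (partials l f)}.

(* f is smooth in u, and each of its partial derivatives in u, of any order
   (0 included), is jointly continuous in (u, k). W is meant to be open. *)
Definition psmooth_on (R : realType) (n : nat) (K : topologicalType)
    (W : set ('rV[R]_n * K)) (f : 'rV[R]_n -> K -> R) : Prop :=
  forall (l : seq 'I_n) u k, W (u, k) ->
    (forall i, derivable (partials l (f^~ k)) u (delta_mx 0 i)) /\
    {for (u, k), continuous (fun p : 'rV[R]_n * K => partials l (f^~ p.2) p.1)}.

(* A chart is a map [cmap] that matters only on [cdom]; [cinv] is its inverse,
   and matters only on the image of [cdom]. *)
Record chart (R : realType) (M : topologicalType) (n : nat) := Chart {
  cdom : set M ;
  cmap : M -> 'rV[R]_n ;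
  cinv : 'rV[R]_n -> M }.

Definition cimg (R : realType) (M : topologicalType) (n : nat)
    (c : chart R M n) : set 'rV[R]_n := cmap c @` cdom c.

Definition is_chart (R : realType) (M : topologicalType) (n : nat)
    (c : chart R M n) : Prop :=
  [/\ open (cdom c), open (cimg c),
      forall x, cdom c x -> cinv c (cmap c x) = x,
      forall x, cdom c x -> {for x, continuous (cmap c)} &
      forall u, cimg c u -> {for u, continuous (cinv c)}].

(* A space with a family of charts, before any axiom is imposed; this makes the
   product below definable without proof obligations. *)
Record atlas_space (R : realType) := AtlasSpace {
  carrier :> topologicalType ;
  mdim : nat ;
  charts : set (chart R carrier mdim) }.

(* The atlas need not be maximal: the notions below do not depend on the choice
   of an atlas within a smooth structure. *)
Definition is_manifold (R : realType) (M : atlas_space R) : Prop :=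
  [/\ hausdorff_space M, @second_countable M,
      forall c, charts (a := M) c -> is_chart c,
      forall x : M, exists2 c, charts (a := M) c & cdom c x &
      forall c c', charts (a := M) c -> charts (a := M) c' -> forall j,
        smooth_on [set u | cimg c u /\ cdom c' (cinv c u)]
          (fun u => cmap c' (cinv c u) 0 j)].

Record manifold (R : realType) := Manifold {
  manifold_atlas :> atlas_space R ;
  manifold_axioms : is_manifold manifold_atlas }.

Definition prod_chart (R : realType) (M1 M2 : topologicalType) (n1 n2 : nat)
    (c1 : chart R M1 n1) (c2 : chart R M2 n2) :
    chart R (M1 * M2)%type (n1 + n2) :=
  @Chart R (M1 * M2)%type (n1 + n2) (cdom c1 `*` cdom c2)
    (fun x => row_mx (cmap c1 x.1) (cmap c2 x.2))
    (fun u => (cinv c1 (lsubmx u), cinv c2 (rsubmx u))).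

Definition prod_atlas (R : realType) (M1 M2 : atlas_space R) : atlas_space R :=
  @AtlasSpace R (M1 * M2)%type (mdim M1 + mdim M2)
    [set c | exists c1 c2, [/\ charts (a := M1) c1, charts (a := M2) c2 &
                               c = prod_chart c1 c2]].

(* f in C^oo(M) *)
Definition smooth_fun (R : realType) (M : atlas_space R) (f : M -> R) : Prop :=
  forall c, charts (a := M) c -> smooth_on (cimg c) (fun u => f (cinv c u)).

Definition smooth_map (R : realType) (M M' : atlas_space R) (f : M -> M') :
    Prop :=
  continuous f /\
  forall c c', charts (a := M) c -> charts (a := M') c' -> forall j,
    smooth_on [set u | cimg c u /\ cdom c' (f (cinv c u))]
      (fun u => cmap c' (f (cinv c u)) 0 j).

(* f is smooth in the variable in M, and f and all its derivatives in that
   variable are continuous in all arguments *)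
Definition psmooth_map (R : realType) (M M' : atlas_space R)
    (K : topologicalType) (f : M -> K -> M') : Prop :=
  continuous (fun p : M * K => f p.1 p.2) /\
  forall c c', charts (a := M) c -> charts (a := M') c' -> forall j,
    psmooth_on [set p | cimg c p.1 /\ cdom c' (f (cinv c p.1) p.2)]
      (fun u k => cmap c' (f (cinv c u) k) 0 j).

Definition embedding (R : realType) (M : atlas_space R) (m : nat)
    (e : M -> 'rV[R]_m) : Prop :=
  [/\ forall j, smooth_fun (fun x => e x 0 j),
      injective e,
      forall U : set M, open U -> exists2 V : set 'rV[R]_m,
        open V & U = e @^-1` V &
      forall c, charts (a := M) c -> forall u, cimg c u ->
        row_free (\matrix_(a < mdim M, j < m)
          'D_(delta_mx 0 a) (fun v => e (cinv c v) 0 j) u)].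

Record lie_group (R : realType) := LieGroup {
  lie_manifold :> manifold R ;
  lone : lie_manifold ;
  lmul : lie_manifold -> lie_manifold -> lie_manifold ;
  linv : lie_manifold -> lie_manifold ;
  lmulA : associative lmul ;
  lmul1 : left_id lone lmul ;
  lmulV : left_inverse lone linv lmul ;
  lmul_smooth : smooth_map (M := prod_atlas lie_manifold lie_manifold)
    (M' := lie_manifold)
    (fun p : lie_manifold * lie_manifold => lmul p.1 p.2) ;
  linv_smooth : smooth_map (M := lie_manifold) (M' := lie_manifold) linv }.

Arguments lone {R} _.

(* A process with values in E is a function [X : R -> T -> E]; only the times
   t >= 0 matter. *)

Record filtration (R : realType) (d : measure_display) (T : measurableType d) :=
  Filtration {
    filt :> R -> set (set T) ;
    filt_sigma : forall t, 0 <= t -> sigma_algebra setT (filt t) ;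
    filt_measurable : forall t, 0 <= t -> filt t `<=` measurable ;
    filt_mono : forall s t, 0 <= s -> s <= t -> filt s `<=` filt t }.

Section processes.
Context (R : realType) (d : measure_display) (T : measurableType d).
Context (P : probability T R) (F : filtration R T).

Definition indistinguishable (E : Type) (X Y : R -> T -> E) : Prop :=
  {ae P, forall w, forall t, 0 <= t -> X t w = Y t w}.

Definition adapted (E : topologicalType) (X : R -> T -> E) : Prop :=
  forall t, 0 <= t -> forall U : set E, open U -> F t (X t @^-1` U).

Definition cadlag (E : topologicalType) (x : R -> E) : Prop :=
  (forall t : R, 0 <= t -> x @ t^'+ --> x t) /\
  (forall t : R, 0 < t -> exists l : E, x @ t^'- --> l).

(* x_{t-}, with the convention x_{0-} = x_0 *)
Definition left_lim (E : ptopologicalType) (x : R -> E) (t : R) : E :=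
  if 0 < t then lim (x @ t^'-) else x 0.

Definition jump (x : R -> R) (t : R) : R := x t - left_lim x t.

(* the sum of an absolutely summable, possibly uncountable, real family *)
Definition sum_over (D : set R) (f : R -> R) : R :=
  fine (\esum_(s in D) (Num.max (f s) 0)%:E) -
  fine (\esum_(s in D) (Num.max (- f s) 0)%:E).

Definition stopping_time (tau : T -> \bar R) : Prop :=
  (forall w, (0 <= tau w)%E) /\
  forall t, 0 <= t -> F t [set w | (tau w <= t%:E)%E].

Definition localizing (tau : nat -> T -> \bar R) : Prop :=
  [/\ forall n, stopping_time (tau n),
      forall n w, (tau n w <= tau n.+1 w)%E &
      {ae P, forall w, tau ^~ w @ \oo --> +oo%E}].

Definition stopped (X : R -> T -> R) (tau : T -> \bar R) : R -> T -> R :=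
  fun t w => X (fine (Order.min t%:E (tau w))) w.

(* E[X_t | F_s] = X_s is expressed by its defining property. *)
Definition martingale (X : R -> T -> R) : Prop :=
  [/\ adapted X,
      forall t, 0 <= t -> P.-integrable setT (EFin \o X t) &
      forall s t A, 0 <= s -> s <= t -> F s A ->
        (\int[P]_(w in A) (X t w)%:E = \int[P]_(w in A) (X s w)%:E)%E].

Definition local_martingale0 (X : R -> T -> R) : Prop :=
  [/\ adapted X, forall w, cadlag (X ^~ w), forall w, X 0 w = 0 &
      exists2 tau, localizing tau & forall n, martingale (stopped X (tau n))].

Definition finite_variation0 (X : R -> T -> R) : Prop :=
  [/\ adapted X, forall w, cadlag (X ^~ w), forall w, X 0 w = 0 &
      forall w t, 0 <= t -> bounded_variation 0 t (X ^~ w)].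

Definition real_semimartingale (X : R -> T -> R) : Prop :=
  [/\ adapted X, forall w, cadlag (X ^~ w) &
      exists L A, [/\ local_martingale0 L, finite_variation0 A &
        forall t w, 0 <= t -> X t w = X 0 w + L t w + A t w]].

Definition semimartingale (M : atlas_space R) (X : R -> T -> M) : Prop :=
  [/\ adapted X, forall w, cadlag (X ^~ w) &
      forall f : M -> R, smooth_fun f ->
        real_semimartingale (fun t w => f (X t w))].

Definition predictable_rectangles : set (set (R * T)) :=
  [set B | exists A, F 0 A /\ B = [set 0] `*` A] `|`
  [set B | exists s u A, [/\ 0 <= s, s <= u, F s A & B = `]s, u] `*` A]].

Definition predictable (E : topologicalType) (H : R -> T -> E) : Prop :=
  forall U : set E, open U ->
    <<s [set p : R * T | 0 <= p.1], predictable_rectangles >>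
      [set p : R * T | 0 <= p.1 /\ U (H p.1 p.2)].

(* Bounded means contained in a compact set: this is the usual meaning for
   E = R, it needs no choice of a metric when E is a manifold, and it is what
   makes phi(H) locally bounded for every continuous phi. *)
Definition locally_bounded (E : topologicalType) (H : R -> T -> E) : Prop :=
  exists2 tau, localizing tau & forall n, exists2 C : set E, compact C &
    forall t w, 0 < t -> (t%:E <= tau n w)%E -> C (H t w).

(* Integration against the semimartingale X of the locally bounded predictable
   processes is the only operator, up to indistinguishability, with the
   properties below (Jacod-Shiryaev, Theorem I.4.31). The values may be modified
   on a P-null event, whence no adaptedness is required of them: F need not
   contain the null events. *)
Definition integral_operator (X : R -> T -> R)
    (J : (R -> T -> R) -> (R -> T -> R)) : Prop :=
  let adm H := predictable H /\ locally_bounded H in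
  [/\ forall H, adm H -> (forall w, cadlag (J H ^~ w)) /\
        (forall t, 0 <= t -> measurable_fun setT (J H t)),
      forall a H H', adm H -> adm H' ->
        indistinguishable (J (fun t w => a * H t w + H' t w))
          (fun t w => a * J H t w + J H' t w),
      forall A, F 0 A ->
        indistinguishable (J (fun t w => \1_([set 0] `*` A) (t, w)))
          (fun _ _ => 0),
      forall s u A, 0 <= s -> s <= u -> F s A ->
        indistinguishable (J (fun t w => \1_(`]s, u] `*` A) (t, w)))
          (fun t w => \1_A w * (X (Num.min u t) w - X (Num.min s t) w)) &
      forall (Hn : nat -> R -> T -> R) H B,
        (forall n, adm (Hn n)) -> adm H -> adm B ->
        (forall n t w, 0 < t -> `|Hn n t w| <= B t w) ->
        (forall t w, 0 < t -> Hn n t w @[n --> \oo] --> H t w) ->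
        forall t, 0 <= t -> forall e, 0 < e ->
          P [set w | e <= `|J (Hn n) t w - J H t w|] @[n --> \oo] --> 0%E].

(* Y = int_0^. H dX, for H predictable and locally bounded *)
Definition is_integral (H X Y : R -> T -> R) : Prop :=
  [/\ predictable H, locally_bounded H &
      exists2 J, integral_operator X J & indistinguishable Y (J H)].

(* C = [X, Y]^c, where [X, Y] = X Y - X_0 Y_0 - int X_- dY - int Y_- dX and
   [X, Y]^c = [X, Y] - sum_{s <= .} (jump X)_s (jump Y)_s *)
Definition is_cont_bracket (X Y C : R -> T -> R) : Prop :=
  exists I1 I2,
    [/\ is_integral (fun t w => left_lim (X ^~ w) t) Y I1,
        is_integral (fun t w => left_lim (Y ^~ w) t) X I2 &
        {ae P, forall w, forall t, 0 <= t ->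
          let J s := jump (X ^~ w) s * jump (Y ^~ w) s in
          summable `[0, t] (EFin \o J) /\
          C t w = X t w * Y t w - X 0 w * Y 0 w - I1 t w - I2 t w
                  - sum_over `[0, t] J}].

(* index of the coordinate z'^a of (x, z', z) in R^m x R^n x R^n *)
Definition zp (m n : nat) (a : 'I_n) : 'I_(m + (n + n)) :=
  rshift m (lshift n a).

Definition pt3 (m n : nat) (x : 'rV[R]_m) (z' z : 'rV[R]_n) :
  'rV[R]_(m + (n + n)) := row_mx x (row_mx z' z).

Definition euclidean_sde (m n : nat) (K : topologicalType)
    (Phi : 'rV[R]_(m + (n + n)) -> K -> 'rV[R]_m) (k : R -> T -> K)
    (xi : R -> T -> 'rV[R]_m) (zeta : R -> T -> 'rV[R]_n) : Prop :=
  let xi_ s w := left_lim (xi ^~ w) s in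
  let zeta_ s w := left_lim (zeta ^~ w) s in
  let zc a t w : R := zeta t w 0 a in
  let D i l s w : R :=
    partials l (fun u => Phi u (k s w) 0 i)
      (pt3 (xi_ s w) (zeta_ s w) (zeta_ s w)) in
  forall i : 'I_m,
  exists (I1 : 'I_n -> R -> T -> R) (C I2 : 'I_n -> 'I_n -> R -> T -> R),
    [/\ forall a, is_integral (D i [:: zp m a]) (zc a) (I1 a),
        forall a b, is_cont_bracket (zc a) (zc b) (C a b),
        forall a b, is_integral (D i [:: zp m a; zp m b]) (C a b) (I2 a b) &
        {ae P, forall w, forall t, 0 <= t ->
          let J s :=
            Phi (pt3 (xi_ s w) (zeta s w) (zeta_ s w)) (k s w) 0 i
            - Phi (pt3 (xi_ s w) (zeta_ s w) (zeta_ s w)) (k s w) 0 i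
            - \sum_a D i [:: zp m a] s w * jump (zc a ^~ w) s in
          summable `[0, t] (EFin \o J) /\
          xi t w 0 i - xi 0 w 0 i =
            \sum_a I1 a t w + 2^-1 * (\sum_a \sum_b I2 a b t w)
            + sum_over `[0, t] J}].

(* An extension of Psi is a map defined and regular on some open neighbourhood O
   of i1(M) x i2(N) x i2(N), possibly the whole Euclidean space. When M and N are
   open in R^m and R^n, Psi is thus an extension of itself. *)
Definition extends_along (M N : atlas_space R) (K : topologicalType)
    (Psi : K -> M -> N -> N -> M) (m n : nat)
    (i1 : M -> 'rV[R]_m) (i2 : N -> 'rV[R]_n)
    (Phi : 'rV[R]_(m + (n + n)) -> K -> 'rV[R]_m) : Prop :=
  (exists O : set 'rV[R]_(m + (n + n)),
    [/\ open O, forall x z' z, O (pt3 (i1 x) (i2 z') (i2 z)) &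
        forall i, psmooth_on [set p : _ * K | O p.1] (fun u k => Phi u k 0 i)])
  /\ forall k x z' z, Phi (pt3 (i1 x) (i2 z') (i2 z)) k = i1 (Psi k x z' z).

Definition geometrical_sde (M N : atlas_space R) (K : topologicalType)
    (Psi : K -> M -> N -> N -> M) (k : R -> T -> K)
    (X : R -> T -> M) (Z : R -> T -> N) : Prop :=
  forall (m n : nat) (i1 : M -> 'rV[R]_m) (i2 : N -> 'rV[R]_n)
      (Phi : 'rV[R]_(m + (n + n)) -> K -> 'rV[R]_m),
    embedding i1 -> embedding i2 -> extends_along Psi i1 i2 Phi ->
    euclidean_sde Phi k (fun t w => i1 (X t w)) (fun t w => i2 (Z t w)).

Definition canonical_sde (M : atlas_space R) (N : lie_group R)
    (K : topologicalType) (Psi : K -> M -> N -> M) (k : R -> T -> K)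
    (X : R -> T -> M) (Z : R -> T -> N) : Prop :=
  geometrical_sde (fun k x z' z => Psi k x (lmul z' (linv z))) k X Z.

(* d Zt = Xi_g (d Z) *)
Definition transformed_noise (N Nt : lie_group R) (G : topologicalType)
    (Xi : G -> N -> Nt) (g : R -> T -> G) (Z : R -> T -> N)
    (Zt : R -> T -> Nt) : Prop :=
  let solution Y :=
    [/\ semimartingale Y, {ae P, forall w, Y 0 w = lone Nt} &
        canonical_sde (fun h y z => lmul (Xi h z) y) g Y Z] in
  solution Zt /\ forall Y, solution Y -> indistinguishable Y Zt.

End processes.

(* Main.v *)
(* Embed M, Nt and N in Euclidean spaces (for the Lie group Nt an embedding is built from a
   separated family of translates of one chart), write xi, eta, zeta for the images of X, Zt, Z, and
   extend both canonical equations. Applying the equation of Zt to the embeddings (i, f), with f any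
   smooth function, gives Ito's formula for f(Zt); products of coordinates give the continuous
   brackets of eta, and eta has the jumps prescribed by the equation. Substituting eta in the
   equation of X shows that xi solves the equation whose coefficients are those of the composite
   extension Phi1(xi_-, Phi2(eta_-, z', zeta_-), eta_-). The given extension differs from the
   composite by a slice F that vanishes on N but has derivatives transverse to N. Their
   contributions cancel: with f = 0 the equation says that a slice vanishing on N contributes 0;
   applied to the defects z - pi(z) of local retractions pi onto N, and to their products with
   coordinates, it kills the normal components of dzeta and d[zeta, zeta]^c, through which the
   contribution of F factors.

   Integrals are handled through a functional monotone class argument on admissible integrands;
   in particular an identity between integrals and sums of jumps may be multiplied by any
   admissible process. *)
Require Import Defs.
From HB Require Import structures.
From mathcomp Require Import all_boot all_order all_algebra.
From mathcomp Require Import all_classical all_reals all_analysis.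
From mathcomp Require Import measurable_realfun ring lra.

Set Implicit Arguments.
Unset Strict Implicit.
Unset Printing Implicit Defensive.

Import Order.TTheory GRing.Theory Num.Theory.
Import numFieldNormedType.Exports.

Local Open Scope classical_set_scope.
Local Open Scope ring_scope.

(** * Differential calculus with a parameter *)

(** A solution is defined by what happens under every embedding and every extension. The goal brings
    its own embeddings of M and N, but the equation of [Zt] says nothing until Nt is embedded;
    translations keep the overlaps of a cover of Nt bounded, so finitely many coordinates suffice.
    Integrals are known only through the properties of [integral_operator]. Their existence for each
    coordinate, and the predictability of left limits on the manifolds, are read off from the
    equations, tested with extra coordinates. Uniqueness, multiplication by integrands and the jumps
    of an integral are derived. Jumps are the delicate point: the limits in [integral_operator] are
    in probability at fixed times, which does not control left limits, so uniform convergence along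
    paths is needed. The second difficulty is that derivatives of an extension at a point of N see
    directions that the process never takes. Two extensions of one map thus have different
    coefficients, and equality of the integrals has to be extracted from the requirement that the
    equation hold for all extensions. *)

Definition box (R : realType) n (u : 'rV[R]_n) (r : R) : set 'rV[R]_n :=
  [set z | forall j, `|z 0 j - u 0 j| < r].

Lemma nbhs_boxP (R : realType) n (u : 'rV[R]_n) (A : set 'rV[R]_n) :
  nbhs u A <-> exists2 r, 0 < r & box u r `<=` A.
Proof.
split.
  move=> /nbhs_ballP[r /= r0 rA]; exists r => // z zu; apply: rA.
  by split=> // i j; rewrite ord1 /ball /= distrC.
move=> [r r0 rA]; apply/nbhs_ballP; exists r => // z zu; apply: rA => j.
by have := zu.2 0 j; rewrite /ball /= distrC.
Qed.

Lemma line_is_derive (R : realType) n (f : 'rV[R]_n -> R) x v t :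
  derivable f (x + t *: v) v ->
  is_derive t 1 (fun s : R => f (x + s *: v)) ('D_v f (x + t *: v)).
Proof.
move=> df.
have E : (fun h : R => h^-1 *: (((fun s => f (x + s *: v)) \o shift t) (h *: 1) -
      f (x + t *: v))) =
    (fun h : R => h^-1 *: ((f \o shift (x + t *: v)) (h *: v) - f (x + t *: v))).
  apply/funext => h /=; congr (_ *: (f _ - _)).
  by rewrite [h *: 1]mulr1 scalerDl addrCA.
by apply: DeriveDef; rewrite /derivable /derive /= E.
Qed.

Lemma mvt_line (R : realType) n (f : 'rV[R]_n -> R) x v d :
  (forall c, (0 <= c <= d) || (d <= c <= 0) -> derivable f (x + c *: v) v) ->
  exists2 c, (0 <= c <= d) || (d <= c <= 0) &
    f (x + d *: v) - f x = d * 'D_v f (x + c *: v).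
Proof.
move=> df; set g := fun s : R => f (x + s *: v).
have dg c : (0 <= c <= d) || (d <= c <= 0) ->
    is_derive c 1 g ('D_v f (x + c *: v)).
  by move=> /df; exact: line_is_derive.
have g0 : f x = g 0 by rewrite /g scale0r addr0.
case: (lerP 0 d) => d0.
  have [||c cd E] := @MVT_segment R g (fun c => 'D_v f (x + c *: v)) 0 d d0.
  - move=> c; rewrite in_itv /= => /andP[c0 cd]; apply: dg.
    by rewrite (ltW c0) (ltW cd).
  - apply: derivable_within_continuous => c; rewrite in_itv /= => c0.
    by have [] := dg c; rewrite ?c0.
  exists c; first by move: cd; rewrite in_itv /= => ->.
  by rewrite g0 -/(g d) E subr0 mulrC.
have [||c cd E] := @MVT_segment R g (fun c => 'D_v f (x + c *: v)) d 0 (ltW d0).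
- move=> c; rewrite in_itv /= => /andP[c0 cd]; apply: dg.
  by rewrite (ltW c0) (ltW cd) orbT.
- apply: derivable_within_continuous => c; rewrite in_itv /= => c0.
  by have [] := dg c; rewrite ?c0 ?orbT.
exists c; first by move: cd; rewrite in_itv /= => ->; rewrite orbT.
by rewrite g0 -/(g d) -opprB E sub0r mulrN opprK mulrC.
Qed.

(** Passing from [w] to [v] one coordinate at a time needs only partial derivatives. The
    intermediate points lie in every box that contains both ends, so they converge whenever the ends
    do. *)
Lemma mvt_box (R : realType) n (f : 'rV[R]_n -> R) u r v w :
  box u r v -> box u r w ->
  (forall z j, box u r z -> derivable f z (delta_mx 0 j)) ->
  exists2 c : 'I_n -> 'rV[R]_n,
    forall a e j, box a e v -> box a e w -> box a e (c j) &
    f v - f w = \sum_j (v 0 j - w 0 j) * 'D_(delta_mx 0 j) f (c j).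
Proof.
move=> uv uw df.
pose h k : 'rV[R]_n := \row_j (if (j < k)%N then v 0 j else w 0 j).
have hS (k : 'I_n) : h k.+1 = h k + (v 0 k - w 0 k) *: delta_mx 0 k.
  apply/rowP => j; rewrite !mxE eqxx /= ltnS leq_eqVlt.
  have [jk|jk] /= := eqVneq (j : nat) k.
    have -> : j = k by exact/val_inj.
    rewrite eqxx ltnn /= mulr1; ring.
  rewrite (_ : (j == k) = false); first by rewrite mulr0 addr0.
  by apply: contra_neqF jk => /eqP ->.
have step (k : 'I_n) : exists c, (forall a e, box a e v -> box a e w -> box a e c) /\
    f (h k.+1) - f (h k) = (v 0 k - w 0 k) * 'D_(delta_mx 0 k) f c.
  have hb a e c : (0 <= c <= v 0 k - w 0 k) || (v 0 k - w 0 k <= c <= 0) ->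
      box a e v -> box a e w -> box a e (h k + c *: delta_mx 0 k).
    move=> {uv uw} cd uv uw j; rewrite !mxE eqxx /=.
    have [->|jk] := eqVneq j k; last first.
      by rewrite mulr0 addr0; case: ifP.
    rewrite ltnn /= mulr1; have := uv k; have := uw k.
    rewrite !ltr_norml => /andP[a1 a2] /andP[a3 a4].
    by case/orP: cd => /andP[b1 b2]; apply/andP; split; lra.
  have [c cd E] := mvt_line (fun c cd => df _ k (hb u r c cd uv uw)).
  by exists (h k + c *: delta_mx 0 k); split; [move=> a e; exact: hb|rewrite hS].
have /choice[c cP] := step.
exists c; first by move=> a e j; have [+ _] := cP j; exact.
have En : v = h n by apply/rowP => j; rewrite mxE ltn_ord.
have E0 : w = h 0%N by apply/rowP => j; rewrite mxE.
have -> : f v - f w = (f \o h) n - (f \o h) 0%N by rewrite /= -E0 -En.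
rewrite -(telescope_sumr (f \o h) (leq0n n)) big_mkord.
by apply: eq_bigr => j _ /=; have [_ ->] := cP j.
Qed.

Lemma cvg_sumr (R : realType) (T : Type) (F : set_system T) {FF : Filter F} (I : Type) (r : seq I)
    (Q : pred I) (f : I -> T -> R) (l : I -> R) :
  (forall i, Q i -> f i @ F --> l i) ->
  (fun x => \sum_(i <- r | Q i) f i x) @ F --> \sum_(i <- r | Q i) l i.
Proof.
move=> fl; elim: r => [|i r IH].
  under eq_fun do rewrite big_nil.
  by rewrite big_nil; exact: cvg_cst.
rewrite big_cons; under eq_fun do rewrite big_cons.
by case: ifP => // Qi; apply: cvgD => //; exact: fl.
Qed.

(* Chain rule along a direction, from the mean value theorem in each coordinate:
   no Frechet differentiability of the inner map is needed. *)
Lemma is_derive_chain (R : realType) n m (f : 'rV[R]_m -> R)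
    (phi : 'rV[R]_n -> 'rV[R]_m) u v :
  (\forall z \near phi u, forall j, derivable f z (delta_mx 0 j)) ->
  (forall j, {for phi u, continuous (fun z => 'D_(delta_mx 0 j) f z)}) ->
  (forall j, derivable (fun z => phi z 0 j) u v) ->
  is_derive u v (fun z => f (phi z))
    (\sum_j 'D_v (fun z => phi z 0 j) u * 'D_(delta_mx 0 j) f (phi u)).
Proof.
move=> /nbhs_boxP[r0 r00 df] cf dphi.
have dphic j : {for 0, continuous (fun h : R => phi (h *: v + u) 0 j)}.
  apply/differentiable_continuous/derivable1_diffP.
  exact/((derivable1P (fun z => phi z 0 j) _ _).1 (dphi j)).
have nearbox e : 0 < e -> \forall h \near (0:R), box (phi u) e (phi (h *: v + u)).
  move=> e0; change (\forall h \near (0:R), forall j, `|phi (h *: v + u) 0 j - phi u 0 j| < e).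
  have H := @filter_forall R 'I_m (fun j h => `|phi (h *: v + u) 0 j - phi u 0 j| < e) (nbhs (0:R)) _.
  apply: H => j.
  have /cvgrPdist_lt /(_ _ e0) := dphic j; rewrite /= scale0r add0r.
  by apply: filterS => h; rewrite distrC.
have uu e : 0 < e -> box (phi u) e (phi u) by move=> e0 j; rewrite subrr normr0.
have /choice[c cP] : forall h : R, exists c : 'I_m -> 'rV[R]_m,
     box (phi u) r0 (phi (h *: v + u)) -> 
       f (phi (h *: v + u)) - f (phi u) =
         \sum_j (phi (h *: v + u) 0 j - phi u 0 j) * 'D_(delta_mx 0 j) f (c j)
         /\ forall e j, 0 < e -> box (phi u) e (phi (h *: v + u)) -> box (phi u) e (c j).
  move=> h; have [b|nb] := pselect (box (phi u) r0 (phi (h *: v + u))); last first.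
    by exists (fun=> 0).
  have [c c1 c2] := mvt_box b (uu _ r00) (fun z j zb => df z zb j).
  exists c => _; split=> // e j e0 be; apply: c1 => //; exact: uu.
have L : (fun h : R => h^-1 *: (((fun z => f (phi z)) \o shift u) (h *: v) - f (phi u)))
    @ 0^' --> \sum_j 'D_v (fun z => phi z 0 j) u * 'D_(delta_mx 0 j) f (phi u).
  have near0 (Q : R -> Prop) : (\forall h \near 0, Q h) -> \forall h \near 0^', Q h.
    by move=> q; apply: filterS q.
  apply: (@cvg_trans _ ((fun h : R => \sum_j
    (h^-1 *: (phi (h *: v + u) 0 j - phi u 0 j)) * 'D_(delta_mx 0 j) f (c h j)) @ 0^')).
    apply: near_eq_cvg; apply: near0.
    apply: filterS (nearbox _ r00) => h /cP[/= -> _].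
    by rewrite scaler_sumr; apply: eq_bigr => j _; rewrite scalerAl.
  apply: cvg_sumr => j _; apply: cvgM; first exact: dphi.
  suff cc : (fun h : R => c h j) @ 0^' --> phi u by exact: (cvg_comp _ _ cc (cf j)).
  move=> A /nbhs_boxP[e e0 eA]; apply: near0.
  have er : 0 < Num.min e r0 by rewrite lt_min e0.
  apply: filterS (nearbox _ er) => h hb; apply: eA.
  have [] := cP h.
    by move=> i; rewrite (lt_le_trans (hb i))// ge_min lexx orbT.
  move=> _ /(_ e j e0); apply.
  by move=> i; rewrite (lt_le_trans (hb i))// ge_min lexx.
apply: DeriveDef; first by apply/cvg_ex; eexists; exact: L.
exact: cvg_lim L.
Qed.

(* [psmooth_on] is the conjunction of the [pC k]; a finite order allows induction. *)
Fixpoint pC (R : realType) (k n : nat) (K : topologicalType)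
    (W : set ('rV[R]_n * K)) (f : 'rV[R]_n -> K -> R) : Prop :=
  (forall p, W p -> {for p, continuous (fun q : 'rV[R]_n * K => f q.1 q.2)}) /\
  if k is k'.+1 then
    forall i, (forall p, W p -> derivable (f^~ p.2) p.1 (delta_mx 0 i)) /\
      pC k' W (fun u q => 'D_(delta_mx 0 i) (f^~ q) u)
  else True.

(** [pC] peels off the innermost derivative, which is the last entry of the list in [partials];
    hence [rcons] and [last_ind]. *)
Lemma psmooth_onP (R : realType) n (K : topologicalType)
    (W : set ('rV[R]_n * K)) f : psmooth_on W f <-> forall k, pC k W f.
Proof.
split.
  move=> + k; elim: k f => [|k IH] f sf /=; split=> //.
  - by move=> [u q] Wp; have [_] := sf [::] u q Wp.
  - by move=> [u q] Wp; have [_] := sf [::] u q Wp.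
  - move=> i; split.
      by move=> [u q] Wp; have [+ _] := sf [::] u q Wp; exact.
    apply: IH => l u q Wp; have := sf (rcons l i) u q Wp.
    have E g : partials (rcons l i) g = partials l ('D_(delta_mx 0 i) g).
      by rewrite /partials foldr_rcons.
    rewrite E /=.
    by rewrite (_ : (fun p : _ * K => partials (rcons l i) (f^~ p.2) p.1) =
      fun p => partials l ('D_(delta_mx 0 i) (f^~ p.2)) p.1)//; apply/funext => p; rewrite E.
move=> + l; elim/last_ind: l f => [|l i IH] f sf u q Wp.
  by have [c /(_ _)/= d] := sf 1%N; split; [move=> i; have [/(_ _ Wp)] := d i|exact: c].
have := IH (fun v r => 'D_(delta_mx 0 i) (f^~ r) v) _ u q Wp.
have E g : partials (rcons l i) g = partials l ('D_(delta_mx 0 i) g).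
  by rewrite /partials foldr_rcons.
rewrite (_ : (fun p : _ * K => partials (rcons l i) (f^~ p.2) p.1) =
      fun p => partials l ('D_(delta_mx 0 i) (f^~ p.2)) p.1); last by apply/funext => p; rewrite E.
rewrite E; apply=> k; have [_ /(_ i)[]] := sf k.+1; exact.
Qed.

Lemma continuous_at_eq (T U : topologicalType) (f g : T -> U) p :
  (\forall z \near p, f z = g z) -> {for p, continuous f} -> {for p, continuous g}.
Proof.
move=> fg cf; rewrite /prop_for /continuous_at -(nbhs_singleton fg).
by apply: cvg_trans cf; apply: near_eq_cvg; exact: filterS fg.
Qed.

Lemma pC_cont (R : realType) n k (K : topologicalType) (W : set ('rV[R]_n * K)) f p :
  pC k W f -> W p -> {for p, continuous (fun q : 'rV[R]_n * K => f q.1 q.2)}.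
Proof. by case: k => [|k] [+ _]; exact. Qed.

Lemma pC_le (R : realType) n k (K : topologicalType) (W : set ('rV[R]_n * K)) f :
  pC k.+1 W f -> pC k W f.
Proof.
elim: k f => [|k IH] f [c d]; split=> // i.
by have [d1 d2] := d i; split=> //; exact: IH.
Qed.

Lemma pC_sub (R : realType) n k (K : topologicalType) (W W' : set ('rV[R]_n * K)) f :
  W' `<=` W -> pC k W f -> pC k W' f.
Proof.
move=> sW; elim: k f => [|k IH] f [c d]; split=> //; try by move=> p /sW; exact: c.
by move=> i; have [d1 d2] := d i; split; [move=> p /sW; exact: d1|exact: IH].
Qed.

(** Derivability and continuity in [pC] are those of the ambient space at each point of the set, so
    any pieces that cover [W] will do. *)
Lemma pC_local (R : realType) n k (K : topologicalType) (W : set ('rV[R]_n * K)) f :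
  (forall p, W p -> exists2 V, V p & pC k V f) -> pC k W f.
Proof.
elim: k f => [|k IH] f Wf; split=> //.
- by move=> p /Wf[V Vp []]; move=> /(_ _ Vp).
- by move=> p /Wf[V Vp []]; move=> /(_ _ Vp).
- move=> i; split.
    by move=> p /Wf[V Vp [_ /(_ i)[+ _]]]; exact.
  by apply: IH => p /Wf[V Vp [_ /(_ i)[_ h]]]; exists V.
Qed.

Lemma open_slice (R : realType) n (K : topologicalType) (W : set ('rV[R]_n * K)) p :
  open W -> W p -> \forall z \near p.1, W (z, p.2).
Proof.
move=> oW Wp; have : nbhs p W by exact: open_nbhs_nbhs.
by case=> -[A B] /= [nA /nbhs_singleton nB] AB; apply: filterS nA => z Az; exact: AB.
Qed.

Lemma open_near (T : topologicalType) (W : set T) (p : T) :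
  open W -> W p -> \forall z \near p, W z.
Proof. by move=> oW Wp; exact: open_nbhs_nbhs. Qed.

Lemma pC_eq (R : realType) n k (K : topologicalType) (W : set ('rV[R]_n * K)) f g :
  open W -> (forall u q, W (u, q) -> f u q = g u q) -> pC k W f -> pC k W g.
Proof.
move=> oW; elim: k f g => [|k IH] f g fg [c d].
  split=> // p Wp; apply: continuous_at_eq (c _ Wp).
  by apply: filterS (open_near oW Wp) => -[v r] /= /fg ->.
have nfg p : W p -> \forall z \near p.1, f z p.2 = g z p.2.
  by move=> Wp; apply: filterS (open_slice oW Wp) => z; exact: fg.
split.
  move=> p Wp; apply: continuous_at_eq (c _ Wp).
  by apply: filterS (open_near oW Wp) => -[v r] /= /fg ->.
move=> i; have [d1 d2] := d i; split.
  by move=> p Wp; apply: near_eq_derivable (nfg _ Wp) (d1 _ Wp).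
apply: IH d2 => u q Wp; apply: near_eq_derive; exact: nfg Wp.
Qed.

Lemma pC_param (R : realType) n k (K : topologicalType) (W : set ('rV[R]_n * K)) (c : K -> R) :
  open W -> (forall p, W p -> {for p.2, continuous c}) -> pC k W (fun _ q => c q).
Proof.
move=> oW; elim: k c => [|k IH] c cc.
  by split=> // p Wp; apply: (@continuous_comp _ _ _ snd c); [exact: cvg_snd|exact: cc].
split.
  by move=> p Wp; apply: (@continuous_comp _ _ _ snd c); [exact: cvg_snd|exact: cc].
move=> i; split; first by move=> p _; exact: derivable_cst.
apply: (pC_eq (f := fun _ _ => 0)) => //.
  by move=> u q _; rewrite (derive_cst (c q)).
by apply: (IH (fun=> 0)) => p _; exact: cst_continuous.
Qed.

Lemma pC_cst (R : realType) n k (K : topologicalType) (W : set ('rV[R]_n * K)) (c : R) :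
  open W -> pC k W (fun _ _ => c).
Proof. by move=> oW; apply: (pC_param _ (c := fun=> c)) => // p _; exact: cst_continuous. Qed.

Lemma is_derive_coord (R : realType) n (j : 'I_n) (u v : 'rV[R]_n) :
  is_derive u v (fun z : 'rV[R]_n => z 0 j) (v 0 j).
Proof.
have E : (fun h : R => h^-1 *: (((fun z : 'rV[R]_n => z 0 j) \o shift u) (h *: v) - u 0 j))
   @ 0^' --> v 0 j.
  apply: (@cvg_trans _ ((fun=> v 0 j) @ (0:R)^')); last exact: cvg_cst.
  apply: near_eq_cvg.
  have : \forall h \near (0:R)^', h != 0 by exact: nbhs_dnbhs_neq.
  by apply: filterS => h h0; rewrite /= !mxE addrK [_ *: _]mulrA mulVf ?mul1r.
by apply: DeriveDef; [apply/cvg_ex; eexists; exact: E|exact: cvg_lim E].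
Qed.

Lemma pC_coord (R : realType) n k (K : topologicalType) (W : set ('rV[R]_n * K)) (j : 'I_n) :
  open W -> pC k W (fun u _ => u 0 j).
Proof.
move=> oW; have c p : W p -> {for p, continuous (fun q : 'rV[R]_n * K => q.1 0 j)}.
  by move=> _; apply: (@continuous_comp _ _ _ fst (fun u : 'rV[R]_n => u 0 j));
      [exact: cvg_fst|exact: coord_continuous].
case: k => [|k]; split=> // i; split.
  by move=> p _; have [] := is_derive_coord j p.1 (delta_mx 0 i).
apply: (pC_eq (f := fun _ _ => delta_mx 0 i 0 j)) => //.
  by move=> u q _; have [_ ->] := is_derive_coord j u (delta_mx 0 i).
exact: (@pC_cst R n k K W (delta_mx 0 i 0 j : R)).
Qed.

Lemma pCD (R : realType) n k (K : topologicalType) (W : set ('rV[R]_n * K)) f g :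
  open W -> pC k W f -> pC k W g -> pC k W (fun u q => f u q + g u q).
Proof.
move=> oW; elim: k f g => [|k IH] f g [cf df] [cg dg].
  by split=> // p Wp; apply: (@continuousD R R^o); [exact: cf|exact: cg].
split; first by move=> p Wp; apply: (@continuousD R R^o); [exact: cf|exact: cg].
move=> i; have [df1 df2] := df i; have [dg1 dg2] := dg i; split.
  by move=> p Wp; apply: derivableD; [exact: df1|exact: dg1].
apply: pC_eq (IH _ _ df2 dg2) => // u q Wp.
by rewrite [RHS]deriveD//; [exact: df1 Wp|exact: dg1 Wp].
Qed.

Lemma pCM (R : realType) n k (K : topologicalType) (W : set ('rV[R]_n * K)) f g :
  open W -> pC k W f -> pC k W g -> pC k W (fun u q => f u q * g u q).
Proof.
move=> oW; elim: k f g => [|k IH] f g Cf Cg; have [cf df] := Cf; have [cg dg] := Cg.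
  by split=> // p Wp; exact: cvgM (cf _ Wp) (cg _ Wp).
split; first by move=> p Wp; exact: cvgM (cf _ Wp) (cg _ Wp).
move=> i; have [df1 df2] := df i; have [dg1 dg2] := dg i; split.
  by move=> p Wp; apply: derivableM; [exact: df1|exact: dg1].
apply: pC_eq (pCD oW (IH _ _ (pC_le Cf) dg2) (IH _ _ (pC_le Cg) df2)) => // u q Wp.
by rewrite [RHS]deriveM//; [exact: df1 Wp|exact: dg1 Wp].
Qed.

Lemma pC_sum (R : realType) n k (K : topologicalType) (W : set ('rV[R]_n * K))
    (I : Type) (r : seq I) (Q : pred I) (f : I -> 'rV[R]_n -> K -> R) :
  open W -> (forall i, Q i -> pC k W (f i)) -> pC k W (fun u q => \sum_(i <- r | Q i) f i u q).
Proof.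
move=> oW Cf; elim: r => [|i r IH].
  by apply: (pC_eq (f := fun _ _ => 0)) => //; [move=> *; rewrite big_nil|exact: pC_cst].
case Qi : (Q i); last by apply: pC_eq IH => // u q _; rewrite big_cons Qi.
by apply: pC_eq (pCD oW (Cf _ Qi) IH) => // u q _; rewrite big_cons Qi.
Qed.

Lemma pC_prod (R : realType) n k (K : topologicalType) (W : set ('rV[R]_n * K))
    (I : Type) (r : seq I) (Q : pred I) (f : I -> 'rV[R]_n -> K -> R) :
  open W -> (forall i, Q i -> pC k W (f i)) -> pC k W (fun u q => \prod_(i <- r | Q i) f i u q).
Proof.
move=> oW Cf; elim: r => [|i r IH].
  by apply: (pC_eq (f := fun _ _ => 1)) => //; [move=> *; rewrite big_nil|exact: pC_cst].
case Qi : (Q i); last by apply: pC_eq IH => // u q _; rewrite big_cons Qi.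
by apply: pC_eq (pCM oW (Cf _ Qi) IH) => // u q _; rewrite big_cons Qi.
Qed.

Lemma pCZ (R : realType) n k (K : topologicalType) (W : set ('rV[R]_n * K)) (c : R) f :
  open W -> pC k W f -> pC k W (fun u q => c * f u q).
Proof. by move=> oW Cf; apply: pCM => //; exact: pC_cst. Qed.

Lemma pCB (R : realType) n k (K : topologicalType) (W : set ('rV[R]_n * K)) f g :
  open W -> pC k W f -> pC k W g -> pC k W (fun u q => f u q - g u q).
Proof.
move=> oW Cf Cg; apply: pC_eq (pCD oW Cf (pCZ (-1) oW Cg)) => // u q _.
by rewrite mulN1r.
Qed.

Lemma rV_continuous (R : realType) (T : topologicalType) m (phi : T -> 'rV[R]_m) p :
  (forall j, {for p, continuous (fun q => phi q 0 j)}) -> {for p, continuous phi}.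
Proof.
move=> c A /nbhs_boxP[e e0 eA].
have : \forall q \near p, forall j, `|phi q 0 j - phi p 0 j| < e.
  apply: (@filter_forall _ _ (fun j q => `|phi q 0 j - phi p 0 j| < e)) => j.
  have /cvgrPdist_lt /(_ _ e0) := c j.
  by apply: filterS => h; rewrite distrC.
by apply: filterS => q qe; exact: eA.
Qed.

Lemma continuous_pair (T U V : topologicalType) (f : T -> U) (g : T -> V) p :
  {for p, continuous f} -> {for p, continuous g} ->
  {for p, continuous (fun x => (f x, g x))}.
Proof. by move=> cf cg; exact: cvg_pair. Qed.

Lemma continuous_snd_slice (R : realType) n (K : topologicalType) (V : topologicalType)
   (g : 'rV[R]_n * K -> V) p : {for p, continuous g} -> {for p.1, continuous (fun z => g (z, p.2))}.
Proof.
case: p => u q c.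
apply: (@continuous_comp _ _ _ (fun z : 'rV[R]_n => (z, q)) g) => //.
by apply: continuous_pair; [exact: cvg_id|exact: cst_continuous].
Qed.

(** The chain rule writes a derivative of the composite with derivatives of [phi] and composites of
    derivatives of [f]; the induction on the order therefore keeps [f] general. *)
Lemma pC_comp (R : realType) n m k (K K' : topologicalType) (W : set ('rV[R]_n * K))
    (W' : set ('rV[R]_m * K')) f (phi : 'rV[R]_n -> K -> 'rV[R]_m) (kappa : K -> K') :
  open W -> open W' -> (forall u q, W (u, q) -> W' (phi u q, kappa q)) ->
  (forall u q, W (u, q) -> {for q, continuous kappa}) ->
  (forall j, pC k W (fun u q => phi u q 0 j)) -> pC k W' f ->
  pC k W (fun u q => f (phi u q) (kappa q)).
Proof.
move=> oW oW' WW' ck; elim: k f => [|k IH] f Cphi Cf.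
  have c p : W p -> {for p, continuous (fun q : 'rV[R]_n * K => f (phi q.1 q.2) (kappa q.2))}.
    move=> Wp; apply: (@continuous_comp _ _ _
      (fun q : 'rV[R]_n * K => (phi q.1 q.2, kappa q.2)) (fun q => f q.1 q.2)).
      apply: continuous_pair.
        by apply: rV_continuous => j; exact: pC_cont (Cphi j) Wp.
      apply: continuous_comp; first exact: cvg_snd.
      by case: p Wp => u q /ck.
    by case: p Wp => u q Wp /=; apply: (pC_cont Cf); exact: WW'.
  by split.
split; first by move=> p; exact: (pC_cont (IH f (fun j => pC_le (Cphi j)) (pC_le Cf))).
have chain i p : W p -> is_derive p.1 (delta_mx 0 i) (fun u => f (phi u p.2) (kappa p.2))
   (\sum_j 'D_(delta_mx 0 i) (fun u => phi u p.2 0 j) p.1 *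
        'D_(delta_mx 0 j) (f^~ (kappa p.2)) (phi p.1 p.2)).
  move=> Wp; apply: (is_derive_chain (f := f^~ (kappa p.2))).
  - case: p Wp => u q Wp /=.
    apply: filterS (open_slice oW' (WW' _ _ Wp)) => z W'z j.
    by have [_ /(_ j)[/(_ _ W'z)]] := Cf.
  - move=> j; have [_ /(_ j)[_ Cj]] := Cf.
    case: p Wp => u q Wp /=.
    exact: (continuous_snd_slice (pC_cont Cj (WW' _ _ Wp))).
  - by move=> j; have [_ /(_ i)[/(_ _ Wp)]] := Cphi j.
move=> i; split; first by move=> p /(chain i)[].
apply: (pC_eq (f := fun u q => \sum_j 'D_(delta_mx 0 i) (fun u => phi u q 0 j) u *
        'D_(delta_mx 0 j) (f^~ (kappa q)) (phi u q))) => //.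
  by move=> u q Wp; have [_ ->] := chain i _ Wp.
apply: pC_sum => // j _; apply: pCM => //.
  by have [_ /(_ i)[]] := Cphi j.
apply: (IH (fun v r => 'D_(delta_mx 0 j) (f^~ r) v)).
  by move=> l; exact: pC_le.
by have [_ /(_ j)[]] := Cf.
Qed.

Lemma derive_line (R : realType) n (f : 'rV[R]_n -> R) u v :
  'D_v f u = 'D_1 (fun s : R => f (s *: v + u)) 0.
Proof.
have E : (fun h : R => h^-1 *: ((f \o shift u) (h *: v) - f u)) =
    (fun h : R => h^-1 *: (((fun s : R => f (s *: v + u)) \o shift 0) (h *: 1) - f (0 *: v + u))).
  by apply/funext => h /=; rewrite addr0 scale0r add0r [h%:A]mulr1.
by rewrite /derive E.
Qed.

Lemma is_derive_comp1 (R : realType) n (f : 'rV[R]_n -> R) (h : R -> R) u v dh :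
  is_derive (f u) 1 h dh -> derivable f u v ->
  is_derive u v (fun z => h (f z)) (dh * 'D_v f u).
Proof.
move=> [hd hv] df.
have f0 : f u = f (0 *: v + u) by rewrite scale0r add0r.
have dl : derivable (fun s : R => f (s *: v + u)) 0 1 by exact: (derivable1P f u v).1.
rewrite f0 in hd hv.
apply: DeriveDef.
  apply/derivable1P/derivable1_diffP.
  exact: (@differentiable_comp _ _ _ _ (fun s : R => f (s *: v + u)) h 0
    ((derivable1_diffP _ _).1 dl) ((derivable1_diffP _ _).1 hd)).
rewrite (derive_line (fun z => h (f z))) -derive1E.
have := @derive1_comp R (fun s : R => f (s *: v + u)) h 0 dl hd.
by rewrite ![in X in _ = X]derive1E hv -derive_line => <-.
Qed.

(* [h j] is the j-th derivative of a smooth real function. *)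
Lemma pC_comp1 (R : realType) n k (K : topologicalType) (W : set ('rV[R]_n * K)) f
    (h : nat -> R -> R) (D : set R) j : open W ->
  (forall j x, D x -> is_derive x 1 (h j) (h j.+1 x)) ->
  (forall u q, W (u, q) -> D (f u q)) ->
  pC k W f -> pC k W (fun u q => h j (f u q)).
Proof.
move=> oW dh WD; elim: k j => [|k IH] j Cf; have [cf df] := Cf.
  split=> // -[u q] Wp; apply: (@continuous_comp _ _ _ (fun q : 'rV[R]_n * K => f q.1 q.2) (h j)); first exact: cf.
  apply/differentiable_continuous/derivable1_diffP.
  by have [] := dh j (f u q) (WD _ _ Wp).
split; first by move=> p; exact: pC_cont (IH j (pC_le Cf)).
move=> i; have [d1 d2] := df i.
have E u q : W (u, q) -> is_derive u (delta_mx 0 i) (fun v => h j (f v q))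
    (h j.+1 (f u q) * 'D_(delta_mx 0 i) (f^~ q) u).
  move=> Wp; apply: (is_derive_comp1 (f := f^~ q)); last exact: d1 Wp.
  exact: dh (WD _ _ Wp).
split; first by move=> [u q] /E[].
apply: (pC_eq (f := fun u q => h j.+1 (f u q) * 'D_(delta_mx 0 i) (f^~ q) u)) => //.
  by move=> u q /E[_ ->].
by apply: pCM => //; exact: (IH j.+1 (pC_le Cf)).
Qed.

Lemma pCV (R : realType) n k (K : topologicalType) (W : set ('rV[R]_n * K)) f :
  open W -> (forall u q, W (u, q) -> f u q != 0) ->
  pC k W f -> pC k W (fun u q => (f u q)^-1).
Proof.
move=> oW f0 Cf.
elim: k f f0 Cf => [|k IH] f f0 Cf; have [cf df] := Cf.
  by split=> // -[u q] Wp; exact: cvgV (f0 _ _ Wp) (cf _ Wp).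
split; first by move=> p; exact: pC_cont (IH f f0 (pC_le Cf)).
move=> i; have [d1 d2] := df i; split.
  by move=> [u q] Wp; apply: derivableV; [exact: f0|exact: d1 Wp].
have IHf := IH f f0 (pC_le Cf).
apply: pC_eq (pCZ (-1) oW (pCM oW (pCM oW IHf IHf) d2)) => // u q Wp.
by rewrite [RHS]deriveV; [rewrite mulN1r -expr2 exprVn scaleNr|exact: f0|exact: d1 Wp].
Qed.

(** * The inverse function theorem *)

(** The parameter space is a dummy, taken to be [R], so that the calculus of [pC] applies to
    functions without parameter. *)
Definition sC (R : realType) (k n : nat) (U : set 'rV[R]_n) (f : 'rV[R]_n -> R) :=
  pC k [set p : 'rV[R]_n * R | U p.1] (fun u _ => f u).

Lemma open_fst (T K : topologicalType) (U : set T) :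
  open U -> open [set p : T * K | U p.1].
Proof.
move=> oU; have : open (fst @^-1` U : set (T * K)).
  by apply: open_comp => // x _; exact: cvg_fst.
by [].
Qed.

Lemma smooth_on_psmooth (R : realType) n (K : topologicalType) (U : set 'rV[R]_n) f :
  smooth_on U f -> psmooth_on [set p : 'rV[R]_n * K | U p.1] (fun u _ => f u).
Proof.
move=> sf l u q /= Uu; have [d c] := sf l u Uu; split=> //.
by apply: (@continuous_comp _ _ _ fst (partials l f)); [exact: cvg_fst|].
Qed.

Lemma psmooth_smooth_on (R : realType) n (K : topologicalType) (q : K) (U : set 'rV[R]_n) f :
  psmooth_on [set p : 'rV[R]_n * K | U p.1] (fun u _ => f u) -> smooth_on U f.
Proof.
move=> sf l u Uu; have [d c] := sf l u q Uu; split=> //.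
exact: (continuous_snd_slice c).
Qed.

Lemma smooth_onP (R : realType) n (U : set 'rV[R]_n) f :
  smooth_on U f <-> forall k, sC k U f.
Proof.
split; first by move=> /(@smooth_on_psmooth _ _ R)/psmooth_onP.
by move=> sf; apply: (@psmooth_smooth_on _ _ R 0); exact/psmooth_onP.
Qed.

Lemma sC_comp (R : realType) n m k (U : set 'rV[R]_n) (V : set 'rV[R]_m) f phi :
  open U -> open V -> (forall u, U u -> V (phi u)) ->
  (forall j, sC k U (fun u => phi u 0 j)) -> sC k V f -> sC k U (fun u => f (phi u)).
Proof.
move=> oU oV UV Cphi Cf.
apply: (pC_comp (W' := [set p : 'rV[R]_m * R | V p.1]) (f := fun v _ => f v)
  (phi := fun u _ => phi u) (kappa := id)) => //; try exact: open_fst.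
- by move=> u q /UV.
- by move=> u q _; exact: cvg_id.
Qed.

Lemma norm_leP (R : realType) n (x : 'rV[R]_n) e : 0 <= e ->
  `|x| <= e <-> forall j, `|x 0 j| <= e.
Proof.
move=> e0; rewrite [`|x|]mx_normrE; split.
  by move=> /bigmax_leP[_ h] j; exact: (h (0, j)).
by move=> h; apply/bigmax_leP; split=> // -[i j] _ /=; rewrite ord1.
Qed.

Lemma norm_ltP (R : realType) n (x : 'rV[R]_n) e : 0 < e ->
  `|x| < e <-> forall j, `|x 0 j| < e.
Proof.
move=> e0; rewrite [`|x|]mx_normrE; split.
  by move=> /bigmax_ltP[_ h] j; exact: (h (0, j)).
by move=> h; apply/bigmax_ltP; split=> // -[i j] _ /=; rewrite ord1.
Qed.

Lemma coord_norm_le (R : realType) n (x : 'rV[R]_n) j : `|x 0 j| <= `|x|.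
Proof. exact: (norm_leP x (normr_ge0 x)).1. Qed.

Lemma boxE (R : realType) n (u z : 'rV[R]_n) r : 0 < r -> box u r z <-> `|z - u| < r.
Proof.
by move=> r0; rewrite norm_ltP//; split=> h j; have := h j; rewrite !mxE.
Qed.

Lemma dist_continuous (R : realType) n (u : 'rV[R]_n) : continuous (fun z : 'rV[R]_n => `|z - u|).
Proof.
move=> z; apply: (@continuous_comp _ _ _ (fun z : 'rV[R]_n => z - u) (fun z => `|z|)).
  by apply: continuousB; [exact: cvg_id|exact: cst_continuous].
exact: norm_continuous.
Qed.

Lemma open_ball_set (R : realType) n (u : 'rV[R]_n) r : open [set z | `|z - u| < r].
Proof.
rewrite (_ : [set z | _] = (fun z : 'rV[R]_n => `|z - u|) @^-1` [set t | t < r])//.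
apply: open_comp; last exact: open_lt.
by move=> z _; exact: dist_continuous.
Qed.

(** Each coordinate of the difference is a sum of [n] terms, each at most [|w|] times the bound on
    the entries. With [n.+1] instead of [n] the bound also makes sense in dimension 0. *)
Lemma near_id_mulmx (R : realType) n (w : 'rV[R]_n) (A : 'M[R]_n) :
  (forall i j, `|A i j - (i == j)%:R| <= (2 * n.+1%:R)^-1) ->
  `|w *m A - w| <= 2^-1 * `|w|.
Proof.
move=> hA; apply/norm_leP; first by rewrite mulr_ge0.
move=> j; rewrite -{2}(mulmx1 w) !mxE -sumrB.
apply: le_trans (ler_norm_sum _ _ _) _.
apply: (@le_trans _ _ (\sum_(i < n) `|w| * (2 * n.+1%:R)^-1)).
  apply: ler_sum => i _; rewrite mxE -mulrBr normrM ler_pM//; exact: coord_norm_le.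
have n0 : n.+1%:R != 0 :> R by [].
rewrite sumr_const card_ord -[_ *+ n]mulr_natr.
have -> : `|w| / (2 * n.+1%:R) * n%:R = 2^-1 * `|w| * (n%:R / n.+1%:R) by field.
by rewrite ler_piMr ?mulr_ge0// ler_pdivrMr// mul1r ler_nat.
Qed.

Lemma near_id_unit (R : realType) n (A : 'M[R]_n) :
  (forall i j, `|A i j - (i == j)%:R| <= (2 * n.+1%:R)^-1) -> A \in unitmx.
Proof.
move=> hA; rewrite -row_free_unit; apply: inj_row_free => w wA.
have := near_id_mulmx w hA; rewrite wA sub0r normrN => h.
by apply/eqP; rewrite -normr_le0; have := normr_ge0 w; lra.
Qed.

Lemma pC_det (R : realType) n m k (K : topologicalType) (W : set ('rV[R]_n * K))
    (A : 'rV[R]_n -> K -> 'M[R]_m) :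
  open W -> (forall i j, pC k W (fun u q => A u q i j)) ->
  pC k W (fun u q => \det (A u q)).
Proof.
by move=> oW CA; apply: pC_sum => // s _; apply: pCM => //; [exact: pC_cst|exact: pC_prod].
Qed.

Lemma pC_invmx (R : realType) n m k (K : topologicalType) (W : set ('rV[R]_n * K))
    (A : 'rV[R]_n -> K -> 'M[R]_m) i j :
  open W -> (forall u q, W (u, q) -> A u q \in unitmx) ->
  (forall i j, pC k W (fun u q => A u q i j)) ->
  pC k W (fun u q => invmx (A u q) i j).
Proof.
move=> oW uA CA.
apply: (pC_eq (f := fun u q => (\det (A u q))^-1 * cofactor (A u q) j i)) => //.
  by move=> u q Wp; rewrite /invmx uA// !mxE.
apply: pCM => //.
  by apply: pCV => //; [move=> u q /uA; rewrite unitmxE unitfE|exact: pC_det].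
apply: pCM => //; first exact: pC_cst.
apply: pC_det => // a b; apply: pC_eq (CA (lift j a) (lift i b)) => // u q _.
by rewrite !mxE.
Qed.

Definition jac (R : realType) n m (h : 'rV[R]_n -> 'rV[R]_m) (u : 'rV[R]_n) : 'M[R]_(n, m) :=
  \matrix_(i, j) 'D_(delta_mx 0 i) (fun z => h z 0 j) u.

Lemma smooth_on_derivable (R : realType) n (U : set 'rV[R]_n) f :
  smooth_on U f -> forall u i, U u -> derivable f u (delta_mx 0 i).
Proof. by move=> sf u i Uu; have [d _] := sf [::] u Uu; exact: d. Qed.

Lemma smooth_on_continuous (R : realType) n (U : set 'rV[R]_n) f u :
  smooth_on U f -> U u -> {for u, continuous f}.
Proof. by move=> sf Uu; have [_] := sf [::] u Uu. Qed.

Lemma smooth_on_derive_continuous (R : realType) n (U : set 'rV[R]_n) f u i :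
  smooth_on U f -> U u -> {for u, continuous (fun z => 'D_(delta_mx 0 i) f z)}.
Proof. by move=> sf Uu; have [_] := sf [:: i] u Uu. Qed.

Lemma near_punctured (R : realType) (Q : R -> Prop) (x : R) :
  (\forall h \near x, Q h) -> \forall h \near x^', Q h.
Proof. by move=> q; apply: filterS q. Qed.

Section inverse_function.
Variables (R : realType) (n : nat) (U : set 'rV[R]_n) (h : 'rV[R]_n -> 'rV[R]_n).
Variables (u0 : 'rV[R]_n) (r : R).
Hypotheses (r0 : 0 < r) (rU : box u0 r `<=` U) (oU : open U).
Hypothesis sh : forall j, smooth_on U (fun u => h u 0 j).
Hypothesis small : forall z, box u0 r z -> forall i j,
  `|jac h z i j - (i == j)%:R| <= (2 * n.+1%:R)^-1.

Lemma jac_unit z : box u0 r z -> jac h z \in unitmx.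
Proof. by move=> zr; apply: near_id_unit; exact: small. Qed.

Let BU : forall z, box u0 r z -> U z. Proof. by move=> z; exact: rU. Qed.

Lemma mvt_map v w : box u0 r v -> box u0 r w ->
  exists2 c : 'I_n -> 'I_n -> 'rV[R]_n,
    forall a e i j, box a e v -> box a e w -> box a e (c i j) &
    h v - h w = (v - w) *m \matrix_(i, j) jac h (c i j) i j.
Proof.
move=> vr wr.
have /choice[c cP] : forall j, exists c : 'I_n -> 'rV[R]_n,
   (forall a e i, box a e v -> box a e w -> box a e (c i)) /\
   h v 0 j - h w 0 j = \sum_i (v 0 i - w 0 i) * 'D_(delta_mx 0 i) (fun z => h z 0 j) (c i).
  move=> j; have [c c1 c2] := mvt_box (f := fun z => h z 0 j) vr wr
    (fun z i zr => smooth_on_derivable (sh j) (BU zr)).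
  by exists c.
exists (fun i j => c j i); first by move=> a e i j; have [+ _] := cP j; exact.
apply/rowP => j; rewrite !mxE; have [_ ->] := cP j.
by apply: eq_bigr => i _; rewrite !mxE.
Qed.

Lemma near_id_map v w : box u0 r v -> box u0 r w ->
  `|h v - h w - (v - w)| <= 2^-1 * `|v - w|.
Proof.
move=> vr wr; have [c c1 ->] := mvt_map vr wr.
by apply: near_id_mulmx => i j; rewrite mxE; apply: small; exact: c1.
Qed.

Lemma near_id_inj v w : box u0 r v -> box u0 r w -> `|v - w| <= 2 * `|h v - h w|.
Proof.
move=> vr wr; have := near_id_map vr wr.
have := ler_normB (h v - h w - (v - w)) (h v - h w).
have -> : h v - h w - (v - w) - (h v - h w) = - (v - w) by rewrite addrAC subrr sub0r.
by rewrite normrN; lra.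
Qed.

(** The map [t u = u + y - h u] is a contraction by 1/2 of the closed ball of radius [r / 2], since
    [r / 4 + r / 4 = r / 2]. Its fixed point is found as a minimiser [c] of [|t u - u|] on this
    compact ball: the value at [t c] is at most half the value at [c]. *)
Lemma near_id_surj y : `|y - h u0| < r / 4 -> exists2 u, `|u - u0| <= r / 2 & h u = y.
Proof.
move=> yr; pose A := [set u | `|u - u0| <= r / 2].
pose t u := u + y - h u.
have Ar u : A u -> box u0 r u.
  by move=> Au; apply/(boxE u0 u r0); apply: le_lt_trans Au _; have := r0; lra.
have cA : compact A.
  apply: bounded_closed_compact.
    exists (`|u0| + r / 2); split; first exact: num_real.
    move=> M hM u /= Au.
    have := ler_normD (u - u0) u0; rewrite subrK; move: Au hM; rewrite /A /=; lra.
  rewrite (_ : A = (fun z : 'rV[R]_n => `|z - u0|) @^-1` [set t | t <= r / 2])//.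
  apply: preimage_closed; last exact: closed_le.
  by move=> z _; exact: dist_continuous.
have tc u v : A u -> A v -> `|t u - t v| <= 2^-1 * `|u - v|.
  move=> /Ar ur /Ar vr; have := near_id_map ur vr.
  rewrite -normrN; suff -> : - (h u - h v - (u - v)) = t u - t v by [].
  by apply/rowP => j; rewrite !mxE; ring.
have tA u : A u -> A (t u).
  move=> Au; have A0 : A u0 by rewrite /A /= subrr normr0; have := r0; lra.
  have := tc u u0 Au A0; have := ler_normD (t u - t u0) (t u0 - u0).
  rewrite subrKA (_ : t u0 - u0 = y - h u0); last by apply/rowP => j; rewrite !mxE; ring.
  by move: Au yr; rewrite /A /=; lra.
have [||c /set_mem Ac cmin] := @EVT_min_rV R n (fun u => `|t u - u|) A _ cA.
- by exists u0; rewrite /A /= subrr normr0; have := r0; lra.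
- apply: continuous_in_subspaceT => u /set_mem Au.
  apply: (@continuous_comp _ _ _ (fun z : 'rV[R]_n => t z - z) (fun z => `|z|)); last exact: norm_continuous.
  apply: continuousB; last exact: cvg_id.
  apply: continuousB; first by apply: continuousD; [exact: cvg_id|exact: cst_continuous].
  by apply: rV_continuous => j; exact: smooth_on_continuous (sh j) (BU (Ar _ Au)).
have := cmin (t c) (mem_set (tA _ Ac)); have := tc _ _ (tA _ Ac) Ac => h1 h2.
have : `|t c - c| <= 0 by lra.
rewrite normr_le0 /t => /eqP E; exists c => //.
apply/rowP => j; have /rowP/(_ j) := E; rewrite !mxE; lra.
Qed.

Lemma local_inverse : exists (V1 U1 : set 'rV[R]_n) (psi : 'rV[R]_n -> 'rV[R]_n),
  [/\ open V1, open U1, U1 u0, (forall u, U1 u -> V1 (h u) /\ psi (h u) = u) &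
    (forall y, V1 y -> box u0 r (psi y) /\ h (psi y) = y)] /\
  forall j, smooth_on V1 (fun y => psi y 0 j).
Proof.
(* By [near_id_map], [h] stretches distances by at most 3/2, so it sends the ball of radius [r / 6]
   into the ball of radius [r / 4] that [near_id_surj] covers. *)
pose V1 := [set y | `|y - h u0| < r / 4]; pose U1 := [set u | `|u - u0| < r / 6].
have /choice[psi psiP] : forall y, exists u, V1 y -> `|u - u0| <= r / 2 /\ h u = y.
  move=> y; have [|nV] := pselect (V1 y); last by exists 0.
  by move=> /near_id_surj[u u1 u2]; exists u.
have psib y : V1 y -> box u0 r (psi y) /\ h (psi y) = y.
  move=> /psiP[h1 h2]; split=> //; apply/boxE => //; apply: le_lt_trans h1 _; have := r0; lra.
have oV1 : open V1 by exact: open_ball_set.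
have Ub u : U1 u -> box u0 r u.
  by move=> Uu; apply/boxE => //; apply: lt_trans Uu _; have := r0; lra.
have u0b : box u0 r u0 by apply/boxE => //; rewrite subrr normr0.
exists V1, U1, psi; split.
  split=> //.
  - exact: open_ball_set.
  - by rewrite /U1 /= subrr normr0; have := r0; lra.
  - move=> u Uu; have V1u : V1 (h u).
      rewrite /V1 /=; have := near_id_map (Ub _ Uu) u0b.
      have := ler_normD (h u - h u0 - (u - u0)) (u - u0); rewrite subrK.
      by move: Uu; rewrite /U1 /=; lra.
    split=> //; have [b1 b2] := psib _ V1u.
    apply/eqP; rewrite -subr_eq0 -normr_le0.
    by have := near_id_inj b1 (Ub _ Uu); rewrite b2 subrr normr0; lra.
have lip y y' : V1 y -> V1 y' -> `|psi y - psi y'| <= 2 * `|y - y'|.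
  move=> /psib[b1 b2] /psib[b1' b2'].
  by have := near_id_inj b1 b1'; rewrite b2 b2'.
have cpsi y : V1 y -> {for y, continuous psi}.
  move=> Vy A /nbhs_boxP[e e0 eA].
  have e20 : 0 < e / 2 by lra.
  have oe : \forall z \near y, `|z - y| < e / 2.
    by apply: open_near; [exact: open_ball_set|rewrite /= subrr normr0].
  apply: filterS2 (open_near oV1 Vy) oe => z Vz zy; apply: eA; apply/boxE => //.
  by have := lip _ _ Vz Vy; lra.
have dpsi y i : V1 y -> forall j, is_derive y (delta_mx 0 i) (fun z => psi z 0 j)
   (invmx (jac h (psi y)) i j).
  move=> Vy; pose D := jac h (psi y).
  have [yb yh] := psib _ Vy.
  have uD : D \in unitmx by exact: jac_unit.
  have nearD e : 0 < e -> exists2 e', 0 < e' & forall z, box (psi y) e' z ->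
      forall a b, `|jac h z a b - D a b| < e.
    move=> e0; have : \forall z \near psi y, forall ab : 'I_n * 'I_n,
        `|jac h z ab.1 ab.2 - D ab.1 ab.2| < e.
      have H := @filter_forall 'rV[R]_n ('I_n * 'I_n)%type
        (fun ab z => `|jac h z ab.1 ab.2 - D ab.1 ab.2| < e) (nbhs (psi y)) _.
      apply: H => -[a b] /=.
      have /cvgrPdist_lt/(_ _ e0) := @smooth_on_derive_continuous _ _ _ _ _ a (sh b) (BU yb).
      by apply: filterS => z; rewrite distrC !mxE.
    by move=> /nbhs_boxP[e' e'0 H]; exists e' => // z /H zb a b; exact: (zb (a, b)).
  (* The difference quotient of [psi]. It is bounded by 2 because [psi] is 2-Lipschitz, and
     [mvt_map] gives [w t *m M = delta_mx 0 i] with [M] close to [D]; hence [w t *m D] tends to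
     [delta_mx 0 i]. *)
  pose w t : 'rV[R]_n := t^-1 *: (psi (t *: delta_mx 0 i + y) - psi y).
  have ct : (fun t : R => t *: delta_mx 0 i + y) @ 0^' --> y.
    suff H : (fun t : R => t *: delta_mx 0 i + y) @ 0 --> y.
      by move=> A /H nA; exact: (near_punctured (Q := fun t => A (t *: delta_mx 0 i + y)) nA).
    move=> A /nbhs_boxP[e e0 eA].
    have : \forall t \near (0:R), `|t| < e by exact: nbhs0_lt.
    apply: filterS => t te; apply: eA => j; rewrite !mxE addrK.
    by case: (_ && _); rewrite ?mulr1 ?mulr0 ?normr0.
  have nV : \forall t \near (0:R)^', V1 (t *: delta_mx 0 i + y).
    exact: ct V1 (open_near oV1 Vy).
  have cw : forall l, (fun t => (w t *m D) 0 l) @ (0:R)^' --> ((i == l)%:R : R).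
    move=> l; apply/cvgrPdist_lt => e e0.
    have e20 : 0 < e / (2 * n.+1%:R) by rewrite divr_gt0.
    have [e' e'0 He'] := nearD _ e20.
    have nb : \forall t \near (0:R)^', box (psi y) e' (psi (t *: delta_mx 0 i + y)).
      have : (fun t => psi (t *: delta_mx 0 i + y)) @ (0:R)^' --> psi y.
        exact: cvg_comp ct (cpsi _ Vy).
      move=> cc; have : nbhs (psi y) (box (psi y) e') by apply/nbhs_boxP; exists e'.
      exact: cc.
    near=> t.
    have t0 : t != 0 by near: t; exact: nbhs_dnbhs_neq.
    have Vt : V1 (t *: delta_mx 0 i + y) by near: t.
    have bt : box (psi y) e' (psi (t *: delta_mx 0 i + y)) by near: t.
    have [tb th] := psib _ Vt.
    have [c c1] := mvt_map tb yb; rewrite th yh addrK.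
    set M := \matrix_(_, _) _ => E.
    have wM : w t *m M = delta_mx 0 i.
      by rewrite -scalemxAl -E scalerA mulVf// scale1r.
    have w2 : `|w t| <= 2.
      rewrite /w normrZ normfV ler_pdivrMl ?normr_gt0// mulrC.
      apply: le_trans (lip _ _ Vt Vy) _; rewrite addrK normrZ ler_wpM2l//.
      rewrite ler_piMr//; apply/norm_leP => // j; rewrite mxE.
      by case: (_ && _); rewrite ?normr1 ?normr0.
    have -> : (i == l)%:R = (w t *m M) 0 l by rewrite wM mxE eqxx eq_sym.
    rewrite -mulmxBr || rewrite !mxE -sumrB.
    apply: le_lt_trans (ler_norm_sum _ _ _) _.
    apply: (@le_lt_trans _ _ (\sum_(b < n) 2 * (e / (2 * n.+1%:R)))).
      apply: ler_sum => b _; rewrite -mulrBr normrM ler_pM//.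
        by apply: le_trans w2; exact: coord_norm_le.
      rewrite mxE; apply/ltW/He' => a; apply: (c1 (psi y)) => //.
      by move=> a'; rewrite subrr normr0.
    rewrite sumr_const card_ord -[_ *+ n]mulr_natr invfM.
    have n0 : (0:R) < n.+1%:R by [].
    have -> : 2 * (e * (2^-1 / n.+1%:R)) * n%:R = e * (n%:R / n.+1%:R) :> R.
      by field; rewrite lt0r_neq0.
    by rewrite gtr_pMr// ltr_pdivrMr// mul1r ltr_nat.
  move=> j.
  have L : (fun t : R => t^-1 *: (((fun z => psi z 0 j) \o shift y) (t *: delta_mx 0 i) - psi y 0 j))
     @ 0^' --> invmx D i j.
    have -> : invmx D i j = \sum_l (i == l)%:R * invmx D l j.
      rewrite (bigD1 i)//= eqxx mul1r big1 ?addr0// => l /negPf li.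
      by rewrite eq_sym li mul0r.
    have -> : (fun t : R => t^-1 *: (((fun z => psi z 0 j) \o shift y) (t *: delta_mx 0 i) - psi y 0 j))
       = fun t => \sum_l (w t *m D) 0 l * invmx D l j.
      apply/funext => t; have : w t = w t *m D *m invmx D by rewrite -mulmxA mulmxV// mulmx1.
      by move/rowP/(_ j); rewrite [RHS]mxE => <-; rewrite !mxE.
    by apply: cvg_sumr => l _; apply: cvgM; [exact: cw|exact: cvg_cst].
  by apply: DeriveDef; [apply/cvg_ex; eexists; exact: L|exact: cvg_lim L].
(* The derivative of [psi] is the inverse Jacobian of [h] at [psi], a smooth expression in [psi]
   itself, so each order of smoothness yields the next. *)
move=> j; apply/smooth_onP => k; elim: k j => [|k IH] j.
  split=> // -[y q] /= Vy.
  apply: (@continuous_comp _ _ _ fst (fun z => psi z 0 j)); first exact: cvg_fst.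
  apply: (@continuous_comp _ _ _ psi (fun z : 'rV[R]_n => z 0 j)); first exact: cpsi.
  exact: coord_continuous.
split; first by move=> p; exact: pC_cont (IH j).
move=> i; split; first by move=> [y q] /= Vy; have [] := @dpsi y i Vy j.
apply: (pC_eq (f := fun y _ => invmx (jac h (psi y)) i j)); first exact: open_fst.
  by move=> y q /= Vy; have [_ ->] := @dpsi y i Vy j.
apply: pC_invmx; first exact: open_fst.
  by move=> y q /= /psib[b _]; exact: jac_unit.
move=> a b; apply: (sC_comp (V := U) (f := fun z => jac h z a b)) => //.
  by move=> y /psib[] /BU.
have /smooth_onP/(_ k.+1)[_ /(_ a)[_]] := sh b.
by apply: pC_eq; [exact: open_fst|move=> u q _; rewrite mxE].
Unshelve. all: by end_near. Qed.
End inverse_function.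

Lemma inverse_function (R : realType) n (U : set 'rV[R]_n) (h : 'rV[R]_n -> 'rV[R]_n) u0 :
  open U -> U u0 -> (forall j, smooth_on U (fun u => h u 0 j)) -> jac h u0 = 1%:M ->
  exists (V1 U1 : set 'rV[R]_n) (psi : 'rV[R]_n -> 'rV[R]_n),
  [/\ open V1, open U1, U1 u0, (forall u, U1 u -> V1 (h u) /\ psi (h u) = u) &
    (forall y, V1 y -> U (psi y))] /\
  forall j, smooth_on V1 (fun y => psi y 0 j).
Proof.
move=> oU Uu0 sh J.
have e0 : 0 < (2 * n.+1%:R)^-1 :> R by rewrite invr_gt0.
have : \forall z \near u0, U z /\ forall ij : 'I_n * 'I_n,
    `|jac h z ij.1 ij.2 - (ij.1 == ij.2)%:R| <= (2 * n.+1%:R)^-1.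
  apply: filterI; first exact: (open_near oU Uu0).
  have H := @filter_forall 'rV[R]_n ('I_n * 'I_n)%type
    (fun ij z => `|jac h z ij.1 ij.2 - (ij.1 == ij.2)%:R| <= (2 * n.+1%:R)^-1) (nbhs u0) _.
  apply: H => -[i j] /=.
  have /cvgrPdist_lt/(_ _ e0) := @smooth_on_derive_continuous _ _ _ _ _ i (sh j) Uu0.
  have -> : 'D_(delta_mx 0 i) (fun z => h z 0 j) u0 = (i == j)%:R.
    by have /matrixP/(_ i j) := J; rewrite !mxE.
  by apply: filterS => z; rewrite distrC !mxE; exact: ltW.
move=> /nbhs_boxP[r r0 H].
have [V1 [U1 [psi [[h1 h2 h3 h4 h5] h6]]]] := @local_inverse R n U h u0 r r0
  (fun z zb => (H z zb).1) oU sh (fun z zb i j => (H z zb).2 (i, j)).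
exists V1, U1, psi; split=> //; split=> // y /h5[yb _].
by have [] := H _ yb.
Qed.

(** * Smooth maps into manifolds *)

Lemma open_preim (T T' : topologicalType) (f : T -> T') (W : set T) (V : set T') :
  open W -> (forall p, W p -> {for p, continuous f}) -> open V ->
  open [set p | W p /\ V (f p)].
Proof.
move=> oW cf oV; rewrite openE => p [Wp Vp].
have h1 := open_near oW Wp.
have h2 : \forall z \near p, V (f z) by exact: (cf _ Wp V (open_near oV Vp)).
by apply: filterS2 h1 h2 => z; split.
Qed.

(** These two axioms carry the composition of smooth maps, and a product inherits them at once;
    products are thus used as bare atlases, without being made manifolds. *)
Definition chart_atlas (R : realType) (A : atlas_space R) :=
  (forall c, charts (a := A) c -> is_chart c) /\
  (forall x : A, exists2 c, charts (a := A) c & cdom c x).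

Lemma manifold_atlasP (R : realType) (M : manifold R) : chart_atlas M.
Proof. by case: M => M []. Qed.

Lemma lsubmx_continuous (R : realType) n1 n2 : continuous (lsubmx : 'rV[R]_(n1 + n2) -> 'rV[R]_n1).
Proof.
move=> u; apply: rV_continuous => j.
rewrite (_ : (fun q : 'rV[R]_(n1 + n2) => lsubmx q 0 j) = (fun q => q 0 (lshift n2 j))).
  exact: coord_continuous.
by apply/funext => q; rewrite mxE.
Qed.

Lemma rsubmx_continuous (R : realType) n1 n2 : continuous (rsubmx : 'rV[R]_(n1 + n2) -> 'rV[R]_n2).
Proof.
move=> u; apply: rV_continuous => j.
rewrite (_ : (fun q : 'rV[R]_(n1 + n2) => rsubmx q 0 j) = (fun q => q 0 (rshift n1 j))).
  exact: coord_continuous.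
by apply/funext => q; rewrite mxE.
Qed.

Lemma row_mx_continuous (R : realType) (T : topologicalType) n1 n2
    (f : T -> 'rV[R]_n1) (g : T -> 'rV[R]_n2) p :
  {for p, continuous f} -> {for p, continuous g} -> {for p, continuous (fun x => row_mx (f x) (g x))}.
Proof.
move=> cf cg; apply: rV_continuous => j; case: (split_ordP j) => k ->.
  rewrite (_ : (fun q => row_mx (f q) (g q) 0 (lshift n2 k)) = fun q => f q 0 k).
    by apply: (@continuous_comp _ _ _ f (fun u : 'rV[R]_n1 => u 0 k)) => //; exact: coord_continuous.
  by apply/funext => q; rewrite row_mxEl.
rewrite (_ : (fun q => row_mx (f q) (g q) 0 (rshift n1 k)) = fun q => g q 0 k).
  by apply: (@continuous_comp _ _ _ g (fun u : 'rV[R]_n2 => u 0 k)) => //; exact: coord_continuous.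
by apply/funext => q; rewrite row_mxEr.
Qed.

Lemma openX (T T' : topologicalType) (A : set T) (B : set T') : open A -> open B -> open (A `*` B).
Proof.
move=> oA oB; rewrite (_ : A `*` B = [set p : T * T' | A p.1] `&` [set p | B p.2])//.
apply: openI; first exact: open_fst.
have : open (snd @^-1` B : set (T * T')).
  by apply: open_comp => // x _; exact: cvg_snd.
by [].
Qed.

Lemma prod_is_chart (R : realType) (M1 M2 : topologicalType) n1 n2
    (c1 : chart R M1 n1) (c2 : chart R M2 n2) :
  is_chart c1 -> is_chart c2 -> is_chart (prod_chart c1 c2).
Proof.
move=> [d1 i1 k1 m1 v1] [d2 i2 k2 m2 v2].
have imgE : cimg (prod_chart c1 c2) = [set u | cimg c1 (lsubmx u) /\ cimg c2 (rsubmx u)].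
  apply/seteqP; split => u.
    by move=> [[x y] [/= dx dy] <-]; rewrite /= row_mxKl row_mxKr; split; [exists x|exists y].
  move=> [[x dx ex] [y dy ey]]; exists (x, y) => //=.
  by rewrite ex ey hsubmxK.
split.
- exact: openX.
- rewrite imgE; apply: openI.
    by apply: (@open_comp _ _ lsubmx) => // u _; exact: lsubmx_continuous.
  by apply: (@open_comp _ _ rsubmx) => // u _; exact: rsubmx_continuous.
- by move=> [x y] [/= dx dy]; rewrite row_mxKl row_mxKr k1// k2.
- move=> [x y] [/= dx dy]; apply: row_mx_continuous.
    by apply: (@continuous_comp _ _ _ fst (cmap c1)); [exact: cvg_fst|exact: m1].
  by apply: (@continuous_comp _ _ _ snd (cmap c2)); [exact: cvg_snd|exact: m2].
- move=> u; rewrite imgE => -[u1 u2]; apply: continuous_pair.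
    by apply: (@continuous_comp _ _ _ lsubmx (cinv c1)); [exact: lsubmx_continuous|exact: v1].
  by apply: (@continuous_comp _ _ _ rsubmx (cinv c2)); [exact: rsubmx_continuous|exact: v2].
Qed.

Lemma prod_chart_atlas (R : realType) (M1 M2 : atlas_space R) :
  chart_atlas M1 -> chart_atlas M2 -> chart_atlas (prod_atlas M1 M2).
Proof.
move=> [h1 k1] [h2 k2]; split.
  by move=> c [c1 [c2 [/h1 ? /h2 ? ->]]]; exact: prod_is_chart.
move=> [x y]; have [c1 ? ?] := k1 x; have [c2 ? ?] := k2 y.
by exists (prod_chart c1 c2) => //; exists c1, c2.
Qed.

(* Manifold-valued counterpart of [psmooth_on]. *)
Definition ps (R : realType) n (K : topologicalType) (M : atlas_space R)
    (W : set ('rV[R]_n * K)) (f : 'rV[R]_n -> K -> M) : Prop :=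
  (forall p, W p -> {for p, continuous (fun q : 'rV[R]_n * K => f q.1 q.2)}) /\
  forall c, charts (a := M) c -> forall j,
    psmooth_on [set p | W p /\ cdom c (f p.1 p.2)] (fun u q => cmap c (f u q) 0 j).

Section ps_theory.
Variables (R : realType) (n : nat) (K : topologicalType) (W : set ('rV[R]_n * K)).
Hypothesis oW : open W.

Lemma ps_sub (M : atlas_space R) (V : set ('rV[R]_n * K)) f :
  V `<=` W -> ps (M := M) W f -> ps V f.
Proof.
move=> VW [cf sf]; split; first by move=> p /VW; exact: cf.
move=> c Cc j; apply/psmooth_onP => k.
have /psmooth_onP/(_ k) := sf c Cc j; apply: pC_sub => p [/VW ? ?].
by split.
Qed.

Lemma ps_open (M : atlas_space R) f (c : chart R M (mdim M)) : ps (M := M) W f -> is_chart c ->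
  open [set p | W p /\ cdom c (f p.1 p.2)].
Proof. by move=> [cf _] [oc _ _ _ _]; exact: (open_preim (f := fun p => f p.1 p.2)). Qed.

Lemma ps_psmooth_map (A M : atlas_space R) (K' : topologicalType) (F : A -> K' -> M) f
    (kappa : K -> K') : chart_atlas A -> chart_atlas M ->
  psmooth_map F -> ps (M := A) W f -> (forall u q, W (u, q) -> {for q, continuous kappa}) ->
  ps (M := M) W (fun u q => F (f u q) (kappa q)).
Proof.
move=> [Ac Acov] [Mc _] [cF sF] fps ck; have [cf sf] := fps.
have cFf p : W p -> {for p, continuous (fun q : 'rV[R]_n * K => F (f q.1 q.2) (kappa q.2))}.
  move=> Wp; apply: (@continuous_comp _ _ _ (fun q : 'rV[R]_n * K => (f q.1 q.2, kappa q.2))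
    (fun p => F p.1 p.2)); last exact: cF.
  apply: continuous_pair; first exact: cf.
  apply: (@continuous_comp _ _ _ snd kappa); first exact: cvg_snd.
  by case: p Wp => u q; exact: ck.
split=> // c' Cc' j; apply/psmooth_onP => k; apply: pC_local => p [Wp dp].
have [c Cc dc] := Acov (f p.1 p.2).
have [oc oi ck1 cm ci] := Ac _ Cc; have [oc' _ _ _ _] := Mc _ Cc'.
pose V := [set p : 'rV[R]_n * K | (W p /\ cdom c (f p.1 p.2)) /\ cdom c' (F (f p.1 p.2) (kappa p.2))].
have oV : open V.
  apply: (open_preim (f := fun p => F (f p.1 p.2) (kappa p.2))) => //.
    exact: ps_open fps (Ac _ Cc).
  by move=> q [Wq _]; exact: cFf.
exists V => //.
pose W' := [set p : 'rV[R]_(mdim A) * K' | cimg c p.1 /\ cdom c' (F (cinv c p.1) p.2)].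
have oW' : open W'.
  apply: (open_preim (f := fun p => F (cinv c p.1) p.2)) => //; first exact: open_fst.
  move=> [u q] /= iu; apply: (@continuous_comp _ _ _ (fun p => (cinv c p.1, p.2)) (fun p => F p.1 p.2)); last exact: cF.
  apply: continuous_pair; last exact: cvg_snd.
  by apply: (@continuous_comp _ _ _ fst (cinv c)); [exact: cvg_fst|exact: ci].
apply: (pC_eq (f := fun u q => cmap c' (F (cinv c (cmap c (f u q))) (kappa q)) 0 j)) => //.
  by move=> u q [[_ d] _]; rewrite ck1.
apply: (pC_comp (W' := W') (phi := fun u q => cmap c (f u q))
  (f := fun v q => cmap c' (F (cinv c v) q) 0 j)) => //.
- move=> u q [[Wuq d] d']; split => /=; first by exists (f u q).
  by rewrite ck1.
- by move=> u q [[Wuq _] _]; exact: ck Wuq.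
- move=> i; have /psmooth_onP/(_ k) := sf c Cc i; apply: pC_sub => q [[? ?] _].
  by split.
- by have /psmooth_onP/(_ k) := sF c c' Cc Cc' j.
Qed.

Lemma ps_smooth_fun (M : atlas_space R) (h : M -> R) f : chart_atlas M ->
  smooth_fun h -> ps (M := M) W f -> psmooth_on W (fun u q => h (f u q)).
Proof.
move=> [Mc Mcov] sh fps; have [cf sf] := fps.
apply/psmooth_onP => k; apply: pC_local => p Wp.
have [c Cc dc] := Mcov (f p.1 p.2); have [oc oi ck1 cm ci] := Mc _ Cc.
have oV := ps_open fps (Mc _ Cc).
exists [set p | W p /\ cdom c (f p.1 p.2)] => //.
apply: (pC_eq (f := fun u q => h (cinv c (cmap c (f u q))))) => //.
  by move=> u q [_ d]; rewrite ck1.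
apply: (pC_comp (W' := [set p : 'rV[R]_(mdim M) * K | cimg c p.1]) (phi := fun u q => cmap c (f u q))
  (f := fun v _ => h (cinv c v)) (kappa := id)) => //.
- exact: open_fst.
- by move=> u q [_ d]; exists (f u q).
- by move=> u q _; exact: cvg_id.
- by move=> i; have /psmooth_onP/(_ k) := sf c Cc i.
- by have /(@smooth_on_psmooth _ _ K)/psmooth_onP/(_ k) := sh c Cc.
Qed.

Lemma ps_pair (A B : atlas_space R) f g : ps (M := A) W f -> ps (M := B) W g ->
  ps (M := prod_atlas A B) W (fun u q => (f u q, g u q)).
Proof.
move=> [cf sf] [cg sg]; split.
  by move=> p Wp; apply: continuous_pair; [exact: cf|exact: cg].
move=> c [c1 [c2 [Cc1 Cc2 ->]]] j; apply/psmooth_onP => k.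
case: (split_ordP j) => i ->.
  have /psmooth_onP/(_ k) := sf c1 Cc1 i.
  move=> /(@pC_sub _ _ _ _ _ [set p | W p /\ cdom (prod_chart c1 c2) (f p.1 p.2, g p.1 p.2)]) H.
  rewrite (_ : (fun u q => _) = fun u q => cmap c1 (f u q) 0 i).
    by apply: H => p [Wp []].
  by apply/funext => u; apply/funext => q; rewrite /= row_mxEl.
have /psmooth_onP/(_ k) := sg c2 Cc2 i.
move=> /(@pC_sub _ _ _ _ _ [set p | W p /\ cdom (prod_chart c1 c2) (f p.1 p.2, g p.1 p.2)]) H.
rewrite (_ : (fun u q => _) = fun u q => cmap c2 (g u q) 0 i).
  by apply: H => p [Wp []].
by apply/funext => u; apply/funext => q; rewrite /= row_mxEr.
Qed.

Lemma ps_cinv (M : manifold R) c (phi : 'rV[R]_n -> K -> 'rV[R]_(mdim M)) :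
  charts (a := M) c -> (forall u q, W (u, q) -> cimg c (phi u q)) ->
  (forall j, psmooth_on W (fun u q => phi u q 0 j)) ->
  ps (M := M) W (fun u q => cinv c (phi u q)).
Proof.
move=> Cc Wi sphi; have [Mc _] := manifold_atlasP M; have [_ oi ck1 cm ci] := Mc _ Cc.
have cp p : W p -> {for p, continuous (fun q : 'rV[R]_n * K => cinv c (phi q.1 q.2))}.
  move=> Wp; apply: (@continuous_comp _ _ _ (fun q : 'rV[R]_n * K => phi q.1 q.2) (cinv c)).
    apply: rV_continuous => j; have /psmooth_onP/(_ 0%N) := sphi j.
    by move=> /pC_cont/(_ Wp).
  by apply: ci; apply: Wi; case: p Wp.
split=> // c' Cc' j; apply/psmooth_onP => k.
have [oc' _ _ _ _] := Mc _ Cc'.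
apply: (pC_comp (W' := [set p : 'rV[R]_(mdim M) * K | cimg c p.1 /\ cdom c' (cinv c p.1)])
  (f := fun u _ => cmap c' (cinv c u) 0 j) (kappa := id)) => //.
- exact: (open_preim (f := fun p => cinv c (phi p.1 p.2))).
- apply: (open_preim (f := fun p => cinv c p.1)) => //; first exact: open_fst.
  move=> p /= ip; apply: (@continuous_comp _ _ _ fst (cinv c)); first exact: cvg_fst.
  exact: ci.
- by move=> u q [/Wi iu du]; split.
- by move=> u q _; exact: cvg_id.
- by move=> i; have /psmooth_onP/(_ k) := sphi i; apply: pC_sub => p [].
- have [_ _ _ _ tr] := manifold_axioms M.
  have /(@smooth_on_psmooth _ _ K)/psmooth_onP/(_ k) := tr c c' Cc Cc' j.
  exact.
Qed.

Lemma ps_param (M : atlas_space R) (kappa : K -> M) : chart_atlas M ->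
  continuous kappa -> ps (M := M) W (fun _ q => kappa q).
Proof.
move=> [Mc _] ck; split.
  by move=> p _; apply: (@continuous_comp _ _ _ snd kappa); [exact: cvg_snd|exact: ck].
move=> c Cc j; apply/psmooth_onP => k; have [oc _ _ cm _] := Mc _ Cc.
apply: (@pC_param _ _ _ _ _ (fun q => cmap c (kappa q) 0 j)).
  apply: (open_preim (f := fun p => kappa p.2)) => //.
  by move=> p _; apply: (@continuous_comp _ _ _ snd kappa); [exact: cvg_snd|exact: ck].
move=> p [_ d]; apply: (@continuous_comp _ _ _ (fun q => cmap c (kappa q)) (fun v : 'rV[R]_(mdim M) => v 0 j)).
  by apply: (@continuous_comp _ _ _ kappa (cmap c)); [exact: ck|exact: cm].
exact: coord_continuous.
Qed.

Lemma smooth_map_psmooth (A M : atlas_space R) (K' : topologicalType) (F : A -> M) :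
  smooth_map F -> psmooth_map (fun x (_ : K') => F x).
Proof.
move=> [cF sF]; split.
  by move=> p; apply: (@continuous_comp _ _ _ fst F); [exact: cvg_fst|exact: cF].
by move=> c c' Cc Cc' j; exact: smooth_on_psmooth (sF c c' Cc Cc' j).
Qed.

Lemma ps_smooth_map (A M : atlas_space R) (F : A -> M) f : chart_atlas A -> chart_atlas M ->
  smooth_map F -> ps (M := A) W f -> ps (M := M) W (fun u q => F (f u q)).
Proof.
move=> hA hM sF fps; apply: (ps_psmooth_map (F := fun x _ => F x) (kappa := id)) => //.
  exact: smooth_map_psmooth.
by move=> u q _; exact: cvg_id.
Qed.

Lemma ps_comp_lin m (M : atlas_space R) (V : set ('rV[R]_m * K)) (f : 'rV[R]_m -> K -> M)
    (phi : 'rV[R]_n -> K -> 'rV[R]_m) : chart_atlas M -> open V ->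
  (forall u q, W (u, q) -> V (phi u q, q)) ->
  (forall j, psmooth_on W (fun u q => phi u q 0 j)) -> ps (M := M) V f ->
  ps (M := M) W (fun u q => f (phi u q) q).
Proof.
move=> [Mc _] oV WV sphi fps; have [cf sf] := fps.
have cc p : W p -> {for p, continuous (fun q : 'rV[R]_n * K => f (phi q.1 q.2) q.2)}.
  move=> Wp; apply: (@continuous_comp _ _ _ (fun q : 'rV[R]_n * K => (phi q.1 q.2, q.2)) (fun q => f q.1 q.2)).
    apply: continuous_pair; last exact: cvg_snd.
    apply: rV_continuous => j; have /psmooth_onP/(_ 0%N) := sphi j.
    by move=> /pC_cont/(_ Wp).
  by apply: cf; apply: WV; case: p Wp.
split=> // c Cc j; apply/psmooth_onP => k; have [oc _ _ _ _] := Mc _ Cc.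
apply: (pC_comp (W' := [set p | V p /\ cdom c (f p.1 p.2)]) (f := fun u q => cmap c (f u q) 0 j) (kappa := id)) => //.
- exact: (open_preim (f := fun p => f (phi p.1 p.2) p.2)).
- exact: open_preim.
- by move=> u q [/WV Vuq d]; split.
- by move=> u q _; exact: cvg_id.
- by move=> i; have /psmooth_onP/(_ k) := sphi i; apply: pC_sub => p [].
- by have /psmooth_onP/(_ k) := sf c Cc j.
Qed.

End ps_theory.

Lemma derive_lincomb (R : realType) n m (f : 'rV[R]_n -> 'rV[R]_m) (b : 'I_m -> R) u v :
  (forall l, derivable (fun z => f z 0 l) u v) ->
  'D_v (fun z => \sum_l f z 0 l * b l) u = \sum_l 'D_v (fun z => f z 0 l) u * b l.
Proof.
move=> df; have dl l : derivable (fun z => f z 0 l * b l) u v.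
  by apply: derivableM => //; exact: derivable_cst.
have -> : (fun z => \sum_l f z 0 l * b l) = \sum_l (fun z => f z 0 l * b l).
  by apply/funext => z; rewrite fct_sumE.
rewrite derive_sum//; apply: eq_bigr => l _.
rewrite (@deriveM _ _ (fun z => f z 0 l) (cst (b l)))// ?derive_cst ?scaler0 ?add0r 1?mulrC//.
Qed.

(* Near each of its points an embedded manifold is a smooth retract: invert
   [u |-> e (cinv c u) *m B] where [B] is a right inverse of the Jacobian. *)
Lemma local_retraction (R : realType) (M : manifold R) m (e : M -> 'rV[R]_m) (x0 : M) :
  embedding e -> exists (O : set 'rV[R]_m) (rho : 'rV[R]_m -> M),
  [/\ open O, O (e x0), forall x, O (e x) -> rho (e x) = x &
    forall K : topologicalType, ps (M := M) [set p : 'rV[R]_m * K | O p.1] (fun u _ => rho u)].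
Proof.
move=> [se einj etop eimm]; have [Mc Mcov] := manifold_atlasP M.
have [c Cc dc] := Mcov x0; have [oc oi ck1 cm ci] := Mc _ Cc.
pose phi u := e (cinv c u); have i0 : cimg c (cmap c x0) by exists x0.
have sphi j : smooth_on (cimg c) (fun u => phi u 0 j) := se j c Cc.
have /row_freeP[B AB] := eimm c Cc _ i0.
pose h u : 'rV[R]_(mdim M) := phi u *m B.
have hE u j : h u 0 j = \sum_l phi u 0 l * B l j by rewrite mxE.
have sh j : smooth_on (cimg c) (fun u => h u 0 j).
  apply/smooth_onP => k; apply: (pC_eq (f := fun u _ => \sum_l phi u 0 l * B l j)).
  - exact: open_fst.
  - by move=> u q _; rewrite hE.
  apply: pC_sum; first exact: open_fst.
  move=> l _; apply: pCM; [exact: open_fst| |exact: (pC_cst _ (B l j) (open_fst _))].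
  by have /smooth_onP/(_ k) := sphi l.
have Jh : jac h (cmap c x0) = 1%:M.
  rewrite -AB; apply/matrixP => i j; rewrite !mxE.
  under eq_fun do rewrite hE.
  rewrite derive_lincomb; last by move=> l; exact: (smooth_on_derivable (sphi l)).
  by apply: eq_bigr => l _; rewrite mxE.
have [V1 [U1 [psi [[oV1 oU1 U1x hU psiV] spsi]]]] := inverse_function oi i0 sh Jh.
have oS : open [set x | cdom c x /\ U1 (cmap c x)] by exact: open_preim.
(* A point of M far from [x0] could have an image near [e x0]; the topological part of the embedding
   provides an ambient open set that excludes such points. *)
have [V' oV' SV'] := etop _ oS.
have inS x : V' (e x) -> cdom c x /\ U1 (cmap c x).
  move=> V'x; have : (e @^-1` V') x by [].
  by rewrite -SV'.
have inV x : cdom c x -> U1 (cmap c x) -> V' (e x).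
  move=> dx Ux; have : [set x | cdom c x /\ U1 (cmap c x)] x by [].
  by rewrite SV'.
have cB (v : 'rV[R]_m) : {for v, continuous (fun v : 'rV[R]_m => v *m B)}.
  apply: rV_continuous => j.
  rewrite (_ : (fun q => _) = fun q : 'rV[R]_m => \sum_l q 0 l * B l j); last by apply/funext => q; rewrite mxE.
  rewrite /prop_for /continuous_at; apply: (@cvg_sumr R _ (nbhs v)) => l _.
  by apply: cvgM; [exact: coord_continuous|exact: cvg_cst].
exists [set v | V' v /\ V1 (v *m B)], (fun v => cinv c (psi (v *m B))); split.
- by apply: open_preim => // v _; exact: cB.
- split; first exact: inV.
  by have [] := hU _ U1x; rewrite /h /phi ck1.
- move=> x [V'x V1x]; have [dx Ux] := inS _ V'x.
  by have [_] := hU _ Ux; rewrite /h /phi ck1// => ->; rewrite ck1.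
- move=> K.
  have oO : open [set p : 'rV[R]_m * K | V' p.1 /\ V1 (p.1 *m B)].
    apply: (@open_fst _ _ [set v | V' v /\ V1 (v *m B)]).
    by apply: open_preim => // v _; exact: cB.
  apply: ps_cinv => //.
    by move=> u q /= [_ V1u]; exact: psiV.
  move=> j; apply/psmooth_onP => k.
  apply: (pC_comp (W' := [set p : 'rV[R]_(mdim M) * K | V1 p.1]) (f := fun v _ => psi v 0 j)
    (phi := fun u _ => u *m B) (kappa := id)) => //.
  + exact: open_fst.
  + by move=> u q [].
  + by move=> u q _; exact: cvg_id.
  + move=> i; apply: (pC_eq (f := fun u _ => \sum_l u 0 l * B l i)) => //.
      by move=> u q _; rewrite mxE.
    apply: pC_sum => // l _; apply: pCM => //; [exact: pC_coord|exact: (pC_cst _ (B l i))].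
  + by have /(@smooth_on_psmooth _ _ K)/psmooth_onP/(_ k) := spsi j.
Qed.

(** * Bump functions and extensions *)

Section flat_function.
Variable R : realType.

(* [flat p] is [p(1/t) exp(-1/t)] for [t > 0], prolonged by 0; this family is closed under
   derivation. *)
Definition flat (p : {poly R}) (t : R) : R :=
  if 0 < t then p.[t^-1] * expR (- t^-1) else 0.

Definition flat_deriv (p : {poly R}) : {poly R} := 'X^2 * (p - p^`()).

(** A power of [exp (s / n) >= s / n]. With [s = 1 / t] it bounds every power of [1 / t] times
    [exp (- 1 / t)]. *)
Lemma expR_ge_pow n (s : R) : 0 < s -> s ^+ n <= n%:R ^+ n * expR s.
Proof.
case: n => [|n] s0; first by rewrite !expr0 mul1r ltW// expR_gt1.
have {1}-> : expR s = expR (s / n.+1%:R) ^+ n.+1.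
  by rewrite -expRM_natl; congr expR; field.
rewrite -exprMn.
rewrite lerXn2r ?nnegrE ?mulr_ge0 ?expR_ge0 ?(ltW s0)//.
have := expR_ge1Dx (s / n.+1%:R) => h.
by rewrite -ler_pdivrMl// [leLHS]mulrC; apply: le_trans h; rewrite lerDr.
Qed.

Lemma flat_bounded p : exists2 C, 0 <= C & forall t, `|flat p t| <= C.
Proof.
exists (\sum_(i < size p) `|p`_i| * i%:R ^+ i).
  by apply: sumr_ge0 => i _; rewrite mulr_ge0.
move=> t; rewrite /flat; case: ifPn => t0; last first.
  by rewrite normr0; apply: sumr_ge0 => i _; rewrite mulr_ge0.
rewrite horner_coef mulr_suml; apply: le_trans (ler_norm_sum _ _ _) _.
apply: ler_sum => i _; rewrite !normrM -mulrA ler_wpM2l//.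
rewrite (ger0_norm (expR_ge0 _)) ger0_norm ?exprn_ge0 ?invr_ge0 ?(ltW t0)//.
rewrite expRN ler_pdivrMr ?expR_gt0//; apply: expR_ge_pow.
by rewrite invr_gt0.
Qed.

Lemma is_derive_flat p (t : R) : is_derive t 1 (flat p) (flat (flat_deriv p) t).
Proof.
case: (ltrgtP t 0) => t0.
- have E : flat (flat_deriv p) t = 0 by rewrite /flat ltNge ltW.
  have N : \forall z \near t, cst (0 : R) z = flat p z.
    by apply: filterS (lt_nbhsl t0) => z z0; rewrite /flat ltNge ltW.
  by rewrite E; exact: (near_eq_is_derive N (is_derive_cst (0 : R) t (1 : R))).
- have dV : is_derive t 1 (fun z : R => z^-1) (- t ^- 2).
    have tn0 : t != 0 by rewrite gt_eqF.
    by have := @is_deriveV R id t 1 1 tn0 (is_derive_id t 1); rewrite [_ *: _]mulr1.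
  have dp : is_derive t 1 (fun z : R => p.[z^-1]) ((p^`()).[t^-1] * - t ^- 2).
    apply: (@is_derive1_comp R (horner p) (fun z => z^-1)) => //.
  have de : is_derive t 1 (fun z : R => expR (- z^-1)) (expR (- t^-1) * t ^- 2).
    apply: (@is_derive1_comp R expR (fun z => - z^-1)) => //.
    by have := @is_deriveN _ _ _ _ t 1 _ dV; rewrite opprK.
  have N : \forall z \near t, p.[z^-1] * expR (- z^-1) = flat p z.
    by apply: filterS (lt_nbhsr t0) => z z0; rewrite /flat z0.
  apply: (near_eq_is_derive N); apply: (is_derive_eq (is_deriveM dp de)).
  rewrite /flat t0 /flat_deriv !hornerE /= -!exprVn /GRing.scale /=; ring.
- rewrite t0.
  (* At 0 the difference quotient of [flat p] is [h * flat ('X^2 * p) h], whose second factor is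
     bounded. *)
  have [C C0 hC] := flat_bounded ('X^2 * p).
  have L : (fun h : R => h^-1 *: ((flat p \o shift 0) (h *: 1) - flat p 0)) @ 0^' --> (0 : R).
    apply/cvgrPdist_lt => e e0.
    have C1 : 0 < e / (C + 1) by rewrite divr_gt0//; lra.
    have n0 : \forall h \near (0:R)^', h != 0 by exact: nbhs_dnbhs_neq.
    have n1 : \forall h \near (0:R)^', `|h| < e / (C + 1).
      by apply: near_punctured; exact: nbhs0_lt.
    apply: filterS2 n0 n1 => h h0 he; rewrite /= addr0 sub0r normrN [h *: 1]mulr1.
    rewrite {2}/flat ltxx subr0.
    have -> : h^-1 *: flat p h = h * flat ('X^2 * p) h.
      rewrite [LHS]mulrC /flat; case: ifP => hp; last by rewrite mul0r mulr0.
      by rewrite !hornerE /=; field.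
    rewrite normrM; apply: (@le_lt_trans _ _ (e / (C + 1) * C)).
      by rewrite ler_pM// ltW.
    by rewrite mulrAC ltr_pdivrMr; [nra|lra].
  have E : flat (flat_deriv p) 0 = 0 by rewrite /flat ltxx.
  by rewrite E; apply: DeriveDef; [apply/cvg_ex; eexists; exact: L|exact: cvg_lim L].
Qed.

Definition flat1 : R -> R := flat 1.

Lemma flat1_ge0 t : 0 <= flat1 t.
Proof. by rewrite /flat1 /flat; case: ifP => // _; rewrite hornerC mul1r expR_ge0. Qed.

Lemma flat1_gt0 t : 0 < t -> 0 < flat1 t.
Proof. by rewrite /flat1 /flat => ->; rewrite hornerC mul1r expR_gt0. Qed.

Lemma flat1_eq0 t : t <= 0 -> flat1 t = 0.
Proof. by rewrite /flat1 /flat => t0; rewrite ltNge t0. Qed.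

Lemma pC_flat1 n k (K : topologicalType) (W : set ('rV[R]_n * K)) f : open W ->
  pC k W f -> pC k W (fun u q => flat1 (f u q)).
Proof.
move=> oW Cf.
apply: (pC_comp1 (h := fun j => flat (iter j flat_deriv 1)) (D := setT) 0%N) => //.
by move=> j x _; exact: is_derive_flat.
Qed.

(** A smooth transition from the value 1 on [s <= 1] to the value 0 on [s >= 2]; the denominator
    never vanishes because [2 - s] and [s - 1] are not both nonpositive. *)
Definition step (s : R) : R := flat1 (2 - s) / (flat1 (2 - s) + flat1 (s - 1)).

Lemma step_den s : 0 < flat1 (2 - s) + flat1 (s - 1).
Proof.
case: (ltP s 2) => s2.
  by rewrite ltr_pwDl ?flat1_ge0// flat1_gt0//; lra.
by rewrite ltr_wpDl ?flat1_ge0// flat1_gt0//; lra.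
Qed.

Lemma step_ge0 s : 0 <= step s.
Proof. by rewrite divr_ge0 ?flat1_ge0// ltW// step_den. Qed.

Lemma step_le1 s : step s <= 1.
Proof. by rewrite ler_pdivrMr ?step_den// mul1r lerDl flat1_ge0. Qed.

Lemma step1 s : s <= 1 -> step s = 1.
Proof.
move=> s1; have := step_den s; rewrite /step (flat1_eq0 (t := s - 1)); last lra.
by rewrite addr0 => h; rewrite divff// gt_eqF.
Qed.

Lemma step0 s : 2 <= s -> step s = 0.
Proof. by move=> s2; rewrite /step flat1_eq0 ?mul0r//; lra. Qed.

(** The square keeps the profile smooth at the centre. The bump is 1 on the box of radius [r] and
    vanishes once a coordinate is [3 / 2 * r] away, because [(3 / 2) ^ 2 >= 2]. *)
Definition bump n (c : 'rV[R]_n) (r : R) (x : 'rV[R]_n) : R :=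
  \prod_i step (((x 0 i - c 0 i) / r) ^+ 2).

Lemma bump_ge0 n (c : 'rV[R]_n) r x : 0 <= bump c r x.
Proof. by apply: prodr_ge0 => i _; exact: step_ge0. Qed.

Lemma bump_le1 n (c : 'rV[R]_n) r x : bump c r x <= 1.
Proof. by apply: prodr_ile1 => i _; rewrite step_ge0 step_le1. Qed.

Lemma bump1 n (c : 'rV[R]_n) r x : 0 < r -> box c r x -> bump c r x = 1.
Proof.
move=> r0 xr; apply: big1 => i _; apply: step1.
rewrite -real_normK ?num_real//.
by rewrite exprn_ile1// normrM normfV (gtr0_norm r0) ler_pdivrMr// mul1r ltW.
Qed.

Lemma bump0 n (c : 'rV[R]_n) r (x : 'rV[R]_n) i : 0 < r -> 3 / 2 * r <= `|x 0 i - c 0 i| -> bump c r x = 0.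
Proof.
move=> r0 xr; rewrite /bump (bigD1 i)//= step0 ?mul0r//.
rewrite -real_normK ?num_real// normrM normfV (gtr0_norm r0).
have : 3 / 2 <= `|x 0 i - c 0 i| / r by rewrite ler_pdivlMr.
nra.
Qed.

Lemma pC_bump n (c : 'rV[R]_n) r k (K : topologicalType) (W : set ('rV[R]_n * K)) : open W ->
  pC k W (fun u _ => bump c r u).
Proof.
move=> oW; apply: pC_prod => // i _.
have Cs : pC k W (fun u _ => ((u 0 i - c 0 i) / r) ^+ 2).
  have C1 : pC k W (fun u _ => (u 0 i - c 0 i) / r).
    apply: pCM => //; last exact: (pC_cst _ (r^-1)).
    by apply: pCB => //; [exact: pC_coord|exact: (pC_cst _ (c 0 i))].
  by apply: pC_eq (pCM oW C1 C1) => // u q _; rewrite expr2.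
have Ca : pC k W (fun u _ => flat1 (2 - ((u 0 i - c 0 i) / r) ^+ 2)).
  by apply: pC_flat1 => //; apply: pCB => //; exact: (pC_cst _ (2 : R)).
have Cb : pC k W (fun u _ => flat1 (((u 0 i - c 0 i) / r) ^+ 2 - 1)).
  by apply: pC_flat1 => //; apply: pCB => //; exact: (pC_cst _ (1 : R)).
apply: pCM => //; apply: pCV => //; last exact: pCD.
by move=> u q _; rewrite gt_eqF// step_den.
Qed.

End flat_function.

(** Pointwise finite sum of a sequence of functions. The bound picked by [xget] is arbitrary;
    [lfsumE] shows that every bound gives the same value. *)
Definition lfsum (R : realType) (T : Type) (f : nat -> T -> R) (x : T) : R :=
  \sum_(i < xget 0%N [set N | forall i, (N <= i)%N -> f i x = 0]) f i x.

Lemma lfsumE (R : realType) (T : Type) (f : nat -> T -> R) (x : T) N :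
  (forall i, (N <= i)%N -> f i x = 0) -> lfsum f x = \sum_(i < N) f i x.
Proof.
move=> fN; rewrite /lfsum; set A := [set N | _].
have : A (xget 0%N A) by case: xgetP => // /(_ N).
move: (xget 0%N A) => N' AN'.
suff H a b : (a <= b)%N -> (forall i, (a <= i)%N -> f i x = 0) ->
    \sum_(i < b) f i x = \sum_(i < a) f i x.
  by case: (leqP N N') => NN'; [rewrite (H N)|rewrite (H N' N)// ltnW].
move=> ab fa; rewrite -(big_mkord predT (f^~ x)) (big_cat_nat (n := a))//= big_mkord.
rewrite [X in _ + X](_ : _ = 0) ?addr0// big_nat.
by apply: big1 => i /andP[ai _]; exact: fa.
Qed.

Section partition.
Variables (R : realType) (T : Type) (chi : nat -> T -> R).

(* The factors [1 - chi j] make the sum locally finite: [theta n] vanishes wherever some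
   [chi j], [j < n], equals 1. *)
Definition theta n (x : T) : R := chi n x * \prod_(j < n) (1 - chi j x).

Lemma sum_theta N x : \sum_(n < N) theta n x = 1 - \prod_(j < N) (1 - chi j x).
Proof.
elim: N => [|N IH]; first by rewrite !big_ord0 subrr.
by rewrite !big_ord_recr /= IH /theta; ring.
Qed.

Lemma theta_eq0 j n x : (j < n)%N -> chi j x = 1 -> theta n x = 0.
Proof.
by move=> jn c1; rewrite /theta (bigD1 (Ordinal jn))//= c1 subrr mul0r mulr0.
Qed.

Lemma sum_theta1 j x : chi j x = 1 -> \sum_(n < j.+1) theta n x = 1.
Proof.
by move=> c1; rewrite sum_theta big_ord_recr /= c1 subrr mulr0 subr0.
Qed.

Lemma theta_ge0 n x : (forall j, 0 <= chi j x <= 1) -> 0 <= theta n x.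
Proof.
move=> h; rewrite mulr_ge0//; first by case/andP: (h n).
by apply: prodr_ge0 => j _; rewrite subr_ge0; case/andP: (h j).
Qed.

End partition.

(** Rational centres and radii are enumerated by [unpickle]; [None] marks the codes that are invalid
    or fail [P]. A radius below [e / 3] and a centre within it of [a] put the doubled box inside
    [box a e]. *)
Lemma ball_system (R : realType) q (S : set 'rV[R]_q) (P : 'rV[R]_q -> R -> Prop) :
  (forall a, S a -> exists2 e, 0 < e & forall c r, 0 < r -> box c (2 * r) `<=` box a e -> P c r) ->
  exists cr : nat -> option ('rV[R]_q * R),
    (forall n c r, cr n = Some (c, r) -> 0 < r /\ P c r) /\
    (forall a, S a -> exists n c r, cr n = Some (c, r) /\ box c r a).
Proof.
move=> SP; pose D := ('rV[rat]_q * rat)%type.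
pose cr n : option ('rV[R]_q * R) := if @unpickle D n is Some (x, y) then
   if `[< 0 < (ratr y : R) /\ P (map_mx ratr x) (ratr y) >] then Some (map_mx ratr x, ratr y) else None
  else None.
exists cr; split.
  move=> n c r; rewrite /cr; case: unpickle => // -[x y].
  by case: asboolP => // h [<- <-].
move=> a /SP[e e0 He].
have e3 : 0 < e / 3 by lra.
have [y] := rat_in_itvoo e3; rewrite in_itv /= => /andP[y0 ye].
have /choice[x xP] : forall j : 'I_q, exists z : rat, `|a 0 j - ratr z| < ratr y.
  move=> j; have /rat_in_itvoo[z] : a 0 j - ratr y < a 0 j + ratr y by lra.
  by rewrite in_itv /= => /andP[z1 z2]; exists z; rewrite ltr_norml; apply/andP; split; lra.
pose xx : 'rV[rat]_q := \row_j x j.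
have Pxy : P (map_mx ratr xx) (ratr y).
  apply: He => // z zb j; have := zb j; have := xP j; rewrite !mxE.
  by rewrite !ltr_norml => /andP[? ?] /andP[? ?]; apply/andP; split; lra.
exists (pickle (xx, y)), (map_mx ratr xx), (ratr y); split.
  by rewrite /cr pickleK; case: asboolP => // -[].
by move=> j; rewrite !mxE.
Qed.

Section ball_partition.
Variables (R : realType) (q : nat) (cr : nat -> option ('rV[R]_q * R)).
Hypothesis crP : forall n c r, cr n = Some (c, r) -> 0 < r.

Definition ball_chi n (x : 'rV[R]_q) : R := if cr n is Some (c, r) then bump c r x else 0.
Definition ball_dom n : set 'rV[R]_q := if cr n is Some (c, r) then box c r else set0.
Definition ball_dom2 n : set 'rV[R]_q := if cr n is Some (c, r) then box c (2 * r) else set0.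

Lemma open_box (c : 'rV[R]_q) r : 0 < r -> open (box c r).
Proof.
move=> r0; rewrite (_ : box c r = [set z | `|z - c| < r]); first exact: open_ball_set.
by apply/seteqP; split => z /(boxE c z r0).
Qed.

Lemma open_ball_dom n : open (ball_dom n).
Proof.
rewrite /ball_dom; case E : (cr n) => [[c r]|]; last exact: open0.
by apply: open_box; exact: crP E.
Qed.

Lemma open_ball_dom2 n : open (ball_dom2 n).
Proof.
rewrite /ball_dom2; case E : (cr n) => [[c r]|]; last exact: open0.
by apply: open_box; rewrite mulr_gt0//; exact: crP E.
Qed.

Lemma ball_chi01 n x : 0 <= ball_chi n x <= 1.
Proof.
rewrite /ball_chi; case: (cr n) => [[c r]|]; last by rewrite lexx ler01.
by rewrite bump_ge0 bump_le1.
Qed.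

Lemma ball_chi1 n x : ball_dom n x -> ball_chi n x = 1.
Proof.
rewrite /ball_chi /ball_dom; case E : (cr n) => [[c r]|]//.
by apply: bump1; exact: crP E.
Qed.

Lemma ball_chi_supp n x : ball_chi n x != 0 -> ball_dom2 n x.
Proof.
rewrite /ball_chi /ball_dom2; case E : (cr n) => [[c r]|]; last by rewrite eqxx.
move=> b0 j; rewrite ltNge; apply: contra b0 => h.
have r0 := crP E; rewrite (bump0 (i := j))//; apply: le_trans h; lra.
Qed.

Lemma pC_ball_chi n k (K : topologicalType) (W : set ('rV[R]_q * K)) : open W ->
  pC k W (fun u _ => ball_chi n u).
Proof.
move=> oW; rewrite /ball_chi; case: (cr n) => [[c r]|]; first exact: pC_bump.
exact: (pC_cst _ (0 : R)).
Qed.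

Lemma pC_theta n k (K : topologicalType) (W : set ('rV[R]_q * K)) : open W ->
  pC k W (fun u _ => theta ball_chi n u).
Proof.
move=> oW; apply: pCM => //; first exact: pC_ball_chi.
apply: pC_prod => // j _; apply: pCB => //; [exact: (pC_cst _ (1 : R))|exact: pC_ball_chi].
Qed.

Lemma theta_supp n x : theta ball_chi n x != 0 -> ball_dom2 n x.
Proof.
move=> t0; apply: ball_chi_supp; apply: contra t0 => /eqP c0.
by rewrite /theta c0 mul0r.
Qed.

(* Multiplying by a bump prolongs smoothly by 0 a function known only near the ball. *)
Lemma pC_chi_mul n k (K : topologicalType) (f : 'rV[R]_q -> K -> R) :
  (forall c r, cr n = Some (c, r) -> pC k [set p | ball_dom2 n p.1] f) ->
  pC k setT (fun u x => ball_chi n u * f u x).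
Proof.
rewrite /ball_dom2 /ball_chi; case E : (cr n) => [[c r]|] Cf; last first.
  apply: (pC_eq (f := fun _ _ => 0)); [exact: openT|by move=> *; rewrite mul0r|].
  exact: (pC_cst _ (0 : R) openT).
have r0 := crP E; have {}Cf := Cf c r erefl.
apply: pC_local => p _.
have [pb|pb] := pselect (box c (2 * r) p.1).
  have oV : open [set p : 'rV[R]_q * K | box c (2 * r) p.1].
    by apply: open_fst; apply: open_box; rewrite mulr_gt0.
  exists [set p | box c (2 * r) p.1] => //; apply: pCM => //; exact: pC_bump.
have /existsNP[j /negP] : ~ forall j, `|p.1 0 j - c 0 j| < 2 * r by [].
rewrite -leNgt => hj.
have oV : open [set p : 'rV[R]_q * K | 3 / 2 * r < `|p.1 0 j - c 0 j|].
  apply: (@open_fst _ _ [set u : 'rV[R]_q | 3 / 2 * r < `|u 0 j - c 0 j|]).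
  apply: (@open_comp _ _ (fun u : 'rV[R]_q => `|u 0 j - c 0 j|) [set t | 3 / 2 * r < t]); last exact: open_gt.
  move=> u _; apply: (@continuous_comp _ _ _ (fun u : 'rV[R]_q => u 0 j - c 0 j) (fun z => `|z|)); last exact: norm_continuous.
  by apply: continuousB; [exact: coord_continuous|exact: cst_continuous].
exists [set p : 'rV[R]_q * K | 3 / 2 * r < `|p.1 0 j - c 0 j|]; first by rewrite /=; lra.
apply: (pC_eq (f := fun _ _ => 0)) => //; last exact: (pC_cst _ (0 : R)).
by move=> u x /= h; rewrite (bump0 (i := j)) ?mul0r// ltW.
Qed.

End ball_partition.

(** Local extensions are averaged with the weights [theta]. At [s b], an index of nonzero weight has
    [s b] in its doubled ball, where its extension takes the value [f b], and the weights add up to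
    1. *)
Lemma smooth_extension (R : realType) q (K : topologicalType) (I : Type) (s : I -> 'rV[R]_q)
    (f : I -> K -> R) :
  (forall a, exists (O : set 'rV[R]_q) (g : 'rV[R]_q -> K -> R),
    [/\ open O, O (s a), psmooth_on [set p | O p.1] g &
      forall b k, O (s b) -> g (s b) k = f b k]) ->
  exists (O : set 'rV[R]_q) (g : 'rV[R]_q -> K -> R),
    [/\ open O, forall a, O (s a), psmooth_on [set p | O p.1] g &
      forall b k, g (s b) k = f b k].
Proof.
move=> loc.
pose P c r := exists g : 'rV[R]_q -> K -> R, psmooth_on [set p | box c (2 * r) p.1] g /\
   forall b k, box c (2 * r) (s b) -> g (s b) k = f b k.
have [cr [crP crS]] : exists cr : nat -> option ('rV[R]_q * R),
    (forall n c r, cr n = Some (c, r) -> 0 < r /\ P c r) /\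
    (forall a, range s a -> exists n c r, cr n = Some (c, r) /\ box c r a).
  apply: ball_system => _ [a _ <-]; have [U [g [oU Ua sg gf]]] := loc a.
  have /nbhs_boxP[e e0 eU] := open_near oU Ua.
  exists e => // c r r0 ce; exists g; split.
    apply/psmooth_onP => k; have /psmooth_onP/(_ k) := sg; apply: pC_sub => p /= /ce; exact: eU.
  by move=> b k /ce/eU; exact: gf.
have cr0 n c r : cr n = Some (c, r) -> 0 < r by move=> /crP[].
have /choice[g gP] : forall n, exists g : 'rV[R]_q -> K -> R,
   psmooth_on [set p | ball_dom2 cr n p.1] g /\
   forall b k, ball_dom2 cr n (s b) -> g (s b) k = f b k.
  move=> n; rewrite /ball_dom2; case E : (cr n) => [[c r]|]; last by exists (fun _ _ => 0); split.
  by have [_] := crP _ _ _ E.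
pose th := theta (ball_chi cr).
pose G u k := lfsum (fun n v => th n v * g n v k) u.
have GE j u k : ball_dom cr j u -> G u k = \sum_(n < j.+1) th n u * g n u k.
  move=> ju; rewrite /G (@lfsumE _ _ _ _ j.+1)// => i ji.
  by rewrite /th (theta_eq0 ji) ?mul0r// ball_chi1.
exists (\bigcup_j ball_dom cr j), G; split.
- by apply: bigcup_open => j _; exact: open_ball_dom.
- move=> a; have [|n [c [r [E ca]]]] := crS (s a); first by exists a.
  by exists n => //; rewrite /ball_dom E.
- apply/psmooth_onP => k; apply: pC_local => p [j _ jp].
  have oV : open [set p : 'rV[R]_q * K | ball_dom cr j p.1] by apply: open_fst; exact: open_ball_dom.
  exists [set p | ball_dom cr j p.1] => //.
  apply: (pC_eq (f := fun u x => \sum_(n < j.+1) th n u * g n u x)) => //.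
    by move=> u x /= ju; rewrite (GE j).
  apply: pC_sum => // n _.
  (* [g n] is smooth only on its doubled ball, so its factor [ball_chi] is moved next to it: the
     product with the bump is smooth everywhere. *)
  apply: (pC_eq (f := fun u x => \prod_(j0 < n) (1 - ball_chi cr j0 u) * (ball_chi cr n u * g n u x))) => //.
    by move=> u x _; rewrite /th /theta; ring.
  apply: pCM => //.
    by apply: pC_prod => // i _; apply: pCB => //; [exact: (pC_cst _ (1 : R))|exact: pC_ball_chi].
  apply: (@pC_sub _ _ _ _ setT) => //; apply: pC_chi_mul => // c r _.
  by have [/psmooth_onP/(_ k)] := gP n.
- move=> b k; have [|n [c [r [E ca]]]] := crS (s b); first by exists b.
  have jb : ball_dom cr n (s b) by rewrite /ball_dom E.
  rewrite (GE n)// -[RHS]mul1r -(sum_theta1 (ball_chi1 cr0 jb)) mulr_suml.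
  apply: eq_bigr => i _; rewrite -/th; have [->|t0] := eqVneq (th i (s b)) 0; first by rewrite !mul0r.
  by congr (_ * _); have [_] := gP i; apply; apply: (theta_supp cr0).
Qed.

(** [h] is the sum of [n * theta n]. If [b] avoids the compact sets of index at most [N], the
    weights up to [N] vanish at [s b]; as the weights add up to 1, [h (s b) >= N]. *)
Lemma proper_function (R : realType) q (I : topologicalType) (s : I -> 'rV[R]_q) :
  (forall a, exists2 O, open O /\ O (s a) & exists2 C : set I, compact C &
     forall b, O (s b) -> C b) ->
  exists (O : set 'rV[R]_q) (h : 'rV[R]_q -> R),
    [/\ open O, forall a, O (s a), smooth_on O h &
      forall c, exists2 C : set I, compact C & forall b, h (s b) <= c -> C b].
Proof.
move=> loc.
pose P c r := exists2 C : set I, compact C & forall b, box c (2 * r) (s b) -> C b.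
have [cr [crP crS]] : exists cr : nat -> option ('rV[R]_q * R),
    (forall n c r, cr n = Some (c, r) -> 0 < r /\ P c r) /\
    (forall a, range s a -> exists n c r, cr n = Some (c, r) /\ box c r a).
  apply: ball_system => _ [a _ <-]; have [U [oU Ua] [C cC UC]] := loc a.
  have /nbhs_boxP[e e0 eU] := open_near oU Ua.
  exists e => // c r r0 ce; exists C => // b /ce/eU; exact: UC.
have cr0 n c r : cr n = Some (c, r) -> 0 < r by move=> /crP[].
have /choice[C CP] : forall n, exists C : set I, compact C /\
    forall b, ball_dom2 cr n (s b) -> C b.
  move=> n; rewrite /ball_dom2; case E : (cr n) => [[c r]|]; last by exists set0; split => //; exact: compact0.
  by have [_ [C ? ?]] := crP _ _ _ E; exists C.
pose th := theta (ball_chi cr).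
pose h u := lfsum (fun n v => th n v * n%:R) u.
have hE j u : ball_dom cr j u -> h u = \sum_(n < j.+1) th n u * n%:R.
  move=> ju; rewrite /h (@lfsumE _ _ _ _ j.+1)// => i ji.
  by rewrite /th (theta_eq0 ji) ?mul0r// ball_chi1.
exists (\bigcup_j ball_dom cr j), h; split.
- by apply: bigcup_open => j _; exact: open_ball_dom.
- move=> a; have [|n [c [r [E ca]]]] := crS (s a); first by exists a.
  by exists n => //; rewrite /ball_dom E.
- apply/smooth_onP => k; apply: pC_local => p [j _ jp].
  have oV : open [set p : 'rV[R]_q * R | ball_dom cr j p.1] by apply: open_fst; exact: open_ball_dom.
  exists [set p | ball_dom cr j p.1] => //.
  apply: (pC_eq (f := fun u x => \sum_(n < j.+1) th n u * n%:R)) => //.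
    by move=> u x /= ju; rewrite (hE j).
  by apply: pC_sum => // n _; apply: pCM => //; [exact: pC_theta|exact: (pC_cst _ (n%:R : R))].
- move=> c; pose N := Num.bound `|c|.
  exists (\big[setU/set0]_(n < N.+1) C n).
    by apply: (@bigsetU_compact _ _ (fun n : 'I_N.+1 => C n)) => n _; have [] := CP n.
  move=> b hb; apply: contrapT => nC.
  have t0 n : (n <= N)%N -> th n (s b) = 0.
    move=> nN; apply/eqP; apply: contrapT => /negP/(theta_supp cr0) d.
    apply: nC; rewrite -bigcup_mkord; exists n => //=; by have [_] := CP n; apply.
  have [|n [c' [r [E ca]]]] := crS (s b); first by exists b.
  have jb : ball_dom cr n (s b) by rewrite /ball_dom E.
  have cN : c < N%:R by apply: le_lt_trans (ler_norm _) _; exact: archi_boundP.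
  have : N%:R <= h (s b).
    rewrite (hE n)// -[leLHS]mul1r -[X in X * _ <= _](sum_theta1 (ball_chi1 cr0 jb)) mulr_suml.
    apply: ler_sum => i _; rewrite -/th.
    have [iN|iN] := leqP i N; first by rewrite (t0 _ iN) !mul0r.
    rewrite ler_wpM2l ?ler_nat 1?ltnW//.
    by apply: theta_ge0 => j; exact: ball_chi01.
  by move: hb cN; lra.
Qed.

(** * Embedding a Lie group *)

Lemma compact_countable_cover (T : topologicalType) (C : set T) (U : nat -> set T) :
  compact C -> (forall n, open (U n)) -> (forall x, C x -> exists n, U n x) ->
  exists N, forall x, C x -> exists2 n, (n < N)%N & U n x.
Proof.
move=> cC oU CU; apply: contrapT => nN.
pose F := filter_from setT (fun N => [set x | C x /\ forall n, (n < N)%N -> ~ U n x]).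
have FF : ProperFilter F.
  apply: filter_from_proper; last first.
    move=> N _; apply: contrapT => h; apply: nN; exists N => x Cx.
    apply: contrapT => h'; apply: h; exists x; split=> // n nN Unx.
    by apply: h'; exists n.
  apply: filter_from_filter; first by exists 0%N.
  move=> i j _ _; exists (maxn i j) => // x [Cx h]; split; split=> // n ni; apply: h.
    by rewrite leq_max ni.
  by rewrite leq_max ni orbT.
have FC : F C by exists 0%N => // x [].
have [x [Cx clx]] := cC F FF FC.
have [n Unx] := CU x Cx.
have Fn : F [set x | C x /\ forall i, (i < n.+1)%N -> ~ U i x] by exists n.+1.
have [y [[_ h] Uny]] := clx _ (U n) Fn (open_near (oU n) Unx).
exact: h (ltnSn n) Uny.
Qed.

Lemma injective_bounded (A : set nat) (f : nat -> nat) B :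
  (forall j, A j -> (f j < B)%N) -> (forall j j', A j -> A j' -> f j = f j' -> j = j') ->
  exists N, forall j, A j -> (j < N)%N.
Proof.
elim: B A => [|B IH] A fB inj; first by exists 0%N => j /fB.
have [[j0 [Aj0 fj0]]|nj] := pselect (exists j, A j /\ f j = B); last first.
  apply: IH inj => j Aj; have := fB j Aj; rewrite ltnS leq_eqVlt => /predU1P[h|//].
  by exfalso; apply: nj; exists j.
have [||N hN] := IH [set j | A j /\ j <> j0].
- move=> j [Aj jj0]; have := fB j Aj; rewrite ltnS leq_eqVlt => /predU1P[h|//].
  by exfalso; apply: jj0; apply: inj => //; rewrite h.
- by move=> j j' [Aj _] [Aj' _]; exact: inj.
exists (maxn N j0.+1) => j Aj; have [->|jj0] := pselect (j = j0).
  by rewrite leq_max ltnSn orbT.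
by rewrite leq_max hN.
Qed.

(** Indices are coloured in increasing order. The injection [f] into the numbers below [B] says that
    at most [B] indices conflict with [n], so one of [B.+1] colours is always free. *)
Lemma greedy_colouring (E : nat -> nat -> Prop) B :
  (forall n, exists f : nat -> nat, forall j, E j n -> (f j < B)%N /\
     forall j', E j' n -> f j = f j' -> j = j') ->
  exists col : nat -> 'I_B.+1, forall j n, (j < n)%N -> E j n -> col j <> col n.
Proof.
move=> Ef.
pose P (s : seq 'I_B.+1) : set 'I_B.+1 :=
  [set a | forall j, (j < size s)%N -> E j (size s) -> nth ord0 s j <> a].
pose cols := fix cols n := if n is k.+1 then rcons (cols k) (xget ord0 (P (cols k))) else [::].
have sz n : size (cols n) = n by elim: n => //= n IH; rewrite size_rcons IH.
have nthS n j : (j < n)%N -> nth ord0 (cols n) j = nth ord0 (cols j.+1) j.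
  elim: n => // n IH; rewrite ltnS leq_eqVlt => /predU1P[->//|jn].
  by rewrite /= nth_rcons sz jn IH.
have Pex s : exists a, P s a.
  apply: contrapT => h; have [f fP] := Ef (size s).
  have /choice[g gP] : forall a : 'I_B.+1, exists j, [/\ (j < size s)%N, E j (size s) & nth ord0 s j = a].
    move=> a; apply: contrapT => h'; apply: h; exists a => j js Ej ja.
    by apply: h'; exists j.
  have fg a : (f (g a) < B)%N by have [_ /fP[]] := gP a.
  have inj : injective (fun a => Ordinal (fg a)).
    move=> a b /(congr1 val) /= ab.
    have [_ Ea <-] := gP a; have [_ Eb <-] := gP b.
    by congr nth; have [_ /(_ _ Eb)] := fP _ Ea; apply.
  by have := leq_card _ inj; rewrite !card_ord ltnn.
exists (fun n => nth ord0 (cols n.+1) n) => j n jn Ejn.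
have key : forall j, (j < size (cols n))%N -> E j (size (cols n)) ->
  nth ord0 (cols n) j <> xget ord0 (P (cols n)) := xgetPex ord0 (Pex (cols n)).
have := key j; rewrite sz => /(_ jn Ejn).
by rewrite nthS// => h; rewrite [X in _ <> X]/= nth_rcons sz ltnn eqxx.
Qed.

Lemma dense_sequence (T : topologicalType) (x0 : T) : @second_countable T ->
  exists d : nat -> T, forall U, open U -> U !=set0 -> exists n, U (d n).
Proof.
move=> [B /countable_injP[f finj] [Bo Bb]].
have /choice[d dP] : forall n, exists x, forall A, B A -> f A = n -> A !=set0 -> A x.
  move=> n; have [[A [BA fA [x Ax]]]|h] := pselect (exists A, [/\ B A, f A = n & A !=set0]).
    exists x => A' BA' fA' _; rewrite -(finj A A') ?inE//; by rewrite fA fA'.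
  by exists x0 => A BA fA A0; exfalso; apply: h; exists A.
exists d => U oU [x Ux]; have [A [BA Ax] AU] := Bb x U (open_near oU Ux).
by exists (f A); apply: AU; apply: dP => //; exists x.
Qed.

Section lie_group_theory.
Variables (R : realType) (L : lie_group R).
Implicit Types x y z : L.

Lemma lmulrV x : lmul x (linv x) = lone L.
Proof.
rewrite -[lmul x _](lmul1 (l := L)) -{1}(lmulV (linv x)) -lmulA [lmul (linv x) _]lmulA.
by rewrite lmulV lmul1 lmulV.
Qed.

Lemma lmulr1 x : lmul x (lone L) = x.
Proof. by rewrite -(lmulV x) lmulA lmulrV lmul1. Qed.

Lemma lmulVK x y : lmul x (lmul (linv x) y) = y.
Proof. by rewrite lmulA lmulrV lmul1. Qed.

Lemma linvK x : linv (linv x) = x.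
Proof. by rewrite -[LHS]lmulr1 -(lmulV x) lmulA lmulV lmul1. Qed.

Lemma linvM x y : linv (lmul x y) = lmul (linv y) (linv x).
Proof.
rewrite -[RHS]lmulr1 -(lmulrV (lmul x y)) !lmulA -(lmulA (linv y)) lmulV lmulr1.
by rewrite lmulV lmul1.
Qed.

Lemma linv1 : linv (lone L) = lone L.
Proof. by rewrite -[LHS]lmulr1 lmulV. Qed.

Lemma lmul_continuous (T : topologicalType) (f g : T -> L) p :
  {for p, continuous f} -> {for p, continuous g} -> {for p, continuous (fun t => lmul (f t) (g t))}.
Proof.
move=> cf cg; have [c _] := lmul_smooth L.
apply: (@continuous_comp _ _ _ (fun t => (f t, g t)) (fun p : L * L => lmul p.1 p.2)); last exact: c.
exact: continuous_pair.
Qed.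

Lemma linv_continuous (T : topologicalType) (f : T -> L) p :
  {for p, continuous f} -> {for p, continuous (fun t => linv (f t))}.
Proof.
move=> cf; have [c _] := linv_smooth L.
by apply: (@continuous_comp _ _ _ f (@linv R L)); last exact: c.
Qed.

Lemma translate_continuous a : continuous (fun x : L => lmul a x).
Proof. by move=> x; apply: lmul_continuous; [exact: cst_continuous|exact: cvg_id]. Qed.

Section ps_lie.
Variables (n : nat) (K : topologicalType) (W : set ('rV[R]_n * K)).
Hypothesis oW : open W.

Lemma ps_lmul f g : ps (M := L) W f -> ps (M := L) W g -> ps (M := L) W (fun u q => lmul (f u q) (g u q)).
Proof.
move=> sf sg; have aL := manifold_atlasP L.
exact: (ps_smooth_map oW (prod_chart_atlas aL aL) aL (lmul_smooth L) (ps_pair sf sg)).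
Qed.

Lemma ps_linv f : ps (M := L) W f -> ps (M := L) W (fun u q => linv (f u q)).
Proof.
by move=> sf; have aL := manifold_atlasP L; exact: (ps_smooth_map oW aL aL (linv_smooth L) sf).
Qed.

Lemma ps_translate a f : ps (M := L) W f -> ps (M := L) W (fun u q => lmul a (f u q)).
Proof.
move=> sf; apply: ps_lmul => //; apply: (ps_param oW (kappa := fun=> a)) => //.
  exact: manifold_atlasP.
by move=> ?; exact: cst_continuous.
Qed.

End ps_lie.

Lemma nbhs_div (V0 : set L) : open V0 -> V0 (lone L) ->
  exists W : set L, [/\ open W, W (lone L),
    forall a b, W a -> W b -> V0 (lmul a (linv b)) &
    forall a b, W a -> W b -> V0 (lmul (linv a) b)].
Proof.
move=> oV V1.
have n1 : \forall p \near ((lone L, lone L) : L * L), V0 (lmul p.1 (linv p.2)).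
  have c : {for (lone L, lone L), continuous (fun p : L * L => lmul p.1 (linv p.2))}.
    by apply: lmul_continuous; [exact: cvg_fst|apply: linv_continuous; exact: cvg_snd].
  by apply: (c V0); apply: open_near => //=; rewrite linv1 lmul1.
have n2 : \forall p \near ((lone L, lone L) : L * L), V0 (lmul (linv p.1) p.2).
  have c : {for (lone L, lone L), continuous (fun p : L * L => lmul (linv p.1) p.2)}.
    by apply: lmul_continuous; [apply: linv_continuous; exact: cvg_fst|exact: cvg_snd].
  by apply: (c V0); apply: open_near => //=; rewrite linv1 lmul1.
have [[A1 B1] /= [nA1 nB1] h1] := n1; have [[A2 B2] /= [nA2 nB2] h2] := n2.
have nW : nbhs (lone L) ((A1 `&` B1) `&` (A2 `&` B2)) by apply: (filterI (filterI nA1 nB1) (filterI nA2 nB2)).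
move: nW; rewrite nbhsE => -[W [oW W1] Wsub]; exists W; split=> //.
- by move=> a b /Wsub[[? ?] _] /Wsub[[? ?] _]; exact: (h1 (a, b)).
- by move=> a b /Wsub[_ [? ?]] /Wsub[_ [? ?]]; exact: (h2 (a, b)).
Qed.

End lie_group_theory.

Lemma mx_index_case m n (P : 'I_(m * n) -> Prop) :
  (forall i j, P (mxvec_index i j)) -> forall k, P k.
Proof. by move=> h k; case/mxvec_indexP: k => i j. Qed.

Lemma left_inverse_jac (R : realType) n m (U : set 'rV[R]_n) (V : set 'rV[R]_m)
    (kappa : 'rV[R]_n -> 'rV[R]_m) (lam : 'rV[R]_m -> 'rV[R]_n) u :
  open U -> open V -> U u -> (forall v, U v -> V (kappa v)) ->
  (forall j, smooth_on U (fun v => kappa v 0 j)) -> (forall j, smooth_on V (fun w => lam w 0 j)) ->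
  (forall v, U v -> lam (kappa v) = v) -> jac kappa u *m jac lam (kappa u) = 1%:M.
Proof.
move=> oU oV Uu UV sk sl lk; apply/matrixP => i j; rewrite !mxE.
have h1 : \forall z \near kappa u, forall l, derivable (fun w => lam w 0 j) z (delta_mx 0 l).
  by apply: filterS (open_near oV (UV _ Uu)) => z Vz l; exact: (smooth_on_derivable (sl j)).
have h2 l : {for kappa u, continuous (fun z => 'D_(delta_mx 0 l) (fun w => lam w 0 j) z)}.
  exact: (smooth_on_derive_continuous (sl j) (UV _ Uu)).
have h3 l : derivable (fun z => kappa z 0 l) u (delta_mx 0 i) by exact: (smooth_on_derivable (sk l)).
have [_ D] := is_derive_chain h1 h2 h3.
rewrite -(eq_bigr _ (fun l _ => erefl)) in D.
transitivity ('D_(delta_mx 0 i) (fun z => lam (kappa z) 0 j) u).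
  by rewrite D; apply: eq_bigr => l _; rewrite !mxE.
have -> : 'D_(delta_mx 0 i) (fun z => lam (kappa z) 0 j) u =
    'D_(delta_mx 0 i) (fun z : 'rV[R]_n => z 0 j) u.
  by apply: near_eq_derive; apply: filterS (open_near oU Uu) => z /lk ->.
by have [_ ->] := is_derive_coord j u (delta_mx 0 i); rewrite mxE eqxx eq_sym.
Qed.

Section lie_embedding.
Variables (R : realType) (L : lie_group R).
Variables (c0 : chart R L (mdim L)) (r : R).
Hypotheses (Cc0 : charts (a := L) c0) (d1 : cdom c0 (lone L)) (r0 : 0 < r).
Let u0 := cmap c0 (lone L).
Hypothesis r_img : box u0 (2 * r) `<=` cimg c0.

Let ch0 : is_chart c0. Proof. by have [h _] := manifold_atlasP L; exact: h. Qed.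

(* Component 0 is a bump at 1, component 1 the same bump, component [j + 2] the j-th coordinate
   cut off by the bump. *)
Definition blob_coord (l : 'I_(mdim L).+2) (u : 'rV[R]_(mdim L)) : R :=
  if unlift ord0 l is Some l' then if unlift ord0 l' is Some j then u 0 j else 1 else 1.

Definition blob (l : 'I_(mdim L).+2) (x : L) : R :=
  if `[< cdom c0 x >] then bump u0 r (cmap c0 x) * blob_coord l (cmap c0 x) else 0.

(** Pulled back from the closed box of radius [3 / 2 * r], outside which the bump vanishes; it is
    compact, while the support lies well inside the chart. *)
Let S : set L := cinv c0 @` [set u : 'rV[R]_(mdim L) | forall j, `|u 0 j - u0 0 j| <= 3 / 2 * r].

Let S_img (u : 'rV[R]_(mdim L)) : (forall j, `|u 0 j - u0 0 j| <= 3 / 2 * r) -> cimg c0 u.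
Proof. by move=> h; apply: r_img => j; apply: le_lt_trans (h j) _; have := r0; lra. Qed.

Lemma blob_supp_compact : compact S.
Proof.
apply: continuous_compact.
  apply: continuous_in_subspaceT => u /set_mem uS.
  by have [_ _ _ _ ci] := ch0; apply: ci; exact: S_img.
rewrite (_ : [set u : 'rV[R]_(mdim L) | _] = [set u : 'rV[R]_(mdim L) | forall j, `[u0 0 j - 3 / 2 * r, u0 0 j + 3 / 2 * r]%classic (u 0 j)]).
  by apply: (@rV_compact R _ (fun j => `[u0 0 j - 3 / 2 * r, u0 0 j + 3 / 2 * r]%classic)) => j; exact: segment_compact.
apply/seteqP; split => u h j; have := h j; rewrite /= in_itv /= ler_norml => /andP[? ?]; apply/andP; split; lra.
Qed.

Lemma blob_supp l x : blob l x != 0 -> S x.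
Proof.
rewrite /blob; case: asboolP => [dx b0|]; last by rewrite eqxx.
exists (cmap c0 x); last by have [_ _ k _ _] := ch0; exact: k.
move=> j; rewrite leNgt; apply: contra b0 => h.
by rewrite (bump0 (i := j)) ?mul0r// ltW.
Qed.

Lemma blob_coord_smooth l k n (K : topologicalType) (W : set ('rV[R]_n * K))
    (phi : 'rV[R]_n -> K -> 'rV[R]_(mdim L)) : open W ->
  (forall j, pC k W (fun u q => phi u q 0 j)) -> pC k W (fun u q => blob_coord l (phi u q)).
Proof.
move=> oW h; rewrite /blob_coord; case: unlift => [l'|]; last exact: (pC_cst _ (1 : R)).
by case: unlift => [j|]; [exact: h|exact: (pC_cst _ (1 : R))].
Qed.

(** Near a point outside the chart the blob is 0: [S] is compact, hence closed in the Hausdorff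
    space [L], and it lies in the chart domain. *)
Lemma ps_blob l n (K : topologicalType) (W : set ('rV[R]_n * K)) f : open W ->
  ps (M := L) W f -> psmooth_on W (fun u q => blob l (f u q)).
Proof.
move=> oW sf; apply/psmooth_onP => k; apply: pC_local => p Wp.
have [dp|dp] := pselect (cdom c0 (f p.1 p.2)).
  have oV := ps_open oW sf ch0.
  exists [set p | W p /\ cdom c0 (f p.1 p.2)] => //.
  have Cphi j : pC k [set p | W p /\ cdom c0 (f p.1 p.2)] (fun u q => cmap c0 (f u q) 0 j).
    by have [_ /(_ c0 Cc0 j)/psmooth_onP/(_ k)] := sf.
  apply: (pC_eq (f := fun u q => bump u0 r (cmap c0 (f u q)) * blob_coord l (cmap c0 (f u q)))) => //.
    by move=> u q [_ d]; rewrite /blob; case: asboolP.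
  apply: pCM => //; last exact: blob_coord_smooth.
  apply: (pC_comp (W' := setT) (f := fun u _ => bump u0 r u) (phi := fun u q => cmap c0 (f u q)) (kappa := id)) => //.
  - exact: openT.
  - by move=> u q _; exact: cvg_id.
  - by apply: pC_bump; exact: openT.
have cS : closed S.
  by apply: compact_closed; [have [] := manifold_axioms L|exact: blob_supp_compact].
have oV : open [set p | W p /\ ~ S (f p.1 p.2)].
  apply: (open_preim (f := fun p => f p.1 p.2) (V := ~` S)) => //; first by have [] := sf.
  exact: closed_openC.
exists [set p | W p /\ ~ S (f p.1 p.2)].
  split=> // -[u hu uE]; apply: dp; rewrite -uE.
  have [x dx xu] := S_img hu; have [_ _ k1 _ _] := ch0.
  by rewrite -xu k1.
apply: (pC_eq (f := fun _ _ => 0)) => //; last exact: (pC_cst _ (0 : R)).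
move=> u q [_ nS]; apply/esym/eqP; apply: contrapT => /negP h; apply: nS.
exact: blob_supp h.
Qed.

Let V0 : set L := [set x | cdom c0 x /\ box u0 r (cmap c0 x)].

Lemma blob_near1 l x : V0 x -> blob l x = blob_coord l (cmap c0 x).
Proof. by move=> [dx bx]; rewrite /blob; case: asboolP => // _; rewrite bump1// mul1r. Qed.

Let oV0 : open V0.
Proof. by have [oc _ _ cm _] := ch0; apply: open_preim => //; exact: open_box. Qed.

Let V01 : V0 (lone L).
Proof. by split=> // j; rewrite subrr normr0. Qed.

(* The family is a maximal separated set of translates. *)
Lemma translates : exists (d : nat -> L) (inc : nat -> Prop) (B : nat),
  (forall x, exists2 m, inc m & V0 (lmul (linv (d m)) x)) /\
  (forall n, exists f : nat -> nat, forall j,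
     (inc j /\ exists2 x, S (lmul (linv (d j)) x) & S (lmul (linv (d n)) x)) -> (f j < B)%N /\
     forall j', (inc j' /\ exists2 x, S (lmul (linv (d j')) x) & S (lmul (linv (d n)) x)) ->
       f j = f j' -> j = j').
Proof.
have [_ sc _ _ _] := manifold_axioms L.
have [d dP] := dense_sequence (lone L) sc.
(* [V0] contains [W W^-1], and [W] contains [W'^-1 W']. Centres are selected so that no quotient of
   two of them lies in [W]: by maximality the translates of [V0] cover, and a translate of [W']
   contains at most one centre. *)
have [W [oW W1 WW _]] := nbhs_div oV0 V01.
have [W' [oW' W'1 _ WW']] := nbhs_div oW W1.
pose Q (s : seq nat) k := forall m, m \in s -> ~ W (lmul (linv (d m)) (d k)).
pose incs := fix incs n := if n is k.+1 then
   (if `[< Q (incs k) k >] then rcons (incs k) k else incs k) else [::].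
pose inc n := n \in incs n.+1.
have incs_lt n m : m \in incs n -> (m < n)%N.
  elim: n => //= n IH; case: asboolP => _; last by move=> /IH; exact: leqW.
  by rewrite mem_rcons inE => /predU1P[->//|/IH]; exact: leqW.
have incsP n m : (m < n)%N -> (m \in incs n) = (m \in incs m.+1).
  elim: n => // n IH; rewrite ltnS leq_eqVlt => /predU1P[->//|mn].
  rewrite /= -IH//; case: asboolP => _ //; rewrite mem_rcons inE.
  by rewrite (ltn_eqF mn).
have incE n : inc n <-> Q (incs n) n.
  rewrite /inc /=; case: asboolP => h; first by rewrite mem_rcons inE eqxx.
  split=> // /incs_lt; by rewrite ltnn.
have sep m n : inc m -> inc n -> (m < n)%N -> ~ W (lmul (linv (d m)) (d n)).
  by move=> im /incE Qn mn; apply: Qn; rewrite incsP.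
(* If the translates of [S] at [d j] and [d n] meet, then [(d n)^-1 d j] lies in [S S^-1]. This
   compact set is covered by [B] translates of [W'], each of which holds at most one such quotient,
   whence the bound on the multiplicity. *)
pose CC := [set lmul p.1 (linv p.2) | p in S `*` S].
have cCC : compact CC.
  apply: continuous_compact; last by apply: compact_setX; exact: blob_supp_compact.
  apply: continuous_in_subspaceT => p _.
  by apply: lmul_continuous; [exact: cvg_fst|apply: linv_continuous; exact: cvg_snd].
have [B CB] : exists B, forall x, CC x -> exists2 n, (n < B)%N & W' (lmul (linv (d n)) x).
  apply: (compact_countable_cover (U := fun n => [set x | W' (lmul (linv (d n)) x)])) => //.
    by move=> n; apply: (@open_comp _ _ (fun x => lmul (linv (d n)) x)) => // x _; exact: translate_continuous.
  move=> x _; apply: (dP [set y | W' (lmul (linv y) x)]); last by exists x; rewrite /= lmulV.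
  apply: (@open_comp _ _ (fun y => lmul (linv y) x)) => // y _.
  by apply: lmul_continuous; [apply: linv_continuous; exact: cvg_id|exact: cst_continuous].
exists d, inc, B; split.
  move=> x; have [n Wn] : exists n, W (lmul (linv x) (d n)).
    apply: (dP [set y | W (lmul (linv x) y)]); last by exists x; rewrite /= lmulV.
    by apply: (@open_comp _ _ (fun y => lmul (linv x) y)) => // y _; exact: translate_continuous.
  have dx y : lmul (linv y) x = lmul (lmul (linv y) (d n)) (linv (lmul (linv x) (d n))).
    by rewrite linvM linvK -!lmulA lmulVK.
  have [/incE h|h] := pselect (inc n).
    exists n; first exact/incE.
    by rewrite dx; apply: WW => //; rewrite lmulV.
  have [m [im Wm]] : exists m, inc m /\ W (lmul (linv (d m)) (d n)).
    apply: contrapT => h'; apply: h; apply/incE => m ms Wm; apply: h'; exists m; split=> //.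
    by rewrite /inc -(incsP n)// incs_lt.
  by exists m => //; rewrite dx; apply: WW.
move=> n; pose A j := inc j /\ exists2 x, S (lmul (linv (d j)) x) & S (lmul (linv (d n)) x).
have AC j : A j -> CC (lmul (linv (d n)) (d j)).
  move=> [_ [x Sj Sn]]; exists (lmul (linv (d n)) x, lmul (linv (d j)) x) => //=.
  by rewrite linvM linvK -!lmulA lmulVK.
have /choice[f fP] : forall j, exists l, A j -> (l < B)%N /\ W' (lmul (linv (d l)) (lmul (linv (d n)) (d j))).
  move=> j; have [/AC/CB[l lB Wl]|h] := pselect (A j); last by exists 0%N.
  by exists l.
exists f => j Aj; have [fB Wj] := fP _ Aj; split=> // j' Aj' ff.
have [fB' Wj'] := fP _ Aj'.
suff H a b : A a -> A b -> (a < b)%N -> f a = f b -> False.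
  case: (ltngtP j j') => // jj; first by have := H _ _ Aj Aj' jj ff.
  by have := H _ _ Aj' Aj jj (esym ff).
move=> Aa Ab ab fab; have [_ Wa] := fP _ Aa; have [_ Wb] := fP _ Ab.
apply: (sep _ _ Aa.1 Ab.1 ab).
have := WW' _ _ Wa Wb; rewrite -fab !linvM !linvK -!lmulA lmulVK.
by rewrite lmulVK.
Qed.

Let V0_supp x : V0 x -> S x.
Proof.
move=> Vx; apply: (blob_supp (l := ord0)); rewrite blob_near1// /blob_coord unlift_none.
exact: oner_neq0.
Qed.

Let i0 : 'I_(mdim L).+2 := ord0.
Let i1 : 'I_(mdim L).+2 := lift ord0 ord0.
Let i2 (j : 'I_(mdim L)) : 'I_(mdim L).+2 := lift ord0 (lift ord0 j).

Let coord_i0 u : blob_coord i0 u = 1. Proof. by rewrite /blob_coord /i0 unlift_none. Qed.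
Let coord_i1 u : blob_coord i1 u = 1. Proof. by rewrite /blob_coord /i1 liftK unlift_none. Qed.
Let coord_i2 j u : blob_coord (i2 j) u = u 0 j. Proof. by rewrite /blob_coord /i2 !liftK. Qed.

Let i21 j : (i2 j == i1) = false. Proof. by []. Qed.

(** Translates of the same colour have disjoint supports, so one sum per colour and component is
    enough, and at each point it has at most one nonzero term. The weight [wt] multiplies component
    1 by the index of the translate: the ratio of components 1 and 0 identifies the translate, and
    the ratios of the others to component 0 are its chart coordinates. *)
Lemma lie_blob_embedding : exists p (e : L -> 'rV[R]_p), (0 < p)%N /\ embedding e.
Proof.
have [d [inc [B [dcov dmul]]]] := translates.
pose bl i l x := blob l (lmul (linv (d i)) x).
have [col colP] : exists col : nat -> 'I_B.+1, forall j n, (j < n)%N ->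
    (inc j /\ exists2 x, S (lmul (linv (d j)) x) & S (lmul (linv (d n)) x)) -> col j <> col n.
  exact: greedy_colouring.
pose wt (l : 'I_(mdim L).+2) (i : nat) : R := if l == i1 then i%:R else 1.
pose term c l i x : R := if `[< inc i >] && (col i == c) then wt l i * bl i l x else 0.
pose EE c l x := lfsum (term c l) x.
have term0 c l i x : term c l i x != 0 -> [/\ inc i, col i = c & bl i l x != 0].
  rewrite /term; case: asboolP => [ii|]; last by rewrite eqxx.
  rewrite /=; case: (col i =P c) => [cc|]; last by rewrite eqxx.
  by move=> h; split=> //; apply: contra h => /eqP ->; rewrite mulr0.
have near_fin m : inc m -> exists N, forall x, V0 (lmul (linv (d m)) x) ->
    forall i, (N <= i)%N -> forall c l, term c l i x = 0.
  move=> im; have [f fP] := dmul m.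
  have [N NP] : exists N, forall j, (inc j /\ exists2 x, S (lmul (linv (d j)) x) & S (lmul (linv (d m)) x)) -> (j < N)%N.
    apply: (@injective_bounded _ f B); first by move=> j /fP[].
    by move=> j j' Aj Aj' ff; have [_ /(_ _ Aj')] := fP _ Aj; apply.
  exists N => x Vx i Ni c l; apply/eqP; apply: contrapT => /negP/term0[ii _ b0].
  have : (i < N)%N by apply: NP; split=> //; exists x; [exact: blob_supp b0|exact: V0_supp].
  by rewrite ltnNge Ni.
have uniq_i i i' l l' x : inc i -> inc i' -> col i = col i' -> bl i l x != 0 -> bl i' l' x != 0 -> i = i'.
  move=> ii ii' cc b b'; have [Sx Sx'] := (blob_supp b, blob_supp b').
  case: (ltngtP i i') => // h.
    by exfalso; apply: (colP i i' h) => //; split=> //; exists x.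
  by exfalso; apply: (colP i' i h) => //; split=> //; exists x.
have EEval i l0 x l : inc i -> bl i l0 x != 0 -> EE (col i) l x = wt l i * bl i l x.
  move=> ii b0; have t0 i' : i' != i -> term (col i) l i' x = 0.
    move=> /eqP h; apply/eqP; apply: contrapT => /negP/term0[ii' cc b'].
    by apply: h; exact: uniq_i b' b0.
  rewrite /EE (@lfsumE _ _ _ _ i.+1); last by move=> i' h; apply: t0; rewrite gt_eqF.
  rewrite big_ord_recr /= big1 ?add0r; last by move=> j _; apply: t0; rewrite ltn_eqF.
  by rewrite /term eqxx; case: asboolP.
have EEn0 c l x : EE c l x != 0 -> exists i, [/\ inc i, col i = c & bl i l x != 0].
  move=> h; apply: contrapT => h'; move/negP: h; apply; apply/eqP.
  rewrite /EE (@lfsumE _ _ _ _ 0%N) ?big_ord0// => i _.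
  by apply/eqP; apply: contrapT => /negP/term0 ?; apply: h'; exists i.
have tr_cont m : continuous (fun x => lmul (linv (d m)) x) by exact: translate_continuous.
have sEE c l n (K : topologicalType) (W : set ('rV[R]_n * K)) f : open W -> ps (M := L) W f ->
    psmooth_on W (fun u q => EE c l (f u q)).
  move=> oW sf; apply/psmooth_onP => k; apply: pC_local => p Wp.
  have [m im Vm] := dcov (f p.1 p.2); have [N NP] := near_fin m im.
  have oV : open [set p | W p /\ V0 (lmul (linv (d m)) (f p.1 p.2))].
    apply: (open_preim (f := fun p => lmul (linv (d m)) (f p.1 p.2))) => // q Wq.
    apply: (@continuous_comp _ _ _ (fun q : 'rV[R]_n * K => f q.1 q.2) (fun x => lmul (linv (d m)) x)); last exact: tr_cont.
    by have [cf _] := sf; exact: cf.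
  exists [set p | W p /\ V0 (lmul (linv (d m)) (f p.1 p.2))] => //.
  apply: (pC_eq (f := fun u q => \sum_(i < N) term c l i (f u q))) => //.
    by move=> u q [_ Vx]; rewrite /EE (@lfsumE _ _ _ _ N)// => i Ni; exact: NP.
  apply: pC_sum => // i _; rewrite /term; case: (`[< inc i >] && (col i == c)); last exact: (pC_cst _ (0 : R)).
  apply: pCZ => //; apply: (@pC_sub _ _ _ _ W); first by move=> q [].
  by have /psmooth_onP/(_ k) := ps_blob l oW (ps_translate oW (linv (d i)) sf).
pose e x : 'rV[R]_(B.+1 * (mdim L).+2) := mxvec (\matrix_(c, l) EE c l x).
have eE x c l : e x 0 (mxvec_index c l) = EE c l x by rewrite mxvecE mxE.
have blob_n0 l x : blob l x != 0 -> cdom c0 x /\ 0 < blob i0 x.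
  rewrite /blob; case: asboolP => [dx|]; last by rewrite eqxx.
  move=> h; split=> //; rewrite coord_i0 mulr1 lt_neqAle bump_ge0 andbT eq_sym.
  by apply: contra h => /eqP ->; rewrite mul0r.
have [aL aLcov] := manifold_atlasP L.
have ixc c l : continuous (fun v : 'rV[R]_(B.+1 * (mdim L).+2) => v 0 (mxvec_index c l)).
  exact: coord_continuous.
have etop (U : set L) : open U -> exists2 V, open V & U = e @^-1` V.
  move=> oU.
  pose A m := [set u : 'rV[R]_(mdim L) | cimg c0 u /\ U (lmul (d m) (cinv c0 u))].
  have oA m : open (A m).
    have [_ oi _ _ ci] := ch0; apply: (open_preim (f := fun u => lmul (d m) (cinv c0 u))) => // u iu.
    by apply: (@continuous_comp _ _ _ (cinv c0) (fun x => lmul (d m) x)); [exact: ci|exact: translate_continuous].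
  pose v_ m l (v : 'rV[R]_(B.+1 * (mdim L).+2)) : R := v 0 (mxvec_index (col m) l).
  (* On the image, the components 0 and 1 are [b] and [i * b] with [b > 0] for the active index [i].
     The second condition then reads [|i - m| < 1], that is [i = m]; the third one recovers the
     point from the ratios. *)
  pose V m := [set v | (1 / 2 < v_ m i0 v /\ `|v_ m i1 v - m%:R * v_ m i0 v| - v_ m i0 v < 0) /\
     A m (\row_j (v_ m (i2 j) v / v_ m i0 v))].
  exists (\bigcup_(m in [set m | inc m]) V m).
    apply: bigcup_open => m _.
    have o1 : open [set v | 1 / 2 < v_ m i0 v /\ `|v_ m i1 v - m%:R * v_ m i0 v| - v_ m i0 v < 0].
      apply: openI.
        by apply: (@open_comp _ _ (v_ m i0) [set t | 1 / 2 < t]); [move=> ? _; exact: ixc|exact: open_gt].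
      apply: (@open_comp _ _ (fun v => `|v_ m i1 v - m%:R * v_ m i0 v| - v_ m i0 v) [set t | t < 0]); last exact: open_lt.
      by move=> v _; exact: (cvgB (cvg_norm (cvgB (ixc _ _ v) (cvgM (cvg_cst _) (ixc _ _ v)))) (ixc _ _ v)).
    apply: (open_preim (f := fun v => \row_j (v_ m (i2 j) v / v_ m i0 v))) => // v [v0 _].
    apply: rV_continuous => j.
    rewrite (_ : (fun q => _) = fun q => v_ m (i2 j) q / v_ m i0 q); last by apply/funext => q; rewrite mxE.
    have vn0 : v_ m i0 v != 0 by rewrite gt_eqF//; lra.
    exact: (cvgM (ixc _ _ v) (cvgV vn0 (ixc _ _ v))).
  have eV m l x : v_ m l (e x) = EE (col m) l x by exact: eE.
  apply/seteqP; split => x.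
    move=> Ux; have [m im Vm] := dcov x; exists m => //.
    have b0 : bl m i0 x != 0 by rewrite /bl blob_near1// coord_i0 oner_neq0.
    have E0 : EE (col m) i0 x = 1 by rewrite (EEval m i0)// /wt /bl blob_near1// coord_i0 mulr1.
    have E1 : EE (col m) i1 x = m%:R by rewrite (EEval m i0)// /wt eqxx /bl blob_near1// coord_i1 mulr1.
    split; first by rewrite !eV E0 E1 mulr1 subrr normr0; split; lra.
    have -> : \row_j (v_ m (i2 j) (e x) / v_ m i0 (e x)) = cmap c0 (lmul (linv (d m)) x).
      apply/rowP => j; rewrite mxE !eV E0 divr1 (EEval m i0)// /wt i21.
      by rewrite mul1r /bl blob_near1// coord_i2.
    have [dx _] := Vm; have [_ _ k1 _ _] := ch0.
    by split; [exists (lmul (linv (d m)) x)|rewrite k1// lmulVK].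
  move=> [m im [[h0 h1]]]; rewrite !eV in h0 h1.
  have [|i [ii ci b0]] := EEn0 (col m) i0 x; first by rewrite gt_eqF//; lra.
  have [dx bpos] := blob_n0 _ _ b0.
  have E0 : EE (col m) i0 x = bl i i0 x by rewrite -ci (EEval i i0)// /wt mul1r.
  have E1 : EE (col m) i1 x = i%:R * bl i i0 x.
    rewrite -ci (EEval i i0)// /wt eqxx; congr (_ * _).
    by rewrite /bl /blob; case: asboolP => //; rewrite coord_i0 coord_i1.
  have im' : i = m.
    move: h1; rewrite E0 E1 -mulrBl normrM (gtr0_norm bpos) subr_lt0 -[ltRHS]mul1r ltr_pM2r//.
    rewrite ltr_norml => /andP[h2 h3]; apply/eqP; rewrite eqn_leq; apply/andP; split.
      by rewrite -ltnS -(ltr_nat R) -natr1; lra.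
    by rewrite -ltnS -(ltr_nat R) -[i.+1%:R]natr1; lra.
  have -> : \row_j (v_ m (i2 j) (e x) / v_ m i0 (e x)) = cmap c0 (lmul (linv (d m)) x).
    apply/rowP => j; rewrite mxE !eV E0 -ci (EEval i i0)// /wt i21.
    rewrite mul1r /bl /blob -im'; case: asboolP => // _; rewrite coord_i0 coord_i2 mulr1 mulrAC divff ?mul1r//.
      by move: bpos; rewrite /blob; case: asboolP => // _; rewrite coord_i0 mulr1 => /gt_eqF ->.
  move=> [_]; have [_ _ k1 _ _] := ch0; rewrite k1 ?lmulVK//.
  by rewrite -im'.
exists (B.+1 * (mdim L).+2)%N, e; split; first by rewrite muln_gt0.
split.
- move=> k; elim/mx_index_case: k => c l; rewrite (_ : (fun x => _) = EE c l); last by apply/funext => x; rewrite eE.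
  move=> ch Cch; have [_ oi _ _ _] := aL _ Cch.
  apply: (@psmooth_smooth_on _ _ R 0); apply: sEE; first exact: open_fst.
  apply: (ps_cinv (open_fst oi) Cch (phi := fun u _ => u)) => // j.
  by apply/psmooth_onP => k; apply: pC_coord; exact: open_fst.
- move=> x y exy; apply/eqP; apply: contrapT => /negP xy.
  have [hL _ _ _ _] := manifold_axioms L; move: hL; rewrite open_hausdorff => /(_ x y xy).
  move=> [[A1 A2]] /= [/set_mem Ax /set_mem Ay] [oA1 _ /eqP AA].
  have [V oV AV] := etop _ oA1.
  have : (A1 `&` A2) y by split=> //; rewrite AV /= -exy; have : (e @^-1` V) x by rewrite -AV.
  by rewrite AA.
- exact: etop.
- move=> c Cc u iu; have [m im Vm] := dcov (cinv c u).
  have [oc oi k1 cm ci] := aL _ Cc; have [oc' oi' k1' cm' ci'] := ch0.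
  pose g v := lmul (linv (d m)) (cinv c v).
  have sg : ps (M := L) [set p : 'rV[R]_(mdim L) * R | cimg c p.1] (fun v _ => g v).
    apply: ps_translate; first exact: open_fst.
    apply: (ps_cinv (open_fst oi) Cc (phi := fun u _ => u)) => // j.
    by apply/psmooth_onP => k; apply: pC_coord; exact: open_fst.
  have sgi : ps (M := L) [set p : 'rV[R]_(mdim L) * R | cimg c0 p.1] (fun v _ => lmul (d m) (cinv c0 v)).
    apply: ps_translate; first exact: open_fst.
    apply: (ps_cinv (open_fst oi') Cc0 (phi := fun u _ => u)) => // j.
    by apply/psmooth_onP => k; apply: pC_coord; exact: open_fst.
  pose W1 := [set v | cimg c v /\ V0 (g v)].
  pose W2 := [set w | cimg c0 w /\ cdom c (lmul (d m) (cinv c0 w))].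
  have oW1 : open W1.
    apply: open_preim => // v iv.
    by apply: (@continuous_comp _ _ _ (cinv c) (fun x => lmul (linv (d m)) x)); [exact: ci|exact: tr_cont].
  have oW2 : open W2.
    apply: (open_preim (f := fun w => lmul (d m) (cinv c0 w))) => // v iv.
    by apply: (@continuous_comp _ _ _ (cinv c0) (fun x => lmul (d m) x)); [exact: ci'|exact: translate_continuous].
  have cinvD v : cimg c v -> cdom c (cinv c v) /\ cmap c (cinv c v) = v.
    by move=> [x dx <-]; rewrite k1.
  have J := left_inverse_jac (kappa := fun v => cmap c0 (g v))
    (lam := fun w => cmap c (lmul (d m) (cinv c0 w))) oW1 oW2 (conj iu Vm).
  have {}J : jac (fun v => cmap c0 (g v)) u *m
      jac (fun w => cmap c (lmul (d m) (cinv c0 w))) (cmap c0 (g u)) = 1%:M.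
    apply: J.
    + move=> v [iv [dv _]]; split; first by exists (g v).
      by rewrite k1'// /g lmulVK; have [] := cinvD _ iv.
    + move=> j; have [_ /(_ c0 Cc0 j)] := sg.
      move=> /psmooth_onP sk; apply: (@psmooth_smooth_on _ _ R 0); apply/psmooth_onP => k.
      by apply: pC_sub (sk k) => p [? []].
    + move=> j; have [_ /(_ c Cc j)] := sgi.
      by move=> sk; apply: (@psmooth_smooth_on _ _ R 0).
    + by move=> v [iv [dv _]]; rewrite k1'// /g lmulVK; have [] := cinvD _ iv.
  (* The components [i2 j] in the colour of [m] suffice: near [u] they are the coordinates in [c0]
     of the translated point, and [J] gives a right inverse of their Jacobian. *)
  apply: inj_row_free => v vJ.
  rewrite -(mulmx1 v) -J mulmxA (_ : v *m _ = 0) ?mul0mx//.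
  apply/rowP => j; have /rowP/(_ (mxvec_index (col m) (i2 j))) := vJ; rewrite !mxE => vJj.
  rewrite -[RHS]vJj; apply: eq_bigr => a _; rewrite !mxE; congr (_ * _).
  apply: near_eq_derive; apply: filterS (open_near oW1 (conj iu Vm : W1 u)) => w [iw Vw].
  have bw : bl m i0 (cinv c w) != 0 by rewrite /bl blob_near1// coord_i0 oner_neq0.
  rewrite eE (EEval m i0)// /wt i21 ?mul1r /bl ?blob_near1// ?coord_i2//.
Qed.

End lie_embedding.

Lemma lie_embedding_exists (R : realType) (L : lie_group R) :
  exists p (e : L -> 'rV[R]_p), (0 < p)%N /\ embedding e.
Proof.
have [aL aLcov] := manifold_atlasP L; have [c0 Cc0 d1] := aLcov (lone L).
have [_ oi _ _ _] := aL _ Cc0.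
have i1 : cimg c0 (cmap c0 (lone L)) by exists (lone L).
have /nbhs_boxP[r r0 rI] := open_near oi i1.
have r2 : 0 < r / 2 by lra.
apply: (lie_blob_embedding Cc0 d1 r2) => u h; apply: rI => j; apply: lt_le_trans (h j) _; lra.
Qed.

(** * Extensions to Euclidean space *)

Lemma row_free_row_mx (R : realType) n m1 m2 (A : 'M[R]_(n, m1)) (B : 'M[R]_(n, m2)) :
  row_free A -> row_free (row_mx A B).
Proof.
move=> /row_freeP[C AC]; apply: inj_row_free => v.
rewrite mul_mx_row => /(congr1 lsubmx); rewrite row_mxKl => vA.
by rewrite -(mulmx1 v) -AC mulmxA vA !linear0 !mul0mx.
Qed.

(** Any smooth function may be adjoined as an extra coordinate. This is how an equation stated for
    embeddings yields one for every smooth function of the solution. *)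
Lemma embedding_row (R : realType) (M : atlas_space R) m1 m2 (e : M -> 'rV[R]_m1) (f : M -> 'rV[R]_m2) :
  embedding e -> (forall j, smooth_fun (fun x => f x 0 j)) ->
  embedding (fun x => row_mx (e x) (f x)).
Proof.
move=> [se einj etop eimm] sf; split.
- move=> j; case: (split_ordP j) => k ->.
    rewrite (_ : (fun x => _) = fun x => e x 0 k)//; apply/funext => x; exact: row_mxEl.
  rewrite (_ : (fun x => _) = fun x => f x 0 k)//; apply/funext => x; exact: row_mxEr.
- by move=> x y /(congr1 lsubmx); rewrite !row_mxKl => /einj.
- move=> U /etop[V oV ->]; exists (lsubmx @^-1` V).
    by apply: open_comp => // v _; exact: lsubmx_continuous.
  by apply/seteqP; split => x /=; rewrite row_mxKl.
- move=> c Cc u iu; have := eimm c Cc u iu.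
  set A := \matrix_(_, _) _ => /row_free_row_mx fA.
  rewrite (_ : \matrix_(_, _) _ = row_mx A (\matrix_(a < mdim M, j < m2)
     'D_(delta_mx 0 a) (fun v => f (cinv c v) 0 j) u)); first exact: fA.
  apply/matrixP => a j; rewrite mxE; case: (split_ordP j) => k ->.
    rewrite row_mxEl mxE; congr ('D_ _ _ _); apply/funext => x; exact: row_mxEl.
  rewrite row_mxEr mxE; congr ('D_ _ _ _); apply/funext => x; exact: row_mxEr.
Qed.

Lemma open_forall (T : topologicalType) (I : finType) (U : I -> set T) :
  (forall i, open (U i)) -> open [set x | forall i, U i x].
Proof.
move=> oU; rewrite openE => x Ux.
have H := @filter_forall T I (fun i y => U i y) (nbhs x) _.
by apply: H => i; exact: open_near.
Qed.

Section projections.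
Variables (R : realType) (m n : nat).
Definition px (u : 'rV[R]_(m + (n + n))) : 'rV[R]_m := lsubmx u.
Definition pz' (u : 'rV[R]_(m + (n + n))) : 'rV[R]_n := lsubmx (rsubmx u).
Definition pz (u : 'rV[R]_(m + (n + n))) : 'rV[R]_n := rsubmx (rsubmx u).

Lemma pxK x z' z : px (pt3 x z' z) = x. Proof. exact: row_mxKl. Qed.
Lemma pz'K x z' z : pz' (pt3 x z' z) = z'. Proof. by rewrite /pz' /pt3 row_mxKr row_mxKl. Qed.
Lemma pzK x z' z : pz (pt3 x z' z) = z. Proof. by rewrite /pz /pt3 row_mxKr row_mxKr. Qed.

Lemma px_continuous : continuous px. Proof. exact: lsubmx_continuous. Qed.
Lemma pz'_continuous : continuous pz'.
Proof.
move=> u; apply: (@continuous_comp _ _ _ rsubmx lsubmx); first exact: rsubmx_continuous.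
exact: lsubmx_continuous.
Qed.
Lemma pz_continuous : continuous pz.
Proof.
move=> u; apply: (@continuous_comp _ _ _ rsubmx rsubmx); first exact: rsubmx_continuous.
exact: rsubmx_continuous.
Qed.

Variables (K : topologicalType) (W : set ('rV[R]_(m + (n + n)) * K)).
Hypothesis oW : open W.

Lemma psmooth_px j : psmooth_on W (fun u _ => px u 0 j).
Proof.
apply/psmooth_onP => k; apply: pC_eq (pC_coord k (lshift (n + n) j) oW) => // u q _.
by rewrite mxE.
Qed.
Lemma psmooth_pz' j : psmooth_on W (fun u _ => pz' u 0 j).
Proof.
apply/psmooth_onP => k; apply: pC_eq (pC_coord k (rshift m (lshift n j)) oW) => // u q _.
by rewrite !mxE.
Qed.
Lemma psmooth_pz j : psmooth_on W (fun u _ => pz u 0 j).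
Proof.
apply/psmooth_onP => k; apply: pC_eq (pC_coord k (rshift m (rshift n j)) oW) => // u q _.
by rewrite !mxE.
Qed.
End projections.

(** Composing [Fun] with local retractions in each of the three variables extends it near every
    point; [smooth_extension] glues these extensions, with no tubular neighbourhood. *)
Lemma sde_extension (R : realType) (M N : manifold R) (K : topologicalType)
    (Fun : K -> M -> N -> N -> R) m n (i1 : M -> 'rV[R]_m) (i2 : N -> 'rV[R]_n) :
  embedding i1 -> embedding i2 ->
  (forall q (W : set ('rV[R]_q * K)) f g h, open W -> ps (M := M) W f -> ps (M := N) W g ->
     ps (M := N) W h -> psmooth_on W (fun u k => Fun k (f u k) (g u k) (h u k))) ->
  exists (U : set 'rV[R]_(m + (n + n))) (Phi : 'rV[R]_(m + (n + n)) -> K -> R),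
    [/\ open U, forall x z' z, U (pt3 (i1 x) (i2 z') (i2 z)),
     psmooth_on [set p | U p.1] Phi &
     forall k x z' z, Phi (pt3 (i1 x) (i2 z') (i2 z)) k = Fun k x z' z].
Proof.
move=> e1 e2 sF.
pose s (a : M * N * N) := pt3 (i1 a.1.1) (i2 a.1.2) (i2 a.2).
have [|U [Phi [oU sU sPhi PhiE]]] := @smooth_extension R _ K _ s (fun a k => Fun k a.1.1 a.1.2 a.2).
  move=> [[x z'] z].
  have [U1 [r1 [oU1 U1x r1K s1]]] := local_retraction x e1.
  have [U2 [r2 [oU2 U2x r2K s2]]] := local_retraction z' e2.
  have [U3 [r3 [oU3 U3x r3K s3]]] := local_retraction z e2.
  pose U := [set u : 'rV[R]_(m + (n + n)) | [/\ U1 (px u), U2 (pz' u) & U3 (pz u)]].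
  have oU : open U.
    rewrite (_ : U = (@px R m n @^-1` U1) `&` (@pz' R m n @^-1` U2) `&` (@pz R m n @^-1` U3)).
      apply: openI; first apply: openI.
      - by apply: open_comp => // ? _; exact: px_continuous.
      - by apply: open_comp => // ? _; exact: pz'_continuous.
      - by apply: open_comp => // ? _; exact: pz_continuous.
    by apply/seteqP; split => u /= => [[? ? ?]|[[? ?] ?]].
  have oW := @open_fst _ K _ oU.
  exists U, (fun u k => Fun k (r1 (px u)) (r2 (pz' u)) (r3 (pz u))); split => //.
  - by rewrite /U /s /= pxK pz'K pzK.
  - apply: sF => //.
    + apply: (ps_comp_lin oW (manifold_atlasP M) (open_fst oU1) (phi := fun u _ => px u)) (s1 K) => //.
        by move=> u q [].
      by move=> j; exact: psmooth_px.
    + apply: (ps_comp_lin oW (manifold_atlasP N) (open_fst oU2) (phi := fun u _ => pz' u)) (s2 K) => //.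
        by move=> u q [].
      by move=> j; exact: psmooth_pz'.
    + apply: (ps_comp_lin oW (manifold_atlasP N) (open_fst oU3) (phi := fun u _ => pz u)) (s3 K) => //.
        by move=> u q [].
      by move=> j; exact: psmooth_pz.
  - move=> [[x1 z1'] z1] k; rewrite /U /s /= pxK pz'K pzK => -[h1 h2 h3].
    by rewrite r1K// r2K// r3K.
exists U, Phi; split => //.
- by move=> x z' z; exact: (sU ((x, z'), z)).
- by move=> k x z' z; exact: (PhiE ((x, z'), z)).
Qed.

Lemma sde_extension_vec (R : realType) (M N : manifold R) (K : topologicalType)
    (Fun : K -> M -> N -> N -> M) m n (i1 : M -> 'rV[R]_m) (i2 : N -> 'rV[R]_n) :
  embedding i1 -> embedding i2 ->
  (forall q (W : set ('rV[R]_q * K)) f g h, open W -> ps (M := M) W f -> ps (M := N) W g ->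
     ps (M := N) W h -> ps (M := M) W (fun u k => Fun k (f u k) (g u k) (h u k))) ->
  exists Phi, extends_along Fun i1 i2 Phi.
Proof.
move=> e1 e2 sF; have [si1 _ _ _] := e1.
have /choice[U UP] : forall j, exists (U : set 'rV[R]_(m + (n + n))),
  exists (Phi : 'rV[R]_(m + (n + n)) -> K -> R),
    [/\ open U, forall x z' z, U (pt3 (i1 x) (i2 z') (i2 z)),
     psmooth_on [set p | U p.1] Phi &
     forall k x z' z, Phi (pt3 (i1 x) (i2 z') (i2 z)) k = i1 (Fun k x z' z) 0 j].
  move=> j; apply: (sde_extension (Fun := fun k x z' z => i1 (Fun k x z' z) 0 j)) => // q W f g h oW sf sg sh.
  by apply: (ps_smooth_fun oW (manifold_atlasP M) (si1 j)); exact: sF.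
have /choice[Phi PhiP] := UP.
have oU : open [set u | forall j, U j u] by apply: open_forall => j; have [] := PhiP j.
exists (fun u k => \row_j Phi j u k); split; last first.
  by move=> k x z' z; apply/rowP => j; rewrite mxE; have [_ _ _ ->] := PhiP j.
exists [set u | forall j, U j u]; split => //.
  by move=> x z' z j; have [_ h _ _] := PhiP j; exact: h.
move=> i; apply/psmooth_onP => k; have [_ _ /psmooth_onP/(_ k) h _] := PhiP i.
apply: pC_eq (pC_sub _ h); [exact: open_fst|by move=> u q _; rewrite mxE|].
by move=> p; exact.
Qed.

Lemma compact_chart_nbhs (R : realType) (M : manifold R) (x : M) :
  exists2 V, open V /\ V x & exists2 C : set M, compact C & V `<=` C.
Proof.
have [Mc Mcov] := manifold_atlasP M; have [c Cc dc] := Mcov x.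
have [oc oi ck1 cm ci] := Mc _ Cc.
have ix : cimg c (cmap c x) by exists x.
have /nbhs_boxP[r r0 rI] := open_near oi ix.
have r2 : 0 < r / 2 by lra.
pose u0 := cmap c x.
exists [set y | cdom c y /\ box u0 (r / 2) (cmap c y)].
  split; first by apply: open_preim => //; exact: open_box.
  by split => // j; rewrite subrr normr0.
exists (cinv c @` [set u : 'rV[R]_(mdim M) | forall j, `[u0 0 j - r / 2, u0 0 j + r / 2]%classic (u 0 j)]).
  apply: continuous_compact; last first.
    apply: (@rV_compact R _ (fun j => `[u0 0 j - r / 2, u0 0 j + r / 2]%classic)) => j.
    exact: segment_compact.
  apply: continuous_in_subspaceT => u /set_mem uS; apply: ci; apply: rI => j.
  have := uS j; rewrite /= in_itv /= ltr_norml => /andP[? ?]; apply/andP; rewrite -/u0; split; lra.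
move=> y [dy by_]; exists (cmap c y); last exact: ck1.
move=> j; have := by_ j; rewrite /= in_itv /= ltr_norml => /andP[? ?]; apply/andP; split; lra.
Qed.

Lemma embedded_proper (R : realType) (M : manifold R) q (e : M -> 'rV[R]_q) : embedding e ->
  exists (U : set 'rV[R]_q) (h : 'rV[R]_q -> R),
    [/\ open U, forall a, U (e a), smooth_on U h &
      forall c, exists2 C : set M, compact C & forall b, h (e b) <= c -> C b].
Proof.
move=> [_ einj etop _]; apply: proper_function => a.
have [V [oV Va] [C cC VC]] := compact_chart_nbhs a.
have [V' oV' VV'] := etop _ oV.
exists V'; first by split => //; have : V a by []; rewrite VV'.
exists C => // b Vb; apply: VC; rewrite VV'; exact: Vb.
Qed.

(** The retractions are not glued, since an average would leave the manifold; processes are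
    localised to the countably many balls instead. *)
Lemma retraction_family (R : realType) (N : manifold R) n (e : N -> 'rV[R]_n) : embedding e ->
  exists (cr : nat -> option ('rV[R]_n * R)) (pi_ : nat -> 'rV[R]_n -> 'rV[R]_n),
  [/\ forall k c r, cr k = Some (c, r) -> 0 < r,
    forall x, exists k, ball_dom cr k (e x),
    forall k j, smooth_on (ball_dom2 cr k) (fun u => pi_ k u 0 j),
    forall k x, ball_dom2 cr k (e x) -> pi_ k (e x) = e x &
    forall k u, ball_dom2 cr k u -> exists x, pi_ k u = e x].
Proof.
move=> ee; have [se _ _ _] := ee.
pose P c r := exists rho : 'rV[R]_n -> N,
  (forall x, box c (2 * r) (e x) -> rho (e x) = x) /\
  ps (M := N) [set p : 'rV[R]_n * R | box c (2 * r) p.1] (fun u _ => rho u).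
have [cr [crP crS]] : exists cr : nat -> option ('rV[R]_n * R),
    (forall n c r, cr n = Some (c, r) -> 0 < r /\ P c r) /\
    (forall a, range e a -> exists n c r, cr n = Some (c, r) /\ box c r a).
  apply: ball_system => _ [a _ <-]; have [U [rho [oU Ua rK srho]]] := local_retraction a ee.
  have /nbhs_boxP[d d0 dU] := open_near oU Ua.
  exists d => // c r r0 ce; exists rho; split; first by move=> x /ce/dU; exact: rK.
  by apply: ps_sub (srho R) => p /= /ce/dU.
have cr0 k c r : cr k = Some (c, r) -> 0 < r by move=> /crP[].
have /choice[pi_ piP] : forall k, exists pi_ : 'rV[R]_n -> 'rV[R]_n,
  [/\ forall j, smooth_on (ball_dom2 cr k) (fun u => pi_ u 0 j),
    forall x, ball_dom2 cr k (e x) -> pi_ (e x) = e x &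
    forall u, ball_dom2 cr k u -> exists x, pi_ u = e x].
  move=> k; rewrite /ball_dom2; case E : (cr k) => [[c r]|]; last first.
    by exists id; split => // j l u [].
  have [r0 [rho [rK srho]]] := crP _ _ _ E.
  exists (fun u => e (rho u)); split; last by move=> u _; exists (rho u).
    move=> j; apply: (@psmooth_smooth_on _ _ R 0).
    apply: (ps_smooth_fun _ (manifold_atlasP N) (se j) srho).
    by apply: open_fst; apply: open_box; rewrite mulr_gt0.
  by move=> x /rK ->.
exists cr, pi_; split => //; try by move=> k; have [] := piP k.
by move=> x; have [|k [c [r [E b]]]] := crS (e x); [exists x|exists k; rewrite /ball_dom E].
Qed.

(** * Uncountable sums and convergence in probability *)

Section sums.
Variable R : realType.
Implicit Types (D : set R) (f g u v : R -> R).

Lemma esum_abs D u : (forall s, D s -> 0 <= u s) ->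
  (\esum_(s in D) `|(EFin \o u) s| = \esum_(s in D) (u s)%:E)%E.
Proof. by move=> u0; apply: eq_esum => s Ds /=; rewrite ger0_norm// u0. Qed.

Lemma summable_le D f g : (forall s, D s -> `|f s| <= g s) ->
  summable D (EFin \o g) -> summable D (EFin \o f).
Proof.
move=> fg; rewrite /summable; apply: le_lt_trans; apply: le_esum => s Ds /=.
by rewrite lee_fin (le_trans (fg _ Ds))// ler_norm.
Qed.

Lemma summable_sub D D' f : D' `<=` D -> summable D (EFin \o f) -> summable D' (EFin \o f).
Proof.
move=> DD; rewrite /summable; apply: le_lt_trans.
rewrite (esumID D' D)//.
rewrite (_ : D `&` D' = D'); last by apply/setIidPr.
by rewrite leeDl// esum_ge0.
Qed.

Lemma esumZ D a u : 0 <= a -> (forall s, D s -> 0 <= u s) ->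
  (\esum_(s in D) (a * u s)%:E = a%:E * \esum_(s in D) (u s)%:E)%E.
Proof.
move=> a0 u0.
have ee (X : set R) : fsets D X ->
    (\sum_(x \in X) (a * u x)%:E = a%:E * \sum_(x \in X) (u x)%:E)%E.
  move=> [fX XD]; rewrite !fsbig_finite//= !sumEFin -EFinM; congr EFin.
  by rewrite mulr_sumr.
apply/eqP; rewrite eq_le; apply/andP; split.
  apply: ub_ereal_sup => _ [X XD <-]; rewrite ee//.
  apply: lee_wpmul2l; first by rewrite lee_fin.
  by apply: esum_ge; exists X.
have [a1|a1] := leP a 0.
  have -> : a = 0 by apply/eqP; rewrite eq_le a0 a1.
  by rewrite mul0e esum_ge0// => s _; rewrite mul0r.
rewrite muleC -lee_pdivlMr//.
apply: ub_ereal_sup => _ [X XD <-]; rewrite lee_pdivlMr// muleC -ee//.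
by apply: esum_ge; exists X.
Qed.

Lemma summable_lin D a f g : summable D (EFin \o f) -> summable D (EFin \o g) ->
  summable D (EFin \o (fun s => a * f s + g s)).
Proof.
move=> sf sg; apply: (@summableD _ _ D (EFin \o (fun s => a * f s)) (EFin \o g)) => //.
move: sf; rewrite /summable => sf.
under eq_esum => s _ do rewrite /= normrM.
rewrite esumZ//; exact: lte_mul_pinfty.
Qed.

Lemma summable_fin D u : (forall s, D s -> 0 <= u s) -> summable D (EFin \o u) ->
  (\esum_(s in D) (u s)%:E)%E \is a fin_num.
Proof. by move=> u0; rewrite summableE esum_abs. Qed.

(** Independence of the splitting into nonnegative summable parts, from which the linearity of
    [sum_over] follows. *)
Lemma sum_overE D f u v : (forall s, D s -> f s = u s - v s) ->
  (forall s, D s -> 0 <= u s) -> (forall s, D s -> 0 <= v s) ->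
  summable D (EFin \o u) -> summable D (EFin \o v) ->
  sum_over D f = fine (\esum_(s in D) (u s)%:E)%E - fine (\esum_(s in D) (v s)%:E)%E.
Proof.
move=> fuv u0 v0 su sv.
have fin1 := summable_fin u0 su; have fin2 := summable_fin v0 sv.
have sf : summable D (EFin \o f).
  apply: (@summable_le _ _ (fun s => 1 * u s + v s)); last exact: summable_lin.
  move=> s Ds; rewrite fuv// mul1r (le_trans (ler_normB _ _))//.
  by rewrite !ger0_norm// ?u0 ?v0.
have f1 : (\esum_(s in D) (Num.max (f s) 0)%:E)%E \is a fin_num.
  apply: summable_fin => [s _|]; first by rewrite le_max lexx orbT.
  apply: (@summable_le _ _ (fun s => `|f s|)).
    move=> s _; rewrite ger0_norm ?le_max ?lexx ?orbT//.
    by rewrite ge_max ler_norm normr_ge0.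
  move: sf; rewrite /summable; congr (_ < _)%E.
  by apply: eq_esum => s _ /=; rewrite normr_id.
have f2 : (\esum_(s in D) (Num.max (- f s) 0)%:E)%E \is a fin_num.
  apply: summable_fin => [s _|]; first by rewrite le_max lexx orbT.
  apply: (@summable_le _ _ (fun s => `|f s|)).
    move=> s _; rewrite ger0_norm ?le_max ?lexx ?orbT//.
    by rewrite ge_max -normrN ler_norm normr_ge0.
  move: sf; rewrite /summable; congr (_ < _)%E.
  by apply: eq_esum => s _ /=; rewrite normr_id.
have := @esumB R R D (EFin \o u) (EFin \o v) su sv.
move=> /(_ _ _)/wrap[||].
- by move=> s Ds; rewrite lee_fin u0.
- by move=> s Ds; rewrite lee_fin v0.
rewrite /sum_over => E.
rewrite -!fineB//; congr fine; rewrite -E; congr (_ - _)%E.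
  by apply: eq_esum => s Ds; rewrite funeposE /= fuv// EFin_max.
by apply: eq_esum => s Ds; rewrite funenegE /= fuv// EFin_max.
Qed.

Lemma eq_sum_over D f g : (forall s, D s -> f s = g s) -> sum_over D f = sum_over D g.
Proof.
by move=> fg; rewrite /sum_over; congr (fine _ - fine _); apply: eq_esum => s Ds; rewrite fg.
Qed.

Lemma summable_pos D f : summable D (EFin \o f) ->
  summable D (EFin \o (fun s => Num.max (f s) 0)).
Proof.
move=> sf; apply: (@summable_le _ _ (fun s => `|f s|)).
  move=> s _; rewrite ger0_norm ?le_max ?lexx ?orbT//.
  by rewrite ge_max ler_norm normr_ge0.
move: sf; rewrite /summable; congr (_ < _)%E.
by apply: eq_esum => s _ /=; rewrite normr_id.
Qed.

Lemma summable_opp D f : summable D (EFin \o f) -> summable D (EFin \o (fun s => - f s)).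
Proof.
rewrite /summable; congr (_ < _)%E.
by apply: eq_esum => s _ /=; rewrite normrN.
Qed.

Lemma summable_norm D f : summable D (EFin \o f) -> summable D (EFin \o (fun s => `|f s|)).
Proof.
rewrite /summable; congr (_ < _)%E.
by apply: eq_esum => s _ /=; rewrite normr_id.
Qed.

Lemma fine_esumD D u v : (forall s, D s -> 0 <= u s) -> (forall s, D s -> 0 <= v s) ->
  summable D (EFin \o u) -> summable D (EFin \o v) ->
  fine (\esum_(s in D) (u s + v s)%:E)%E = fine (\esum_(s in D) (u s)%:E)%E + fine (\esum_(s in D) (v s)%:E)%E.
Proof.
move=> u0 v0 su sv; rewrite -fineD ?summable_fin//; congr fine.
by rewrite -esumD// => s Ds; rewrite lee_fin ?u0 ?v0.
Qed.

Lemma max_subE (x : R) : x = Num.max x 0 - Num.max (- x) 0.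
Proof.
have [x0|x0] := leP x 0.
  by rewrite max_l ?oppr_ge0// sub0r opprK.
by rewrite max_r ?subr0// oppr_le0 ltW.
Qed.

Lemma sum_overD D f g : summable D (EFin \o f) -> summable D (EFin \o g) ->
  sum_over D (fun s => f s + g s) = sum_over D f + sum_over D g.
Proof.
move=> sf sg.
have p0 (h : R -> R) s : 0 <= Num.max (h s) 0 by rewrite le_max lexx orbT.
have sfp := summable_pos sf; have sfn := summable_pos (summable_opp sf).
have sgp := summable_pos sg; have sgn := summable_pos (summable_opp sg).
rewrite (@sum_overE _ _ (fun s => Num.max (f s) 0 + Num.max (g s) 0)
                      (fun s => Num.max (- f s) 0 + Num.max (- g s) 0)).
- rewrite (fine_esumD _ _ sfp sgp)// (fine_esumD _ _ sfn sgn)//.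
  by rewrite /sum_over; ring.
- by move=> s _; rewrite {1}(max_subE (f s)) {1}(max_subE (g s)); ring.
- by move=> s _; rewrite addr_ge0.
- by move=> s _; rewrite addr_ge0.
- exact: (summableD sfp sgp).
- exact: (summableD sfn sgn).
Qed.

Lemma summableZ D a f : summable D (EFin \o f) -> summable D (EFin \o (fun s => a * f s)).
Proof.
move=> sf; have := summable_lin a sf (summable_lin (- 1) sf sf).
rewrite (_ : (fun s => _) = (fun s => a * f s))//.
by apply/funext => s; rewrite mulN1r addNr addr0.
Qed.

Lemma sum_overZ D a f : summable D (EFin \o f) ->
  sum_over D (fun s => a * f s) = a * sum_over D f.
Proof.
move=> sf.
have p0 (h : R -> R) s : 0 <= Num.max (h s) 0 by rewrite le_max lexx orbT.
have sfp := summable_pos sf; have sfn := summable_pos (summable_opp sf).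
have fe b u : 0 <= b -> (forall s, D s -> 0 <= u s) -> summable D (EFin \o u) ->
    fine (\esum_(s in D) (b * u s)%:E)%E = b * fine (\esum_(s in D) (u s)%:E)%E.
  by move=> b0 u0 su; rewrite esumZ// fineM// summable_fin.
case: (lerP 0 a) => a0.
  rewrite (@sum_overE _ _ (fun s => a * Num.max (f s) 0) (fun s => a * Num.max (- f s) 0)).
  - by rewrite (fe _ _ a0 _ sfp)// (fe _ _ a0 _ sfn)// -mulrBr.
  - by move=> s _; rewrite {1}(max_subE (f s)); ring.
  - by move=> s _; rewrite mulr_ge0.
  - by move=> s _; rewrite mulr_ge0.
  - exact: summableZ.
  - exact: summableZ.
have a1 : 0 <= - a by rewrite oppr_ge0 ltW.
rewrite (@sum_overE _ _ (fun s => (- a) * Num.max (- f s) 0) (fun s => (- a) * Num.max (f s) 0)).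
- by rewrite (fe _ _ a1 _ sfp)// (fe _ _ a1 _ sfn)// -mulrBr mulNr -mulrN opprB.
- by move=> s _; rewrite {1}(max_subE (f s)); ring.
- by move=> s _; rewrite mulr_ge0.
- by move=> s _; rewrite mulr_ge0.
- exact: summableZ.
- exact: summableZ.
Qed.

Lemma sum_over_lin D a f g : summable D (EFin \o f) -> summable D (EFin \o g) ->
  sum_over D (fun s => a * f s + g s) = a * sum_over D f + sum_over D g.
Proof. by move=> sf sg; rewrite sum_overD ?sum_overZ//; exact: summableZ. Qed.

Lemma sum_over0 D : sum_over D (fun=> 0) = 0.
Proof. by rewrite /sum_over oppr0 subrr. Qed.

Lemma summable0 D : summable D (EFin \o (fun=> 0 : R)).
Proof. by rewrite /summable esum1// => s _ /=; rewrite normr0. Qed.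

Lemma summable_sum D (I : Type) (r : seq I) (f : I -> R -> R) :
  (forall i, summable D (EFin \o f i)) -> summable D (EFin \o (fun s => \sum_(i <- r) f i s)).
Proof.
move=> sf; elim: r => [|i r IH].
  rewrite (_ : (fun s => _) = fun=> 0); first exact: summable0.
  by apply/funext => s; rewrite big_nil.
rewrite (_ : (fun s => _) = (fun s => 1 * f i s + \sum_(i <- r) f i s)); first exact: summable_lin.
by apply/funext => s; rewrite big_cons mul1r.
Qed.

Lemma sum_over_sum D (I : Type) (r : seq I) (f : I -> R -> R) :
  (forall i, summable D (EFin \o f i)) ->
  sum_over D (fun s => \sum_(i <- r) f i s) = \sum_(i <- r) sum_over D (f i).
Proof.
move=> sf; elim: r => [|i r IH].
  by rewrite big_nil -[RHS](sum_over0 D); apply: eq_sum_over => s _; rewrite big_nil.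
rewrite big_cons -IH -sum_overD//; last exact: summable_sum.
by apply: eq_sum_over => s _; rewrite big_cons.
Qed.

Lemma sum_over_restrict D B f :
  sum_over D (fun s => \1_B s * f s) = sum_over (D `&` B) f.
Proof.
by rewrite /sum_over !esum_mkcondr; congr (fine _ - fine _); apply: eq_esum => s _;
  rewrite indicE; case: (s \in B); rewrite ?mul1r ?mul0r ?oppr0 ?maxxx.
Qed.

Lemma sum_over_bound D f g : (forall s, D s -> `|f s| <= g s) -> summable D (EFin \o g) ->
  `|sum_over D f| <= fine (\esum_(s in D) (g s)%:E)%E.
Proof.
move=> fg sg.
have g0 s : D s -> 0 <= g s by move=> Ds; exact: le_trans (normr_ge0 _) (fg s Ds).
have sf := summable_le fg sg.
have p0 (h : R -> R) s : D s -> 0 <= Num.max (h s) 0 by rewrite le_max lexx orbT.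
have sfp := summable_pos sf; have sfn := summable_pos (summable_opp sf).
have pl (h : R -> R) : (forall s, D s -> `|h s| <= g s) -> summable D (EFin \o (fun s => Num.max (h s) 0)) ->
    0 <= fine (\esum_(s in D) (Num.max (h s) 0)%:E)%E <= fine (\esum_(s in D) (g s)%:E)%E.
  move=> hg sh; rewrite fine_ge0 ?esum_ge0//=; last by move=> s Ds; rewrite lee_fin p0.
  apply: fine_le; rewrite ?summable_fin//; first by move=> s Ds; exact: p0.
  apply: le_esum => s Ds; rewrite lee_fin ge_max g0// andbT.
  exact: le_trans (ler_norm _) (hg _ Ds).
have /andP[a1 a2] := pl _ fg sfp.
have /andP[b1 b2] : 0 <= fine (\esum_(s in D) (Num.max (- f s) 0)%:E)%E <= fine (\esum_(s in D) (g s)%:E)%E.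
  by apply: pl => // s Ds; rewrite normrN fg.
by rewrite /sum_over ler_norml; apply/andP; split; lra.
Qed.

Lemma summable_tail D g (e : R) : (forall s, D s -> 0 <= g s) -> summable D (EFin \o g) -> 0 < e ->
  exists2 A : set R, finite_set A & A `<=` D /\ fine (\esum_(s in D `\` A) (g s)%:E)%E < e.
Proof.
move=> g0 sg e0; have fin := summable_fin g0 sg.
have := ub_ereal_sup_adherent e0 fin => -[_ [A [fA AD] <-] hA].
exists A => //; split => //.
have /esym E : (\esum_(s in D) (g s)%:E = \esum_(s in A) (g s)%:E + \esum_(s in D `\` A) (g s)%:E)%E.
  rewrite (esumID A D); last by move=> s Ds; rewrite lee_fin g0.
  by rewrite (_ : D `&` A = A)//; apply/setIidPr.
have finD : (\esum_(s in D `\` A) (g s)%:E)%E \is a fin_num.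
  by apply: summable_fin => [s [/g0]|]//; apply: summable_sub sg => s [].
have finA : (\esum_(s in A) (g s)%:E)%E \is a fin_num.
  by apply: summable_fin => [s /AD/g0|]//; apply: summable_sub sg.
move: hA; rewrite -esum_fset//; last by move=> s /set_mem /AD/g0; rewrite lee_fin.
rewrite -[ereal_sup _]/(\esum_(s in D) (g s)%:E)%E -E -(fineK finA) -(fineK finD) -EFinD.
by rewrite lte_fin /=; lra.
Qed.

(** Outside a finite set [A] the dominating family sums to less than [e / 4], which bounds the
    difference there by [e / 2]; on [A] pointwise convergence is uniform. *)
Lemma sum_over_dominated (I : Type) (FI : set_system I) {FF : Filter FI} D
   (f : I -> R -> R) (f0 g : R -> R) :
  summable D (EFin \o g) ->
  (\forall i \near FI, forall s, D s -> `|f i s| <= g s) ->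
  (forall s, D s -> `|f0 s| <= g s) ->
  (forall s, D s -> f i s @[i --> FI] --> f0 s) ->
  sum_over D (f i) @[i --> FI] --> sum_over D f0.
Proof.
move=> sg fg f0g cf.
have g0 s : D s -> 0 <= g s by move=> Ds; exact: le_trans (normr_ge0 _) (f0g s Ds).
apply/cvgrPdist_lt => e e0.
have e4 : 0 < e / 4 by lra.
have [A fA [AD tA]] := summable_tail g0 sg e4.
(* The cardinality of [A], written as a sum of ones; [N + 1] avoids a division by 0 when [A] is
   empty. *)
pose N := fine (\esum_(s in A) 1%:E)%E : R.
have sA (h : R -> R) : summable A (EFin \o h).
  rewrite summableE esum_fset// fsbig_finite//=.
  by rewrite sumEFin.
have N0 : 0 <= N by apply: fine_ge0; apply: esum_ge0.
have d0 : 0 < e / (2 * (N + 1)) by rewrite divr_gt0//; lra.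
have nearA : \forall i \near FI, forall s, A s -> `|f0 s - f i s| < e / (2 * (N + 1)).
  move: AD; have /finite_seqP[l ->] := fA; elim: l => [|a l IH] lD; first by apply: filterE.
  have {}IH : \forall i \near FI, forall s, s \in l -> `|f0 s - f i s| < e / (2 * (N + 1)).
    by apply: IH => s /= sl; apply: lD => /=; rewrite inE sl orbT.
  have /cvgrPdist_lt/(_ _ d0) ca := cf a (lD a (mem_head _ _)).
  by apply: filterS2 ca IH => i ca IH s; rewrite /= inE => /predU1P[->|/IH].
apply: filterS2 nearA fg => i nA fgi.
have sf := summable_le fgi sg; have sf0 := summable_le f0g sg.
have -> : sum_over D f0 - sum_over D (f i) = sum_over D (fun s => -1 * f i s + f0 s).
  by rewrite sum_over_lin// mulN1r addrC.
pose h := fun s => -1 * f i s + f0 s.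
have sh : summable D (EFin \o h) by exact: summable_lin.
have -> : sum_over D h = sum_over A h + sum_over (D `\` A) h.
  have {1}-> : A = D `&` A by apply/esym/setIidPr.
  rewrite setDE -!sum_over_restrict -sum_overD.
  - apply: eq_sum_over => s _; rewrite !indicE in_setC.
    by case: (s \in A); rewrite ?mul1r ?mul0r ?addr0 ?add0r.
  - apply: summable_le (summable_norm sh) => s _; rewrite normrM ler_piMl//.
    by rewrite indicE; case: (_ \in _); rewrite ?normr0 ?normr1.
  - apply: summable_le (summable_norm sh) => s _; rewrite normrM ler_piMl//.
    by rewrite indicE; case: (_ \in _); rewrite ?normr0 ?normr1.
have b1 : `|sum_over A h| <= e / 2.
  have : `|sum_over A h| <= fine (\esum_(s in A) (e / (2 * (N + 1)) * 1)%:E)%E.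
    apply: sum_over_bound => // s As; rewrite mulr1 ltW//.
    by have := nA s As; rewrite /h mulN1r addrC.
  rewrite esumZ ?(ltW d0)// fineM ?summable_fin// -/N => /le_trans; apply.
  rewrite /=; set q := e / (2 * (N + 1)) in d0 *.
  have : q * (2 * (N + 1)) = e by rewrite mulfVK// lt0r_neq0//; lra.
  by move: d0 N0; nra.
have b2 : `|sum_over (D `\` A) h| < e / 2.
  have sg' : summable (D `\` A) (EFin \o g) by apply: summable_sub sg => s [].
  have : `|sum_over (D `\` A) h| <= fine (\esum_(s in D `\` A) (2 * g s)%:E)%E.
    apply: sum_over_bound => [s [Ds _]|]; last exact: summableZ.
    rewrite /h mulN1r (le_trans (ler_normD _ _))// normrN.
    by have := fgi s Ds; have := f0g s Ds; lra.
  have g0' s : (D `\` A) s -> 0 <= g s by move=> [/g0].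
  by rewrite esumZ// fineM ?summable_fin//= => /le_lt_trans; apply; lra.
by rewrite (le_lt_trans (ler_normD _ _))//; lra.
Qed.

Lemma summable_indic D B f : summable D (EFin \o f) ->
  summable D (EFin \o (fun s => \1_B s * f s)).
Proof.
move=> sf; apply: summable_le (summable_norm sf) => s _; rewrite normrM ler_piMl//.
by rewrite indicE; case: (_ \in _); rewrite ?normr0 ?normr1.
Qed.

Section cumulative.
Variable j : R -> R.
Hypothesis sj : forall t, 0 <= t -> summable `[0, t] (EFin \o j).

Lemma cumulative_right t : 0 <= t ->
  sum_over `[0, x] j @[x --> t^'+] --> sum_over `[0, t] j.
Proof.
move=> t0; have t1 : 0 <= t + 1 by lra.
have cutE (x : R) : x <= t + 1 -> sum_over `[0, x] j = sum_over `[0, t + 1] (fun s => \1_(`[0, x]%classic) s * j s).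
  move=> xt; rewrite sum_over_restrict; congr sum_over; apply/esym/setIidPr.
  by move=> s /=; rewrite !in_itv/= => /andP[-> /le_trans ->].
rewrite (cutE t); last by lra.
have near1 : \forall x \near t^'+, t < x < t + 1.
  near=> x; apply/andP; split => //; near: x; apply: nbhs_right_lt; lra.
have := @sum_over_dominated _ (t^'+) (@at_right_proper_filter R t) `[0, t + 1] (fun x s => \1_(`[0, x]%classic) s * j s) 
  (fun s => \1_(`[0, t]%classic) s * j s) (fun s => `|j s|) (summable_norm (sj t1)).
have bd (B : set R) s : `|\1_B s * j s| <= `|j s|.
  rewrite normrM ler_piMl// indicE; by case: (_ \in _); rewrite ?normr0 ?normr1.
move=> /(_ _ _ _)/wrap[|||H].
- by apply: filterE => x s _.
- by move=> s _.
- move=> s /=; rewrite in_itv/= => /andP[s0 _]; apply: cvg_near_cst.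
  have [st|ts] := leP s t.
    apply: filterS near1 => x /andP[tx _]; rewrite !indicE !mem_setE !in_itv/= s0 st.
    by rewrite (le_trans st (ltW tx)).
  near=> x; have xs : x < s by near: x; exact: nbhs_right_lt.
  by rewrite !indicE !mem_setE !in_itv/= s0 !leNgt xs ts.
apply: cvg_trans H; apply: near_eq_cvg; apply: filterS near1 => x /andP[_ xt].
by rewrite cutE// ltW.
Unshelve. all: by end_near.
Qed.

Lemma cumulative_left t : 0 < t ->
  sum_over `[0, x] j @[x --> t^'-] --> sum_over `[0, t] j - j t.
Proof.
move=> t0; have t1 := ltW t0.
have cutE (x : R) : x <= t -> sum_over `[0, x] j = sum_over `[0, t] (fun s => \1_(`[0, x]%classic) s * j s).
  move=> xt; rewrite sum_over_restrict; congr sum_over; apply/esym/setIidPr.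
  by move=> s /=; rewrite !in_itv/= => /andP[-> /le_trans ->].
have near1 : \forall x \near t^'-, 0 < x < t.
  near=> x; apply/andP; split => //; near: x; exact: nbhs_left_gt.
have bd (B : set R) s : `|\1_B s * j s| <= `|j s|.
  rewrite normrM ler_piMl// indicE; by case: (_ \in _); rewrite ?normr0 ?normr1.
have -> : sum_over `[0, t] j - j t = sum_over `[0, t] (fun s => \1_(`[0, t[%classic) s * j s).
  have -> : sum_over `[0, t] j = sum_over `[0, t] (fun s => \1_(`[0, t[%classic) s * j s) + sum_over `[0, t] (fun s => \1_[set t] s * j s).
    rewrite -sum_overD; [|exact: summable_indic (sj t1)..].
    apply: eq_sum_over => s /=; rewrite in_itv/= => /andP[s0 st].
    rewrite !indicE !mem_setE in_itv/= s0/= -mulrDl.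
    have [->|ne] := eqVneq s t; first by rewrite ltxx mem_set// add0r mul1r.
    rewrite lt_neqAle ne st/= memNset ?addr0 ?mul1r//.
    by move=> /= h; rewrite h eqxx in ne.
  rewrite [X in _ + X - _]sum_over_restrict (_ : _ `&` [set t] = [set t]); last first.
    by apply/setIidPr => s /= ->; rewrite in_itv/= t1 lexx.
  rewrite [X in _ + X - _]/sum_over !esum_set1 ?lee_fin ?le_max ?lexx ?orbT//=.
  by rewrite -max_subE addrK.
have := @sum_over_dominated _ (t^'-) (@at_left_proper_filter R t) `[0, t] (fun x s => \1_(`[0, x]%classic) s * j s) 
  (fun s => \1_(`[0, t[%classic) s * j s) (fun s => `|j s|) (summable_norm (sj t1)).
move=> /(_ _ _ _)/wrap[|||H].
- by apply: filterE => x s _.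
- by move=> s _.
- move=> s /=; rewrite in_itv/= => /andP[s0 st']; apply: cvg_near_cst.
  have [st|ts] := ltP s t.
    near=> x; have xs : s < x by near: x; exact: nbhs_left_gt.
    by rewrite !indicE !mem_setE !in_itv/= s0 st (ltW xs).
  apply: filterS near1 => x /andP[x0 xt]; rewrite !indicE !mem_setE !in_itv/= s0/=.
  by rewrite ltNge ts leNgt (lt_le_trans xt ts).
apply: cvg_trans H; apply: near_eq_cvg; apply: filterS near1 => x /andP[_ xt].
by rewrite cutE// ltW.
Unshelve. all: by end_near.
Qed.

Lemma cumulative_rect (s u t : R) : 0 <= s -> s <= u -> 0 <= t ->
  sum_over `[0, t] (fun r => \1_(`]s, u]%classic) r * j r) =
  sum_over `[0, Num.min u t] j - sum_over `[0, Num.min s t] j.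
Proof.
move=> s0 su t0.
have cutE (x : R) : 0 <= x -> sum_over `[0, Num.min x t] j = sum_over `[0, t] (fun s => \1_(`[0, x]%classic) s * j s).
  move=> x0; rewrite sum_over_restrict; congr sum_over; apply/seteqP; split => y /=; rewrite !in_itv/= le_min.
    by move=> /andP[-> /andP[-> ->]].
  by move=> [/andP[-> ->] /andP[_ ->]].
rewrite (cutE u) ?(le_trans s0 su)// (cutE s)//.
apply/eqP; rewrite eq_sym subr_eq -sum_overD; [|exact: summable_indic (sj t0)..].
apply/eqP; apply: eq_sum_over => r /=; rewrite in_itv/= => /andP[r0 rt].
rewrite -mulrDl; congr (_ * _); rewrite !indicE !mem_setE !in_itv/= r0/=.
have [rs|sr] := leP r s; last by rewrite addr0.
by rewrite (le_trans rs su) add0r.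
Qed.
End cumulative.
End sums.

Section in_probability.
Variables (R : realType) (d : measure_display) (T : measurableType d) (P : probability T R).
Implicit Types D : nat -> T -> R.

Definition cvg_prob D := forall e : R, 0 < e -> P [set w | e <= `|D n w|] @[n --> \oo] --> 0%E.

Lemma measurable_norm_ge (f : T -> R) (e : R) : measurable_fun setT f ->
  measurable [set w | e <= `|f w|].
Proof.
move=> mf; have := measurableT_comp (@normr_measurable R setT) mf.
move=> /(_ measurableT _ (measurable_itv `[e, +oo[)); rewrite setTI.
by congr (measurable _); apply/seteqP; split => w /=; rewrite in_itv/= andbT.
Qed.

Lemma squeeze_cvge0 (u v : nat -> \bar R) : (forall n, 0 <= u n <= v n)%E ->
  v n @[n --> \oo] --> 0%E -> u n @[n --> \oo] --> 0%E.
Proof.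
move=> uv v0; apply: (@squeeze_cvge _ _ _ _ (fun=> 0%E) u v) => //; last exact: cvg_cst.
exact: filterE.
Qed.

Lemma le_prob_ae (A B : set T) : measurable A -> measurable B ->
  {ae P, forall w, A w -> B w} -> (P A <= P B)%E.
Proof.
move=> mA mB [N [mN N0 NAB]].
apply: (@le_trans _ _ (P (B `|` N))).
  apply: le_measure; rewrite ?inE//; first exact: measurableU.
  move=> w Aw; have [Nw|nN] := pselect (N w); [by right|left].
  by apply: contrapT => nB; apply: nN; apply: NAB => /= /(_ Aw).
by apply: le_trans (measureU2 P mB mN) _; rewrite [X in (_ + X)%E](_ : _ = 0%E) ?adde0//; exact: N0.
Qed.

Lemma cvg_prob_le D D' : (forall n, measurable_fun setT (D n)) -> (forall n, measurable_fun setT (D' n)) ->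
  (forall n, {ae P, forall w, `|D' n w| <= `|D n w|}) -> cvg_prob D -> cvg_prob D'.
Proof.
move=> mD mD' le cD e e0; apply: squeeze_cvge0 (cD _ e0) => n; rewrite measure_ge0/=.
apply: le_prob_ae; try exact: measurable_norm_ge.
by apply: filterS (le n) => w le_w /= /le_trans; apply.
Qed.

Lemma cvg_probD D D' : (forall n, measurable_fun setT (D n)) -> (forall n, measurable_fun setT (D' n)) ->
  cvg_prob D -> cvg_prob D' -> cvg_prob (fun n w => D n w + D' n w).
Proof.
move=> mD mD' cD cD' e e0.
have e2 : 0 < e / 2 by rewrite divr_gt0.
have H : (P [set w | (e / 2 <= `|D n w|)%R] + P [set w | (e / 2 <= `|D' n w|)%R])%E @[n --> \oo] --> 0%E.
  by rewrite -[X in _ --> X]adde0; apply: cvgeD => //; [exact: cD|exact: cD'].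
apply: squeeze_cvge0 H => n; rewrite measure_ge0/=.
apply: le_trans (measureU2 _ _ _); [|exact: measurable_norm_ge..].
apply: le_measure; rewrite ?inE.
- by apply: measurable_norm_ge; exact: measurable_funD.
- by apply: measurableU; exact: measurable_norm_ge.
move=> w /= h; have [|h1] := leP (e / 2) `|D n w|; [by left|right].
by have := ler_normD (D n w) (D' n w); lra.
Qed.

Lemma cvg_probZ a D : (forall n, measurable_fun setT (D n)) -> cvg_prob D -> cvg_prob (fun n w => a * D n w).
Proof.
move=> mD cD e e0; have a1 : 0 < `|a| + 1 by have := normr_ge0 a; lra.
have e2 : 0 < e / (`|a| + 1) by rewrite divr_gt0.
apply: squeeze_cvge0 (cD _ e2) => n; rewrite measure_ge0/=.
apply: le_measure; rewrite ?inE.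
- by apply: measurable_norm_ge; exact: measurable_funM.
- exact: measurable_norm_ge.
by move=> w /=; rewrite normrM ler_pdivrMr// => h; have := normr_ge0 (D n w); nra.
Qed.

(** Borel-Cantelli with thresholds and probabilities [2 ^- n.+1]. Strict monotonicity of [phi] is
    replaced by [n <= phi n], which already preserves limits. *)
Lemma cvg_prob_subseq D : (forall n, measurable_fun setT (D n)) -> cvg_prob D ->
  exists2 phi : nat -> nat, forall n, (n <= phi n)%N &
    {ae P, forall w, D (phi n) w @[n --> \oo] --> (0 : R)}.
Proof.
move=> mD cD.
have ex n : exists m, (n <= m)%N /\ (P [set w | (2 ^- n.+1 <= `|D m w|)%R] <= (2 ^- n.+1)%:E)%E.
  have e0 : 0 < (2 ^- n.+1 : R) by rewrite invr_gt0 exprn_gt0.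
  have := cD _ e0 => /fine_cvgP[_] /cvgrPdist_lt /(_ _ e0) [N _ hN].
  exists (maxn n N); split; first exact: leq_maxl.
  have := hN (maxn n N) (leq_maxr _ _); rewrite sub0r normrN /= => h.
  rewrite -[leLHS]fineK; last exact: fin_num_measure (measurable_norm_ge _ (mD _)).
  by rewrite lee_fin; apply: ltW; apply: le_lt_trans h; exact: ler_norm.
have [phi hphi] := choice ex.
exists phi; first by move=> n; case: (hphi n).
pose E n := [set w | (2 ^- n.+1 : R) <= `|D (phi n) w|].
have mE n : measurable (E n) by exact: measurable_norm_ge.
have : P (lim_sup_set E) = 0%E.
  apply: lim_sup_set_cvg0 => //.
  apply: (@le_lt_trans _ _ (\sum_(0 <= n <oo) (0 + (1 / (2 ^ n.+1)%:R)%:E))%E).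
    apply: lee_nneseries => [n _|n _].
      by rewrite measure_ge0.
    by rewrite add0e; case: (hphi n) => _ /le_trans; apply; rewrite lee_fin natrX div1r.
  apply: le_lt_trans (epsilon_trick xpredT _ _) _ => //.
  by rewrite eseries0// add0e ltry.
move=> P0; exists (lim_sup_set E); split => //.
  by apply: bigcap_measurable => // k _; apply: bigcup_measurable.
move=> w /= nc; apply: contrapT => /existsNP[N]; rewrite not_implyP => -[_ hN].
apply: nc; apply/cvgr0Pnorm_lt => e e0.
have [N1 _ hN1] : \forall n \near \oo, (2 ^- n.+1 : R) < e.
  have h1 : `|1 / 2 : R| < 1 by rewrite ger0_norm; lra.
  have /cvgr0Pnorm_lt/(_ _ e0) := @cvg_expr R _ h1.
  apply: filterS => n /= h; apply: le_lt_trans h.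
  have p0 : 0 <= (1 / 2 : R) ^+ n by apply: exprn_ge0; lra.
  rewrite ger0_norm//.
  rewrite expr_div_n expr1n div1r lef_pV2 ?posrE ?exprn_gt0// exprS.
  by rewrite ler_peMl ?exprn_ge0//; lra.
exists (maxn N N1) => // n /=; rewrite geq_max => /andP[nN nN1].
apply: lt_trans (hN1 n nN1); rewrite ltNge; apply/negP => h.
by apply: hN; exists n.
Qed.

Lemma cvg_comp_subseq (u : nat -> R) (l : R) (phi : nat -> nat) :
  (forall n, (n <= phi n)%N) -> u n @[n --> \oo] --> l -> u (phi n) @[n --> \oo] --> l.
Proof.
move=> hphi ul; apply: (cvg_comp phi u) ul => A [N _ hN].
by exists N => // n /= Nn; apply: hN; exact: leq_trans Nn (hphi n).
Qed.

Lemma cvg_prob_ae D (L : T -> R) : (forall n, measurable_fun setT (D n)) -> cvg_prob D ->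
  {ae P, forall w, D n w @[n --> \oo] --> L w} -> {ae P, forall w, L w = 0}.
Proof.
move=> mD /(cvg_prob_subseq mD)[phi hphi cD] cL.
apply: filterS2 cD cL => w cD /(cvg_comp_subseq hphi) cL.
by apply: cvg_unique cL cD.
Qed.
End in_probability.

(** * Predictable processes *)

Section predictability.
Variables (R : realType) (d : measure_display) (T : measurableType d).
Variables (P : probability T R) (F : filtration R T).
Let D0 : set (R * T) := [set p : R * T | 0 <= p.1].
Notation proc := (R -> T -> R).

(** The predictable sigma-algebra, given on nonnegative times, is prolonged to all of [R * T] by
    forgetting negative times; predictability becomes measurability on [setT]. *)
Definition pred_sets : set (set (R * T)) :=
  [set B | <<s [set p : R * T | 0 <= p.1], predictable_rectangles F >> ([set p : R * T | 0 <= p.1] `&` B)].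

Lemma pred_sets_sigma : sigma_algebra setT pred_sets.
Proof.
have [s0 sC sU] := smallest_sigma_algebra D0 (predictable_rectangles F).
split.
- by rewrite /pred_sets /= setI0.
- move=> A; rewrite /pred_sets /= => /sC; congr (<<s _, _ >> _).
  apply/seteqP; split => p /=; last by move=> [? [_ ?]]; split => // -[].
  by move=> [p0 /not_andP[|]].
- by move=> A hA; rewrite /pred_sets /= setI_bigcupr; exact: sU.
Qed.

Definition pred_type := g_sigma_algebraType pred_sets.

Lemma pred_typeE (B : set (R * T)) : measurable (B : set pred_type) = pred_sets B.
Proof.
by rewrite /measurable /=; have := sigma_algebra_id pred_sets_sigma => ->.
Qed.

Lemma predictableE (E : topologicalType) (H : R -> T -> E) :
  predictable F H <-> forall U, open U -> measurable ([set p | U (H p.1 p.2)] : set pred_type).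
Proof. by split => h U /h; rewrite pred_typeE. Qed.

Lemma predictable_measurable (H : proc) :
  predictable F H <-> measurable_fun setT (fun p : pred_type => H p.1 p.2).
Proof.
rewrite predictableE; split.
- move=> h; apply: (measurability (@RGenOInfty.G R)); first exact: RGenOInfty.measurableE.
  move=> _ [_ [a ->] <-]; rewrite setTI /preimage/=.
  by have := h _ (@open_gt R a); congr (measurable _); apply/seteqP; split => p /=; rewrite in_itv/= andbT.
- by move=> h U oU; rewrite -[X in measurable X]setTI; apply: h => //; exact: open_measurable.
Qed.

Definition adm (H : proc) := predictable F H /\ locally_bounded P F H.

Lemma filtI t A B : 0 <= t -> F t A -> F t B -> F t (A `&` B).
Proof.
move=> t0; have [_ C U] := filt_sigma F t0 => FA FB.
have CU A1 B1 : F t A1 -> F t B1 -> F t (A1 `|` B1).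
  by move=> h1 h2; rewrite -bigcup2E; apply: U => -[|[|n]] //=; have [] := filt_sigma F t0.
have {}C A1 : F t A1 -> F t (~` A1) by rewrite -setTD; exact: C.
by rewrite -[_ `&` _]setCK setCI; apply/C/CU; exact: C.
Qed.

Lemma filtU t A B : 0 <= t -> F t A -> F t B -> F t (A `|` B).
Proof.
move=> t0; have [? C U] := filt_sigma F t0 => FA FB.
by rewrite -bigcup2E; apply: U => -[|[|n]].
Qed.

Lemma filtT t : 0 <= t -> F t setT.
Proof. by move=> t0; have [s0 C U] := filt_sigma F t0; have := C _ s0; rewrite setD0. Qed.

Lemma localizing_min tau1 tau2 : localizing P F tau1 -> localizing P F tau2 ->
  localizing P F (fun n w => Order.min (tau1 n w) (tau2 n w)).
Proof.
move=> [s1 m1 c1] [s2 m2 c2]; split.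
- move=> n; have [p1 q1] := s1 n; have [p2 q2] := s2 n; split.
    by move=> w; rewrite le_min p1 p2.
  move=> t t0; rewrite (_ : [set w | _] = [set w | (tau1 n w <= t%:E)%E] `|` [set w | (tau2 n w <= t%:E)%E]).
    by apply: filtU => //; [exact: q1|exact: q2].
  by apply/seteqP; split => w /=; rewrite ge_min => /orP.
- move=> n w; rewrite le_min !ge_min m1 m2 ?orbT //.
- apply: filterS2 c1 c2 => w h1 h2; apply/cvgeyPge => A.
  move/cvgeyPge : h1 => /(_ A) h1; move/cvgeyPge : h2 => /(_ A) h2.
  by apply: filterS2 h1 h2 => n h1 h2; rewrite le_min h1 h2.
Qed.

Lemma locally_bounded_real (H : proc) : locally_bounded P F H <->
  exists2 tau, localizing P F tau & forall n, exists C : R,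
    forall t w, 0 < t -> (t%:E <= tau n w)%E -> `|H t w| <= C.
Proof.
split=> -[tau ltau h]; exists tau => // n; have [C hC] := h n.
- move=> CH; have /compact_bounded [M [_ /(_ (M + 1))]] := hC.
  have M1 : M < M + 1 by lra.
  move=> /(_ M1) CM; exists (M + 1) => t w t0 tt; exact: CM (CH _ _ t0 tt).
- exists `[- C, C]%classic; first exact: segment_compact.
  by move=> t w t0 tt /=; rewrite in_itv/= -ler_norml hC.
Qed.

Lemma locally_bounded2 (E1 E2 : topologicalType) (H1 : R -> T -> E1) (H2 : R -> T -> E2) :
  locally_bounded P F H1 -> locally_bounded P F H2 ->
  locally_bounded P F (fun t w => (H1 t w, H2 t w)).
Proof.
move=> [t1 l1 h1] [t2 l2 h2].
exists (fun n w => Order.min (t1 n w) (t2 n w)); first exact: localizing_min.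
move=> n; have [C1 cC1 hC1] := h1 n; have [C2 cC2 hC2] := h2 n.
exists (C1 `*` C2); first exact: compact_setX.
by move=> t w t0; rewrite le_min => /andP[a b]; split => /=; [exact: hC1|exact: hC2].
Qed.

Lemma adm_cst a : adm (fun _ _ => a).
Proof.
split; first by apply/predictable_measurable; exact: measurable_cst.
apply/locally_bounded_real; exists (fun n _ => n%:R%:E); last first.
  by move=> n; exists `|a| => t w _ _.
split.
- move=> n; split; first by move=> w; rewrite lee_fin.
  move=> t t0; have [nt|tn] := leP (n%:R : R) t.
    by rewrite (_ : [set w | _] = setT); [exact: filtT|apply/seteqP; split => w //=; rewrite lee_fin].
  rewrite (_ : [set w | _] = set0); first by have [] := filt_sigma F t0.
  by apply/seteqP; split => w //=; rewrite lee_fin leNgt tn.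
- by move=> n w; rewrite lee_fin ler_nat.
- apply: aeW => w; by apply/cvgeryP; exact: cvgr_idn.
Qed.

Lemma adm_dom (H B : proc) : predictable F H -> adm B ->
  (forall t w, 0 < t -> `|H t w| <= `|B t w|) -> adm H.
Proof.
move=> pH [_ /locally_bounded_real[tau lt h]] HB; split => //.
apply/locally_bounded_real; exists tau => // n; have [C hC] := h n.
by exists C => t w t0 tt; rewrite (le_trans (HB _ _ t0))// hC.
Qed.

Lemma adm_bop (op : R -> R -> R) (b : R -> R -> R) H1 H2 :
  (predictable F H1 -> predictable F H2 -> predictable F (fun t w => op (H1 t w) (H2 t w))) ->
  (forall C1 C2 x y, `|x| <= C1 -> `|y| <= C2 -> `|op x y| <= b C1 C2) ->
  adm H1 -> adm H2 -> adm (fun t w => op (H1 t w) (H2 t w)).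
Proof.
move=> pop bop [p1 /locally_bounded_real[t1 l1 h1]] [p2 /locally_bounded_real[t2 l2 h2]].
split; first exact: pop.
apply/locally_bounded_real; exists (fun n w => Order.min (t1 n w) (t2 n w)); first exact: localizing_min.
move=> n; have [C1 hC1] := h1 n; have [C2 hC2] := h2 n.
exists (b C1 C2) => t w t0; rewrite le_min => /andP[a c].
by apply: bop; [exact: hC1|exact: hC2].
Qed.

Lemma admD H1 H2 : adm H1 -> adm H2 -> adm (fun t w => H1 t w + H2 t w).
Proof.
apply: (@adm_bop +%R +%R).
  move=> /predictable_measurable h1 /predictable_measurable h2; apply/predictable_measurable.
  exact: measurable_funD.
by move=> C1 C2 x y h1 h2; rewrite (le_trans (ler_normD _ _))// lerD.
Qed.

Lemma admM H1 H2 : adm H1 -> adm H2 -> adm (fun t w => H1 t w * H2 t w).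
Proof.
apply: (@adm_bop *%R *%R).
  move=> /predictable_measurable h1 /predictable_measurable h2; apply/predictable_measurable.
  exact: measurable_funM.
by move=> C1 C2 x y h1 h2; rewrite normrM ler_pM.
Qed.

Lemma admZ a H : adm H -> adm (fun t w => a * H t w).
Proof. by move=> aH; apply: admM => //; exact: adm_cst. Qed.

Lemma admN H : adm H -> adm (fun t w => - H t w).
Proof.
move=> /(admZ (-1)); congr adm; apply/funext => t; apply/funext => w; exact: mulN1r.
Qed.

Lemma admB H1 H2 : adm H1 -> adm H2 -> adm (fun t w => H1 t w - H2 t w).
Proof. by move=> a1 a2; apply: admD => //; exact: admN. Qed.

Lemma adm_lin a H1 H2 : adm H1 -> adm H2 -> adm (fun t w => a * H1 t w + H2 t w).
Proof. by move=> a1 a2; apply: admD => //; exact: admZ. Qed.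

Lemma adm_sum (I : Type) (r : seq I) (H : I -> proc) : (forall i, adm (H i)) ->
  adm (fun t w => \sum_(i <- r) H i t w).
Proof.
move=> aH; elim: r => [|i r IH].
  have := adm_cst 0; congr adm; apply/funext => t; apply/funext => w; by rewrite big_nil.
have := admD (aH i) IH; congr adm; apply/funext => t; apply/funext => w; by rewrite big_cons.
Qed.

Lemma adm_norm H : adm H -> adm (fun t w => `|H t w|).
Proof.
move=> aH; apply: (adm_dom _ aH) => [|t w _]; last by rewrite normr_id.
apply/predictable_measurable; have [/predictable_measurable mH _] := aH.
exact: measurableT_comp.
Qed.

Lemma adm_indic (S : set (R * T)) : measurable (S : set pred_type) -> adm (fun t w => \1_S (t, w)).
Proof.
move=> mS; apply: (adm_dom _ (adm_cst 1)) => [|t w _].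
  apply/predictable_measurable; rewrite (_ : (fun p => _) = \1_S); first exact: measurable_indic.
  by apply/funext => -[].
by rewrite indicE; case: (_ \in _); rewrite ?normr0 ?normr1.
Qed.

Lemma measurable_rect0 A : F 0 A -> measurable ([set 0] `*` A : set pred_type).
Proof.
move=> FA; rewrite pred_typeE /pred_sets /= setIC (_ : _ `&` _ = [set 0] `*` A).
  by apply: sub_sigma_algebra; left; exists A.
by apply/setIidPl => -[t w] /= [-> _].
Qed.

Lemma measurable_rect s u A : 0 <= s -> s <= u -> F s A -> measurable (`]s, u] `*` A : set pred_type).
Proof.
move=> s0 su FA; rewrite pred_typeE /pred_sets /= setIC (_ : _ `&` _ = `]s, u] `*` A).
  by apply: sub_sigma_algebra; right; exists s, u, A.
by apply/setIidPl => -[t w] /= [/=]; rewrite in_itv/= => /andP[st _] _; rewrite (le_trans s0)// ltW.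
Qed.

Lemma rectangles_setI : setI_closed (predictable_rectangles F).
Proof.
have ab A B : F 0 A -> F 0 B -> predictable_rectangles F ((([set 0] `*` A) : set (R * T)) `&` ([set 0] `*` B)).
  move=> FA FB; left; exists (A `&` B); split; first by apply: filtI.
  by apply/seteqP; split => -[t w] /=; tauto.
have ac A s u B : 0 <= s -> s <= u -> F s B -> predictable_rectangles F ((([set 0] `*` A) : set (R * T)) `&` (`]s, u] `*` B)).
  move=> s0 su FB; left; exists set0; split; first by have [] := filt_sigma F (lexx 0).
  apply/seteqP; split => -[t w] /= [] //; move=> [-> _] [/=]; rewrite in_itv/= => /andP[h _].
  by have := lt_le_trans h s0; rewrite ltxx.
move=> _ _ [[A [FA ->]]|[s [u [A [s0 su FA ->]]]]] [[B [FB ->]]|[s' [u' [B [s0' su' FB ->]]]]].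
- exact: ab.
- exact: ac.
- by rewrite setIC; exact: ac.
have ms0 : 0 <= Num.max s s' by rewrite le_max s0.
have [h|h] := leP (Num.max s s') (Num.min u u').
  right; exists (Num.max s s'), (Num.min u u'), (A `&` B); split => //.
    apply: filtI => //; [apply: filt_mono FA|apply: filt_mono FB] => //; by rewrite le_max lexx ?orbT.
  apply/seteqP; split => -[t w] /=; rewrite !in_itv/= gt_max le_min.
    by move=> [[/andP[-> ->] ?] [/andP[-> ->] ?]].
  by move=> [/andP[/andP[-> ->] /andP[-> ->]] [? ?]].
left; exists set0; split; first by have [] := filt_sigma F (lexx 0).
apply/seteqP; split => -[t w] //=; rewrite ?in_itv//=; last by case.
move=> -[[/andP[h1 h2] _] [/andP[h3 h4] _]].
move: h; rewrite lt_max !gt_min; lra.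
Qed.

Lemma rect_sub A : predictable_rectangles F A -> A `<=` D0.
Proof.
move=> [[A' [_ ->]]|[s [u [A' [s0 _ _ ->]]]]] [t w] [/=]; first by move=> -> _; exact: lexx.
by rewrite in_itv/= => /andP[/ltW st _] _; exact: le_trans st.
Qed.

Section induction.
Variable Q : proc -> Prop.
Hypothesis Q0 : forall A, F 0 A -> Q (fun t w => \1_([set 0] `*` A) (t, w)).
Hypothesis Qr : forall s u A, 0 <= s -> s <= u -> F s A -> Q (fun t w => \1_(`]s, u] `*` A) (t, w)).
Hypothesis Ql : forall a H H', adm H -> adm H' -> Q H -> Q H' -> Q (fun t w => a * H t w + H' t w).
Hypothesis Qd : forall (Hn : nat -> proc) H B, (forall n, adm (Hn n)) -> adm H -> adm B ->
  (forall n t w, 0 < t -> `|Hn n t w| <= B t w) ->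
  (forall t w, 0 < t -> Hn n t w @[n --> \oo] --> H t w) -> (forall n, Q (Hn n)) -> Q H.

Let Qset (S : set (R * T)) : measurable (S : set pred_type) -> S `<=` D0 -> Q (fun t w => \1_S (t, w)).
Proof.
move=> mS SD.
pose G := [set S : set (R * T) | [/\ measurable (S : set pred_type), S `<=` D0 & Q (fun t w => \1_S (t, w))]].
suff : G S by case.
have lG : lambda_system D0 G.
  split.
  - by move=> A [].
  - split=> //.
      by rewrite pred_typeE /pred_sets /= setIid; have [s0 sC _] := smallest_sigma_algebra D0 (predictable_rectangles F); have := sC _ s0; rewrite setD0.
    have mR n : measurable (`]0, n%:R] `*` setT : set pred_type) by apply: measurable_rect => //; exact: filtT.
    apply: (Qd (Hn := fun n t w => \1_(`]0, n%:R] `*` setT) (t, w)) (B := fun _ _ => 1)).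
    + by move=> n; exact: adm_indic.
    + apply: adm_indic.
      by rewrite pred_typeE /pred_sets /= setIid; have [s0 sC _] := smallest_sigma_algebra D0 (predictable_rectangles F); have := sC _ s0; rewrite setD0.
    + exact: adm_cst.
    + by move=> n t w _; rewrite indicE; case: (_ \in _); rewrite ?normr0 ?normr1.
    + move=> t w t0; apply: cvg_near_cst; near=> n.
      rewrite !indicE !mem_set//; [exact: ltW|split => //=; rewrite in_itv/= t0/=].
      near: n; exact: nbhs_infty_ger.
    + by move=> n; apply: Qr => //; exact: filtT.
  - move=> A B BA [mA AD QA] [mB BD QB]; split.
    + exact: (@measurableD _ pred_type).
    + by move=> p [/AD].
    + rewrite (_ : (fun t w => _) = fun t w => -1 * \1_B (t, w) + \1_A (t, w)).
        by apply: Ql => //; exact: adm_indic.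
      apply/funext => t; apply/funext => w; rewrite !indicE in_setD.
      case: (boolP ((t, w) \in B)) => hB /=; last by rewrite mulr0 add0r andbT.
      by rewrite (mem_set (BA _ (set_mem hB))) mulr1 addNr.
  - move=> E ndE hE.
    have mE n : measurable (E n : set pred_type) by case: (hE n).
    have mU : measurable (\bigcup_n E n : set pred_type) by apply: (@bigcup_measurable _ pred_type) => n _.
    split => //.
      by move=> p [n _]; case: (hE n) => _ ED _ /ED.
    apply: (Qd (Hn := fun n t w => \1_(E n) (t, w)) (B := fun _ _ => 1)).
    + by move=> n; exact: adm_indic.
    + exact: adm_indic.
    + exact: adm_cst.
    + by move=> n t w _; rewrite indicE; case: (_ \in _); rewrite ?normr0 ?normr1.
    + move=> t w t0; apply: cvg_near_cst.
      have [[n _ En]|nU] := pselect ((\bigcup_n E n) (t, w)).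
        exists n => // k /= nk; rewrite !indicE !mem_set//; first by exists n.
        by move/subsetPset : (ndE _ _ nk); exact.
      apply: filterE => n; rewrite !indicE !memNset// => En; apply: nU; by exists n.
    + by move=> n; case: (hE n).
apply: (lambda_system_subset rectangles_setI lG) => [A hA|X|].
- split.
  + rewrite pred_typeE /pred_sets /= setIC (_ : _ `&` _ = A); first exact: sub_sigma_algebra.
    by apply/setIidPl; exact: rect_sub.
  + exact: rect_sub.
  + by move: hA => [[A' [FA ->]]|[s [u [A' [s0 su FA ->]]]]]; [exact: Q0|exact: Qr].
- apply: (smallest_sub _ rect_sub); split => [||B hB]; first exact: sub0set.
    by move=> B _ p [].
  by move=> p [n _]; exact: hB.
- by move: mS; rewrite pred_typeE /pred_sets /= (_ : _ `&` S = S)//; exact/setIidPr.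
Unshelve. all: by end_near.
Qed.

(** A constant sequence in [Qd], where convergence is asked at positive times only: [Q] does not see
    the values at time 0. *)
Let Qext H H' : adm H -> adm H' -> (forall t w, 0 < t -> H t w = H' t w) -> Q H -> Q H'.
Proof.
move=> aH aH' HH QH.
apply: (Qd (Hn := fun _ => H) (B := fun t w => `|H t w|)) => //; first exact: adm_norm.
by move=> t w t0; rewrite HH//; exact: cvg_cst.
Qed.

Let Qset' (S : set (R * T)) : measurable (S : set pred_type) -> Q (fun t w => \1_S (t, w)).
Proof.
move=> mS.
have mD : measurable (D0 : set pred_type).
  rewrite pred_typeE /pred_sets /= setIid.
  by have [s0 sC _] := smallest_sigma_algebra D0 (predictable_rectangles F); have := sC _ s0; rewrite setD0.
have mDS : measurable (D0 `&` S : set pred_type) by exact: measurableI.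
apply: (Qext (H := fun t w => \1_(D0 `&` S) (t, w))); [exact: adm_indic..| |by apply: Qset => // p []].
by move=> t w t0; rewrite !indicE in_setI [X in X && _]mem_set//; exact: ltW.
Qed.

Import HBNNSimple.
Let Qpos H : adm H -> (forall t w, 0 <= H t w) -> Q H.
Proof.
move=> aH H0; have [/predictable_measurable mH _] := aH.
have mf : measurable_fun setT (fun p : pred_type => (H p.1 p.2)%:E) by exact/measurable_EFinP.
have mT : measurable (setT : set pred_type) by exact: measurableT.
pose g := nnsfun_approx mT mf.
have gH n p : 0 <= g n p <= H p.1 p.2.
  apply/andP; split; first exact: fun_ge0.
  have cg : (g k p)%:E @[k --> \oo] --> (H p.1 p.2)%:E.
    by apply: (@cvg_nnsfun_approx _ _ _ _ mT _ mf) => // q _; rewrite lee_fin.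
  have /fine_cvgP[_ {}cg] := cg.
  have nd : nondecreasing_seq (fun k => g k p).
    by move=> a b ab; move/lefP : (nd_nnsfun_approx mT mf ab); exact.
  rewrite -(cvg_lim _ cg)//; apply: (nondecreasing_cvgn_le (u_ := fun k => g k p)) => //.
  by apply/cvg_ex; eexists; exact: cg.
have mg n y : measurable (g n @^-1` [set y] : set pred_type) by exact: measurable_sfunP.
have agn n : adm (fun t w => g n (t, w)).
  apply: adm_dom aH _ => [|t w _]; last by have /andP[a b] := gH n (t, w); rewrite !ger0_norm.
  apply/predictable_measurable; rewrite (_ : (fun p => _) = g n); first exact: measurable_funP.
  by apply/funext => -[].
apply: (Qd (Hn := fun n t w => g n (t, w)) (B := H)) => //.
- by move=> n t w _; have /andP[a b] := gH n (t, w); rewrite ger0_norm.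
- move=> t w _.
  have cg : (g k (t, w))%:E @[k --> \oo] --> (H t w)%:E.
    by apply: (@cvg_nnsfun_approx _ _ _ _ mT _ mf _ (t, w)) => // q _; rewrite lee_fin.
  by have /fine_cvgP[] := cg.
move=> n.
have -> : (fun t w => g n (t, w)) = (fun t w => \sum_(y <- finmap.enum_fset (fset_set (range (g n)))) y * \1_(g n @^-1` [set y]) (t, w)).
  by apply/funext => t; apply/funext => w; rewrite fimfunE fsbig_finite.
elim: (finmap.enum_fset _) => [|y l IH].
  have := Qset' (@measurable0 _ pred_type); congr Q; apply/funext => t; apply/funext => w.
  by rewrite big_nil indic0.
have -> : (fun t w => \sum_(j <- y :: l) j * \1_(g n @^-1` [set j]) (t, w)) =
  (fun t w => y * \1_(g n @^-1` [set y]) (t, w) + \sum_(j <- l) j * \1_(g n @^-1` [set j]) (t, w)).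
  by apply/funext => t; apply/funext => w; rewrite big_cons.
apply: Ql => //; last exact: Qset'.
- exact: adm_indic.
- by apply: adm_sum => j; apply: admZ; exact: adm_indic.
Qed.

(** Indicators are reached by the pi-lambda theorem, nonnegative processes by increasing simple
    functions, and [H] is the difference of the nonnegative processes [|H|] and [|H| - H]. *)
Lemma adm_ind H : adm H -> Q H.
Proof.
move=> aH; have aN := adm_norm aH.
have a2 : adm (fun t w => `|H t w| - H t w) by exact: admB.
have := Ql (-1) a2 aN (Qpos a2 _) (Qpos aN _) => /(_ _ _)/wrap[t w|t w|].
- by rewrite subr_ge0 ler_norm.
- exact: normr_ge0.
by congr Q; apply/funext => t; apply/funext => w; rewrite mulN1r opprB subrK.
Qed.

End induction.
End predictability.

(** * Integral functionals and their jumps *)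

Lemma min_absorb (R : realType) (a b t : R) : a <= b -> Num.min b (Num.min a t) = Num.min a t.
Proof. by move=> ab; rewrite minA (min_r ab). Qed.

Lemma min_absorb' (R : realType) (a b t : R) : a <= b -> Num.min a (Num.min b t) = Num.min a t.
Proof. by move=> ab; rewrite minA (min_l ab). Qed.

(** The product of the indicators of []s, u]] and []s', u']] is that of []max s s', min u u']], or 0
    when this interval is empty; this is the same rule for increments of a stopped path. *)
Lemma rect_increment (R : realType) (x : R -> R) (s u s' u' t : R) : s <= u -> s' <= u' ->
  (x (Num.min u' (Num.min u t)) - x (Num.min s' (Num.min u t)))
  - (x (Num.min u' (Num.min s t)) - x (Num.min s' (Num.min s t))) =
  if Num.max s s' <= Num.min u u' then x (Num.min (Num.min u u') t) - x (Num.min (Num.max s s') t) else 0.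
Proof.
move=> su su'; case: ifPn => [|].
  rewrite ge_max !le_min => /andP[/andP[_ h1] /andP[h2 _]].
  rewrite (minC u u') -minA.
  have [h|h] := leP s s'.
    by rewrite (min_absorb _ h) (min_absorb _ h1) subrr subr0 (min_absorb' _ h2).
  rewrite (min_absorb _ h1) (min_absorb' _ h2) (min_absorb' _ (ltW h)); ring.
rewrite -ltNge lt_max !gt_min !ltNge su su' /= orbF => h.
move: h => /orP[/negbTE h|/negbTE h].
- have h1 : u' <= s by rewrite ltW// ltNge h.
  rewrite (min_absorb' _ h1) (min_absorb' _ (le_trans h1 su)) (min_absorb' _ (le_trans su' h1)).
  by rewrite (min_absorb' _ (le_trans (le_trans su' h1) su)); ring.
- have h1 : u <= s' by rewrite ltW// ltNge h.
  rewrite (min_absorb _ h1) (min_absorb _ (le_trans h1 su')) (min_absorb _ (le_trans su h1)).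
  by rewrite (min_absorb _ (le_trans (le_trans su h1) su')); ring.
Qed.

Section integral_functionals.
Variables (R : realType) (d : measure_display) (T : measurableType d).
Variables (P : probability T R) (F : filtration R T).
Notation proc := (R -> T -> R).
Notation adm := (adm P F).
Notation indist := (@indistinguishable R d T P R).

(** Right-continuous paths are determined by countably many times. Absolute values keep the
    enumerated rationals among the times [t >= 0]. *)
Lemma indist_of_times (X Y : proc) :
  {ae P, forall w, forall t, 0 <= t -> X x w @[x --> t^'+] --> X t w} ->
  {ae P, forall w, forall t, 0 <= t -> Y x w @[x --> t^'+] --> Y t w} ->
  (forall t, 0 <= t -> {ae P, forall w, X t w = Y t w}) -> indist X Y.
Proof.
move=> cX cY XY.
have : {ae P, forall w, forall n, X `|ratr (odflt 0 (unpickle n))| w = Y `|ratr (odflt 0 (unpickle n))| w}.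
  by apply: ae_foralln => n; apply: XY.
apply: filterS3 cX cY => w cX cY q t t0.
apply: contrapT => /eqP ne.
have c : X x w - Y x w @[x --> t^'+] --> X t w - Y t w by apply: cvgB; [exact: cX|exact: cY].
have : \forall x \near t^'+, X x w - Y x w != 0.
  by apply: cvgr_neq0 c _; rewrite subr_eq0.
move=> [e /= e0 he].
have /rat_in_itvoo[r] : t < t + e by lra.
rewrite in_itv/= => /andP[r1 r2].
have := he (ratr r); rewrite /ball/= distrC ger0_norm; last by lra.
move=> /(_ _ r1) /wrap[|/eqP]; first by lra.
apply; have := q (pickle r); rewrite pickleK/= ger0_norm ?(le_trans t0 (ltW r1))//.
by move=> ->; rewrite subrr.
Qed.

Lemma cadlag_right (X : proc) : (forall w, cadlag (X ^~ w)) ->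
  {ae P, forall w, forall t, 0 <= t -> X x w @[x --> t^'+] --> X t w}.
Proof. by move=> cX; apply: aeW => w t t0; have [h _] := cX w; exact: h. Qed.

Lemma cvg_prob_const (D : nat -> T -> R) (L : T -> R) : (forall n, measurable_fun setT (D n)) ->
  cvg_prob P D -> (forall n, {ae P, forall w, D n w = L w}) -> {ae P, forall w, L w = 0}.
Proof.
move=> mD cD DL; apply: (cvg_prob_ae mD cD).
apply: filterS (ae_foralln DL) => w h; under eq_fun do rewrite h; exact: cvg_cst.
Qed.

(* What the proofs use of [H |-> int H dX]; unlike [integral_operator], it is stable under sums
   and under [l |-> l (_ * H)]. *)
Definition ifun (l : proc -> proc) := 
 [/\ forall H, adm H -> (forall w, cadlag (l H ^~ w)) /\ (forall t, 0 <= t -> measurable_fun setT (l H t)),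
     forall a H H', adm H -> adm H' -> 
        indist (l (fun t w => a * H t w + H' t w)) (fun t w => a * l H t w + l H' t w),
     forall s u A H, 0 <= s -> s <= u -> F s A -> adm H -> 
        indist (l (fun t w => \1_(`]s, u] `*` A) (t, w) * H t w))
           (fun t w => \1_A w * (l H (Num.min u t) w - l H (Num.min s t) w)) &
     forall (Hn : nat -> proc) H B, (forall n, adm (Hn n)) -> adm H -> adm B ->
        (forall n t w, 0 < t -> `|Hn n t w| <= B t w) ->
        (forall t w, 0 < t -> Hn n t w @[n --> \oo] --> H t w) ->
        forall t, 0 <= t -> cvg_prob P (fun n w => l (Hn n) t w - l H t w)].

Lemma adm_rectM s u A H : 0 <= s -> s <= u -> F s A -> adm H ->
  adm (fun t w => \1_(`]s, u] `*` A) (t, w) * H t w).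
Proof. by move=> s0 su FA aH; apply: admM => //; apply: adm_indic; exact: measurable_rect. Qed.

Section dominated_functional.
Variable l : proc -> proc.
Hypothesis lc : forall H, adm H -> (forall w, cadlag (l H ^~ w)) /\ (forall t, 0 <= t -> measurable_fun setT (l H t)).
Hypothesis ld : forall (Hn : nat -> proc) H B, (forall n, adm (Hn n)) -> adm H -> adm B ->
        (forall n t w, 0 < t -> `|Hn n t w| <= B t w) ->
        (forall t w, 0 < t -> Hn n t w @[n --> \oo] --> H t w) ->
        forall t, 0 <= t -> cvg_prob P (fun n w => l (Hn n) t w - l H t w).

Lemma dom_ext H H' : adm H -> adm H' -> (forall t w, 0 < t -> H t w = H' t w) -> indist (l H) (l H').
Proof.
move=> aH aH' HH; have [c1 m1] := lc aH; have [c2 m2] := lc aH'.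
apply: indist_of_times; [exact: cadlag_right..|move=> t t0].
have c := @ld (fun _ => H) H' (fun t w => `|H t w|) (fun _ => aH) aH' (adm_norm aH) _ _ t t0.
have {}c : cvg_prob P (fun _ w => l H t w - l H' t w).
  by apply: c => // t' w t0'; rewrite HH//; exact: cvg_cst.
have := cvg_prob_const (L := fun w => l H t w - l H' t w) _ c => /(_ _ _)/wrap[n|n|].
- by apply: measurable_funB; [exact: m1|exact: m2].
- exact: aeW.
by apply: filterS => w /subr0_eq.
Qed.

End dominated_functional.

Lemma ifun_ext l H H' : ifun l -> adm H -> adm H' -> (forall t w, 0 < t -> H t w = H' t w) ->
  indist (l H) (l H').
Proof. by move=> [lc _ _ ld]; exact: dom_ext. Qed.

Lemma adm0 : adm (fun _ _ => 0). Proof. exact: adm_cst. Qed.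
Lemma adm1 : adm (fun _ _ => 1). Proof. exact: adm_cst. Qed.

Section operator.
Variables (X : proc) (J : proc -> proc).
Hypothesis XJ : integral_operator P F X J.

Let Jc : forall H, adm H -> (forall w, cadlag (J H ^~ w)) /\ (forall t, 0 <= t -> measurable_fun setT (J H t)).
Proof. by case: XJ. Qed.
Let Jl : forall a H H', adm H -> adm H' -> 
        indist (J (fun t w => a * H t w + H' t w)) (fun t w => a * J H t w + J H' t w).
Proof. by case: XJ. Qed.
Let Jd : forall (Hn : nat -> proc) H B, (forall n, adm (Hn n)) -> adm H -> adm B ->
        (forall n t w, 0 < t -> `|Hn n t w| <= B t w) ->
        (forall t w, 0 < t -> Hn n t w @[n --> \oo] --> H t w) ->
        forall t, 0 <= t -> cvg_prob P (fun n w => J (Hn n) t w - J H t w).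
Proof. by case: XJ => _ _ _ _ h Hn H B a1 a2 a3 h1 h2 t t0 e e0; exact: (h _ _ _ a1 a2 a3). Qed.
Let Jr : forall s u A, 0 <= s -> s <= u -> F s A ->
        indist (J (fun t w => \1_(`]s, u] `*` A) (t, w)))
          (fun t w => \1_A w * (X (Num.min u t) w - X (Num.min s t) w)).
Proof. by case: XJ. Qed.

Let J0 H : adm H -> (forall t w, 0 < t -> H t w = 0) -> indist (J H) (fun _ _ => 0).
Proof.
move=> aH H0; have := Jl 1 adm0 adm0 => h.
have e : indist (J H) (J (fun _ _ => 0)) by apply: (dom_ext Jc Jd) => //; exact: adm0.
apply: filterS2 h e => w h e t t0; rewrite e//.
have := h t t0; have -> : (fun _ _ => 1 * 0 + 0) = (fun _ _ => 0) :> proc.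
  by apply/funext => ?; apply/funext => ?; rewrite mulr0 addr0.
by rewrite mul1r; lra.
Qed.

(** What has to be shown is that restriction to a rectangle commutes with the integral of every [H],
    not only of 1. For rectangles it is [rect_increment]; it passes to limits in probability at each
    time, and right continuity then gives all times at once. *)
Lemma operator_ifun : ifun J.
Proof.
split => // s u A H s0 su FA; move: H; apply: adm_ind => [A'|s' u' A'|a H H' aH aH'|Hn H B aHn aH aB HB HnH].
- move=> FA'; pose K (t : R) (w : T) : R := \1_([set 0] `*` A') (t, w).
  have aK : adm K by apply: adm_indic; exact: measurable_rect0.
  have K0 t w : 0 < t -> K t w = 0.
    by move=> t0; rewrite /K indicE memNset// => -[/= t00]; rewrite t00 ltxx in t0.
  have e1 := J0 aK K0.
  have e2 : indist (J (fun t w => \1_(`]s, u] `*` A) (t, w) * K t w)) (fun _ _ => 0).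
    by apply: J0 => [|t w /K0 ->]; [exact: adm_rectM|rewrite mulr0].
  apply: filterS2 e1 e2 => w e1 e2 t t0.
  by rewrite e2// !e1 ?subrr ?mulr0// le_min t0 ?s0// (le_trans s0).
- move=> s0' su' FA'.
  have e1 := Jr s0' su' FA'.
  have e2 : indist (J (fun t w => \1_(`]s, u] `*` A) (t, w) * \1_(`]s', u'] `*` A') (t, w)))
      (fun t w => \1_A w * \1_A' w * (if Num.max s s' <= Num.min u u' then X (Num.min (Num.min u u') t) w - X (Num.min (Num.max s s') t) w else 0)).
    have [h|h] := leP (Num.max s s') (Num.min u u').
      have ms0 : 0 <= Num.max s s' by rewrite le_max s0.
      have FAA : F (Num.max s s') (A `&` A').
        by apply: filtI => //; [apply: filt_mono FA|apply: filt_mono FA'] => //; rewrite le_max lexx ?orbT.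
      have := Jr ms0 h FAA; congr indist; last first.
        by apply/funext => t; apply/funext => w; rewrite indicI.
      congr J; apply/funext => t; apply/funext => w; rewrite !indicE -natrM mulnb; congr (_ _)%:R.
      apply/idP/idP.
        rewrite !inE /= !in_itv/= gt_max le_min.
        by move=> [/and3P[/andP[a1 a2] a3 a4] [b1 b2]]; apply/andP; split; rewrite inE; split => //=; rewrite in_itv/= ?a1 ?a2.
      rewrite !inE /= !in_itv/= gt_max le_min.
      by move=> /andP[]; rewrite !inE /= !in_itv/= => -[/andP[-> ->] ?] [/andP[-> ->] ?].
    apply: (@filterS _ _ _ _ _ _ (J0 _ _)).
    + by move=> w e t t0; rewrite e// mulr0.
    + by apply: (adm_rectM s0 su FA); apply: (adm_indic P); exact: (measurable_rect s0' su' FA').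
    move=> t w t0 /=; rewrite !indicE -natrM mulnb (_ : _ && _ = false)//.
    apply/negbTE/negP => /andP[]; rewrite !inE /= !in_itv/= => -[/andP[h1 h2] _] [/andP[h3 h4] _].
    move: h; rewrite lt_max !gt_min; lra.
  apply: filterS2 e1 e2 => w e1 e2 t t0.
  have ut0 : 0 <= Num.min u t by rewrite le_min t0 (le_trans s0 su).
  have st0 : 0 <= Num.min s t by rewrite le_min t0 s0.
  rewrite e2// (e1 _ ut0) (e1 _ st0).
  by rewrite -(rect_increment (X ^~ w) t su su'); ring.
- move=> QH QH'.
  have e1 := Jl a aH aH'.
  have e2 := Jl a (adm_rectM s0 su FA aH) (adm_rectM s0 su FA aH').
  apply: filterS3 e1 e2 (filterI QH QH') => w e1 e2 [{}QH {}QH'] t t0.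
  have -> : (fun t w => \1_(`]s, u] `*` A) (t, w) * (a * H t w + H' t w)) = (fun t w => a * (\1_(`]s, u] `*` A) (t, w) * H t w) + \1_(`]s, u] `*` A) (t, w) * H' t w) :> proc.
    by apply/funext => ?; apply/funext => ?; ring.
  rewrite e2// QH// QH'// !e1 ?le_min ?t0 ?s0 ?(le_trans s0 su)//; ring.
- move=> QHn.
  have aRH : adm (fun t w => \1_(`]s, u] `*` A) (t, w) * H t w) by exact: adm_rectM.
  have aRHn n : adm (fun t w => \1_(`]s, u] `*` A) (t, w) * Hn n t w) by exact: adm_rectM.
  have [c1 m1] := Jc aRH; have [c2 m2] := Jc aH.
  have u0 := le_trans s0 su.
  apply: indist_of_times; first exact: cadlag_right.
    apply: aeW => w t t0; apply: cvgM; first exact: cvg_cst.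
    have cc a : 0 <= a -> J H (Num.min a x) w @[x --> t^'+] --> J H (Num.min a t) w.
      move=> a0; have [c _] := c2 w.
      have [ta|at_] := ltP t a.
        apply: cvg_trans (c t t0); apply: near_eq_cvg.
        near=> x; have : x < a by near: x; exact: nbhs_right_lt.
        by move=> /ltW xa; rewrite (min_r xa).
      apply: cvg_near_cst; near=> x.
      have : t < x by [].
      by move=> tx; rewrite min_l// (le_trans at_)// ltW.
    by apply: cvgB; exact: cc.
  move=> t t0.
  have ut0 : 0 <= Num.min u t by rewrite le_min u0.
  have st0 : 0 <= Num.min s t by rewrite le_min s0.
  have mJ n r : 0 <= r -> measurable_fun setT (fun w => J (Hn n) r w - J H r w).
    by move=> r0; apply: measurable_funB; [have [_ mm] := Jc (aHn n); exact: mm|exact: m2].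
  have mJR n : measurable_fun setT (fun w => J (fun t w => \1_(`]s, u] `*` A) (t, w) * Hn n t w) t w - J (fun t w => \1_(`]s, u] `*` A) (t, w) * H t w) t w).
    by apply: measurable_funB; [have [_ mm] := Jc (aRHn n); exact: mm|exact: m1].
  have d1 := Jd aRHn aRH aB _ _ t0.
  have {}d1 : cvg_prob P (fun n w => J (fun t w => \1_(`]s, u] `*` A) (t, w) * Hn n t w) t w - J (fun t w => \1_(`]s, u] `*` A) (t, w) * H t w) t w).
    apply: d1 => [n t' w t0'|t' w t0'].
      apply: le_trans (HB n t' w t0'); rewrite normrM ler_piMl// indicE.
      by case: (_ \in _); rewrite ?normr0 ?normr1.
    by apply: cvgM; [exact: cvg_cst|exact: HnH].
  have d2 := Jd aHn aH aB HB HnH ut0; have d3 := Jd aHn aH aB HB HnH st0.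
  have mN n : measurable_fun setT (fun w => -1 * (J (Hn n) (Num.min s t) w - J H (Num.min s t) w)).
    by apply: measurable_funM => //; exact: mJ.
  have d23 := cvg_probD (fun n => mJ n _ ut0) mN d2 (cvg_probZ (-1) (fun n => mJ n _ st0) d3).
  have m23 n : measurable_fun setT (fun w => J (Hn n) (Num.min u t) w - J H (Num.min u t) w + -1 * (J (Hn n) (Num.min s t) w - J H (Num.min s t) w)).
    by apply: measurable_funD; [exact: mJ|apply: measurable_funM => //; exact: mJ].
  have mA : measurable A by exact: filt_measurable FA.
  have mA23 n : measurable_fun setT (fun w => -1 * (\1_A w * (J (Hn n) (Num.min u t) w - J H (Num.min u t) w + -1 * (J (Hn n) (Num.min s t) w - J H (Num.min s t) w)))).
    apply: measurable_funM => //; apply: measurable_funM => //; exact: measurable_indic.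
  have dA : cvg_prob P (fun n w => -1 * (\1_A w * (J (Hn n) (Num.min u t) w - J H (Num.min u t) w + -1 * (J (Hn n) (Num.min s t) w - J H (Num.min s t) w)))).
    apply: cvg_prob_le d23 => // n; apply: aeW => w.
    rewrite mulN1r normrN normrM ler_piMl// indicE.
    by case: (_ \in _); rewrite ?normr0 ?normr1.
  have dd := cvg_probD mJR mA23 d1 dA.
  pose L w := \1_A w * (J H (Num.min u t) w - J H (Num.min s t) w) - J (fun t w => \1_(`]s, u] `*` A) (t, w) * H t w) t w.
  have := cvg_prob_const (L := L) _ dd => /(_ _ _)/wrap[n|n|].
  - exact: measurable_funD.
  - by apply: filterS (QHn n) => w h; rewrite h// /L; ring.
  - by apply: filterS => w; rewrite /L => /subr0_eq.
Unshelve. all: by end_near.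
Qed.

(** [integral_operator] prescribes the integral of bounded intervals only. The integral of []0, n]]
    is computed from [X] and, by restriction, from the integral of 1; they are compared for
    [n >= t], after checking that the latter starts at 0. *)
Lemma operator_at1 : {ae P, forall w, forall t, 0 <= t -> J (fun _ _ => 1) t w = X t w - X 0 w}.
Proof.
have iJ := operator_ifun.
pose K n (t : R) (w : T) : R := \1_(`]0, n%:R] `*` setT) (t, w).
have aK n : adm (K n) by apply: adm_indic; apply: measurable_rect => //; exact: filtT.
have [c1 m1] := Jc adm1.
have eK n : indist (J (K n)) (fun t w => X (Num.min n%:R t) w - X 0 w).
  have n0 : (0 : R) <= n%:R by [].
  have := Jr (lexx 0) n0 (filtT F (lexx 0)); apply: filterS => w h t t0.
  by rewrite h// indicE in_setT mul1r (min_l t0).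
have eK1 n : indist (J (K n)) (fun t w => J (fun _ _ => 1) (Num.min n%:R t) w - J (fun _ _ => 1) 0 w).
  have n0 : (0 : R) <= n%:R by [].
  have [_ _ h _] := iJ; have := h _ _ _ _ (lexx 0) n0 (filtT F (lexx 0)) adm1.
  apply: filterS => w {}h t t0; have := h t t0.
  rewrite (_ : (fun t w => _) = K n); last by apply/funext => ?; apply/funext => ?; rewrite mulr1.
  by move=> ->; rewrite indicE in_setT mul1r (min_l t0).
have J00 : {ae P, forall w, J (fun _ _ => 1) 0 w = 0}.
  have dK := Jd aK adm1 adm1 _ _ (lexx 0).
  have {}dK : cvg_prob P (fun n w => J (K n) 0 w - J (fun _ _ => 1) 0 w).
    apply: dK => [n t w _|t w t0].
      by rewrite /K indicE; case: (_ \in _); rewrite ?normr0 ?normr1.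
    apply: cvg_near_cst; near=> n; rewrite /K indicE mem_set//; split => //=; rewrite in_itv/= t0/=.
    near: n; exact: nbhs_infty_ger.
  have := cvg_prob_const (L := fun w => - J (fun _ _ => 1) 0 w) _ dK => /(_ _ _)/wrap[n|n|].
  - by apply: measurable_funB; [have [_ mm] := Jc (aK n); exact: mm|exact: m1].
  - by apply: filterS (eK n) => w h; rewrite h// min_r// subrr sub0r.
  - by apply: filterS => w /eqP; rewrite oppr_eq0 => /eqP.
apply: filterS3 J00 (ae_foralln eK) (ae_foralln eK1) => w J00 e1 e2 t t0.
pose n := (Num.truncn t).+1.
have tn : t <= n%:R by apply: ltW; exact: truncnS_gt.
have := e1 n t t0; rewrite e2// !(min_r tn) J00 subr0.
by [].
Unshelve. all: by end_near.
Qed.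

End operator.

Lemma ifun_comp l H : ifun l -> adm H -> ifun (fun K => l (fun t w => K t w * H t w)).
Proof.
move=> [lc ll lr ld] aH; split.
- by move=> K aK; apply: lc; exact: admM.
- move=> a K K' aK aK'; have := ll a _ _ (admM aK aH) (admM aK' aH); congr indist.
  by congr l; apply/funext => t; apply/funext => w; ring.
- move=> s u A K s0 su FA aK; have := lr _ _ _ _ s0 su FA (admM aK aH); congr indist.
  by congr l; apply/funext => t; apply/funext => w; rewrite mulrA.
- move=> Kn K B aKn aK aB KB cK t t0.
  apply: (ld _ _ (fun t w => B t w * `|H t w|)) => //.
  + by move=> n; exact: admM.
  + exact: admM.
  + by apply: admM => //; exact: adm_norm.
  + by move=> n t' w t0'; rewrite normrM ler_wpM2r// KB.
  + by move=> t' w t0'; apply: cvgM; [exact: cK|exact: cvg_cst].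
Qed.

Lemma cadlag_lin (a : R) (x y : R -> R) : cadlag x -> cadlag y -> cadlag (fun t => a * x t + y t).
Proof.
move=> [x1 x2] [y1 y2]; split=> t t0.
  apply: cvgD; last exact: y1.
  by apply: cvgM; [exact: cvg_cst|exact: x1].
have [l hl] := x2 t t0; have [l' hl'] := y2 t t0; exists (a * l + l').
by apply: cvgD => //; apply: cvgM => //; exact: cvg_cst.
Qed.

Lemma ifun_lin a l1 l2 : ifun l1 -> ifun l2 -> ifun (fun K t w => a * l1 K t w + l2 K t w).
Proof.
move=> [c1 i1 r1 d1] [c2 i2 r2 d2]; split.
- move=> K aK; have [ca ma] := c1 K aK; have [cb mb] := c2 K aK; split=> [w|t t0].
    by apply: cadlag_lin; [exact: ca|exact: cb].
  apply: measurable_funD; last exact: mb.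
  by apply: measurable_funM => //; exact: ma.
- move=> b K K' aK aK'.
  by apply: filterS2 (i1 b _ _ aK aK') (i2 b _ _ aK aK') => w h1 h2 t t0; rewrite h1// h2//; ring.
- move=> s u A K s0 su FA aK.
  by apply: filterS2 (r1 _ _ _ _ s0 su FA aK) (r2 _ _ _ _ s0 su FA aK) => w h1 h2 t t0; rewrite h1// h2//; ring.
- move=> Kn K B aKn aK aB KB cK t t0.
  have h1 := d1 _ _ _ aKn aK aB KB cK t t0; have h2 := d2 _ _ _ aKn aK aB KB cK t t0.
  have m1 n : measurable_fun setT (fun w => l1 (Kn n) t w - l1 K t w).
    by apply: measurable_funB; [have [_ m] := c1 _ (aKn n)|have [_ m] := c1 _ aK]; exact: m.
  have m2 n : measurable_fun setT (fun w => l2 (Kn n) t w - l2 K t w).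
    by apply: measurable_funB; [have [_ m] := c2 _ (aKn n)|have [_ m] := c2 _ aK]; exact: m.
  have := cvg_probD (fun n => measurable_funM (measurable_cst a) (m1 n)) m2 (cvg_probZ a m1 h1) h2.
  by congr cvg_prob; apply/funext => n; apply/funext => w /=; ring.
Qed.

Lemma ifun0 : ifun (fun _ _ _ => 0).
Proof.
split.
- move=> H _; split=> [w|t _]; last exact: measurable_cst.
  by split=> [t _|t _]; [exact: cvg_cst|exists 0; exact: cvg_cst].
- by move=> *; apply: aeW => w t _; rewrite mulr0 addr0.
- by move=> *; apply: aeW => w t _; rewrite subrr mulr0.
- move=> Hn H B _ _ _ _ _ t _ e e0; rewrite (_ : (fun n => _) = fun=> 0%E); first exact: cvg_cst.
  apply/funext => n; rewrite (_ : [set w | _] = set0) ?measure0//.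
  by apply/seteqP; split => w //=; rewrite subrr normr0 leNgt e0.
Qed.

Lemma ifun_sum (I : Type) (r : seq I) (l : I -> proc -> proc) : (forall i, ifun (l i)) ->
  ifun (fun K t w => \sum_(i <- r) l i K t w).
Proof.
move=> il; elim: r => [|i r IH].
  have := ifun0; congr ifun; apply/funext => K; apply/funext => t; apply/funext => w; by rewrite big_nil.
have := ifun_lin 1 (il i) IH; congr ifun.
by apply/funext => K; apply/funext => t; apply/funext => w; rewrite big_cons mul1r.
Qed.

Lemma ifunZ a l : ifun l -> ifun (fun K t w => a * l K t w).
Proof.
move=> il; have := ifun_lin a il ifun0; congr ifun.
by apply/funext => K; apply/funext => t; apply/funext => w; rewrite addr0.
Qed.

Lemma ifunD l1 l2 : ifun l1 -> ifun l2 -> ifun (fun K t w => l1 K t w + l2 K t w).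
Proof.
move=> i1 i2; have := ifun_lin 1 i1 i2; congr ifun.
by apply/funext => K; apply/funext => t; apply/funext => w; rewrite mul1r.
Qed.

Lemma ifunB l1 l2 : ifun l1 -> ifun l2 -> ifun (fun K t w => l1 K t w - l2 K t w).
Proof.
move=> i1 i2; have := ifun_lin (-1) i2 i1; congr ifun.
by apply/funext => K; apply/funext => t; apply/funext => w; rewrite mulN1r addrC.
Qed.

Lemma adm_path_bounded H : adm H ->
  {ae P, forall w, forall t, exists C : R, forall s, 0 < s -> s <= t -> `|H s w| <= C}.
Proof.
move=> [_ /locally_bounded_real[tau [_ _ ct] h]].
apply: filterS ct => w /cvgeyPge ct t; have [n _ hn] := ct t; have [C hC] := h n.
by exists C => s s0 st; apply: hC => //; apply: le_trans (hn n (leqnn n)); rewrite lee_fin.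
Qed.

Section jump_functional.
Variables (l : proc -> proc) (j : proc).
Hypothesis il : ifun l.
Hypothesis j0 : {ae P, forall w, j 0 w = 0}.
Hypothesis lj : {ae P, forall w, forall t, 0 <= t ->
  summable `[0, t] (EFin \o (j ^~ w)) /\ l (fun _ _ => 1) t w = sum_over `[0, t] (j ^~ w)}.

Let jK (K : proc) w s := K s w * j s w.

Lemma jump_summable K : adm K -> {ae P, forall w, forall t, 0 <= t ->
  summable `[0, t] (EFin \o (jK K w))}.
Proof.
move=> /adm_path_bounded bK.
apply: filterS3 bK j0 lj => w bK j0w lw t t0; have [sj _] := lw t t0; have [C hC] := bK t.
apply: summable_le (summableZ `|C| (summable_norm sj)) => s /=; rewrite in_itv/= => /andP[s0 st].
have [->|sn] := eqVneq s 0; first by rewrite /jK j0w mulr0 normr0 mulr0.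
by rewrite normrM ler_wpM2r// (le_trans (hC s _ st)) ?ler_norm// lt_neqAle eq_sym sn.
Qed.

(* [adm_ind] in K: a rectangle gives increments of both sides of [lj]; limits are taken in
   probability on the left and by domination on the right. *)
Lemma jump_functional K : adm K -> {ae P, forall w, forall t, 0 <= t ->
  summable `[0, t] (EFin \o (jK K w)) /\ l K t w = sum_over `[0, t] (jK K w)}.
Proof.
move=> aK; suff : indist (l K) (fun t w => sum_over `[0, t] (jK K w)).
  by apply: filterS2 (jump_summable aK) => w h1 h2 t t0; split; [exact: h1|exact: h2].
have [lc ll lr ld] := il.
move: K aK; apply: adm_ind => [A FA|s u A s0 su FA|a H H' aH aH' QH QH'|Hn H B aHn aH aB HB HnH QHn].
- have aK : adm (fun t w => \1_([set 0] `*` A) (t, w)) by apply: adm_indic; exact: measurable_rect0.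
  have K0 (t : R) w : 0 < t -> \1_([set 0] `*` A) (t, w) = 0 :> R.
    by move=> t0; rewrite indicE memNset// => -[/= t00]; rewrite t00 ltxx in t0.
  have e1 : indist (l (fun t w => \1_([set 0] `*` A) (t, w))) (fun _ _ => 0).
    have e0 : indist (l (fun t w => \1_([set 0] `*` A) (t, w))) (l (fun _ _ => 0)).
      by apply: ifun_ext => //; exact: adm0.
    apply: filterS2 e0 (ll 1 _ _ adm0 adm0) => w e0 h t t0; rewrite e0//.
    have := h t t0; have -> : (fun _ _ => 1 * 0 + 0) = (fun _ _ => 0) :> proc.
      by apply/funext => ?; apply/funext => ?; rewrite mulr0 addr0.
    by rewrite mul1r; lra.
  apply: filterS2 e1 j0 => w e1 j0w t t0; rewrite e1// -[LHS](sum_over0 `[0, t]).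
  apply: eq_sum_over => s /=; rewrite in_itv/= => /andP[s0 _]; rewrite /jK.
  have [->|sn] := eqVneq s 0; first by rewrite j0w mulr0.
  by rewrite K0 ?mul0r// lt_neqAle eq_sym sn.
- have := lr _ _ _ _ s0 su FA adm1.
  apply: filterS2 lj => w lw h t t0; have := h t t0.
  have -> : (fun t w => \1_(`]s, u] `*` A) (t, w) * 1) = (fun t w => \1_(`]s, u] `*` A) (t, w)) :> proc.
    by apply/funext => ?; apply/funext => ?; rewrite mulr1.
  have u0 := le_trans s0 su.
  move=> ->; have ut0 : 0 <= Num.min u t by rewrite le_min t0 u0.
  have st0 : 0 <= Num.min s t by rewrite le_min t0 s0.
  have [_ ->] := lw _ ut0; have [_ ->] := lw _ st0.
  have sj r : 0 <= r -> summable `[0, r] (EFin \o (j ^~ w)) by move=> /lw[].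
  rewrite -(cumulative_rect sj s0 su t0) -sum_overZ; last exact: summable_indic (sj _ t0).
  apply: eq_sum_over => r _; rewrite /jK mulrA; congr (_ * _).
  rewrite !indicE -natrM mulnb andbC; congr (_ %:R); congr nat_of_bool.
  by apply/andP/idP => [[/set_mem h1 /set_mem h2]|/set_mem[h1 h2]]; [exact: mem_set|split; exact: mem_set].
- apply: filterS3 (ll a _ _ aH aH') (filterI QH QH') (filterI (jump_summable aH) (jump_summable aH')) => w h [q1 q2] [s1 s2] t t0.
  rewrite h// q1// q2// -sum_over_lin; [|exact: s1|exact: s2].
  by apply: eq_sum_over => s _; rewrite /jK; ring.
- have [c m] := lc _ aH.
  apply: indist_of_times; first exact: cadlag_right.
    by apply: filterS (jump_summable aH) => w sH t t0; exact: cumulative_right.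
  move=> t t0.
  have dl := ld _ _ _ aHn aH aB HB HnH t t0.
  have mD n : measurable_fun setT (fun w => l (Hn n) t w - l H t w).
    by apply: measurable_funB; [have [_ mm] := lc _ (aHn n); exact: mm|exact: m].
  have := cvg_prob_ae (L := fun w => sum_over `[0, t] (jK H w) - l H t w) mD dl => /(_ _)/wrap[|].
    apply: filterS3 (ae_foralln QHn) (jump_summable aB) j0 => w q sB j0w.
    apply: cvgB; last exact: cvg_cst.
    rewrite (_ : (fun n => _) = fun n => sum_over `[0, t] (jK (Hn n) w)); last by apply/funext => n; rewrite q.
    apply: (@sum_over_dominated _ _ _ _ _ _ _ (fun s => `|jK B w s|)) => //.
    + exact: summable_norm (sB t t0).
    + apply: filterE => n s /=; rewrite in_itv/= => /andP[s0 _]; rewrite /jK !normrM.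
      have [->|sn] := eqVneq s 0; first by rewrite j0w normr0 !mulr0.
      rewrite ler_wpM2r//; apply: le_trans (ler_norm _); apply: HB.
      by rewrite lt_neqAle eq_sym sn.
    + move=> s /=; rewrite in_itv/= => /andP[s0 _]; rewrite /jK !normrM.
      have [->|sn] := eqVneq s 0; first by rewrite j0w normr0 !mulr0.
      have sp : 0 < s by rewrite lt_neqAle eq_sym sn.
      rewrite ler_wpM2r//.
      have := HnH s w sp => /cvg_norm cn.
      rewrite -(cvg_lim _ cn)//; apply: limr_le; first by apply/cvg_ex; eexists; exact: cn.
      apply: filterE => n; apply: le_trans (HB n s w sp) (ler_norm _).
    + move=> s /=; rewrite in_itv/= => /andP[s0 _]; rewrite /jK.
      have [->|sn] := eqVneq s 0; first by rewrite j0w mulr0; under eq_fun do rewrite mulr0; exact: cvg_cst.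
      by apply: cvgM; [apply: HnH; rewrite lt_neqAle eq_sym sn|exact: cvg_cst].
  by apply: filterS => w /subr0_eq.
Qed.

End jump_functional.

(** [jump_functional] with zero jumps, applied to the difference: a functional that vanishes at the
    constant 1 vanishes everywhere. Uniqueness of the integral is a special case. *)
Lemma ifun_eq l1 l2 : ifun l1 -> ifun l2 -> indist (l1 (fun _ _ => 1)) (l2 (fun _ _ => 1)) ->
  forall K, adm K -> indist (l1 K) (l2 K).
Proof.
move=> i1 i2 e K aK.
have := @jump_functional _ (fun _ _ => 0) (ifunB i1 i2) _ _ K aK => /(_ _ _)/wrap[||].
- exact: aeW.
- by apply: filterS e => w e t t0; split; [exact: summable0|rewrite sum_over0 e// subrr].
apply: filterS => w h t t0; have [_] := h t t0.
rewrite (_ : (fun s => _) = fun=> 0); last by apply/funext => s; rewrite mulr0.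
by rewrite sum_over0 => /subr0_eq.
Qed.

Lemma operator_unique X X' J J' : integral_operator P F X J -> integral_operator P F X' J' ->
  {ae P, forall w, forall t, 0 <= t -> X t w - X 0 w = X' t w - X' 0 w} ->
  forall K, adm K -> indist (J K) (J' K).
Proof.
move=> XJ XJ' e; apply: ifun_eq; [exact: operator_ifun XJ|exact: operator_ifun XJ'|].
by apply: filterS3 e (operator_at1 XJ) (operator_at1 XJ') => w e h1 h2 t t0; rewrite h1// h2// e.
Qed.
End integral_functionals.

(** * Uniform limits and jumps of integrals *)

Section completed_filtration.
Variables (R : realType) (d : measure_display) (T : measurableType d).
Variables (P : probability T R) (F : filtration R T).

(* [integral_operator] fixes its values only up to null events, so they are measurable for the
   completed filtration only. *)
Definition cfilt (t : R) : set (set T) :=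
  [set B | exists2 A, F t A & {ae P, forall w, B w <-> A w}].

Lemma cfilt_sigma t : 0 <= t -> sigma_algebra setT (cfilt t).
Proof.
move=> t0; have [s0 sC sU] := filt_sigma F t0; split.
- by exists set0 => //; apply: aeW.
- move=> B [A FA BA]; exists (setT `\` A); first exact: sC.
  by apply: filterS BA => w BA; split=> -[_ h]; split => // /BA.
- move=> B hB; have [A hA] := choice (fun n => let: ex_intro2 A a b := hB n in ex_intro (fun A => F t A /\ {ae P, forall w, B n w <-> A w}) A (conj a b)).
  exists (\bigcup_k A k); first by apply: sU => n; case: (hA n).
  have /ae_foralln : forall n, {ae P, forall w, B n w <-> A n w} by move=> n; case: (hA n).
  by apply: filterS => w h; split=> -[n _ /h Bn]; exists n.
Qed.

Definition cfilt_type t := g_sigma_algebraType (cfilt t).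

Lemma cfilt_typeE t (B : set T) : 0 <= t -> measurable (B : set (cfilt_type t)) = cfilt t B.
Proof.
by move=> t0; rewrite /measurable /=; have := sigma_algebra_id (cfilt_sigma t0) => ->.
Qed.

Definition cmeas t (Y : T -> R) := measurable_fun setT (Y : cfilt_type t -> R).

Lemma cmeas_mono s t Y : 0 <= s -> s <= t -> cmeas s Y -> cmeas t Y.
Proof.
move=> s0 st mY _ U mU; have := mY measurableT _ mU.
rewrite cfilt_typeE// cfilt_typeE ?(le_trans s0)// => -[A FA h].
by exists A => //; exact: filt_mono FA.
Qed.

Lemma cmeas_ae t Y Y' : 0 <= t -> {ae P, forall w, Y w = Y' w} -> cmeas t Y -> cmeas t Y'.
Proof.
move=> t0 YY mY _ U mU; have := mY measurableT _ mU; rewrite !cfilt_typeE// => -[A FA h].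
by exists A => //; apply: filterS2 YY h => w e <-; rewrite !setTI /= e.
Qed.

Lemma cmeas_lim t (Y : nat -> T -> R) (L : T -> R) : 0 <= t -> (forall n, cmeas t (Y n)) ->
  {ae P, forall w, Y n w @[n --> \oo] --> L w} -> cmeas t L.
Proof.
move=> t0 mY cY.
pose C w := `[< Y n w @[n --> \oo] --> L w >].
apply: (@cmeas_ae _ (fun w => if C w then L w else 0)) => //.
  by apply: filterS cY => w cw; rewrite ifT//; apply/asboolP.
apply: (@measurable_fun_cvg _ (cfilt_type t) R setT (fun n w => if C w then Y n w else 0)).
  move=> n; apply: cmeas_ae (mY n) => //.
  by apply: filterS cY => w cw; rewrite ifT//; apply/asboolP.
move=> w _; case: ifPn => [/asboolP//|_]; exact: cvg_cst.
Qed.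

Lemma adapted_cmeas (X : R -> T -> R) t : 0 <= t -> adapted F X -> cmeas t (X t).
Proof.
move=> t0 aX; apply: (measurability (@RGenOInfty.G R)); first exact: RGenOInfty.measurableE.
move=> _ [_ [a ->] <-]; rewrite setTI cfilt_typeE//; exists (X t @^-1` `]a, +oo[); last exact: aeW.
by apply: aX => //; exact: itv_open.
Qed.

Lemma filt_cmeas s t A : 0 <= s -> s <= t -> F s A -> cmeas t (\1_A).
Proof.
move=> s0 st FA; apply: (@measurable_indic _ (cfilt_type t)).
rewrite cfilt_typeE ?(le_trans s0 st)//; exists A; last exact: aeW.
exact: filt_mono FA.
Qed.

End completed_filtration.

Section maximal.
Variables (R : realType) (d : measure_display) (T : measurableType d).
Variables (P : probability T R) (F : filtration R T).
Notation proc := (R -> T -> R).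
Notation adm := (adm P F).
Notation indist := (@indistinguishable R d T P R).
Variables (X : proc) (l : proc -> proc).
Hypothesis il : ifun P F l.
Hypothesis aX : adapted F X.
Hypothesis lX : {ae P, forall w, forall t, 0 <= t -> l (fun _ _ => 1) t w = X t w - X 0 w}.

Lemma ifun_eq0 H : adm H -> (forall t w, 0 < t -> H t w = 0) -> indist (l H) (fun _ _ => 0).
Proof.
move=> aH H0; have [_ ll _ _] := il; have a0 := adm0 P F.
have e : indist (l H) (l (fun _ _ => 0)) by apply: (ifun_ext il aH a0).
apply: filterS2 (ll 1 _ _ a0 a0) e => w h e t t0; rewrite e//.
have := h t t0; have -> : (fun _ _ => 1 * 0 + 0) = (fun _ _ => 0) :> proc.
  by apply/funext => ?; apply/funext => ?; rewrite mulr0 addr0.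
by rewrite mul1r; lra.
Qed.

Lemma rect_functional s u A : 0 <= s -> s <= u -> F s A ->
  indist (l (fun t w => \1_(`]s, u] `*` A) (t, w))) (fun t w => \1_A w * (X (Num.min u t) w - X (Num.min s t) w)).
Proof.
move=> s0 su FA; have [_ _ lr _] := il.
have := lr _ _ _ _ s0 su FA (adm1 P F).
have -> : (fun t w => \1_(`]s, u] `*` A) (t, w) * 1) = (fun t w => \1_(`]s, u] `*` A) (t, w)) :> proc.
  by apply/funext => ?; apply/funext => ?; rewrite mulr1.
apply: filterS2 lX => w e h t t0; rewrite h//.
have ut0 : 0 <= Num.min u t by rewrite le_min t0 (le_trans s0 su).
have st0 : 0 <= Num.min s t by rewrite le_min t0 s0.
by rewrite !e//; congr (_ * _); ring.
Qed.

(** Needed to stop an integral when it crosses a level: the crossing event at time [t] must agree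
    with an event of [F t] up to a null event. *)
Lemma functional_cmeas H : adm H -> forall t, 0 <= t -> cmeas P F t (l H t).
Proof.
have [lc ll lr ld] := il.
move: H; apply: adm_ind => [A FA|s u A s0 su FA|a H H' aH aH' QH QH'|Hn H B aHn aH aB HB HnH QHn] t t0.
- have aK : adm (fun t w => \1_([set 0] `*` A) (t, w)) by apply: adm_indic; exact: measurable_rect0.
  have K0 (r : R) w : 0 < r -> \1_([set 0] `*` A) (r, w) = 0 :> R.
    by move=> t0'; rewrite indicE memNset// => -[/= t00]; rewrite t00 ltxx in t0'.
  apply: (@cmeas_ae _ _ _ _ _ _ (fun=> 0)) => //; last exact: measurable_cst.
  by apply: filterS (ifun_eq0 aK K0) => w e; rewrite e.
- have [st|ts] := leP s t; last first.
    apply: (@cmeas_ae _ _ _ _ _ _ (fun=> 0)) => //; last exact: measurable_cst.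
    apply: filterS (rect_functional s0 su FA) => w e; rewrite e//.
    by rewrite !min_r ?subrr ?mulr0 ?(ltW ts)// (le_trans (ltW ts)).
  apply: (@cmeas_ae _ _ _ _ _ _ (fun w => \1_A w * (X (Num.min u t) w - X (Num.min s t) w))) => //.
    by apply: filterS (rect_functional s0 su FA) => w e; rewrite e.
  apply: measurable_funM; first exact: filt_cmeas st FA.
  apply: measurable_funB.
    apply: (@cmeas_mono _ _ _ _ _ (Num.min u t)); rewrite ?le_min ?ge_min ?lexx ?orbT ?t0 ?(le_trans s0)//.
    by apply: adapted_cmeas => //; rewrite le_min t0 (le_trans s0).
  apply: (@cmeas_mono _ _ _ _ _ (Num.min s t)); rewrite ?le_min ?ge_min ?lexx ?orbT ?t0 ?s0//.
  by apply: adapted_cmeas => //; rewrite le_min t0 s0.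
- apply: (@cmeas_ae _ _ _ _ _ _ (fun w => a * l H t w + l H' t w)) => //.
    by apply: filterS (ll a _ _ aH aH') => w e; rewrite e.
  apply: measurable_funD; last exact: QH'.
  by apply: measurable_funM; [exact: measurable_cst|exact: QH].
- have [_ m] := lc _ aH.
  have mD n : measurable_fun setT (fun w => l (Hn n) t w - l H t w).
    by apply: measurable_funB; [have [_ mm] := lc _ (aHn n); exact: mm|exact: m].
  have [phi _ cD] := cvg_prob_subseq mD (ld _ _ _ aHn aH aB HB HnH t t0).
  apply: (@cmeas_lim _ _ _ _ _ _ (fun n => l (Hn (phi n)) t)) => //; first by move=> n; exact: QHn.
  apply: filterS cD => w c.
  have : l (Hn (phi n)) t w - l H t w + l H t w @[n --> \oo] --> 0 + l H t w by apply: cvgD => //; exact: cvg_cst.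
  by rewrite add0r; under eq_fun do rewrite subrK.
Qed.

Section finite_maximal.
Variables (H : proc) (e T0 : R) (q : nat -> R).
Hypotheses (aH : adm H) (T00 : 0 <= T0) (q0 : forall i, 0 <= q i).

Let E i := [set w | q i <= T0 /\ e < `|l H (q i) w|].

(* [K] stops integrating at the first [q i] where the threshold is exceeded, on a set of [F (q i)]
   that approximates the exceedance event. *)
Lemma finite_maximal N : exists K : proc,
  [/\ adm K, forall t w, `|K t w| <= 1 &
     {ae P, forall w, (exists2 i, (i < N)%N & E i w) -> e < `|l (fun t w => K t w * H t w) T0 w|}].
Proof.
have exB i : exists B, F (q i) B /\ {ae P, forall w, E i w <-> B w}.
  have [qT|nqT] := pselect (q i <= T0); last first.
    exists set0; split; first by have [] := filt_sigma F (q0 i).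
    by apply: aeW => w; split => // -[].
  have := functional_cmeas aH (q0 i) => m.
  have := measurableT_comp (@normr_measurable R setT) m.
  move=> /(_ measurableT _ (measurable_itv `]e, +oo[)); rewrite setTI cfilt_typeE// => -[B FB h].
  exists B; split => //; apply: filterS h => w <-; rewrite /E /= in_itv/= andbT.
  by split => [[]|].
have [B hB] := choice exB.
have FB i : F (q i) (B i) by case: (hB i).
have EB : {ae P, forall w, forall i, E i w <-> B i w} by apply: ae_foralln => i; case: (hB i).
(* The first of the times [q i], [i < N], not beyond [T0], at which [B i] occurs, and [T0] if there
   is none. *)
pose tau := fix tau N w := if N is N'.+1 then (if `[< q N' <= T0 /\ B N' w >] then Num.min (q N') (tau N' w) else tau N' w) else T0.
have tau0 M w : 0 <= tau M w.
  by elim: M => //= M IH; case: ifP => _ //; rewrite le_min q0.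
have tauP M w : (exists i, [/\ q i <= T0, B i w & tau M w = q i]) \/
    (tau M w = T0 /\ forall i, (i < M)%N -> q i <= T0 -> ~ B i w).
  elim: M => [|M IH] /=; first by right.
  case: asboolP => [[qM BM]|nM].
    left; case: IH => [[i [qi Bi ->]]|[-> _]].
      by case: leP => _; [exists M|exists i].
    by exists M; rewrite (min_l qM).
  case: IH => [?|[-> h]]; [by left|right; split => // i].
  rewrite ltnS leq_eqVlt => /predU1P[->|/h//] qM BM; exact: nM.
have ex : exists K : proc, [/\ adm K, forall t w, `|K t w| <= 1 &
    {ae P, forall w, forall t, 0 <= t -> t <= T0 -> l (fun t w => K t w * H t w) t w = l H (Num.min (tau N w) t) w}].
  elim: N => [|M [K [aK K1 lK]]].
    exists (fun _ _ => 1); split; [exact: adm_cst|by move=> *; rewrite normr1|].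
    apply: aeW => w t t0 tT /=; rewrite (min_r tT); congr (l _ t w).
    by apply/funext => ?; apply/funext => ?; rewrite mul1r.
  have [qT|nqT] := pselect (q M <= T0); last first.
    exists K; split => //; apply: filterS lK => w h t t0 tT; rewrite h//=.
    by rewrite ifF//; apply/asboolP => -[].
  (* On the event [B M], the new integrand switches [K] off after time [q M]; elsewhere it is
     unchanged. *)
  exists (fun t w => -1 * (\1_(`]q M, T0] `*` B M) (t, w) * K t w) + K t w); split.
  - by apply: adm_lin => //; apply: adm_rectM.
  - move=> t w; rewrite indicE; case: (_ \in _); rewrite ?mul1r ?mulN1r ?addNr ?normr0//.
    by rewrite mul0r oppr0 add0r.
  have aKH : adm (fun t w => K t w * H t w) by exact: admM.
  have [_ ll lr _] := il.
  apply: filterS3 lK (lr _ _ _ _ (q0 M) qT (FB M) aKH) (ll (-1) _ _ (adm_rectM (q0 M) qT (FB M) aKH) aKH).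
  move=> w lK e1 e2 t t0 tT.
  have -> : (fun t w => (-1 * (\1_(`]q M, T0] `*` B M) (t, w) * K t w) + K t w) * H t w) =
     (fun t w => -1 * (\1_(`]q M, T0] `*` B M) (t, w) * (K t w * H t w)) + K t w * H t w) :> proc.
    by apply/funext => ?; apply/funext => ?; ring.
  rewrite e2// e1// (min_r tT).
  have qt0 : 0 <= Num.min (q M) t by rewrite le_min q0.
  have qtT : Num.min (q M) t <= T0 by rewrite ge_min qT.
  rewrite (lK t)// (lK _ qt0 qtT) /= indicE.
  case: (boolP (w \in B M)) => BM.
    by rewrite ifT; [rewrite mul1r (minC (q M) (tau M w)) minA; ring|apply/asboolP; rewrite inE in BM].
  rewrite ifF; first by rewrite mul0r mulr0 add0r.
  by apply/asboolP => -[_ /mem_set]; rewrite (negbTE BM).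
have [K [aK K1 lK]] := ex; exists K; split => //.
apply: filterS2 EB lK => w EB lK [i iN Ei]; rewrite lK//.
have [qi _] := Ei; move/EB : Ei => Bi.
have [[k [qk Bk tk]]|[_ /(_ _ iN qi)//]] := tauP N w.
by rewrite tk (min_l qk); have /EB[] := Bk.
Qed.

End finite_maximal.

(* Convergence of [l (Dn n)] in probability at each time improves to uniform convergence along a
   subsequence through [finite_maximal], without semimartingale inequalities. *)
Lemma ucp (Dn : nat -> proc) B (e T0 : R) : (forall n, adm (Dn n)) -> adm B ->
  (forall n t w, 0 < t -> `|Dn n t w| <= B t w) ->
  (forall t w, 0 < t -> Dn n t w @[n --> \oo] --> (0 : R)) -> 0 < e -> 0 <= T0 ->
  {ae P, forall w, forall N, exists2 n, (N <= n)%N & forall t, 0 <= t -> t < T0 -> `|l (Dn n) t w| <= e}.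
Proof.
move=> aD aB DB D0 e0 T00; have [lc ll lr ld] := il; have a0 := adm0 P F.
pose q i : R := `|ratr (odflt 0 (unpickle i))|.
have q0 i : 0 <= q i by exact: normr_ge0.
pose E n i := [set w | q i <= T0 /\ e < `|l (Dn n) (q i) w|].
have mE n i : measurable (E n i).
  have [qT|nqT] := pselect (q i <= T0); last first.
    by rewrite (_ : E n i = set0)//; apply/seteqP; split => w // -[].
  have [_ m] := lc _ (aD n).
  have := measurableT_comp (@normr_measurable R setT) (m _ (q0 i)).
  move=> /(_ measurableT _ (measurable_itv `]e, +oo[)); rewrite setTI.
  by congr measurable; apply/seteqP; split => w; rewrite /E /= in_itv/= andbT// => -[].
pose M n N := \bigcup_(i in `I_N) E n i.
have mM n N : measurable (M n N) by apply: bigcup_measurable => // k _.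
pose U n := \bigcup_N M n N.
have mU n : measurable (U n) by apply: bigcup_measurable => // k _.
(* [finite_maximal] handles finitely many times; continuity of [P] from below reduces all rational
   times to finitely many at the cost of [1 / (n + 1)]. *)
have exN n : exists N, (P (U n) <= P (M n N) + (n.+1%:R^-1)%:E)%E.
  have c : P (M n N) @[N --> \oo] --> P (U n).
    apply: nondecreasing_cvg_mu => //; first exact: mU.
    by move=> a b ab; apply/subsetPset => w [i /= ia Ei]; exists i => //=; exact: leq_trans ab.
  have fU := fin_num_measure P _ (mU n).
  move: c; rewrite -(fineK fU) => /fine_cvgP[_ /cvgrPdist_lt].
  have n0 : 0 < (n.+1%:R^-1 : R) by rewrite invr_gt0.
  move=> /(_ _ n0)[N _ /(_ N (leqnn N))] /= h; exists N.
  rewrite -(fineK (fin_num_measure P _ (mM n N))) -EFinD lee_fin.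
  by rewrite -lerBlDl; exact: le_trans (ler_norm _) (ltW h).
have [Nn hN] := choice exN.
have [K hK] := choice (fun n => finite_maximal e (aD n) T00 q0 (Nn n)).
have aKD n : adm (fun t w => K n t w * Dn n t w) by apply: admM => //; case: (hK n).
have KDB n t w : 0 < t -> `|K n t w * Dn n t w| <= B t w.
  move=> t0; apply: le_trans (DB n t w t0); rewrite normrM ler_piMl//; by case: (hK n) => _ /(_ t w).
have KD0 t w : 0 < t -> K n t w * Dn n t w @[n --> \oo] --> (0 : R).
  move=> t0; have := D0 t w t0 => /cvgr0Pnorm_lt c; apply/cvgr0Pnorm_lt => r r0.
  apply: filterS (c r r0) => n; apply: le_lt_trans; rewrite normrM ler_piMl//.
  by case: (hK n) => _ /(_ t w).
have cl := ld _ _ _ aKD a0 aB KDB KD0 T0 T00.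
have mD n : measurable_fun setT (fun w => l (fun t w => K n t w * Dn n t w) T0 w - l (fun _ _ => 0) T0 w).
  by apply: measurable_funB; [have [_ mm] := lc _ (aKD n)|have [_ mm] := lc _ a0]; exact: mm.
have cU : P (U n) @[n --> \oo] --> 0%E.
  have h1 : (n.+1%:R^-1 : R)%:E @[n --> \oo] --> 0%E by apply: cvg_EFin; [exact: filterE|exact: cvg_harmonic].
  have h2 : (P [set w | (e <= `|l (fun t w => K n t w * Dn n t w) T0 w - l (fun _ _ => 0) T0 w|)%R] + (n.+1%:R^-1 : R)%:E)%E @[n --> \oo] --> 0%E.
    by rewrite -[X in _ --> X]adde0; apply: cvgeD => //; exact: cl.
  apply: squeeze_cvge0 h2 => n; rewrite measure_ge0/=.
  apply: le_trans (hN n) _; apply: leeD2r.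
  apply: le_prob_ae => //; first exact: measurable_norm_ge.
  have [_ _ h] := hK n.
  apply: filterS2 h (ifun_eq0 a0 (fun _ _ _ => erefl)) => w h z [i /= iN Ei].
  by rewrite z// subr0 ltW// h//; exists i.
have mI n : measurable_fun setT (\1_(U n) : T -> R) by exact: measurable_indic.
have cI : cvg_prob P (fun n => \1_(U n) : T -> R).
  move=> r r0; apply: squeeze_cvge0 cU => n; rewrite measure_ge0/=.
  apply: le_measure; rewrite ?inE//; first exact: measurable_norm_ge.
  move=> w /=; rewrite indicE; case: (boolP (w \in U n)) => [/set_mem//|_].
  by rewrite normr0 leNgt r0.
have [phi hphi cphi] := cvg_prob_subseq mI cI.
apply: filterS cphi => w /cvgr0Pnorm_lt/(_ 1 ltr01)[N1 _ hN1] N.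
pose n := phi (maxn N N1).
exists n; first by apply: leq_trans (hphi _); exact: leq_maxl.
have nU : ~ U n w.
  by move=> Uw; have := hN1 (maxn N N1) (leq_maxr _ _); rewrite /= indicE mem_set// normr1 ltxx.
(* An excess at [t] would persist, by right continuity, at a rational time in the interval from [t]
   to [T0]; this requires [t < T0]. *)
move=> t t0 tT; rewrite leNgt; apply/negP => he.
have [cn _] := lc _ (aD n); have [/(_ t t0)/cvg_norm c _] := cn w.
have := cvgr_gt _ c _ he => -[r /= r0 hr].
have /rat_in_itvoo[p] : t < Num.min (t + r) T0 by rewrite lt_min tT; lra.
rewrite in_itv/= lt_min => /and3P[p1 p2 p3].
have pq : q (pickle p) = ratr p.
  by rewrite /q pickleK/= ger0_norm// (le_trans t0)// ltW.
apply: nU; exists (pickle p).+1 => //; exists (pickle p) => //=; split.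
  by rewrite pq ltW.
rewrite pq; apply: hr => //=; rewrite distrC ger0_norm; lra.
Qed.

Hypothesis cX : forall w, cadlag (X ^~ w).

Lemma cadlag_jump (x : R -> R) t : cadlag x -> 0 < t -> x @ t^'- --> x t - jump x t.
Proof.
move=> [_ /(_ t)] h t0; have [L cL] := h t0.
by rewrite /jump /left_lim t0 subKr (cvg_lim _ cL).
Qed.

(** The jump of an integral is the integrand times the jump of the integrator. Rectangles are
    explicit. For limits, [ucp] yields on almost every path arbitrarily large [n] with [l (Hn n)]
    uniformly close to [l H] on a bounded interval, so that left limits may be compared. *)
Lemma functional_jump K : adm K -> {ae P, forall w, forall t, 0 < t ->
  l K x w @[x --> t^'-] --> l K t w - K t w * jump (X ^~ w) t}.
Proof.
have [lc ll lr ld] := il.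
have left_eq (f g : proc) w t c : (forall t, 0 <= t -> f t w = g t w) -> 0 < t ->
    g x w @[x --> t^'-] --> g t w - c -> f x w @[x --> t^'-] --> f t w - c.
  move=> fg t0 cg; rewrite fg; last exact: ltW.
  apply: cvg_trans cg; apply: near_eq_cvg; near=> x; apply/esym/fg/ltW; near: x; exact: nbhs_left_gt.
move: K; apply: adm_ind => [A FA|s u A s0 su FA|a H H' aH aH' QH QH'|Hn H B aHn aH aB HB HnH QHn].
- have aK : adm (fun t w => \1_([set 0] `*` A) (t, w)) by apply: adm_indic; exact: measurable_rect0.
  have K0 (r : R) w : 0 < r -> \1_([set 0] `*` A) (r, w) = 0 :> R.
    by move=> t0'; rewrite indicE memNset// => -[/= t00]; rewrite t00 ltxx in t0'.
  apply: filterS (ifun_eq0 aK K0) => w e t t0.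
  apply: (left_eq _ (fun _ _ => 0) _ _ _ e t0); rewrite K0// mul0r subr0; exact: cvg_cst.
- apply: filterS (rect_functional s0 su FA) => w e t t0.
  apply: (left_eq _ (fun t w => \1_A w * (X (Num.min u t) w - X (Num.min s t) w)) _ _ _ e t0).
  have cj := cadlag_jump (cX w) t0.
  have cut a : X (Num.min a x) w @[x --> t^'-] --> X (Num.min a t) w - (t <= a)%R%:R * jump (X ^~ w) t.
    have [ta|at_] := leP t a.
      rewrite mul1r; apply: cvg_trans cj; apply: near_eq_cvg; near=> x.
      by rewrite min_r// (le_trans _ ta)// ltW.
    rewrite mul0r subr0; apply: cvg_near_cst; near=> x; rewrite min_l//.
    by apply: ltW; near: x; exact: nbhs_left_gt.
  suff -> : \1_(`]s, u] `*` A) (t, w) = \1_A w * ((t <= u)%R%:R - (t <= s)%R%:R) :> R.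
    rewrite [X in _ --> X](_ : _ = \1_A w * ((X (Num.min u t) w - (t <= u)%R%:R * jump (X ^~ w) t) - (X (Num.min s t) w - (t <= s)%R%:R * jump (X ^~ w) t))); last ring.
    by apply: cvgM; [exact: cvg_cst|apply: cvgB; exact: cut].
  rewrite !indicE; have [Aw|nA] := boolP (w \in A); last first.
    by rewrite mul0r memNset// => -[_ /mem_set]; rewrite (negbTE nA).
  rewrite mul1r; have [ts|st] := leP t s.
    rewrite (le_trans ts su) subrr memNset// => -[/=]; rewrite in_itv/= => /andP[]; lra.
  rewrite subr0; have [tu|ut] := leP t u.
    by rewrite mem_set//; split => /=; [rewrite in_itv/= st tu|exact: set_mem].
  by rewrite memNset// => -[/=]; rewrite in_itv/= => /andP[]; lra.
- apply: filterS3 (ll a _ _ aH aH') QH QH' => w e h1 h2 t t0.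
  apply: (left_eq _ (fun t w => a * l H t w + l H' t w) _ _ _ e t0).
  rewrite [X in _ --> X](_ : _ = a * (l H t w - H t w * jump (X ^~ w) t) + (l H' t w - H' t w * jump (X ^~ w) t)); last ring.
  by apply: cvgD; [apply: cvgM; [exact: cvg_cst|exact: h1]|exact: h2].
- pose Dn n t w : R := Hn n t w - H t w.
  have aD n : adm (Dn n) by exact: admB.
  have aBH : adm (fun t w => B t w + `|H t w|) by apply: admD => //; exact: adm_norm.
  have DB n t w : 0 < t -> `|Dn n t w| <= B t w + `|H t w|.
    by move=> t0; rewrite (le_trans (ler_normB _ _))// lerD2r HB.
  have D0 t w : 0 < t -> Dn n t w @[n --> \oo] --> (0 : R).
    by move=> t0; rewrite -(subrr (H t w)); apply: cvgB; [exact: HnH|exact: cvg_cst].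
  have ne0 n : 0 < (n.+1%:R^-1 : R) by rewrite invr_gt0.
  (* All precisions [1 / (m + 1)] and all integer horizons [k] at once, so that the exceptional
     event depends neither on [e] nor on [t]. *)
  have U := ae_foralln (fun m => ae_foralln (fun k => ucp aD aBH DB D0 (ne0 m) (ler0n R k))).
  have lD n : indist (l (Dn n)) (fun t w => l (Hn n) t w - l H t w).
    apply: filterS (ll (-1) _ _ aH (aHn n)) => w e t t0.
    have := e t t0.
    have -> : (fun t w => -1 * H t w + Hn n t w) = Dn n by apply/funext => ?; apply/funext => ?; rewrite /Dn; ring.
    by move=> ->; ring.
  apply: filterS3 U (ae_foralln QHn) (ae_foralln lD) => w U Q lDw t t0.
  have [clH _] := lc _ aH; have [_ /(_ t t0)[L cL]] := clH w.
  suff -> : l H t w - H t w * jump (X ^~ w) t = L by [].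
  set J := jump _ _ in Q *.
  apply/eqP; rewrite -subr_eq0 -normr_le0; apply/ler_addgt0Pr => e e0; rewrite add0r.
  have e4 : 0 < e / 4 by lra.
  have [m _ hm] : \forall m \near \oo, (m.+1%:R^-1 : R) < e / 4.
    have /cvgrPdist_lt/(_ _ e4) := @cvg_harmonic R.
    by apply: filterS => m; rewrite /= sub0r normrN ger0_norm// invr_ge0.
  have {}hm := hm m (leqnn m).
  pose k := (Num.truncn t).+1.
  have tk : t < k%:R by exact: truncnS_gt.
  have J1 : 0 < `|J| + 1 by have := normr_ge0 J; lra.
  have eJ : 0 < e / 4 / (`|J| + 1) by rewrite divr_gt0.
  have /cvgr0Pnorm_lt/(_ _ eJ)[N _ hN] := D0 t w t0.
  have [n Nn hn] := U m k N.
  have DJ : `|Dn n t w * J| < e / 4.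
    have := hN n Nn; rewrite /= ltr_pdivlMr// normrM => h; apply: le_lt_trans h.
    by have := normr_ge0 (Dn n t w); nra.
  have cdiff : l (Hn n) x w - l H x w @[x --> t^'-] --> l (Hn n) t w - Hn n t w * J - L.
    by apply: cvgB cL; exact: Q.
  have le1 : `|l (Hn n) t w - Hn n t w * J - L| <= e / 4.
    have cn : `|l (Hn n) x w - l H x w| @[x --> t^'-] --> `|l (Hn n) t w - Hn n t w * J - L| by exact: cvg_norm.
    rewrite -(cvg_lim _ cn)//; apply: limr_le.
      by apply/cvg_ex; eexists; exact: cn.
    near=> x; have x0 : 0 <= x by apply: ltW; near: x; exact: nbhs_left_gt.
    have xt : x < t by near: x; exact: nbhs_left_lt.
    rewrite -lDw// (le_trans (hn x x0 (lt_trans xt tk)))// ltW//.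
  have le2 := hn t (ltW t0) tk; rewrite lDw in le2; last exact: ltW.
  have -> : l H t w - H t w * J - L = (l (Hn n) t w - Hn n t w * J - L) - (l (Hn n) t w - l H t w) + Dn n t w * J.
    by rewrite /Dn; ring.
  rewrite (le_trans (ler_normD _ _))//.
  have h := ler_normB (l (Hn n) t w - Hn n t w * J - L) (l (Hn n) t w - l H t w).
  apply: le_trans (lerD (le_trans h (lerD le1 (le_trans le2 (ltW hm)))) (ltW DJ)) _.
  by lra.
Unshelve. all: by end_near.
Qed.

End maximal.

(** * Equations with explicit coefficients *)

Section brackets.
Variables (R : realType) (d : measure_display) (T : measurableType d).
Variables (P : probability T R) (F : filtration R T).
Notation proc := (R -> T -> R).
Notation adm := (adm P F).
Notation ifun := (ifun P F).
Notation indist := (@indistinguishable R d T P R).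
Notation iop := (integral_operator P F).
Notation minus X := (fun t w => left_lim (X ^~ w) t).

Lemma ifunl l a H H' : ifun l -> adm H -> adm H' ->
  indist (l (fun t w => a * H t w + H' t w)) (fun t w => a * l H t w + l H' t w).
Proof. by move=> [_ h _ _]; exact: h. Qed.

Lemma ifunl0 l : ifun l -> indist (l (fun _ _ => 0)) (fun _ _ => 0).
Proof.
move=> il; have a0 := adm0 P F; apply: filterS (ifunl 1 il a0 a0) => w h t t0.
have := h t t0; have -> : (fun _ _ => 1 * 0 + 0) = (fun _ _ => 0) :> proc.
  by apply/funext => ?; apply/funext => ?; rewrite mulr0 addr0.
by rewrite mul1r; lra.
Qed.

(** The restrictions of [K] to []0, n]] have integrals that start at 0, and they converge to [K] at
    positive times. *)
Lemma ifun_at0 l K : ifun l -> adm K -> {ae P, forall w, l K 0 w = 0}.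
Proof.
move=> il aK; have [lc ll lr ld] := il.
pose S n : proc := fun t w => \1_(`]0, n%:R] `*` setT) (t, w) * K t w.
have aS n : adm (S n) by apply: adm_rectM => //; exact: filtT.
have lS n : {ae P, forall w, l (S n) 0 w = 0}.
  have n0 : (0 : R) <= n%:R by [].
  apply: filterS (lr _ _ _ _ (lexx 0) n0 (filtT F (lexx 0)) aK) => w h; rewrite h//.
  by rewrite min_r// min_l// subrr mulr0.
have dS : cvg_prob P (fun n w => l (S n) 0 w - l K 0 w).
  apply: (ld _ _ _ aS aK (adm_norm aK)) => // [n t w t0|t w t0].
    by rewrite normrM ler_piMl// indicE; case: (_ \in _); rewrite ?normr0 ?normr1.
  apply: cvg_near_cst; near=> n; rewrite /S indicE mem_set ?mul1r//; split => //=; rewrite in_itv/= t0/=.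
  near: n; exact: nbhs_infty_ger.
have := cvg_prob_const (L := fun w => - l K 0 w) _ dS => /(_ _ _)/wrap[n|n|].
- by apply: measurable_funB; [have [_ mm] := lc _ (aS n); exact: mm|have [_ mm] := lc _ aK; exact: mm].
- by apply: filterS (lS n) => w h; rewrite h sub0r.
- by apply: filterS => w /eqP; rewrite oppr_eq0 => /eqP.
Unshelve. all: by end_near.
Qed.

Lemma jump0 (x : R -> R) : jump x 0 = 0.
Proof. by rewrite /jump /left_lim ltxx subrr. Qed.

Lemma operator_uniq X J J' K : iop X J -> iop X J' -> adm K -> indist (J K) (J' K).
Proof. by move=> o o' aK; apply: (operator_unique o o') => //; exact: aeW. Qed.

(** [is_cont_bracket] comes with operators of its own; uniqueness replaces them by the fixed [JX]
    and [JY], so that different brackets can be compared. *)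
Lemma cont_bracket_normal X Y C JX JY : is_cont_bracket P F X Y C -> iop X JX -> iop Y JY ->
  [/\ adm (minus X), adm (minus Y) & {ae P, forall w, forall t, 0 <= t ->
    summable `[0, t] (EFin \o (fun s => jump (X ^~ w) s * jump (Y ^~ w) s)) /\
    C t w = X t w * Y t w - X 0 w * Y 0 w - JY (minus X) t w - JX (minus Y) t w
       - sum_over `[0, t] (fun s => jump (X ^~ w) s * jump (Y ^~ w) s)}].
Proof.
move=> [I1 [I2 [[p1 b1 [J1 o1 e1]] [p2 b2 [J2 o2 e2]] h]]] oX oY.
have a1 : adm (minus X) by []. have a2 : adm (minus Y) by [].
split => //.
have u1 := operator_uniq o1 oY a1; have u2 := operator_uniq o2 oX a2.
apply: filterS3 h (filterI e1 u1) (filterI e2 u2) => w h [{}e1 {}u1] [{}e2 {}u2] t t0.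
by have [s ->] := h t t0; split => //; rewrite e1// u1// e2// u2.
Qed.

Lemma cont_bracket0 X Y C JX JY : is_cont_bracket P F X Y C -> iop X JX -> iop Y JY ->
  {ae P, forall w, C 0 w = 0}.
Proof.
move=> b oX oY; have [aX aY h] := cont_bracket_normal b oX oY.
have iX := operator_ifun oX; have iY := operator_ifun oY.
apply: filterS3 h (ifun_at0 iY aX) (ifun_at0 iX aY) => w h e1 e2.
have [_ ->] := h 0 (lexx 0); rewrite e1 e2 (eq_sum_over (g := fun=> 0)); first by rewrite sum_over0; ring.
move=> s /=; rewrite in_itv/= => /andP[s0 s1]; have -> : s = 0 by apply/eqP; rewrite eq_le s0 s1.
by rewrite jump0 mul0r.
Qed.

Lemma cont_bracket_unique X Y C C' JX JY : is_cont_bracket P F X Y C -> is_cont_bracket P F X Y C' ->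
  iop X JX -> iop Y JY -> indist C C'.
Proof.
move=> b b' oX oY; have [_ _ h] := cont_bracket_normal b oX oY; have [_ _ h'] := cont_bracket_normal b' oX oY.
by apply: filterS2 h h' => w h h' t t0; have [_ ->] := h t t0; have [_ ->] := h' t t0.
Qed.

Lemma cont_bracket_sym X Y C C' JX JY : is_cont_bracket P F X Y C -> is_cont_bracket P F Y X C' ->
  iop X JX -> iop Y JY -> indist C C'.
Proof.
move=> b b' oX oY; have [_ _ h] := cont_bracket_normal b oX oY; have [_ _ h'] := cont_bracket_normal b' oY oX.
apply: filterS2 h h' => w h h' t t0; have [_ ->] := h t t0; have [_ ->] := h' t t0.
rewrite (eq_sum_over (g := fun s => jump (Y ^~ w) s * jump (X ^~ w) s)); first ring.
by move=> s _; rewrite mulrC.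
Qed.

Lemma cadlagM (x y : R -> R) : cadlag x -> cadlag y -> cadlag (fun t => x t * y t).
Proof.
move=> [x1 x2] [y1 y2]; split=> t t0; first by apply: cvgM; [exact: x1|exact: y1].
by have [l hl] := x2 t t0; have [l' hl'] := y2 t t0; exists (l * l'); exact: cvgM.
Qed.

Lemma jumpM (x y : R -> R) t : cadlag x -> cadlag y -> 0 < t ->
  jump (fun t => x t * y t) t = left_lim x t * jump y t + left_lim y t * jump x t + jump x t * jump y t.
Proof.
move=> cx cy t0; have lx := cadlag_jump cx t0; have ly := cadlag_jump cy t0.
have -> : left_lim x t = x t - jump x t by rewrite /jump subKr.
have -> : left_lim y t = y t - jump y t by rewrite /jump subKr.
rewrite [LHS]/jump [left_lim _ _]/left_lim t0 (cvg_lim _ (cvgM lx ly))//; ring.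
Qed.

Lemma jump_unique (x : R -> R) t v : cadlag x -> 0 < t -> x @ t^'- --> x t - v -> jump x t = v.
Proof. by move=> cx t0 h; rewrite /jump /left_lim t0 (cvg_lim _ h)// subKr. Qed.

Section bracket_jump.
Variables (X Y C : proc) (JX JY JXY JC : proc -> proc).
Hypotheses (oX : iop X JX) (oY : iop Y JY) (oXY : iop (fun t w => X t w * Y t w) JXY) (oC : iop C JC).
Hypothesis bC : is_cont_bracket P F X Y C.
Hypotheses (aX : adapted F X) (aY : adapted F Y) (aXY : adapted F (fun t w => X t w * Y t w)).
Hypotheses (cX : forall w, cadlag (X ^~ w)) (cY : forall w, cadlag (Y ^~ w)).

(* [int K d[X, Y]^c] is a combination of integrals with respect to [X Y], [X], [Y] and a sum of
   jumps; the jumps cancel. *)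
Lemma bracket_functional_jump K : adm K ->
  {ae P, forall w, forall t, 0 < t -> JC K x w @[x --> t^'-] --> JC K t w}.
Proof.
move=> aK; have [amX amY hC] := cont_bracket_normal bC oX oY.
have iX := operator_ifun oX; have iY := operator_ifun oY; have iXY := operator_ifun oXY; have iC := operator_ifun oC.
pose l K t w := JXY K t w - JY (fun t w => K t w * left_lim (X ^~ w) t) t w
   - JX (fun t w => K t w * left_lim (Y ^~ w) t) t w - JC K t w.
have il : ifun l.
  by apply: ifunB => //; apply: ifunB; [apply: ifunB => //; exact: ifun_comp iY amX|exact: ifun_comp iX amY].
have := @jump_functional _ _ _ _ _ l (fun s w => jump (X ^~ w) s * jump (Y ^~ w) s) il _ _ K aK => /(_ _ _)/wrap[||nl].
- by apply: aeW => w; rewrite jump0 mul0r.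
- apply: filterS3 hC (operator_at1 oXY) (filterI (operator_at1 oC) (cont_bracket0 bC oX oY)) => w h e1 [e2 e20] t t0.
  have [s hCt] := h t t0; split => //.
  rewrite /l e1// e2// e20 hCt.
  have -> : (fun t w => 1 * left_lim (X ^~ w) t) = minus X :> proc by apply/funext => ?; apply/funext => ?; rewrite mul1r.
  have -> : (fun t w => 1 * left_lim (Y ^~ w) t) = minus Y :> proc by apply/funext => ?; apply/funext => ?; rewrite mul1r.
  by ring.
have jXY := functional_jump iXY aXY (operator_at1 oXY) (fun w => cadlagM (cX w) (cY w)) aK.
have jY := functional_jump iY aY (operator_at1 oY) cY (admM aK amX).
have jX := functional_jump iX aX (operator_at1 oX) cX (admM aK amY).
apply: filterS3 nl jXY (filterI jX jY) => w nl jXY [{}jX {}jY] t t0.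
pose V x := JXY K x w - JY (fun t w => K t w * left_lim (X ^~ w) t) x w
   - JX (fun t w => K t w * left_lim (Y ^~ w) t) x w - sum_over `[0, x] (fun s => K s w * (jump (X ^~ w) s * jump (Y ^~ w) s)).
have VC x : 0 <= x -> JC K x w = V x by move=> x0; have [_] := nl x x0; rewrite /V /l; lra.
rewrite VC; last exact: ltW.
have cs := @cumulative_left R (fun s => K s w * (jump (X ^~ w) s * jump (Y ^~ w) s)) (fun t t0 => (nl t t0).1) t t0.
have -> : V t = (JXY K t w - K t w * jump (fun t => X t w * Y t w) t)
    - (JY (fun t w => K t w * left_lim (X ^~ w) t) t w - K t w * left_lim (X ^~ w) t * jump (Y ^~ w) t)
    - (JX (fun t w => K t w * left_lim (Y ^~ w) t) t w - K t w * left_lim (Y ^~ w) t * jump (X ^~ w) t)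
    - (sum_over `[0, t] (fun s => K s w * (jump (X ^~ w) s * jump (Y ^~ w) s)) - K t w * (jump (X ^~ w) t * jump (Y ^~ w) t)).
  by rewrite (jumpM (cX w) (cY w) t0) /V; ring.
have cV : V x @[x --> t^'-] --> (JXY K t w - K t w * jump (fun t => X t w * Y t w) t)
    - (JY (fun t w => K t w * left_lim (X ^~ w) t) t w - K t w * left_lim (X ^~ w) t * jump (Y ^~ w) t)
    - (JX (fun t w => K t w * left_lim (Y ^~ w) t) t w - K t w * left_lim (Y ^~ w) t * jump (X ^~ w) t)
    - (sum_over `[0, t] (fun s => K s w * (jump (X ^~ w) s * jump (Y ^~ w) s)) - K t w * (jump (X ^~ w) t * jump (Y ^~ w) t)).
  by apply: cvgB => //; apply: cvgB; [apply: cvgB; [exact: jXY|exact: jY]|exact: jX].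
apply: cvg_trans cV; apply: near_eq_cvg; near=> x; apply/esym/VC/ltW; near: x; exact: nbhs_left_gt.
Unshelve. all: by end_near.
Qed.
End bracket_jump.

End brackets.

Section driver.
Variables (R : realType) (d : measure_display) (T : measurableType d).
Variables (P : probability T R) (F : filtration R T).
Notation proc := (R -> T -> R).
Notation adm := (adm P F).
Notation ifun := (ifun P F).
Notation indist := (@indistinguishable R d T P R).
Notation iop := (integral_operator P F).
Notation minus X := (fun t w => left_lim (X ^~ w) t).

(** One choice of operators for the coordinates and their continuous brackets. Equations obtained
    from different tests are brought to these common operators before being combined. *)
Definition driver (n : nat) (z : 'I_n -> proc) (Jz : 'I_n -> proc -> proc)
    (C : 'I_n -> 'I_n -> proc) (JC : 'I_n -> 'I_n -> proc -> proc) :=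
  [/\ forall a, iop (z a) (Jz a), forall a b, is_cont_bracket P F (z a) (z b) (C a b) &
      forall a b, iop (C a b) (JC a b)].

Definition Lfun n (Jz : 'I_n -> proc -> proc) (JC : 'I_n -> 'I_n -> proc -> proc)
   (A : 'I_n -> proc) (B : 'I_n -> 'I_n -> proc) (K : proc) : proc :=
  fun t w => \sum_a Jz a (fun t w => K t w * A a t w) t w
     + 2^-1 * (\sum_a \sum_b JC a b (fun t w => K t w * B a b t w) t w).

(* [dY = A dz + 1/2 B d[z, z]^c + j], with explicit coefficients. *)
Definition gsolves n Jz JC (A : 'I_n -> proc) (B : 'I_n -> 'I_n -> proc) (j Y : proc) :=
  [/\ forall a, adm (A a), forall a b, adm (B a b), {ae P, forall w, j 0 w = 0} &
    {ae P, forall w, forall t, 0 <= t -> summable `[0, t] (EFin \o (j ^~ w)) /\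
      Y t w - Y 0 w = Lfun Jz JC A B (fun _ _ => 1) t w + sum_over `[0, t] (j ^~ w)}].

(* [A dz + 1/2 B d[z, z]^c + j = 0] as a measure, tested against every admissible [K]. *)
Definition lnull n Jz JC (A : 'I_n -> proc) (B : 'I_n -> 'I_n -> proc) (j : proc) :=
  [/\ forall a, adm (A a), forall a b, adm (B a b), {ae P, forall w, j 0 w = 0} &
    forall K, adm K -> {ae P, forall w, forall t, 0 <= t -> summable `[0, t] (EFin \o (fun s => K s w * j s w)) /\
      Lfun Jz JC A B K t w + sum_over `[0, t] (fun s => K s w * j s w) = 0}].

Section fixed_driver.
Variables (n : nat) (z : 'I_n -> proc) (Jz : 'I_n -> proc -> proc).
Variables (C : 'I_n -> 'I_n -> proc) (JC : 'I_n -> 'I_n -> proc -> proc).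
Hypothesis dr : driver z Jz C JC.
Implicit Types (A : 'I_n -> proc) (B : 'I_n -> 'I_n -> proc) (j Y K : proc).
Notation L := (Lfun Jz JC).

Lemma ifun_Jz a : ifun (Jz a). Proof. by case: dr => h _ _; exact: operator_ifun (h a). Qed.
Lemma ifun_JC a b : ifun (JC a b). Proof. by case: dr => _ _ h; exact: operator_ifun (h a b). Qed.

Lemma Lfun_ifun A B : (forall a, adm (A a)) -> (forall a b, adm (B a b)) -> ifun (L A B).
Proof.
move=> aA aB; apply: ifunD.
  by apply: ifun_sum => a; apply: ifun_comp; [exact: ifun_Jz|exact: aA].
apply: ifunZ; apply: ifun_sum => a; apply: ifun_sum => b.
by apply: ifun_comp; [exact: ifun_JC|exact: aB].
Qed.

Lemma Lfun_eq A B A' B' K K' : (forall a t w, K t w * A a t w = K' t w * A' a t w) ->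
  (forall a b t w, K t w * B a b t w = K' t w * B' a b t w) -> L A B K = L A' B' K'.
Proof.
move=> hA hB; apply/funext => t; apply/funext => w; rewrite /Lfun.
congr (_ + _ * _); apply: eq_bigr => a _.
  by congr Jz; apply/funext => ?; apply/funext => ?.
by apply: eq_bigr => b _; congr JC; apply/funext => ?; apply/funext => ?.
Qed.

Lemma ae_ord (I : finType) (Q : I -> T -> Prop) : (forall i, {ae P, forall w, Q i w}) ->
  {ae P, forall w, forall i, Q i w}.
Proof.
move=> h; have : {ae P, forall w, forall m : nat, forall i, enum_rank i = m :> nat -> Q i w}.
  apply: ae_foralln => m; have [mI|Im] := ltnP m #|I|.
    apply: filterS (h (enum_val (Ordinal mI))) => w hw i im.
    by have -> : i = enum_val (Ordinal mI) by rewrite -(enum_rankK i); congr enum_val; apply: val_inj.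
  by apply: aeW => w i im; have := ltn_ord (enum_rank i); rewrite im ltnNge Im.
by apply: filterS => w hw i; exact: hw.
Qed.

Lemma Lfun_lin A B A' B' H K : (forall a, adm (A a)) -> (forall a b, adm (B a b)) ->
  (forall a, adm (A' a)) -> (forall a b, adm (B' a b)) -> adm H -> adm K ->
  indist (L (fun a t w => H t w * A a t w + A' a t w) (fun a b t w => H t w * B a b t w + B' a b t w) K)
    (fun t w => L A B (fun t w => K t w * H t w) t w + L A' B' K t w).
Proof.
move=> aA aB aA' aB' aH aK; have aKH : adm (fun t w => K t w * H t w) by exact: admM.
have e1 := ae_ord (fun a => ifunl 1 (ifun_Jz a) (admM aKH (aA a)) (admM aK (aA' a))).
have e2 := ae_ord (fun p : 'I_n * 'I_n => ifunl 1 (ifun_JC p.1 p.2) (admM aKH (aB p.1 p.2)) (admM aK (aB' p.1 p.2))).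
apply: filterS2 e1 e2 => w e1 e2 t t0; rewrite /Lfun.
rewrite addrACA -mulrDr -!big_split/=; congr (_ + _ * _).
  apply: eq_bigr => a _; have := e1 a t t0; rewrite mul1r => <-.
  by congr Jz; apply/funext => ?; apply/funext => ?; ring.
apply: eq_bigr => a _; rewrite -big_split/=; apply: eq_bigr => b _.
have := e2 (a, b) t t0; rewrite mul1r => <-.
by congr JC; apply/funext => ?; apply/funext => ?; ring.
Qed.

Lemma Lfun0 K : indist (L (fun _ _ _ => 0) (fun _ _ _ _ => 0) K) (fun _ _ => 0).
Proof.
have e1 := ae_ord (fun a => ifunl0 (ifun_Jz a)).
have e2 := ae_ord (fun p : 'I_n * 'I_n => ifunl0 (ifun_JC p.1 p.2)).
apply: filterS2 e1 e2 => w e1 e2 t t0; rewrite /Lfun.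
rewrite !big1 ?mulr0 ?addr0// => a _; last first.
  have -> : (fun t w => K t w * 0) = (fun _ _ => 0) :> proc by apply/funext => ?; apply/funext => ?; rewrite mulr0.
  exact: e1.
rewrite big1// => b _.
have -> : (fun t w => K t w * 0) = (fun _ _ => 0) :> proc by apply/funext => ?; apply/funext => ?; rewrite mulr0.
exact: (e2 (a, b)).
Qed.

Lemma operator_gsolves A B j Y JY K : gsolves Jz JC A B j Y -> iop Y JY -> adm K ->
  {ae P, forall w, forall t, 0 <= t -> summable `[0, t] (EFin \o (fun s => K s w * j s w)) /\
    JY K t w = L A B K t w + sum_over `[0, t] (fun s => K s w * j s w)}.
Proof.
move=> [aA aB j0 h] oY aK.
have il : ifun (fun K t w => JY K t w - L A B K t w).
  by apply: ifunB; [exact: operator_ifun oY|exact: Lfun_ifun].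
have := @jump_functional _ _ _ _ _ _ j il j0 _ K aK => /(_ _)/wrap[|].
  apply: filterS2 h (operator_at1 oY) => w h e t t0; have [s ht] := h t t0; split => //.
  by rewrite e// ht; ring.
apply: filterS => w h' t t0; have [s <-] := h' t t0; split => //; ring.
Qed.

(** An equation for a constant process is an identity at [K = 1] between integrals and sums of
    jumps; [jump_functional] multiplies it by any admissible [K]. *)
Lemma gsolves_lnull A B j : gsolves Jz JC A B j (fun _ _ => 0) -> lnull Jz JC A B j.
Proof.
move=> [aA aB j0 h]; split => // K aK.
have il : ifun (fun K t w => -1 * L A B K t w) by apply: ifunZ; exact: Lfun_ifun.
have := @jump_functional _ _ _ _ _ _ j il j0 _ K aK => /(_ _)/wrap[|].
  apply: filterS h => w h t t0; have [s] := h t t0; split => //; lra.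
apply: filterS => w h' t t0; have [s <-] := h' t t0; split => //; ring.
Qed.

Lemma lnull_lin A B j A' B' j' H : lnull Jz JC A B j -> lnull Jz JC A' B' j' -> adm H ->
  lnull Jz JC (fun a t w => H t w * A a t w + A' a t w) (fun a b t w => H t w * B a b t w + B' a b t w)
    (fun t w => H t w * j t w + j' t w).
Proof.
move=> [aA aB j0 h] [aA' aB' j0' h'] aH; split.
- by move=> a; apply: admD => //; exact: admM.
- by move=> a b; apply: admD => //; exact: admM.
- by apply: filterS2 j0 j0' => w -> ->; rewrite mulr0 addr0.
move=> K aK; have aKH : adm (fun t w => K t w * H t w) by exact: admM.
apply: filterS3 (h _ aKH) (h' _ aK) (Lfun_lin aA aB aA' aB' aH aK) => w e1 e2 e3 t t0.
have [s1 q1] := e1 t t0; have [s2 q2] := e2 t t0.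
have E : (fun s => K s w * (H s w * j s w + j' s w)) = (fun s => K s w * H s w * j s w + K s w * j' s w).
  by apply/funext => s; ring.
rewrite E; split; first exact: (summableD s1 s2).
by rewrite e3// sum_overD//; move: q1 q2; lra.
Qed.

Lemma lnull0 : lnull Jz JC (fun _ _ _ => 0) (fun _ _ _ _ => 0) (fun _ _ => 0).
Proof.
split; [by move=> _; exact: adm0|by move=> _ _; exact: adm0|exact: aeW|move=> K aK].
apply: filterS (Lfun0 K) => w e t t0; rewrite e//.
have -> : (fun s => K s w * 0) = (fun=> 0) by apply/funext => s; rewrite mulr0.
by rewrite sum_over0 addr0; split => //; exact: summable0.
Qed.

Lemma lnull_eq A B j A' B' j' : lnull Jz JC A B j -> (forall a t w, A a t w = A' a t w) ->
  (forall a b t w, B a b t w = B' a b t w) -> (forall t w, j t w = j' t w) -> lnull Jz JC A' B' j'.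
Proof.
move=> h hA hB hj.
have <- : A = A' by apply/funext => a; apply/funext => t; apply/funext => w; exact: hA.
have <- : B = B' by apply/funext => a; apply/funext => b; apply/funext => t; apply/funext => w; exact: hB.
by have <- : j = j' by apply/funext => t; apply/funext => w; exact: hj.
Qed.

Lemma lnull_scale A B j H : lnull Jz JC A B j -> adm H ->
  lnull Jz JC (fun a t w => H t w * A a t w) (fun a b t w => H t w * B a b t w) (fun t w => H t w * j t w).
Proof. by move=> h aH; apply: lnull_eq (lnull_lin h lnull0 aH) _ _ _ => *; rewrite addr0. Qed.

Lemma lnull_add A B j A' B' j' : lnull Jz JC A B j -> lnull Jz JC A' B' j' ->
  lnull Jz JC (fun a t w => A a t w + A' a t w) (fun a b t w => B a b t w + B' a b t w)
    (fun t w => j t w + j' t w).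
Proof. by move=> h h'; apply: lnull_eq (lnull_lin h h' (adm1 P F)) _ _ _ => *; rewrite mul1r. Qed.

Lemma lnull_sum (I : Type) (r : seq I) (A : I -> 'I_n -> proc) (B : I -> 'I_n -> 'I_n -> proc) (j : I -> proc) :
  (forall i, lnull Jz JC (A i) (B i) (j i)) ->
  lnull Jz JC (fun a t w => \sum_(i <- r) A i a t w) (fun a b t w => \sum_(i <- r) B i a b t w)
    (fun t w => \sum_(i <- r) j i t w).
Proof.
move=> h; elim: r => [|i r IH]; first by apply: lnull_eq lnull0 _ _ _ => *; rewrite big_nil.
by apply: lnull_eq (lnull_add (h i) IH) _ _ _ => *; rewrite big_cons.
Qed.

Lemma gsolves_lnull_add A B j Y A' B' j' : gsolves Jz JC A B j Y -> lnull Jz JC A' B' j' ->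
  gsolves Jz JC (fun a t w => A a t w + A' a t w) (fun a b t w => B a b t w + B' a b t w)
    (fun t w => j t w + j' t w) Y.
Proof.
move=> [aA aB j0 h] [aA' aB' j0' h']; split.
- by move=> a; apply: admD.
- by move=> a b; apply: admD.
- by apply: filterS2 j0 j0' => w -> ->; rewrite addr0.
have e := Lfun_lin aA aB aA' aB' (adm1 P F) (adm1 P F).
apply: filterS3 h (h' _ (adm1 P F)) e => w h e2 e t t0.
have [s1 q1] := h t t0; have [s2 q2] := e2 t t0.
have E : (fun s => 1 * j' s w) = j' ^~ w by apply/funext => s; rewrite mul1r.
rewrite E in s2 q2; split; first exact: (summableD s1 s2).
rewrite q1 sum_overD//; have := e t t0.
rewrite (@Lfun_eq _ _ (fun a t w => A a t w + A' a t w) (fun a b t w => B a b t w + B' a b t w) _ (fun _ _ => 1)); [|by move=> *; rewrite !mul1r..].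
rewrite (@Lfun_eq A B A B _ (fun _ _ => 1)); [|by move=> *; rewrite !mul1r..].
by move=> ->; move: q2; lra.
Qed.

End fixed_driver.
End driver.

Section driver_theory.
Variables (R : realType) (d : measure_display) (T : measurableType d).
Variables (P : probability T R) (F : filtration R T).
Notation proc := (R -> T -> R).
Notation adm := (adm P F).
Notation ifun := (ifun P F).
Notation indist := (@indistinguishable R d T P R).
Notation iop := (integral_operator P F).
Notation minus X := (fun t w => left_lim (X ^~ w) t).
Variables (n : nat) (z : 'I_n -> proc) (Jz : 'I_n -> proc -> proc).
Variables (C : 'I_n -> 'I_n -> proc) (JC : 'I_n -> 'I_n -> proc -> proc).
Hypothesis dr : driver P F z Jz C JC.
Implicit Types (A : 'I_n -> proc) (B : 'I_n -> 'I_n -> proc) (j Y K : proc).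
Notation L := (Lfun Jz JC).
Notation solves := (gsolves P F Jz JC).
Notation lnull := (lnull P F Jz JC).

Lemma Lfun_sum (I : Type) (r : seq I) (A : I -> 'I_n -> proc) (B : I -> 'I_n -> 'I_n -> proc) (H : I -> proc) K :
  (forall i a, adm (A i a)) -> (forall i a b, adm (B i a b)) -> (forall i, adm (H i)) -> adm K ->
  indist (L (fun a t w => \sum_(i <- r) H i t w * A i a t w) (fun a b t w => \sum_(i <- r) H i t w * B i a b t w) K)
    (fun t w => \sum_(i <- r) L (A i) (B i) (fun t w => K t w * H i t w) t w).
Proof.
move=> aA aB aH aK; elim: r => [|i r IH].
  apply: filterS (Lfun0 dr K) => w e t t0; rewrite big_nil -[RHS](e t t0).
  by congr (_ t w); apply: Lfun_eq => *; rewrite big_nil.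
have aAs a : adm (fun t w => \sum_(i <- r) H i t w * A i a t w) by apply: adm_sum => k; exact: admM.
have aBs a b : adm (fun t w => \sum_(i <- r) H i t w * B i a b t w) by apply: adm_sum => k; exact: admM.
apply: filterS2 IH (Lfun_lin dr (aA i) (aB i) aAs aBs (aH i) aK) => w IH e t t0.
rewrite big_cons -IH// -e//.
by congr (_ t w); apply: Lfun_eq => *; rewrite big_cons.
Qed.

Lemma Lfun_sym B K : (forall a b, adm (B a b)) -> adm K ->
  indist (L (fun _ _ _ => 0) (fun a b => B b a) K) (L (fun _ _ _ => 0) B K).
Proof.
move=> aB aK; have [oz bC oC] := dr.
have e (p : 'I_n * 'I_n) : indist (JC p.1 p.2 (fun t w => K t w * B p.2 p.1 t w)) (JC p.2 p.1 (fun t w => K t w * B p.2 p.1 t w)).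
  case: p => a b /=; apply: (operator_unique (oC a b) (oC b a)); last exact: admM.
  by apply: filterS (cont_bracket_sym (bC a b) (bC b a) (oz a) (oz b)) => w e t t0; rewrite !e.
apply: filterS (ae_ord e) => w {}e t t0; rewrite /Lfun; congr (_ + _ * _).
rewrite exchange_big/=; apply: eq_bigr => a _; apply: eq_bigr => b _.
exact: (e (b, a)).
Qed.

Lemma adm_zm a : adm (minus (z a)).
Proof. by have [oz bC oC] := dr; have [] := cont_bracket_normal (bC a a) (oz a) (oz a). Qed.

(** The continuous bracket is symmetric, so it sees only the symmetric part of [B]; the integral of
    [B] plus its transpose is twice that of [B]. *)
Lemma lnull_half B : (forall a b, adm (B a b)) ->
  lnull (fun _ _ _ => 0) (fun a b t w => B a b t w + B b a t w) (fun _ _ => 0) ->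
  lnull (fun _ _ _ => 0) B (fun _ _ => 0).
Proof.
move=> aB [_ _ _ h]; split; [by move=> _; exact: adm0|by []|exact: aeW|move=> K aK].
have a0 (a : 'I_n) : adm (fun _ _ => 0) by exact: adm0.
have e := Lfun_lin dr a0 aB a0 (fun a b => aB b a) (adm1 P F) aK.
apply: filterS3 (h K aK) (Lfun_sym aB aK) e => w {}h es e t t0.
have E : (fun s => K s w * 0) = (fun=> 0) by apply/funext => s; rewrite mulr0.
have [s1] := h t t0; rewrite E sum_over0 addr0 => h0; rewrite E in s1; split => //; rewrite addr0.
have := e t t0; rewrite es//.
rewrite (@Lfun_eq _ _ _ _ _ _ _ _ (fun _ _ _ => 0) (fun a b t w => B a b t w + B b a t w) _ K); last 2 first.
- by move=> *; ring.
- by move=> *; rewrite mul1r.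
rewrite (@Lfun_eq _ _ _ _ _ _ _ B (fun _ _ _ => 0) B _ K); [|by move=> *; rewrite !mulr0|by move=> *; rewrite mulr1].
by rewrite h0; lra.
Qed.

(** The coefficients of the second equation are those given by the product rule for a vanishing
    slice times the coordinate [b0]. Subtracting [left_lim (z b0)] times the first equation leaves
    the cross terms, symmetric in the two indices, which [lnull_half] separates. *)
Lemma tangent A B j (b0 : 'I_n) :
  solves A B j (fun _ _ => 0) ->
  solves (fun a t w => left_lim (z b0 ^~ w) t * A a t w)
    (fun a b t w => left_lim (z b0 ^~ w) t * B a b t w + (A a t w * (b == b0)%:R + A b t w * (a == b0)%:R))
    (fun t w => left_lim (z b0 ^~ w) t * j t w) (fun _ _ => 0) ->
  lnull (fun _ _ _ => 0) (fun a b t w => A a t w * (b == b0)%:R) (fun _ _ => 0).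
Proof.
move=> g1 g2; have [aA _ _ _] := g1.
apply: lnull_half => [a b|]; first by apply: admM => //; exact: adm_cst.
have n1 := gsolves_lnull dr g1; have n2 := gsolves_lnull dr g2.
have am := admN (adm_zm b0).
apply: lnull_eq (lnull_lin dr n1 n2 am) _ _ _ => *; ring.
Qed.

Section glue.
Variables (A : 'I_n -> proc) (B : 'I_n -> 'I_n -> proc) (j : proc) (S : nat -> set (R * T)).
Hypotheses (aA : forall a, adm (A a)) (aB : forall a b, adm (B a b)) (j0 : {ae P, forall w, j 0 w = 0}).
Hypothesis mS : forall c, measurable (S c : set (pred_type F)).
Hypothesis nS : forall c, lnull (fun a t w => \1_(S c) (t, w) * A a t w)
   (fun a b t w => \1_(S c) (t, w) * B a b t w) (fun t w => \1_(S c) (t, w) * j t w).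
Hypothesis coverS : forall w t, exists N, forall s, 0 < s -> s <= t -> exists2 c, (c < N)%N & S c (s, w).

Let U m := \bigcup_(c < m) S c.

Let mU m : measurable (U m : set (pred_type F)).
Proof. by apply: bigcup_measurable => c _; exact: mS. Qed.

(** Only the part of [S m] outside the previous sets is added, which spares a disjoint cover. *)
Let indU m p : \1_(U m.+1) p = (1 - \1_(U m) p) * \1_(S m) p + \1_(U m) p :> R.
Proof.
rewrite !indicE; have [Up|nU] := boolP (p \in U m).
  rewrite subrr mul0r add0r mem_set//; have [c /= cm Sc] := set_mem Up.
  by exists c => //=; exact: ltnW.
rewrite subr0 mul1r addr0; congr (_%:R); congr nat_of_bool; apply/idP/idP.
  move=> /set_mem[c /= cm Sc]; apply: mem_set; move: cm; rewrite ltnS leq_eqVlt => /predU1P[<-//|cm].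
  by exfalso; move/negP : nU; apply; apply: mem_set; exists c.
by move=> /set_mem Sp; apply: mem_set; exists m => /=.
Qed.

Let nU m : lnull (fun a t w => \1_(U m) (t, w) * A a t w)
   (fun a b t w => \1_(U m) (t, w) * B a b t w) (fun t w => \1_(U m) (t, w) * j t w).
Proof.
elim: m => [|m IH].
  have U0 p : \1_(U 0) p = 0 :> R by rewrite indicE memNset// => -[c].
  by apply: lnull_eq (lnull0 dr) _ _ _ => *; rewrite U0 mul0r.
have aH : adm (fun t w => 1 - \1_(U m) (t, w)) by apply: admB; [exact: adm1|exact: adm_indic].
by apply: lnull_eq (lnull_lin dr (nS m) IH aH) _ _ _ => *; rewrite indU; ring.
Qed.

Lemma lnull_glue : lnull A B j.
Proof.
split => // K aK.
have Ucover w t : exists N, forall m s, (N <= m)%N -> 0 < s -> s <= t -> U m (s, w).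
  have [N hN] := coverS w t; exists N => m s Nm s0 st; have [c cN Sc] := hN s s0 st.
  by exists c => //=; exact: leq_trans Nm.
have hU := ae_foralln (fun m => let: And4 _ _ _ h := nU m in h K aK).
have summ : {ae P, forall w, forall t, 0 <= t -> summable `[0, t] (EFin \o (fun s => K s w * j s w)) /\
   exists N, forall m, (N <= m)%N -> sum_over `[0, t] (fun s => K s w * (\1_(U m) (s, w) * j s w)) = sum_over `[0, t] (fun s => K s w * j s w)}.
  apply: filterS2 hU j0 => w hU j0w t t0; have [N hN] := Ucover w t.
  have E m s : (N <= m)%N -> `[0, t]%classic s -> K s w * (\1_(U m) (s, w) * j s w) = K s w * j s w.
    move=> Nm /=; rewrite in_itv/= => /andP[s0 st].
    have [->|sn] := eqVneq s 0; first by rewrite j0w !mulr0.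
    by rewrite indicE mem_set ?mul1r//; apply: hN => //; rewrite lt_neqAle eq_sym sn.
  split; last by exists N => m Nm; apply: eq_sum_over => s; exact: E.
  have [sN _] := hU N t t0; move: sN; rewrite /summable; congr (_ < _)%E.
  by apply: eq_esum => s /= ss; rewrite E.
suff : indist (L A B K) (fun t w => - sum_over `[0, t] (fun s => K s w * j s w)).
  apply: filterS2 summ => w s e t t0; have [st _] := s t t0; split => //.
  by rewrite e// addNr.
have iL := Lfun_ifun dr aA aB; have [lc ll lr ld] := iL.
have [cL mL] := lc _ aK.
apply: indist_of_times; first exact: cadlag_right.
  apply: filterS summ => w s t t0; apply: cvgN; apply: cumulative_right => // r r0.
  by have [] := s r r0.
move=> t t0.
have aKU m : adm (fun t w => K t w * \1_(U m) (t, w)) by apply: admM => //; exact: adm_indic.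
have dL := ld (fun m t w => K t w * \1_(U m) (t, w)) K (fun t w => `|K t w|) aKU aK (adm_norm aK) _ _ t t0.
have {}dL : cvg_prob P (fun m w => L A B (fun t w => K t w * \1_(U m) (t, w)) t w - L A B K t w).
  apply: dL => [m s w s0|s w s0].
    by rewrite normrM ler_piMr// indicE; case: (_ \in _); rewrite ?normr0 ?normr1.
  apply: cvg_near_cst; have [N hN] := Ucover w s; exists N => // m /= Nm.
  by rewrite indicE mem_set ?mulr1//; exact: hN.
have mD m : measurable_fun setT (fun w => L A B (fun t w => K t w * \1_(U m) (t, w)) t w - L A B K t w).
  by apply: measurable_funB; [have [_ mm] := lc _ (aKU m); exact: mm|exact: mL].
have := cvg_prob_ae (L := fun w => - sum_over `[0, t] (fun s => K s w * j s w) - L A B K t w) mD dL => /(_ _)/wrap[|].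
  apply: filterS2 hU summ => w hU s; have [_ [N hN]] := s t t0.
  apply: cvgB; last exact: cvg_cst.
  apply: cvg_near_cst; exists N => // m /= Nm; have [_ e] := hU m t t0; rewrite -(hN m Nm).
  move: e; rewrite (@Lfun_eq _ _ _ _ _ _ _ _ A B _ (fun t w => K t w * \1_(U m) (t, w))); last 2 first.
  - by move=> *; rewrite mulrA.
  - by move=> *; rewrite mulrA.
  by lra.
by apply: filterS => w /subr0_eq.
Qed.

End glue.

Section jumps.
Hypotheses (az : forall a, adapted F (z a)) (cz : forall a w, cadlag (z a ^~ w)).
Hypothesis azz : forall a b, adapted F (fun t w => z a t w * z b t w).
Hypothesis ozz : forall a b, exists J, iop (fun t w => z a t w * z b t w) J.

(** Integrals with respect to the continuous brackets do not jump, by [bracket_functional_jump];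
    only the integrals with respect to the coordinates contribute. *)
Lemma Lfun_jump A B K : (forall a, adm (A a)) -> (forall a b, adm (B a b)) -> adm K ->
  {ae P, forall w, forall t, 0 < t -> 
    L A B K x w @[x --> t^'-] --> L A B K t w - K t w * \sum_a A a t w * jump (z a ^~ w) t}.
Proof.
move=> aA aB aK; have [oz bC oC] := dr.
have e1 a := functional_jump (operator_ifun (oz a)) (az a) (operator_at1 (oz a)) (cz a) (admM aK (aA a)).
have e2 (p : 'I_n * 'I_n) : {ae P, forall w, forall t, 0 < t ->
   JC p.1 p.2 (fun t w => K t w * B p.1 p.2 t w) x w @[x --> t^'-] --> JC p.1 p.2 (fun t w => K t w * B p.1 p.2 t w) t w}.
  case: p => a b /=; have [J oJ] := ozz a b.
  exact: (bracket_functional_jump (oz a) (oz b) oJ (oC a b) (bC a b) (az a) (az b) (azz a b) (cz a) (cz b) (admM aK (aB a b))).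
apply: filterS2 (ae_ord e1) (ae_ord e2) => w {}e1 {}e2 t t0.
rewrite [X in _ --> X](_ : _ = \sum_a (Jz a (fun t w => K t w * A a t w) t w - K t w * A a t w * jump (z a ^~ w) t)
    + 2^-1 * (\sum_a \sum_b JC a b (fun t w => K t w * B a b t w) t w)); last first.
  rewrite /Lfun sumrB mulr_sumr addrAC; congr (_ - _ + _).
  by apply: eq_bigr => a _; rewrite mulrA.
apply: cvgD; first by apply: cvg_sumr => a _; exact: e1.
apply: cvgM; first exact: cvg_cst.
apply: cvg_sumr => a _; apply: cvg_sumr => b _; exact: (e2 (a, b)).
Qed.

Lemma gsolves_jump A B j Y : solves A B j Y -> (forall w, cadlag (Y ^~ w)) ->
  {ae P, forall w, forall t, 0 < t -> jump (Y ^~ w) t = \sum_a A a t w * jump (z a ^~ w) t + j t w}.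
Proof.
move=> [aA aB j0 h] cY.
apply: filterS2 h (Lfun_jump aA aB (adm1 P F)) => w h e t t0; apply: jump_unique => //.
have E x : 0 <= x -> Y x w = Y 0 w + (L A B (fun _ _ => 1) x w + sum_over `[0, x] (j ^~ w)).
  by move=> x0; have [_ <-] := h x x0; ring.
have cs := @cumulative_left R (j ^~ w) (fun t t0 => (h t t0).1) t t0.
have : Y 0 w + (L A B (fun _ _ => 1) x w + sum_over `[0, x] (j ^~ w)) @[x --> t^'-] --> 
   Y 0 w + ((L A B (fun _ _ => 1) t w - 1 * \sum_a A a t w * jump (z a ^~ w) t) + (sum_over `[0, t] (j ^~ w) - j t w)).
  by apply: cvgD; [exact: cvg_cst|apply: cvgD => //; exact: e].
rewrite (E t (ltW t0)).
have -> : Y 0 w + ((L A B (fun _ _ => 1) t w - 1 * \sum_a A a t w * jump (z a ^~ w) t) + (sum_over `[0, t] (j ^~ w) - j t w)) =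
  Y 0 w + (L A B (fun _ _ => 1) t w + sum_over `[0, t] (j ^~ w)) - (\sum_a A a t w * jump (z a ^~ w) t + j t w) by ring.
apply: cvg_trans; apply: near_eq_cvg; near=> x; apply/esym/E/ltW; near: x; exact: nbhs_left_gt.
Unshelve. all: by end_near.
Qed.

(** The third equation is the one of the product [Y Y']. Integration by parts expresses the bracket
    as this product minus two integrals given by the first two equations; [gsolves_jump] identifies
    the product of jumps, and the cross terms remain. By [ifun_eq] it is enough to compare at
    [K = 1]. *)
Lemma bracket_operator A B j Y A' B' j' Y' C1 JC1 JY JY' K :
  solves A B j Y -> solves A' B' j' Y' ->
  solves (fun a t w => left_lim (Y ^~ w) t * A' a t w + left_lim (Y' ^~ w) t * A a t w)
   (fun a b t w => left_lim (Y ^~ w) t * B' a b t w + (left_lim (Y' ^~ w) t * B a b t w + (A a t w * A' b t w + A b t w * A' a t w)))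
   (fun t w => left_lim (Y ^~ w) t * j' t w + left_lim (Y' ^~ w) t * j t w +
       (\sum_a A a t w * jump (z a ^~ w) t + j t w) * (\sum_a A' a t w * jump (z a ^~ w) t + j' t w))
   (fun t w => Y t w * Y' t w) ->
  (forall w, cadlag (Y ^~ w)) -> (forall w, cadlag (Y' ^~ w)) ->
  iop Y JY -> iop Y' JY' -> is_cont_bracket P F Y Y' C1 -> iop C1 JC1 -> adm K ->
  indist (JC1 K) (L (fun _ _ _ => 0) (fun a b t w => A a t w * A' b t w + A b t w * A' a t w) K).
Proof.
move=> g1 g2 g3 cY cY' oY oY' bC1 oC1; move: K.
have [aA aB j0 h1] := g1; have [aA' aB' j0' h2] := g2; have [_ _ _ h3] := g3.
have aD a b : adm (fun t w => A a t w * A' b t w + A b t w * A' a t w) by apply: admD; exact: admM.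
have a0 (a : 'I_n) : adm (fun _ _ => 0) by exact: adm0.
have [amY amY' hC] := cont_bracket_normal bC1 oY oY'.
apply: ifun_eq; [exact: operator_ifun oC1|exact: (Lfun_ifun dr)|].
have s1 := operator_gsolves dr g1 oY amY'; have s2 := operator_gsolves dr g2 oY' amY.
have u1 := gsolves_jump g1 cY; have u2 := gsolves_jump g2 cY'.
have aYA a : adm (fun t w => left_lim (Y' ^~ w) t * A a t w) by exact: admM.
have aYB a b : adm (fun t w => left_lim (Y' ^~ w) t * B a b t w + (A a t w * A' b t w + A b t w * A' a t w)).
  by apply: admD => //; exact: admM.
have e1 := Lfun_lin dr aA' aB' aYA aYB amY (adm1 P F).
have e2 := Lfun_lin dr aA aB a0 aD amY' (adm1 P F).
apply: filterS3 (filterI e1 e2) (filterI (filterI s1 s2) (filterI u1 u2)) (filterI (filterI hC h3) (filterI (filterI j0 j0') (filterI (operator_at1 oC1) (cont_bracket0 bC1 oY oY')))).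
move=> w [{}e1 {}e2] [[{}s1 {}s2] [{}u1 {}u2]] [[{}hC {}h3] [[{}j0 {}j0'] [at1 C10]]] t t0.
rewrite at1// C10 subr0.
have [_ ->] := hC t t0; have [_ ->] := s1 t t0; have [_ ->] := s2 t t0; have [_ h3t] := h3 t t0.
rewrite h3t.
have sJ s : `[0, t]%classic s -> jump (Y ^~ w) s * jump (Y' ^~ w) s =
   (\sum_a A a s w * jump (z a ^~ w) s + j s w) * (\sum_a A' a s w * jump (z a ^~ w) s + j' s w).
  rewrite /= in_itv/= => /andP[s0 _]; have [->|sn] := eqVneq s 0.
    by rewrite j0 j0' !jump0 mul0r !big1 ?addr0 ?mul0r// => a _; rewrite jump0 mulr0.
  by rewrite u1 ?u2// lt_neqAle eq_sym sn.
have [sJJ _] := hC t t0; have [sY _] := s1 t t0; have [sY' _] := s2 t t0.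
have -> : sum_over `[0, t] (fun s => left_lim (Y ^~ w) s * j' s w + left_lim (Y' ^~ w) s * j s w +
       (\sum_a A a s w * jump (z a ^~ w) s + j s w) * (\sum_a A' a s w * jump (z a ^~ w) s + j' s w)) =
   sum_over `[0, t] (fun s => left_lim (Y ^~ w) s * j' s w) + sum_over `[0, t] (fun s => left_lim (Y' ^~ w) s * j s w)
     + sum_over `[0, t] (fun s => jump (Y ^~ w) s * jump (Y' ^~ w) s).
  rewrite -sum_overD// -sum_overD//; last exact: (summableD sY' sY).
  by apply: eq_sum_over => s /sJ ->.
have := e1 t t0; have := e2 t t0.
rewrite (@Lfun_eq _ _ _ _ _ _ (fun a t w => left_lim (Y' ^~ w) t * A a t w + 0) (fun a b t w => left_lim (Y' ^~ w) t * B a b t w + (A a t w * A' b t w + A b t w * A' a t w))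
  (fun a t w => left_lim (Y' ^~ w) t * A a t w) (fun a b t w => left_lim (Y' ^~ w) t * B a b t w + (A a t w * A' b t w + A b t w * A' a t w)) _ (fun _ _ => 1)); [|by move=> *; rewrite addr0|by []].
move=> -> ->.
rewrite (@Lfun_eq _ _ _ _ _ _ A B A B _ (minus Y')); [|by move=> *; rewrite mul1r..].
rewrite (@Lfun_eq _ _ _ _ _ _ A' B' A' B' _ (minus Y)); [|by move=> *; rewrite mul1r..].
ring.
Qed.

End jumps.

Lemma Lfun_double D E K : (forall a b, adm (D a b)) -> adm K ->
  (forall a b t w, E a b t w = D a b t w + D b a t w) ->
  indist (L (fun _ _ _ => 0) E K) (fun t w => 2 * L (fun _ _ _ => 0) D K t w).
Proof.
move=> aD aK hE; have a0 (a : 'I_n) : adm (fun _ _ => 0) by exact: adm0.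
have e := Lfun_lin dr a0 aD a0 (fun a b => aD b a) (adm1 P F) aK.
apply: filterS2 (Lfun_sym aD aK) e => w es e t t0.
have := e t t0; rewrite es//.
rewrite (@Lfun_eq _ _ _ _ _ _ _ _ (fun _ _ _ => 0) E _ K); last 2 first.
- by move=> *; ring.
- by move=> *; rewrite mul1r hE.
rewrite (@Lfun_eq _ _ _ _ _ _ _ D (fun _ _ _ => 0) D _ K); [|by move=> *; rewrite !mulr0|by move=> *; rewrite mulr1].
by move=> ->; ring.
Qed.

Section composition.
Variables (p : nat) (eta : 'I_p -> proc) (Je : 'I_p -> proc -> proc).
Variables (C1 : 'I_p -> 'I_p -> proc) (JC1 : 'I_p -> 'I_p -> proc -> proc).
Hypothesis dr1 : driver P F eta Je C1 JC1.
Variables (A1 : 'I_p -> proc) (B1 : 'I_p -> 'I_p -> proc) (j1 Y : proc).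
Hypothesis g1 : gsolves P F Je JC1 A1 B1 j1 Y.
Variables (A2 : 'I_p -> 'I_n -> proc) (B2 : 'I_p -> 'I_n -> 'I_n -> proc) (j2 : 'I_p -> proc).
Hypothesis g2 : forall a, solves (A2 a) (B2 a) (j2 a) (eta a).
Hypothesis hC1 : forall a b K, adm K -> 
  indist (JC1 a b K) (L (fun _ _ _ => 0) (fun x y t w => A2 a x t w * A2 b y t w + A2 a y t w * A2 b x t w) K).

(** Each integral and bracket of [eta] is replaced by its expression in the driver. The bracket
    comes in symmetrised form, twice the integral of [A2 a x * A2 b y]; the factor 1/2 in front of
    the second-order term absorbs the 2, leaving the second-order chain rule. *)
Lemma gsolves_comp : solves (fun x t w => \sum_a A1 a t w * A2 a x t w)
  (fun x y t w => \sum_(q : 'I_p * 'I_p) B1 q.1 q.2 t w * (A2 q.1 x t w * A2 q.2 y t w) + \sum_a A1 a t w * B2 a x y t w)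
  (fun t w => j1 t w + \sum_a A1 a t w * j2 a t w) Y.
Proof.
have [aA1 aB1 j10 h1] := g1; have [oe bC1 oC1] := dr1.
have aA2 a x : adm (A2 a x) by case: (g2 a).
have aB2 a x y : adm (B2 a x y) by case: (g2 a).
have j20 : {ae P, forall w, forall a, j2 a 0 w = 0} by apply: ae_ord => a; case: (g2 a).
have a0 (a : 'I_n) : adm (fun _ _ => 0) by exact: adm0.
have aAA (q : 'I_p * 'I_p) x y : adm (fun t w => A2 q.1 x t w * A2 q.2 y t w) by exact: admM.
have aS1 x : adm (fun t w => \sum_a A1 a t w * A2 a x t w) by apply: adm_sum => a; exact: admM.
have aS2 x y : adm (fun t w => \sum_a A1 a t w * B2 a x y t w) by apply: adm_sum => a; exact: admM.
have aS3 x y : adm (fun t w => \sum_(q : 'I_p * 'I_p) B1 q.1 q.2 t w * (A2 q.1 x t w * A2 q.2 y t w)).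
  by apply: adm_sum => q; apply: admM => //; exact: admM.
split => //.
- by move=> x y; exact: admD.
- by apply: filterS2 j10 j20 => w -> e; rewrite big1 ?addr0// => a _; rewrite e mulr0.
have e1 := Lfun_sum (index_enum 'I_p) aA2 aB2 aA1 (adm1 P F).
have e2 := @Lfun_sum _ (index_enum ('I_p * 'I_p)%type) (fun _ _ _ _ => 0) (fun q x y t w => A2 q.1 x t w * A2 q.2 y t w) (fun q => B1 q.1 q.2) _ (fun _ => a0) aAA (fun q => aB1 q.1 q.2) (adm1 P F).
have e3 := Lfun_lin dr a0 aS3 aS1 aS2 (adm1 P F) (adm1 P F).
have e4 a := operator_gsolves dr (g2 a) (oe a) (aA1 a).
have e5 (q : 'I_p * 'I_p) := hC1 q.1 q.2 (aB1 q.1 q.2).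
have e6 (q : 'I_p * 'I_p) : indist (L (fun _ _ _ => 0) (fun x y t w => A2 q.1 x t w * A2 q.2 y t w + A2 q.1 y t w * A2 q.2 x t w) (B1 q.1 q.2))
   (fun t w => 2 * L (fun _ _ _ => 0) (fun x y t w => A2 q.1 x t w * A2 q.2 y t w) (B1 q.1 q.2) t w).
  by apply: Lfun_double.
apply: filterS3 (filterI h1 (filterI e1 e2)) (filterI e3 (ae_ord e4)) (filterI (ae_ord e5) (ae_ord e6)).
move=> w [{}h1 [{}e1 {}e2]] [{}e3 {}e4] [{}e5 {}e6] t t0; have [s1 q1] := h1 t t0.
have s2 a : summable `[0, t] (EFin \o (fun s => A1 a s w * j2 a s w)) by have [] := e4 a t t0.
split; first exact: (summableD s1 (summable_sum _ s2)).
rewrite sum_overD//; last exact: summable_sum.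
rewrite sum_over_sum//.
have -> : L (fun x t w => \sum_a A1 a t w * A2 a x t w)
   (fun x y t w => \sum_(q : 'I_p * 'I_p) B1 q.1 q.2 t w * (A2 q.1 x t w * A2 q.2 y t w) + \sum_a A1 a t w * B2 a x y t w) (fun _ _ => 1) t w =
   \sum_(q : 'I_p * 'I_p) L (fun _ _ _ => 0) (fun x y t w => A2 q.1 x t w * A2 q.2 y t w) (B1 q.1 q.2) t w
   + \sum_a L (A2 a) (B2 a) (A1 a) t w.
  have := e3 t t0.
  rewrite (@Lfun_eq _ _ _ _ _ _ _ _ (fun x t w => \sum_a A1 a t w * A2 a x t w)
     (fun x y t w => \sum_(q : 'I_p * 'I_p) B1 q.1 q.2 t w * (A2 q.1 x t w * A2 q.2 y t w) + \sum_a A1 a t w * B2 a x y t w) _ (fun _ _ => 1)); last 2 first.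
  - by move=> *; rewrite mulr0 add0r.
  - by move=> *; rewrite !mul1r.
  move=> ->; congr (_ + _).
    have := e2 t t0.
    rewrite (@Lfun_eq _ _ _ _ _ _ _ _ (fun _ _ _ => 0) (fun x y t w => \sum_(q : 'I_p * 'I_p) B1 q.1 q.2 t w * (A2 q.1 x t w * A2 q.2 y t w)) _ (fun t w => 1 * 1)); last 2 first.
    + by move=> *; rewrite big1 ?mulr0// => *; rewrite mulr0.
    + by move=> *; rewrite mulr1.
    move=> ->; apply: eq_bigr => q _; congr (_ t w); apply: Lfun_eq => *; rewrite ?mulr0//.
    by rewrite mul1r.
  rewrite e1//; apply: eq_bigr => a _; congr (_ t w); apply: Lfun_eq => *; by rewrite mul1r.
have one H : (fun t w => 1 * H t w) = H :> proc by apply/funext => ?; apply/funext => ?; rewrite mul1r.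
rewrite q1 {1}/Lfun.
have -> : \sum_a Je a (fun t w => 1 * A1 a t w) t w = \sum_a (L (A2 a) (B2 a) (A1 a) t w + sum_over `[0, t] (fun s => A1 a s w * j2 a s w)).
  by apply: eq_bigr => a _; have [_ <-] := e4 a t t0; rewrite one.
have -> : \sum_a \sum_b JC1 a b (fun t w => 1 * B1 a b t w) t w =
    2 * \sum_(q : 'I_p * 'I_p) L (fun _ _ _ => 0) (fun x y t w => A2 q.1 x t w * A2 q.2 y t w) (B1 q.1 q.2) t w.
  rewrite pair_big/= mulr_sumr; apply: eq_bigr => q _.
  by rewrite -e6// -e5// one.
rewrite big_split/= mulrA mulVf ?pnatr_eq0// mul1r; ring.
Qed.

End composition.

End driver_theory.

(** * Derivatives along the driver *)

Section slices.
Variables (R : realType) (m n : nat).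

Lemma delta_pt3 (x : 'rV[R]_m) (z' z : 'rV[R]_n) (a : 'I_n) (h : R) :
  h *: delta_mx 0 (zp m a) + pt3 x z' z = pt3 x (h *: delta_mx 0 a + z') z.
Proof.
have -> : delta_mx 0 (zp m a) = pt3 0 (delta_mx 0 a) 0 :> 'rV[R]_(m + (n + n)).
  apply/rowP => i; rewrite /pt3 /zp mxE eqxx /=; case: (split_ordP i) => k ->.
    rewrite row_mxEl mxE; case: (lshift _ _ =P _) => // /(congr1 val) /= e.
    by have := ltn_ord k; rewrite e ltnNge leq_addr.
  rewrite row_mxEr; case: (split_ordP k) => l ->.
    by rewrite row_mxEl mxE eqxx /= (inj_eq (@rshift_inj _ _)) (inj_eq (@lshift_inj _ _)).
  rewrite row_mxEr mxE (inj_eq (@rshift_inj _ _)); case: (rshift _ _ =P _) => // /(congr1 val) /= e.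
  by have := ltn_ord a; rewrite -e ltnNge leq_addr.
by rewrite /pt3 !scale_row_mx !add_row_mx !scaler0 !add0r.
Qed.

Lemma derive_pt3 (f : 'rV[R]_(m + (n + n)) -> R) (x : 'rV[R]_m) (z' z : 'rV[R]_n) (a : 'I_n) :
  'D_(delta_mx 0 (zp m a)) f (pt3 x z' z) = 'D_(delta_mx 0 a) (fun y => f (pt3 x y z)) z'.
Proof.
rewrite !derive_line; congr ('D_ _ _ _); apply/funext => s; by rewrite delta_pt3.
Qed.

Lemma derivable_pt3 (f : 'rV[R]_(m + (n + n)) -> R) (x : 'rV[R]_m) (z' z : 'rV[R]_n) (a : 'I_n) :
  derivable f (pt3 x z' z) (delta_mx 0 (zp m a)) -> derivable (fun y => f (pt3 x y z)) z' (delta_mx 0 a).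
Proof.
have E : (fun h => h^-1 *: ((f \o shift (pt3 x z' z)) (h *: delta_mx 0 (zp m a)) - f (pt3 x z' z))) =
   (fun h : R => h^-1 *: (((fun y => f (pt3 x y z)) \o shift z') (h *: delta_mx 0 a) - f (pt3 x z' z))).
  by apply/funext => h; rewrite /= /shift /= delta_pt3.
by rewrite /derivable E.
Qed.

Lemma partials_pt3 (l : seq 'I_n) (f : 'rV[R]_(m + (n + n)) -> R) x z' z :
  partials (map (@zp m n) l) f (pt3 x z' z) = partials l (fun y => f (pt3 x y z)) z'.
Proof.
elim: l z' => //= a l IH z'; rewrite derive_pt3; congr ('D_ _ _ _).
by apply/funext => y; exact: IH.
Qed.

Lemma continuous_slice_pt3 (x : 'rV[R]_m) (z : 'rV[R]_n) : continuous (fun y : 'rV[R]_n => pt3 x y z).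
Proof.
move=> y; apply: (@row_mx_continuous R _ m (n + n) (fun=> x) (fun y => row_mx y z)); first exact: cst_continuous.
by apply: (@row_mx_continuous R _ n n id (fun=> z)); [move=> A hA|exact: cst_continuous].
Qed.

Lemma smooth_slice (K : topologicalType) (U : set 'rV[R]_(m + (n + n))) (Phi : 'rV[R]_(m + (n + n)) -> K -> R) k x z :
  psmooth_on [set p | U p.1] Phi -> smooth_on [set y | U (pt3 x y z)] (fun y => Phi (pt3 x y z) k).
Proof.
move=> sP l y Uy; have := sP (map (@zp m n) l) (pt3 x y z) k Uy => -[d c].
have E y' : partials l (fun y => Phi (pt3 x y z) k) y' = partials (map (@zp m n) l) (Phi^~ k) (pt3 x y' z).
  by rewrite (partials_pt3 l (Phi^~ k)).
rewrite (funext E); split=> [a|].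
  by apply: (derivable_pt3 (f := partials (map (@zp m n) l) (Phi^~ k))); exact: d.
have cp : {for y, continuous (fun y => (pt3 x y z, k))}.
  by apply: continuous_pair; [exact: continuous_slice_pt3|exact: cst_continuous].
exact: (continuous_comp cp c).
Qed.

Lemma open_slice_pt3 (U : set 'rV[R]_(m + (n + n))) x z : open U -> open [set y | U (pt3 x y z)].
Proof.
move=> oU; apply: (@open_comp _ _ (fun y => pt3 x y z)) => // y _; exact: continuous_slice_pt3.
Qed.
End slices.

Section calculus.
Variables (R : realType) (n : nat).
Implicit Types (U : set 'rV[R]_n) (f g : 'rV[R]_n -> R).

Lemma smooth_onM U f g : open U -> smooth_on U f -> smooth_on U g -> smooth_on U (fun u => f u * g u).
Proof.
move=> oU /smooth_onP sf /smooth_onP sg; apply/smooth_onP => k.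
exact: (pCM (open_fst oU) (sf k) (sg k)).
Qed.

Lemma smooth_on_sub U V f : V `<=` U -> smooth_on U f -> smooth_on V f.
Proof. by move=> VU sf l u /VU; exact: sf. Qed.

Lemma smooth_on_comp p U (V : set 'rV[R]_p) (f : 'rV[R]_p -> R) (phi : 'rV[R]_n -> 'rV[R]_p) :
  open U -> open V -> (forall u, U u -> V (phi u)) -> (forall j, smooth_on U (fun u => phi u 0 j)) ->
  smooth_on V f -> smooth_on U (fun u => f (phi u)).
Proof.
move=> oU oV UV sp /smooth_onP sf; apply/smooth_onP => k.
by apply: (sC_comp oU oV UV) => // j; have /smooth_onP := sp j; exact.
Qed.

Lemma smooth_on_partial q (U : set 'rV[R]_q) (f : 'rV[R]_q -> R) a : smooth_on U f -> smooth_on U (partials [:: a] f).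
Proof. by move=> sf l u Uu; have := sf (rcons l a) u Uu; rewrite /partials -cats1 foldr_cat. Qed.

Lemma smooth_is_derive U f u a : smooth_on U f -> U u ->
  is_derive u (delta_mx 0 a) f (partials [:: a] f u).
Proof. by move=> sf Uu; apply: derivableP; exact: (sf [::] u Uu).1. Qed.

Lemma partials_near (l : seq 'I_n) f g u : (\forall z \near u, f z = g z) -> partials l f u = partials l g u.
Proof.
elim: l u => [|a l IH] u fg; first exact: nbhs_singleton fg.
by apply: near_eq_derive; apply: filterS (nbhs_interior fg) => y; exact: IH.
Qed.

Lemma sum_delta2 (h : 'I_n -> 'I_n -> R) a b :
  \sum_(q : 'I_n * 'I_n) h q.1 q.2 * ((a == q.1)%:R * (b == q.2)%:R) = h a b.
Proof.
rewrite (bigD1 (a, b))//= !eqxx !mulr1 big1 ?addr0// => -[c d'] /=; rewrite xpair_eqE negb_and.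
by rewrite (eq_sym c) (eq_sym d') => /orP[] /negbTE ->; rewrite ?mul0r !mulr0.
Qed.

Lemma partials1_coord (g a : 'I_n) (z : 'rV[R]_n) : partials [:: a] (fun z => z 0 g) z = (a == g)%:R.
Proof.
apply: (etrans (@derive_val _ _ _ _ _ _ _ (is_derive_coord g z (delta_mx 0 a)))).
by rewrite mxE eqxx/= eq_sym.
Qed.

Lemma smooth_on_coord U (g : 'I_n) : open U -> smooth_on U (fun z : 'rV[R]_n => z 0 g).
Proof. by move=> oU; apply/smooth_onP => k; exact: (pC_coord k g (open_fst oU)). Qed.

Lemma partials_cst0 (l : seq 'I_n) (u : 'rV[R]_n) : partials l (fun=> 0) u = 0.
Proof.
elim: l u => // a l IH u.
change ('D_(delta_mx 0 a) (partials l (fun=> 0)) u = 0).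
by rewrite (funext IH); exact: derive_cst.
Qed.

Lemma partialsM1 U f g a u : smooth_on U f -> smooth_on U g -> U u ->
  partials [:: a] (fun z => f z * g z) u = f u * partials [:: a] g u + g u * partials [:: a] f u.
Proof.
move=> sf sg Uu.
exact: (@derive_val _ _ _ _ _ _ _ (is_deriveM (smooth_is_derive a sf Uu) (smooth_is_derive a sg Uu))).
Qed.

Lemma partialsM2 U f g a b u : open U -> smooth_on U f -> smooth_on U g -> U u ->
  partials [:: a; b] (fun z => f z * g z) u =
  f u * partials [:: a; b] g u + (g u * partials [:: a; b] f u +
   (partials [:: a] f u * partials [:: b] g u + partials [:: b] f u * partials [:: a] g u)).
Proof.
move=> oU sf sg Uu.
have -> : partials [:: a; b] (fun z => f z * g z) u =
   partials [:: a] (fun z => f z * partials [:: b] g z + g z * partials [:: b] f z) u.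
  apply: (@partials_near [:: a]); apply: filterS (open_near oU Uu) => z Uz.
  exact: partialsM1 sf sg Uz.
have h := is_deriveD (is_deriveM (smooth_is_derive a sf Uu) (smooth_is_derive a (smooth_on_partial b sg) Uu))
  (is_deriveM (smooth_is_derive a sg Uu) (smooth_is_derive a (smooth_on_partial b sf) Uu)).
apply: (etrans (@derive_val _ _ _ _ _ _ _ h)).
rewrite -[partials [:: a] (partials [:: b] g) u]/(partials [:: a; b] g u).
rewrite -[partials [:: a] (partials [:: b] f) u]/(partials [:: a; b] f u).
move: (partials [:: a; b] g u) (partials [:: a; b] f u) (partials [:: a] f u) (partials [:: b] g u) (partials [:: b] f u) (partials [:: a] g u).
by move=> *; rewrite /GRing.scale /=; ring.
Qed.

Lemma smooth_chain p U (V : set 'rV[R]_p) (f : 'rV[R]_p -> R) (phi : 'rV[R]_n -> 'rV[R]_p) a u :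
  open U -> open V -> (forall u, U u -> V (phi u)) -> (forall j, smooth_on U (fun u => phi u 0 j)) ->
  smooth_on V f -> U u -> is_derive u (delta_mx 0 a) (fun z => f (phi z))
  (\sum_i partials [:: i] f (phi u) * partials [:: a] (fun z => phi z 0 i) u).
Proof.
move=> oU oV UV sp sf Uu; have h := @is_derive_chain R n p f phi u (delta_mx 0 a) _ _ _.
have {}h := h _ _ _; apply: (is_derive_eq (h _ _ _)).
- apply: filterS (open_near oV (UV _ Uu)) => z Vz j; exact: (sf [::] z Vz).1.
- by move=> j; exact: (@smooth_on_derive_continuous _ _ _ _ _ j sf (UV _ Uu)).
- by move=> j; exact: ((sp j) [::] u Uu).1.
by apply: eq_bigr => i _; rewrite mulrC.
Qed.

Lemma partials_chain1 p U (V : set 'rV[R]_p) (f : 'rV[R]_p -> R) (phi : 'rV[R]_n -> 'rV[R]_p) a u :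
  open U -> open V -> (forall u, U u -> V (phi u)) -> (forall j, smooth_on U (fun u => phi u 0 j)) ->
  smooth_on V f -> U u -> partials [:: a] (fun z => f (phi z)) u =
  \sum_i partials [:: i] f (phi u) * partials [:: a] (fun z => phi z 0 i) u.
Proof. by move=> oU oV UV sp sf Uu; exact: (@derive_val _ _ _ _ _ _ _ (smooth_chain a oU oV UV sp sf Uu)). Qed.

Lemma partials_chain2 p U (V : set 'rV[R]_p) (f : 'rV[R]_p -> R) (phi : 'rV[R]_n -> 'rV[R]_p) a b u :
  open U -> open V -> (forall u, U u -> V (phi u)) -> (forall j, smooth_on U (fun u => phi u 0 j)) ->
  smooth_on V f -> U u ->
  partials [:: a; b] (fun z => f (phi z)) u =
  \sum_(q : 'I_p * 'I_p) partials [:: q.1; q.2] f (phi u) *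
      (partials [:: a] (fun z => phi z 0 q.1) u * partials [:: b] (fun z => phi z 0 q.2) u)
  + \sum_i partials [:: i] f (phi u) * partials [:: a; b] (fun z => phi z 0 i) u.
Proof.
move=> oU oV UV sp sf Uu.
have -> : partials [:: a; b] (fun z => f (phi z)) u =
   partials [:: a] (fun z => \sum_i partials [:: i] f (phi z) * partials [:: b] (fun z => phi z 0 i) z) u.
  apply: (@partials_near [:: a]); apply: filterS (open_near oU Uu) => z Uz.
  exact: (partials_chain1 b oU oV UV sp sf Uz).
have h i := is_deriveM (smooth_chain a oU oV UV sp (smooth_on_partial i sf) Uu) (smooth_is_derive a (smooth_on_partial b (sp i)) Uu).
have := is_derive_sum h => {}h.
have E : (\sum_(i < p) (fun z => partials [:: i] f (phi z)) * partials [:: b] (fun u => phi u 0 i))%R =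
   (fun z => \sum_i partials [:: i] f (phi z) * partials [:: b] (fun z => phi z 0 i) z).
  by apply/funext => z; rewrite fct_sumE.
rewrite E in h; rewrite [LHS](@derive_val _ _ _ _ _ _ _ h) big_split/= addrC; congr (_ + _).
rewrite -(pair_bigA _ (fun i j => partials [:: i; j] f (phi u) *
      (partials [:: a] (fun z => phi z 0 i) u * partials [:: b] (fun z => phi z 0 j) u)))/= exchange_big/=.
apply: eq_bigr => i _; rewrite scaler_sumr; apply: eq_bigr => j _.
rewrite /GRing.scale /=; ring.
Qed.

(* The tangential identities: a function vanishing on the image of a local
   retraction [pi_] has its derivatives at a fixed point of [pi_] expressed
   through those of the defects [u^g - pi_^g]. *)
Lemma vanishing_partials U (V : set 'rV[R]_n) f (pi_ : 'rV[R]_n -> 'rV[R]_n) u :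
  open U -> open V -> U u -> V u -> smooth_on U f -> (forall j, smooth_on V (fun z => pi_ z 0 j)) ->
  pi_ u = u -> (forall z, V z -> f (pi_ z) = 0) ->
  let A (g a : 'I_n) := partials [:: a] (fun z : 'rV[R]_n => z 0 g - pi_ z 0 g) u in
  let B (g a b : 'I_n) := partials [:: a; b] (fun z : 'rV[R]_n => z 0 g - pi_ z 0 g) u in
  (forall a, partials [:: a] f u = \sum_g partials [:: g] f u * A g a) /\
  (forall a b, partials [:: a; b] f u =
     \sum_(q : 'I_n * 'I_n) partials [:: q.1; q.2] f u * (A q.1 a * (b == q.2)%:R + (a == q.1)%:R * A q.2 b - A q.1 a * A q.2 b)
     + \sum_g partials [:: g] f u * B g a b).
Proof.
move=> oU oV Uu Vu sf sp pu f0 A B.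
have cpi : {for u, continuous pi_}.
  by apply: rV_continuous => j; exact: smooth_on_continuous (sp j) Vu.
pose V' := V `&` pi_ @^-1` U.
have [W [oW Wu WV]] : exists W, [/\ open W, W u & W `<=` V'].
  have : nbhs u V'.
    apply: (filterI (open_near oV Vu)).
    by apply: cpi; rewrite pu; exact: (open_near oU Uu).
  by rewrite nbhsE => -[W [oW Wu] WV]; exists W.
have spW j : smooth_on W (fun z => pi_ z 0 j) by apply: smooth_on_sub (sp j) => z /WV[].
have WU z : W z -> U (pi_ z) by move=> /WV[].
have co (g : 'I_n) : smooth_on W (fun z : 'rV[R]_n => z 0 g).
  exact: smooth_on_coord.
have dc := partials1_coord.
have dA (g a : 'I_n) z : W z -> partials [:: a] (fun z : 'rV[R]_n => z 0 g - pi_ z 0 g) z = (a == g)%:R - partials [:: a] (fun z => pi_ z 0 g) z.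
  move=> Wz; rewrite -(dc g a z).
  exact: (@derive_val _ _ _ _ _ _ _ (is_deriveB (smooth_is_derive a (co g) Wz) (smooth_is_derive a (spW g) Wz))).
have dP (g a : 'I_n) : partials [:: a] (fun z => pi_ z 0 g) u = (a == g)%:R - A g a by rewrite /A dA// subKr.
have dP2 (g a b : 'I_n) : partials [:: a; b] (fun z => pi_ z 0 g) u = - B g a b.
  rewrite /B.
  have -> : partials [:: a; b] (fun z : 'rV[R]_n => z 0 g - pi_ z 0 g) u = partials [:: a] (fun z => (b == g)%:R - partials [:: b] (fun z => pi_ z 0 g) z) u.
    by apply: (@partials_near [:: a]); apply: filterS (open_near oW Wu) => z Wz; exact: dA.
  have h := @is_deriveB R _ _ _ _ u (delta_mx 0 a) _ _ (is_derive_cst ((b == g)%:R : R) u (delta_mx 0 a)) (smooth_is_derive a (smooth_on_partial b (spW g)) Wu).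
  by rewrite [X in - X](@derive_val _ _ _ _ _ _ _ h) sub0r opprK.
(* The composite of [f] with [pi_] is 0 near [u], so both of its chain rules equate a sum to 0;
   inserting the derivatives [(a == g) - A g a] and [- B g a b] of [pi_] and solving for those of
   [f] gives the identities. *)
have fpi0 (l : seq 'I_n) : partials l (fun z => f (pi_ z)) u = 0.
  have -> : partials l (fun z => f (pi_ z)) u = partials l (fun=> 0) u.
    by apply: partials_near; apply: filterS (open_near oV Vu) => z; exact: f0.
  exact: partials_cst0.
split=> [a|a b].
  have := partials_chain1 a oW oU WU spW sf Wu; rewrite fpi0 pu.
  under eq_bigr do rewrite dP mulrBr.
  rewrite sumrB => /esym/subr0_eq <-.
  by rewrite (bigD1 a)//= eqxx mulr1 big1 ?addr0// => i /negbTE ia; rewrite eq_sym ia mulr0.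
have := partials_chain2 a b oW oU WU spW sf Wu; rewrite fpi0 pu.
under [X in _ + X]eq_bigr do rewrite dP2 mulrN.
rewrite sumrN => /esym/subr0_eq <-.
have -> : partials [:: a; b] f u = \sum_(q : 'I_n * 'I_n) partials [:: q.1; q.2] f u * ((a == q.1)%:R * (b == q.2)%:R).
  by rewrite (sum_delta2 (fun i j => partials [:: i; j] f u)).
under [X in _ = _ + X]eq_bigr do rewrite !dP.
rewrite -big_split/=; apply: eq_bigr => q _; rewrite -mulrDr; congr (_ * _).
move: (A q.1 a) (A q.2 b) => *; ring.
Qed.

End calculus.

(** * Coordinates of a geometrical equation *)

(* The left limit in M; unlike [left_lim], it asks for no base point in M. *)
Definition llim (R : realType) (M : topologicalType) (x : R -> M) (t : R) : M :=
  if 0 < t then xget (x 0) [set l | x @ t^'- --> l] else x 0.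

Lemma llim_cvg (R : realType) (M : topologicalType) (x : R -> M) t : cadlag x -> 0 < t ->
  x @ t^'- --> llim x t.
Proof.
move=> [_ h] t0; have [l hl] := h t t0; rewrite /llim t0.
by case: xgetP => [y _ //|/(_ l)].
Qed.

Lemma left_lim_comp (R : realType) (M : topologicalType) (E : ptopologicalType) (f : M -> E) (x : R -> M) t :
  hausdorff_space E -> continuous f -> cadlag x -> left_lim (fun s => f (x s)) t = f (llim x t).
Proof.
move=> hE cf cx; rewrite /left_lim; case: ifPn => [t0|]; last by rewrite /llim => /negbTE ->.
apply: (@cvg_lim _ hE); apply: (cvg_comp _ _ (llim_cvg cx t0)); exact: cf.
Qed.

Section left_lim_values.
Variables (R : realType) (M : topologicalType) (x : R -> M) (t : R).
Hypothesis cx : cadlag x.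

Lemma left_lim_real (f : M -> R) : continuous f -> left_lim (fun s => f (x s)) t = f (llim x t).
Proof. by move=> cf; apply: left_lim_comp => //; exact: norm_hausdorff. Qed.

Lemma left_lim_rV q (f : M -> 'rV[R]_q) : continuous f -> left_lim (fun s => f (x s)) t = f (llim x t).
Proof. by move=> cf; apply: left_lim_comp => //; exact: norm_hausdorff. Qed.

Lemma cadlag_comp (E : topologicalType) (f : M -> E) : continuous f -> cadlag (fun s => f (x s)).
Proof.
move=> cf; have [c1 c2] := cx; split=> s s0; first by apply: cvg_comp (c1 s s0) _; exact: cf.
by have [l hl] := c2 s s0; exists (f l); apply: cvg_comp hl _; exact: cf.
Qed.
End left_lim_values.

(** Left limits do not vary continuously, yet close to a time [r] they stay near [y r] on the right
    and near the left limit at [r] on the left; compactness of [[0, t]] does the rest. Halving the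
    boxes leaves room for left limits, which are only in the closure of the values. *)
Lemma left_lim_finite_cover (R : realType) n (y : R -> 'rV[R]_n) (U : nat -> set 'rV[R]_n) t :
  cadlag y -> (forall c, open (U c)) -> (forall s, 0 <= s -> exists c, U c (y s)) ->
  (forall s, 0 < s -> exists c, U c (left_lim y s)) ->
  exists N, forall s, 0 < s -> s <= t -> exists2 c, (c < N)%N & U c (left_lim y s).
Proof.
move=> [yr yl] oU U1 U2.
have ylim (s : R) : 0 < s -> y @ s^'- --> left_lim y s.
  move=> s0; have [l hl] := yl s s0; rewrite /left_lim s0.
  by rewrite (cvg_lim _ hl)//; exact: norm_hausdorff.
pose good m : set R := [set s : R | 0 < s -> exists2 c, (c < m)%N & U c (left_lim y s)].
have boxcl (a : 'rV[R]_n) (e : R) : 0 < e -> forall s : R, 0 < s -> (\forall s' \near s^'-, box a (e / 2) (y s')) ->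
    box a e (left_lim y s).
  move=> e0 s s0 h j.
  have cj : (fun s' => `|y s' 0 j - a 0 j|) @ s^'- --> `|left_lim y s 0 j - a 0 j|.
    apply: cvg_norm; apply: cvgB; last exact: cvg_cst.
      have cc : continuous (fun v : 'rV[R]_n => v 0 j) by exact: coord_continuous.
    exact: (cvg_comp _ _ (ylim s s0) (cc _)).
  apply: (@le_lt_trans _ _ (e / 2)); last by rewrite ltr_pdivrMr// mulr_natr mulr2n ltrDl.
  have cl : closed [set v : R | v <= e / 2] by exact: closed_le.
  by apply: (@closed_cvg _ _ _ _ _ _ cl _ _ cj); apply: filterS h => s' /(_ j)/ltW.
have opens a c : U c a -> exists2 e : R, 0 < e & box a e `<=` U c.
  by move=> Uca; apply/nbhs_boxP; exact: open_near (oU c) Uca.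
have step (r : R) : 0 <= r -> exists m, nbhs r (good m).
  move=> r0; have [c1 Uc1] := U1 r r0; have [e1 e10 he1] := opens _ _ Uc1.
  have n1 : \forall s \near r, r < s -> box (y r) (e1 / 2) (y s).
    have nb : nbhs (y r) (box (y r) (e1 / 2)) by apply/nbhs_boxP; exists (e1 / 2) => //; rewrite divr_gt0.
    exact: (yr r r0 _ nb).
  have g1 : \forall s \near r, r < s -> U c1 (left_lim y s).
    apply: filterS (nbhs_interior n1) => s hs rs; apply: he1.
    apply: boxcl => //; first exact: le_lt_trans rs.
    have : \forall s' \near s, r < s' by exact: lt_nbhsr.
    by apply: filterS2 hs => s' h1 h2 _; exact: h1.
  have [r00|] := ltP 0 r; last first.
    move=> r00; have -> : r = 0 by apply/eqP; rewrite eq_le r00.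
    exists c1.+1; have -> : 0 = r by apply/eqP; rewrite eq_le r00 r0.
    by apply: filterS g1 => s h s0; exists c1 => //; apply: h; exact: le_lt_trans s0.
  have [c2 Uc2] := U2 r r00; have [e2 e20 he2] := opens _ _ Uc2.
  have n2 : \forall s \near r, s < r -> box (left_lim y r) (e2 / 2) (y s).
    have nb : nbhs (left_lim y r) (box (left_lim y r) (e2 / 2)).
      by apply/nbhs_boxP; exists (e2 / 2) => //; rewrite divr_gt0.
    exact: (ylim r r00 _ nb).
  have g2 : \forall s \near r, s < r -> 0 < s -> U c2 (left_lim y s).
    apply: filterS (nbhs_interior n2) => s hs rs s0; apply: he2.
    apply: boxcl => //.
    have : \forall s' \near s, s' < r by exact: lt_nbhsl.
    by apply: filterS2 hs => s' h1 h2 _; exact: h1.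
  exists (maxn c1 c2).+1; apply: filterS2 g1 g2 => s h1 h2 s0.
  have [sr|rs|->] := ltgtP s r.
  - by exists c2; [rewrite ltnS leq_maxr|exact: h2].
  - by exists c1; [rewrite ltnS leq_maxl|exact: h1].
  - by exists c2 => //; rewrite ltnS leq_maxr.
have [N hN] : exists N, forall s, `[0, t]%classic s -> exists2 m, (m < N)%N & (good m)^° s.
  apply: compact_countable_cover; first exact: segment_compact.
    by move=> m; exact: open_interior.
  by move=> s /=; rewrite in_itv/= => /andP[s0 _]; exact: step.
exists N => s s0 st; have [|m mN /interior_subset h] := hN s; first by rewrite /= in_itv/= (ltW s0).
by have [c cm Uc] := h s0; exists c => //; exact: ltn_trans mN.
Qed.

Section predictable_processes.
Variables (R : realType) (d : measure_display) (T : measurableType d).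
Variables (P : probability T R) (F : filtration R T).

Lemma predictable_comp (E1 E2 : topologicalType) (f : E1 -> E2) (H : R -> T -> E1) :
  continuous f -> predictable F H -> predictable F (fun t w => f (H t w)).
Proof. by move=> cf pH U oU; apply: (pH (f @^-1` U)); exact: open_comp. Qed.

(** An open set of the product is a union of [b * V b] over a base of the first factor, where [V b]
    is the largest open set that fits; with a countable base on one side this union is countable,
    and the other factor may be arbitrary. *)
Lemma predictable_pair (E1 E2 : topologicalType) (H1 : R -> T -> E1) (H2 : R -> T -> E2) :
  @second_countable E1 -> predictable F H1 -> predictable F H2 ->
  predictable F (fun t w => (H1 t w, H2 t w)).
Proof.
move=> [B /countable_injP[f finj] [Bo Bb]] /predictableE p1 /predictableE p2; apply/predictableE => U oU.
pose V (b : set E1) := [set y : E2 | exists2 W : set E2, open W /\ W y & b `*` W `<=` U].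
have oV b : open (V b).
  rewrite openE => y [W [oW Wy] WU]; rewrite /interior /=.
  by apply: filterS (open_near oW Wy) => y' Wy'; exists W.
have -> : [set p : R * T | U (H1 p.1 p.2, H2 p.1 p.2)] =
    \bigcup_m [set p | exists b, [/\ B b, f b = m, b (H1 p.1 p.2) & V b (H2 p.1 p.2)]].
  apply/seteqP; split => [p Up|p [m _ [b [_ _ bp [W [_ Wp] WU]]]]]; last by apply: WU.
  have [[A W] /= [nA nW] AW] : nbhs (H1 p.1 p.2, H2 p.1 p.2) U by exact: open_nbhs_nbhs.
  have [b [Bb1 b1] bA] := Bb _ _ nA.
  have : nbhs (H2 p.1 p.2) W by [].
  rewrite nbhsE => -[W' [oW' W'p] W'W].
  exists (f b) => //; exists b; split => //; exists W' => // -[y y'] [/= /bA Ay /W'W Wy]; exact: (AW (y, y')).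
apply: bigcup_measurable => m _; have [[b [Bb1 fb]]|h] := pselect (exists b, B b /\ f b = m); last first.
  rewrite (_ : [set p | _] = set0); first exact: measurable0.
  by apply/seteqP; split => // p [b [Bb1 fb _ _]]; apply: h; exists b.
rewrite (_ : [set p | _] = [set p | b (H1 p.1 p.2)] `&` [set p | V b (H2 p.1 p.2)]).
  by apply: measurableI; [apply: p1; exact: Bo|apply: p2; exact: oV].
apply/seteqP; split => p /= => [[b' [Bb' fb' h1 h2]]|[h1 h2]]; last by exists b.
by have -> : b = b' by apply: finj; rewrite ?inE// fb fb'.
Qed.

(** Every open set is a countable union of boxes with rational centre and radius [1 / (r + 1)], and
    membership in a box is decided by finitely many coordinates. *)
Lemma predictable_rV n (H : R -> T -> 'rV[R]_n) :
  (forall i, predictable F (fun t w => H t w 0 i)) -> predictable F H.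
Proof.
move=> pH; apply/predictableE => V oV.
pose bx (k : nat) : set 'rV[R]_n := 
  if unpickle k is Some q then let: (c, r) := (q : 'rV[rat]_n * nat) in 
    let b := box (map_mx ratr c) (r.+1%:R^-1 : R) in if `[< b `<=` V >] then b else set0
  else set0.
have bxV k : bx k `<=` V by rewrite /bx; case: unpickle => [[c r]|] //; case: asboolP => // _ v [].
have -> : [set p : R * T | V (H p.1 p.2)] = \bigcup_k [set p | bx k (H p.1 p.2)].
  apply/seteqP; split => [p Vp|p [k _ /bxV]//].
  have /nbhs_boxP[e e0 eV] := open_near oV Vp.
  have e2 : 0 < e / 2 by rewrite divr_gt0.
  have [r _ hr] : \forall r \near \oo, (r.+1%:R^-1 : R) < e / 2.
    have /cvgrPdist_lt/(_ _ e2) := @cvg_harmonic R.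
    by apply: filterS => m; rewrite /= sub0r normrN ger0_norm// invr_ge0.
  have {}hr := hr r (leqnn r).
  have r0 : 0 < (r.+1%:R^-1 : R) by rewrite invr_gt0.
  have /choice[c hc] : forall i, exists c : rat, `|(ratr c : R) - H p.1 p.2 0 i| < r.+1%:R^-1.
    move=> i; have /rat_in_itvoo[c] : H p.1 p.2 0 i < H p.1 p.2 0 i + r.+1%:R^-1 by rewrite ltrDl.
    rewrite in_itv/= => /andP[c1 c2]; exists c.
    by rewrite ger0_norm ?subr_ge0 ?(ltW c1)// ltrBlDl.
  exists (pickle (\row_i c i : 'rV[rat]_n, r)) => //=; rewrite /bx pickleK.
  have cH : box (map_mx ratr (\row_i c i)) (r.+1%:R^-1) (H p.1 p.2).
    by move=> i; rewrite !mxE distrC.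
  case: asboolP => // bV; exfalso; apply: bV => v vb; apply: eV => i.
  have := vb i; have := cH i; rewrite !mxE.
  have := ler_distD (ratr (c i)) (v 0 i) (H p.1 p.2 0 i).
  move=> h1 h2 h3; apply: (le_lt_trans h1); rewrite [ltRHS]splitr.
  by apply: ltrD; [exact: lt_trans h3 hr|rewrite distrC; exact: lt_trans h2 hr].
apply: bigcup_measurable => k _; rewrite /bx; case: unpickle => [[c r]|]; last first.
  rewrite (_ : [set p | _] = set0); first exact: measurable0.
  by apply/seteqP; split.
case: asboolP => _; last first.
  rewrite (_ : [set p | _] = set0); first exact: measurable0.
  by apply/seteqP; split.
rewrite (_ : [set p | _] = \bigcap_(i in [set: 'I_n]) [set p | `|H p.1 p.2 0 i - ratr (c 0 i)| < r.+1%:R^-1]).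
  apply: fin_bigcap_measurable => // i _; have /predictableE := pH i.
  move=> /(_ [set y : R | `|y - ratr (c 0 i)| < r.+1%:R^-1]); apply.
  have := @ball_open R R (ratr (c 0 i)) (r.+1%:R^-1); congr open.
  by apply/seteqP; split => y; rewrite /ball /= distrC.
by apply/seteqP; split => p /= h; [move=> i _|move=> i]; have := h i; rewrite mxE// => /(_ I).
Qed.

Lemma predictable_embedded (M : atlas_space R) q (e : M -> 'rV[R]_q) (H : R -> T -> M) :
  embedding e -> (forall i, predictable F (fun t w => e (H t w) 0 i)) -> predictable F H.
Proof.
move=> [_ _ top _] /predictable_rV pH U /top[V oV ->]; exact: pH.
Qed.

Lemma adm_continuous (E : topologicalType) (f : E -> R) (H : R -> T -> E) :
  continuous f -> predictable F H -> locally_bounded P F H -> adm P F (fun t w => f (H t w)).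
Proof.
move=> cf pH [tau lt h]; split; first exact: predictable_comp.
exists tau => // n; have [C cC hC] := h n; exists (f @` C).
  by apply: continuous_compact => //; exact: continuous_subspaceT.
by move=> t w t0 tt; exists (H t w) => //; exact: hC.
Qed.

Lemma adapted_comp (E1 E2 : topologicalType) (f : E1 -> E2) (X : R -> T -> E1) :
  continuous f -> adapted F X -> adapted F (fun t w => f (X t w)).
Proof. by move=> cf aX t t0 U oU; apply: (aX t t0 (f @^-1` U)); exact: open_comp. Qed.

Section slice.
Variables (n : nat) (z : R -> T -> 'rV[R]_n).
Let zm s w := left_lim (z ^~ w) s.
Let zc a t w : R := z t w 0 a.

(* The equation of [euclidean_sde] for one coordinate Y of the state; the
   coefficient is given, at each time, as a function of z' alone. *)
Definition slice_sde (e : R -> T -> 'rV[R]_n -> R) (Y : R -> T -> R) : Prop :=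
  exists (I1 : 'I_n -> R -> T -> R) (C I2 : 'I_n -> 'I_n -> R -> T -> R),
    [/\ forall a, is_integral P F (fun s w => partials [:: a] (e s w) (zm s w)) (zc a) (I1 a),
        forall a b, is_cont_bracket P F (zc a) (zc b) (C a b),
        forall a b, is_integral P F (fun s w => partials [:: a; b] (e s w) (zm s w)) (C a b) (I2 a b) & 
        {ae P, forall w, forall t, 0 <= t ->
          let J s := e s w (z s w) - e s w (zm s w)
            - \sum_a partials [:: a] (e s w) (zm s w) * jump (zc a ^~ w) s in
          summable `[0, t] (EFin \o J) /\
          Y t w - Y 0 w = \sum_a I1 a t w + 2^-1 * (\sum_a \sum_b I2 a b t w) + sum_over `[0, t] J}].

Lemma slice_driver e Y : slice_sde e Y -> exists Jz C JC, driver P F zc Jz C JC.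
Proof.
move=> [I1 [C [I2 [h1 hC h2 _]]]].
have /choice[Jz hJz] : forall a, exists J, integral_operator P F (zc a) J.
  by move=> a; have [_ _ [J oJ _]] := h1 a; exists J.
have /choice[JC hJC] : forall q : 'I_n * 'I_n, exists J, integral_operator P F (C q.1 q.2) J.
  by move=> q; have [_ _ [J oJ _]] := h2 q.1 q.2; exists J.
by exists Jz, C, (fun a b => JC (a, b)); split => // a b; exact: (hJC (a, b)).
Qed.

Lemma slice_gsolves e Y Jz C JC : driver P F zc Jz C JC -> slice_sde e Y ->
  gsolves P F Jz JC (fun a s w => partials [:: a] (e s w) (zm s w))
    (fun a b s w => partials [:: a; b] (e s w) (zm s w))
    (fun s w => e s w (z s w) - e s w (zm s w)
            - \sum_a partials [:: a] (e s w) (zm s w) * jump (zc a ^~ w) s) Y.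
Proof.
move=> [oz bC oC] [I1 [C' [I2 [h1 hC' h2 h]]]]; split.
- by move=> a; have [] := h1 a.
- by move=> a b; have [] := h2 a b.
- apply: aeW => w; rewrite /zm {1 2}/left_lim ltxx subrr sub0r big1 ?oppr0// => a _.
  by rewrite jump0 mulr0.
have e1 a : indistinguishable P (I1 a) (Jz a (fun s w => partials [:: a] (e s w) (zm s w))).
  have [p l [J oJ eJ]] := h1 a.
  by apply: filterS2 eJ (operator_uniq oJ (oz a) (conj p l)) => w a1 a2 t t0; rewrite a1// a2.
have e2 (q : 'I_n * 'I_n) : indistinguishable P (I2 q.1 q.2) (JC q.1 q.2 (fun s w => partials [:: q.1; q.2] (e s w) (zm s w))).
  case: q => a b /=; have [p l [J oJ eJ]] := h2 a b.
  have := operator_unique oJ (oC a b) _ (conj p l) => /(_ _)/wrap[|u].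
    by apply: filterS (cont_bracket_unique (hC' a b) (bC a b) (oz a) (oz b)) => w u t t0; rewrite !u.
  by apply: filterS2 eJ u => w a1 a2 t t0; rewrite a1// a2.
have one (H : R -> T -> R) : (fun t w => 1 * H t w) = H by apply/funext => ?; apply/funext => ?; rewrite mul1r.
apply: filterS3 h (ae_ord e1) (ae_ord e2) => w h {}e1 {}e2 t t0.
have [s ->] := h t t0; split => //; rewrite /Lfun; congr (_ + _ * _ + _).
  by apply: eq_bigr => a _; rewrite e1// one.
by apply: eq_bigr => a _; apply: eq_bigr => b _; rewrite (e2 (a, b))// one.
Qed.
End slice.

Lemma euclidean_slice m n (K : topologicalType) (Phi : 'rV[R]_(m + (n + n)) -> K -> 'rV[R]_m) k xi (z : R -> T -> 'rV[R]_n) :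
  euclidean_sde P F Phi k xi z <->
  forall i, slice_sde z (fun s w y => Phi (pt3 (left_lim (xi ^~ w) s) y (left_lim (z ^~ w) s)) (k s w) 0 i)
     (fun t w => xi t w 0 i).
Proof.
pose f i s w y := Phi (pt3 (left_lim (xi ^~ w) s) y (left_lim (z ^~ w) s)) (k s w) 0 i.
have E1 i a : (fun s w => partials [:: zp m a] (fun u => Phi u (k s w) 0 i)
      (pt3 (left_lim (xi ^~ w) s) (left_lim (z ^~ w) s) (left_lim (z ^~ w) s))) =
   (fun s w => partials [:: a] (f i s w) (left_lim (z ^~ w) s)).
  by apply/funext => s; apply/funext => w; rewrite -(partials_pt3 [:: a] (fun u => Phi u (k s w) 0 i)).
have E2 i a b : (fun s w => partials [:: zp m a; zp m b] (fun u => Phi u (k s w) 0 i)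
      (pt3 (left_lim (xi ^~ w) s) (left_lim (z ^~ w) s) (left_lim (z ^~ w) s))) =
   (fun s w => partials [:: a; b] (f i s w) (left_lim (z ^~ w) s)).
  by apply/funext => s; apply/funext => w; rewrite -(partials_pt3 [:: a; b] (fun u => Phi u (k s w) 0 i)).
have E3 i w : (fun s => Phi (pt3 (left_lim (xi ^~ w) s) (z s w) (left_lim (z ^~ w) s)) (k s w) 0 i
      - Phi (pt3 (left_lim (xi ^~ w) s) (left_lim (z ^~ w) s) (left_lim (z ^~ w) s)) (k s w) 0 i
      - \sum_a partials [:: zp m a] (fun u => Phi u (k s w) 0 i)
      (pt3 (left_lim (xi ^~ w) s) (left_lim (z ^~ w) s) (left_lim (z ^~ w) s)) * jump (fun t => z t w 0 a) s) =
   (fun s => f i s w (z s w) - f i s w (left_lim (z ^~ w) s)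
       - \sum_a partials [:: a] (f i s w) (left_lim (z ^~ w) s) * jump (fun t => z t w 0 a) s).
  apply/funext => s; congr (_ - _); apply: eq_bigr => a _; congr (_ * _).
  exact: (congr1 (fun g => g s w) (E1 i a)).
split => [h i|h]; last (rewrite /euclidean_sde /= => i); have [I1 [C [I2 [h1 hC h2 h3]]]] := h i; exists I1, C, I2; (split; [|exact: hC| |]).
- move=> a; exact: (eq_ind _ (fun H => is_integral P F H _ (I1 a)) (h1 a) _ (E1 i a)).
- move=> a b; exact: (eq_ind _ (fun H => is_integral P F H (C a b) (I2 a b)) (h2 a b) _ (E2 i a b)).
- by apply: filterS h3 => w h3 t t0; have := h3 t t0; rewrite /= E3.
- move=> a; exact: (eq_ind_r (fun H => is_integral P F H _ (I1 a)) (h1 a) (E1 i a)).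
- move=> a b; exact: (eq_ind_r (fun H => is_integral P F H (C a b) (I2 a b)) (h2 a b) (E2 i a b)).
- by apply: filterS h3 => w h3 t t0; rewrite E3; exact: h3.
Qed.

End predictable_processes.

Lemma smooth_fun_continuous (R : realType) (M : manifold R) (f : M -> R) : smooth_fun f -> continuous f.
Proof.
move=> sf x; have [ch cov] := manifold_atlasP M; have [c Cc cx] := cov x.
have [oc _ ck cm _] := ch c Cc.
apply: (@continuous_at_eq _ _ (fun y => f (cinv c (cmap c y)))).
  by apply: filterS (open_near oc cx) => y cy; rewrite ck.
apply: (@continuous_comp _ _ _ (cmap c) (fun u => f (cinv c u))); first exact: cm.
by apply: (smooth_on_continuous (sf c Cc)); exists x.
Qed.

Lemma embedding_continuous (R : realType) (M : manifold R) q (e : M -> 'rV[R]_q) : embedding e -> continuous e.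
Proof. by move=> [se _ _ _] x; apply: rV_continuous => j; exact: smooth_fun_continuous. Qed.

Lemma smooth_on_cst (R : realType) n (U : set 'rV[R]_n) (a : R) : open U -> smooth_on U (fun=> a).
Proof. by move=> oU; apply/smooth_onP => k; apply: pC_cst; exact: open_fst. Qed.

Lemma smooth_on_coordE (R : realType) n (U : set 'rV[R]_n) (f : 'rV[R]_n -> R) j :
  open U -> (forall u, f u = u 0 j) -> smooth_on U f.
Proof. by move=> oU /funext ->; exact: smooth_on_coord. Qed.

Lemma smooth_fun_cst (R : realType) (M : manifold R) (a : R) : smooth_fun (fun _ : M => a).
Proof.
move=> c Cc; apply: smooth_on_cst; have [ch _] := manifold_atlasP M.
by have [_ ] := ch c Cc.
Qed.

Lemma smooth_funM (R : realType) (M : manifold R) (f g : M -> R) :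
  smooth_fun f -> smooth_fun g -> smooth_fun (fun x => f x * g x).
Proof.
move=> sf sg c Cc; apply: smooth_onM; [|exact: sf|exact: sg].
by have [ch _] := manifold_atlasP M; have [_ ] := ch c Cc.
Qed.

Lemma psmooth_row (R : realType) n p q (K : topologicalType) (W : set ('rV[R]_n * K))
    (f : 'rV[R]_n -> K -> 'rV[R]_p) (g : 'rV[R]_n -> K -> 'rV[R]_q) :
  (forall i, psmooth_on W (fun u k => f u k 0 i)) -> (forall i, psmooth_on W (fun u k => g u k 0 i)) ->
  forall i, psmooth_on W (fun u k => row_mx (f u k) (g u k) 0 i).
Proof.
move=> sf sg i; case: (split_ordP i) => a ->.
  by rewrite (_ : (fun u k => _) = fun u k => f u k 0 a)//; apply/funext => u; apply/funext => k; exact: row_mxEl.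
by rewrite (_ : (fun u k => _) = fun u k => g u k 0 a)//; apply/funext => u; apply/funext => k; exact: row_mxEr.
Qed.

Lemma smooth_precomp (R : realType) n p (dr : 'rV[R]_n -> 'rV[R]_p) : (forall j, smooth_on setT (fun u => dr u 0 j)) ->
  continuous dr /\ forall U, open U -> open [set u | U (dr u)] /\
   forall (K : topologicalType) G, psmooth_on [set q : _ * K | U q.1] G ->
     psmooth_on [set q | U (dr q.1)] (fun u k => G (dr u) k).
Proof.
move=> sdr; have cdr : continuous dr.
  by move=> u; apply: rV_continuous => j; exact: (smooth_on_continuous (sdr j)).
split => // U oU; have od : open [set u | U (dr u)] by apply: open_comp => // u _; exact: cdr.
split => // K G /psmooth_onP sG; apply/psmooth_onP => l.
apply: (@pC_comp _ _ _ _ _ _ _ [set a | U a.1] G (fun u _ => dr u) id) => //.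
- exact: (open_fst od).
- exact: open_fst.
- by move=> u q _; exact: cvg_id.
- move=> j; have /smooth_on_psmooth h := smooth_on_sub (fun _ _ => I) (sdr j) : smooth_on [set u | U (dr u)] _.
  by have /psmooth_onP := h K; exact.
Qed.

Section geometrical_equation.
Variables (R : realType) (d : measure_display) (T : measurableType d).
Variables (P : probability T R) (F : filtration R T).
Variables (M N : manifold R) (K : topologicalType) (Psi : K -> M -> N -> N -> M).
Variables (k : R -> T -> K) (X : R -> T -> M) (Z : R -> T -> N).
Hypothesis sde : geometrical_sde P F Psi k X Z.
Hypotheses (cX : forall w, cadlag (X ^~ w)) (cZ : forall w, cadlag (Z ^~ w)).

(* Applying the equation to the embedding [(i1, f)] and the extension [(Phi, E)]. *)
Lemma coord_sde m n (i1 : M -> 'rV[R]_m) (i2 : N -> 'rV[R]_n) Phi (f : M -> R) O E :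
  embedding i1 -> embedding i2 -> extends_along Psi i1 i2 Phi -> smooth_fun f ->
  open O -> (forall x z' z, O (pt3 (i1 x) (i2 z') (i2 z))) -> psmooth_on [set p | O p.1] E ->
  (forall k x z' z, E (pt3 (i1 x) (i2 z') (i2 z)) k = f (Psi k x z' z)) ->
  slice_sde P F (fun t w => i2 (Z t w))
    (fun s w y => E (pt3 (i1 (llim (X ^~ w) s)) y (i2 (llim (Z ^~ w) s))) (k s w)) (fun t w => f (X t w)).
Proof.
move=> ei1 ei2 [[U1 [oO1 U1i sPhi]] ePhi] sf oO Oi sE eE.
pose i1' x : 'rV[R]_(m + 1) := row_mx (i1 x) (const_mx (f x)).
have ei1' : embedding i1'.
  apply: embedding_row => // j.
  by rewrite (_ : (fun x => _) = f)//; apply/funext => x; rewrite mxE.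
pose dr (u : 'rV[R]_((m + 1) + (n + n))) : 'rV[R]_(m + (n + n)) := pt3 (lsubmx (px u)) (pz' u) (pz u).
have drE x y z' z : dr (pt3 (row_mx x y) z' z) = pt3 x z' z by rewrite /dr pxK pz'K pzK row_mxKl.
have sdr j : smooth_on setT (fun u => dr u 0 j).
  rewrite /dr /pt3; case: (split_ordP j) => a -> /=.
    by apply: (smooth_on_coordE (j := lshift _ (lshift _ a)) openT) => // u; rewrite row_mxEl !mxE.
  by apply: (smooth_on_coordE (j := rshift _ a) openT) => // u; rewrite row_mxEr /pz' /pz hsubmxK mxE.
have [cdr hdr] := smooth_precomp sdr.
have oO2 : open (U1 `&` O) by exact: openI.
have [od sd] := hdr _ oO2.
have sub (G : 'rV[R]_(m + (n + n)) -> K -> R) (U V : set 'rV[R]_(m + (n + n))) : U `<=` V -> psmooth_on [set p | V p.1] G ->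
    psmooth_on [set p | U p.1] G by move=> UV h l u q Uu; apply: h; exact: UV.
pose Phi' u q : 'rV[R]_(m + 1) := row_mx (Phi (dr u) q) (const_mx (E (dr u) q)).
have xPhi' : extends_along Psi i1' i2 Phi'.
  split; last by move=> q x z' z; rewrite /Phi' drE ePhi eE.
  exists [set u | (U1 `&` O) (dr u)]; split => //.
    by move=> x z' z; rewrite /= drE; split; [exact: U1i|exact: Oi].
  apply: psmooth_row => i.
    by apply: (sd K (fun u q => Phi u q 0 i)); apply: sub (sPhi i) => u [].
  have := sd K E; rewrite (_ : (fun u q => _ 0 i) = fun u q => E (dr u) q); last first.
    by apply/funext => u; apply/funext => q; rewrite mxE.
  by apply; apply: sub sE => u [].
have /euclidean_slice/(_ (rshift m ord0)) := sde ei1' ei2 xPhi'.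
have ci1' := embedding_continuous ei1'; have ci2 := embedding_continuous ei2.
have -> : (fun s w y => Phi' (pt3 (left_lim (fun t => i1' (X t w)) s) y (left_lim (fun t => i2 (Z t w)) s)) (k s w) 0 (rshift m ord0))
   = (fun s w y => E (pt3 (i1 (llim (X ^~ w) s)) y (i2 (llim (Z ^~ w) s))) (k s w)).
  apply/funext => s; apply/funext => w; apply/funext => y.
  by rewrite (left_lim_rV _ (cX w) ci1') (left_lim_rV _ (cZ w) ci2) /Phi' row_mxEr mxE drE.
by have -> : (fun t w => i1' (X t w) 0 (rshift m ord0)) = (fun t w => f (X t w)) by
  apply/funext => t; apply/funext => w; rewrite /i1' row_mxEr mxE.
Qed.

Lemma extends_row m n q (i1 : M -> 'rV[R]_m) (i2 : N -> 'rV[R]_n) (f : N -> 'rV[R]_q) Phi :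
  extends_along Psi i1 i2 Phi -> exists Phi', extends_along Psi i1 (fun z => row_mx (i2 z) (f z)) Phi'.
Proof.
move=> [[U1 [oO1 U1i sPhi]] ePhi].
pose dr (u : 'rV[R]_(m + ((n + q) + (n + q)))) : 'rV[R]_(m + (n + n)) := pt3 (px u) (lsubmx (pz' u)) (lsubmx (pz u)).
have drE x z' w' z w : dr (pt3 x (row_mx z' w') (row_mx z w)) = pt3 x z' z by rewrite /dr pxK pz'K pzK !row_mxKl.
have sdr j : smooth_on setT (fun u => dr u 0 j).
  rewrite /dr /pt3; case: (split_ordP j) => a -> /=.
    by apply: (smooth_on_coordE (j := lshift _ a) openT) => // u; rewrite row_mxEl !mxE.
  case: (split_ordP a) => b ->.
    by apply: (smooth_on_coordE (j := rshift _ (lshift _ (lshift _ b))) openT) => // u; rewrite row_mxEr row_mxEl !mxE.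
  by apply: (smooth_on_coordE (j := rshift _ (rshift _ (lshift _ b))) openT) => // u; rewrite row_mxEr row_mxEr !mxE.
have [cdr hdr] := smooth_precomp sdr.
have [od sd] := hdr _ oO1.
exists (fun u h => Phi (dr u) h); split; last by move=> h x z' z; rewrite drE ePhi.
exists [set u | U1 (dr u)]; split => //; first by move=> x z' z; rewrite /= drE.
by move=> i; exact: (sd K _ (sPhi i)).
Qed.

Section extended.
Variables (m n : nat) (i1 : M -> 'rV[R]_m) (i2 : N -> 'rV[R]_n) (Phi : 'rV[R]_(m + (n + n)) -> K -> 'rV[R]_m).
Hypotheses (ei1 : embedding i1) (ei2 : embedding i2) (xPhi : extends_along Psi i1 i2 Phi).

Lemma vanishing_sde O E : 
  open O -> (forall x z' z, O (pt3 (i1 x) (i2 z') (i2 z))) -> psmooth_on [set p | O p.1] E ->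
  (forall k x z' z, E (pt3 (i1 x) (i2 z') (i2 z)) k = 0) ->
  slice_sde P F (fun t w => i2 (Z t w))
    (fun s w y => E (pt3 (i1 (llim (X ^~ w) s)) y (i2 (llim (Z ^~ w) s))) (k s w)) (fun t w => 0).
Proof.
move=> oO Oi sE E0.
exact: (coord_sde ei1 ei2 xPhi (smooth_fun_cst 0) oO Oi sE).
Qed.

(** Even the equation of the zero slice asserts that its integrals exist; its clauses supply
    operators for all coordinates of the driver and all their continuous brackets. *)
Lemma geometrical_driver : exists Jz C JC, driver P F (fun a t w => i2 (Z t w) 0 a) Jz C JC.
Proof.
apply: (slice_driver (z := fun t w => i2 (Z t w))); apply: (@vanishing_sde setT (fun _ _ => 0)) => //; first exact: openT.
by apply/psmooth_onP => l; apply: pC_cst; exact: open_fst openT.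
Qed.
End extended.

Section left_limits.
Variables (m n : nat) (i1 : M -> 'rV[R]_m) (i2 : N -> 'rV[R]_n) (Phi : 'rV[R]_(m + (n + n)) -> K -> 'rV[R]_m).
Hypotheses (ei1 : embedding i1) (ei2 : embedding i2) (xPhi : extends_along Psi i1 i2 Phi).

(** [f] is adjoined as a last coordinate of the embedding of the driver, so [geometrical_driver]
    covers it. *)
Lemma driver_fun f : smooth_fun f -> exists J, integral_operator P F (fun t w => f (Z t w)) J.
Proof.
move=> sf; pose j2 z : 'rV[R]_(n + 1) := row_mx (i2 z) (const_mx (f z)).
have ej2 : embedding j2.
  apply: embedding_row => // j.
  by rewrite (_ : (fun x => _) = f)//; apply/funext => x; rewrite mxE.
have [Phi' xPhi'] := extends_row (fun z => const_mx (f z) : 'rV[R]_1) xPhi.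
have [Jz [_ [_ [h _ _]]]] := geometrical_driver ei1 ej2 xPhi'.
exists (Jz (rshift n ord0)); have := h (rshift n ord0).
by rewrite (_ : (fun t w => _) = fun t w => f (Z t w))//; apply/funext => t; apply/funext => w; rewrite /j2 row_mxEr mxE.
Qed.

(* With [(i2, 0)] as embedding of the driver, [h] times the last coordinate
   extends 0, and [h] is its derivative in the last coordinate. *)
Lemma adm_left_limits U h : open U -> (forall x z, U (row_mx (i1 x) (i2 z))) -> smooth_on U h ->
  adm P F (fun t w => h (row_mx (i1 (llim (X ^~ w) t)) (i2 (llim (Z ^~ w) t)))).
Proof.
move=> oU Ui sh; pose j2 z : 'rV[R]_(n + 1) := row_mx (i2 z) (const_mx 0).
have ej2 : embedding j2.
  apply: embedding_row => // j.
  by rewrite (_ : (fun x => _) = fun=> 0); [exact: smooth_fun_cst|apply/funext => x; rewrite mxE].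
have [Phi' xPhi'] := extends_row (fun z => const_mx 0 : 'rV[R]_1) xPhi.
pose dr (u : 'rV[R]_(m + ((n + 1) + (n + 1)))) : 'rV[R]_(m + n) := row_mx (px u) (lsubmx (pz u)).
have drE x z' z : dr (pt3 x z' z) = row_mx x (lsubmx z) by rewrite /dr pxK pzK.
have sdr j : smooth_on setT (fun u => dr u 0 j).
  rewrite /dr; case: (split_ordP j) => a -> /=.
    by apply: (smooth_on_coordE (j := lshift _ a) openT) => // u; rewrite row_mxEl !mxE.
  by apply: (smooth_on_coordE (j := rshift _ (rshift _ (lshift _ a))) openT) => // u; rewrite row_mxEr !mxE.
have [cdr hdr] := smooth_precomp sdr.
have [od sd] := hdr _ oU.
pose a0 : 'I_(n + 1) := rshift n ord0.
pose E u (_ : K) := h (dr u) * pz' u 0 a0.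
have sE : psmooth_on [set p | U (dr p.1)] E.
  apply: (@smooth_on_psmooth _ _ _ [set u | U (dr u)] (fun u => h (dr u) * pz' u 0 a0)); apply: smooth_onM => //.
    by apply: (smooth_on_comp od oU _ _ sh) => // j; exact: smooth_on_sub (sdr j).
  by apply: (smooth_on_coordE (j := rshift _ (lshift _ a0)) od) => // u; rewrite !mxE.
have Ej x z' z : U (dr (pt3 (i1 x) (j2 z') (j2 z))) by rewrite drE row_mxKl.
have E0 q x z' z : E (pt3 (i1 x) (j2 z') (j2 z)) q = 0.
  by rewrite /E pz'K /j2 row_mxEr mxE mulr0.
have [I1 [C [I2 [h1 _ _ _]]]] := vanishing_sde ei1 ej2 xPhi' od Ej sE E0.
have [p l _] := h1 a0.
suff <- : (fun s w => partials [:: a0] (fun y => E (pt3 (i1 (llim (X ^~ w) s)) y (j2 (llim (Z ^~ w) s))) (k s w))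
   (left_lim (fun t => j2 (Z t w)) s)) = (fun t w => h (row_mx (i1 (llim (X ^~ w) t)) (i2 (llim (Z ^~ w) t)))) by [].
apply/funext => s; apply/funext => w.
set H := h _.
rewrite (_ : (fun y => _) = fun y : 'rV[R]_(n + 1) => H * y 0 a0); last first.
  by apply/funext => y; rewrite /E drE pz'K row_mxKl.
rewrite (@partialsM1 _ _ setT) //; [|exact: smooth_on_cst openT|exact: smooth_on_coord openT].
by rewrite partials1_coord eqxx mulr1 /partials /= derive_cst mulr0 addr0.
Qed.

(** Coordinates determine predictability in an embedded manifold. For local boundedness, the proper
    function of [embedded_proper] turns a real bound into membership in a compact subset of M. *)
Lemma llim_state : predictable F (fun t w => llim (X ^~ w) t) /\ locally_bounded P F (fun t w => llim (X ^~ w) t).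
Proof.
split.
  apply: (predictable_embedded ei1) => i.
  have [p _] := @adm_left_limits setT (fun u => u 0 (lshift n i)) openT (fun _ _ => I) (smooth_on_coord _ openT).
  by move: p; congr predictable; apply/funext => t; apply/funext => w; rewrite row_mxEl.
have [U [h [oU Ui sh hC]]] := embedded_proper ei1.
have [|||_] := @adm_left_limits [set u | U (lsubmx u)] (fun u => h (lsubmx u)).
- by apply: open_comp => // u _; exact: lsubmx_continuous.
- by move=> x z; rewrite /= row_mxKl.
- have oV : open [set u : 'rV[R]_(m + n) | U (lsubmx u)] by apply: open_comp => // u _; exact: lsubmx_continuous.
  apply: (smooth_on_comp oV oU _ _ sh) => // j.
  by apply: (smooth_on_coordE (j := lshift _ j)) => // u; rewrite mxE.
move=> /locally_bounded_real[tau lt hb]; exists tau => // l; have [b hb'] := hb l.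
have [C cC hC'] := hC b; exists C => // t w t0 tt; apply: hC'.
by have := hb' t w t0 tt; rewrite row_mxKl => /(le_trans (ler_norm _)).
Qed.

Lemma llim_driver : predictable F (fun t w => llim (Z ^~ w) t) /\ locally_bounded P F (fun t w => llim (Z ^~ w) t).
Proof.
split.
  apply: (predictable_embedded ei2) => i.
  have [p _] := @adm_left_limits setT (fun u => u 0 (rshift m i)) openT (fun _ _ => I) (smooth_on_coord _ openT).
  by move: p; congr predictable; apply/funext => t; apply/funext => w; rewrite row_mxEr.
have [U [h [oU Ui sh hC]]] := embedded_proper ei2.
have [|||_] := @adm_left_limits [set u | U (rsubmx u)] (fun u => h (rsubmx u)).
- by apply: open_comp => // u _; exact: rsubmx_continuous.
- by move=> x z; rewrite /= row_mxKr.
- have oV : open [set u : 'rV[R]_(m + n) | U (rsubmx u)] by apply: open_comp => // u _; exact: rsubmx_continuous.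
  apply: (smooth_on_comp oV oU _ _ sh) => // j.
  by apply: (smooth_on_coordE (j := rshift _ j)) => // u; rewrite mxE.
move=> /locally_bounded_real[tau lt hb]; exists tau => // l; have [b hb'] := hb l.
have [C cC hC'] := hC b; exists C => // t w t0 tt; apply: hC'.
by have := hb' t w t0 tt; rewrite row_mxKr => /(le_trans (ler_norm _)).
Qed.

End left_limits.
End geometrical_equation.

(** * Composition of geometrical equations *)

Section slice_calculus.
Variables (R : realType) (d : measure_display) (T : measurableType d).
Variables (P : probability T R) (F : filtration R T).
Variables (n : nat) (z : R -> T -> 'rV[R]_n).
Notation zm w s := (left_lim (z ^~ w) s).
Implicit Types (S : R -> T -> 'rV[R]_n -> R).

Definition d1 S a : R -> T -> R := fun s w => partials [:: a] (S s w) (zm w s).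
Definition d2 S a b : R -> T -> R := fun s w => partials [:: a; b] (S s w) (zm w s).
Definition dj S : R -> T -> R := fun s w =>
  S s w (z s w) - S s w (zm w s) - \sum_a d1 S a s w * jump (fun t => z t w 0 a) s.

Lemma sum_dj S s w : \sum_a d1 S a s w * jump (fun t => z t w 0 a) s + dj S s w = S s w (z s w) - S s w (zm w s).
Proof. by rewrite /dj addrC subrK. Qed.

Variables (Jz : 'I_n -> (R -> T -> R) -> R -> T -> R) (C : 'I_n -> 'I_n -> R -> T -> R).
Variable (JC : 'I_n -> 'I_n -> (R -> T -> R) -> R -> T -> R).
Hypothesis dr : driver P F (fun a t w => z t w 0 a) Jz C JC.
Notation solves S Y := (gsolves P F Jz JC (d1 S) (d2 S) (dj S) Y).

Lemma gsolves_eq A B j Y A' B' j' : gsolves P F Jz JC A B j Y ->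
  (forall a t w, A a t w = A' a t w) -> (forall a b t w, B a b t w = B' a b t w) ->
  {ae P, forall w, forall t, 0 <= t -> j t w = j' t w} -> gsolves P F Jz JC A' B' j' Y.
Proof.
move=> [aA aB j0 h] eA eB ej.
have -> : A' = A by apply/funext => a; apply/funext => t; apply/funext => w.
have -> : B' = B by apply/funext => a; apply/funext => b; apply/funext => t; apply/funext => w.
split => //; first by apply: filterS2 j0 ej => w j0 ej; rewrite -ej.
apply: filterS2 h ej => w h ej t t0; have [s e] := h t t0.
have ej' s' : (`[0, t]%classic : set R) s' -> j s' w = j' s' w.
  by rewrite /= in_itv/= => /andP[s0 _]; exact: ej.
split; last by rewrite e; congr (_ + _); apply: eq_sum_over.
move: s; rewrite /summable; congr (_ < _)%E.
by apply: eq_esum => s' /ej' /= ->.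
Qed.

Lemma gsolves_slice S Y : solves S Y -> slice_sde P F z S Y.
Proof.
move=> [aA aB _ h]; have [oz bC oC] := dr.
exists (fun a => Jz a (d1 S a)), C, (fun a b => JC a b (d2 S a b)); split => //.
- by move=> a; have [p l] := aA a; split => //; exists (Jz a) => //; apply: aeW.
- by move=> a b; have [p l] := aB a b; split => //; exists (JC a b) => //; apply: aeW.
apply: filterS h => w h t t0; have [s ->] := h t t0; split => //.
have one (H : R -> T -> R) : (fun t w => 1 * H t w) = H by apply/funext => ?; apply/funext => ?; rewrite mul1r.
rewrite /Lfun; congr (_ + _ * _ + _); first by apply: eq_bigr => a _; rewrite one.
by apply: eq_bigr => a _; apply: eq_bigr => b _; rewrite one.
Qed.

Lemma product_solves S S' Y Y' V :
  (forall s w, exists U, [/\ open U, U (zm w s), smooth_on U (S s w) & smooth_on U (S' s w)]) ->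
  (forall s w, S s w (zm w s) = left_lim (Y ^~ w) s) ->
  (forall s w, S' s w (zm w s) = left_lim (Y' ^~ w) s) ->
  solves (fun s w y => S s w y * S' s w y) V ->
  gsolves P F Jz JC (fun a t w => left_lim (Y ^~ w) t * d1 S' a t w + left_lim (Y' ^~ w) t * d1 S a t w)
   (fun a b t w => left_lim (Y ^~ w) t * d2 S' a b t w + (left_lim (Y' ^~ w) t * d2 S a b t w
       + (d1 S a t w * d1 S' b t w + d1 S b t w * d1 S' a t w)))
   (fun t w => left_lim (Y ^~ w) t * dj S' t w + left_lim (Y' ^~ w) t * dj S t w +
       (\sum_a d1 S a t w * jump (fun t => z t w 0 a) t + dj S t w) *
       (\sum_a d1 S' a t w * jump (fun t => z t w 0 a) t + dj S' t w)) V.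
Proof.
move=> hU hY hY' h; have E1 a s w : d1 (fun s w y => S s w y * S' s w y) a s w =
    left_lim (Y ^~ w) s * d1 S' a s w + left_lim (Y' ^~ w) s * d1 S a s w.
  by have [U [oU Uz sS sS']] := hU s w; rewrite /d1 (partialsM1 a sS sS' Uz) hY hY'.
apply: (gsolves_eq h) => //.
- move=> a b s w; have [U [oU Uz sS sS']] := hU s w.
  by rewrite /d2 (partialsM2 a b oU sS sS' Uz) hY hY'.
- apply: aeW => w s _; rewrite !sum_dj /dj.
  under eq_bigr do rewrite E1.
  rewrite -!hY -!hY'.
  have -> : \sum_a (S s w (zm w s) * d1 S' a s w + S' s w (zm w s) * d1 S a s w) * jump (fun t => z t w 0 a) s =
    S s w (zm w s) * (\sum_a d1 S' a s w * jump (fun t => z t w 0 a) s) +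
    S' s w (zm w s) * (\sum_a d1 S a s w * jump (fun t => z t w 0 a) s).
    by rewrite !mulr_sumr -big_split/=; apply: eq_bigr => a _; rewrite mulrDl !mulrA.
  move: (\sum_a _) (\sum_a _) (S s w _) (S' s w _) (S s w _) (S' s w _) => u1 u2 u3 u4 u5 u6.
  by ring.
Qed.

(* Subtracting [z_b] times the equation of [S] from the equation of [z_b S] leaves only the
   continuous brackets of [z_b] with the integrals of the first derivatives of [S]. *)
Lemma vanishing_tangent S (b : 'I_n) U : (forall w, cadlag (z ^~ w)) -> open U -> (forall s w, U (zm w s)) -> (forall s w, smooth_on U (S s w)) ->
  (forall s w, S s w (z s w) = 0) -> (forall s w, S s w (zm w s) = 0) ->
  solves S (fun _ _ => 0) -> solves (fun s w y => y 0 b * S s w y) (fun _ _ => 0) ->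
  [/\ lnull P F Jz JC (d1 S) (d2 S) (fun s w => - \sum_a d1 S a s w * jump (fun t => z t w 0 a) s),
    lnull P F Jz JC (fun _ _ _ => 0) (fun a c t w => d1 S a t w * (c == b)%:R) (fun _ _ => 0) &
    lnull P F Jz JC (fun _ _ _ => 0) (fun a c t w => (a == b)%:R * d1 S c t w) (fun _ _ => 0)].
Proof.
move=> cz oU Uz sS Sz Szm h hb.
have cb w s : left_lim (fun t => z t w 0 b) s = zm w s 0 b.
  have ci : continuous (id : 'rV[R]_n -> 'rV[R]_n) by move=> v; exact: cvg_id.
  have cc : continuous (fun v : 'rV[R]_n => v 0 b) by exact: coord_continuous.
  by rewrite (left_lim_real _ (cz w) cc) (left_lim_rV _ (cz w) ci).
have E1 a s w : d1 (fun s w y => y 0 b * S s w y) a s w = zm w s 0 b * d1 S a s w.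
  rewrite /d1 (partialsM1 a (smooth_on_coord b oU) (sS s w) (Uz s w)).
  by rewrite Szm mul0r addr0.
have null2 : lnull P F Jz JC (fun _ _ _ => 0) (fun a c t w => d1 S a t w * (c == b)%:R) (fun _ _ => 0).
  apply: (tangent dr h (b0 := b)); apply: (gsolves_eq hb).
  - by move=> a s w; rewrite E1 cb.
  - move=> a c s w; rewrite /d2 (partialsM2 a c oU (smooth_on_coord b oU) (sS s w) (Uz s w)).
    rewrite Szm mul0r add0r !partials1_coord cb /d1.
    by move: (partials _ _ _) (partials _ _ _) (partials _ _ _) => u1 u2 u3; ring.
  - apply: aeW => w s _; rewrite /dj Sz Szm !mulr0 !subr0 !sub0r mulrN mulr_sumr cb.
    by under eq_bigr do rewrite E1 -mulrA.
split => //.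
- apply: (lnull_eq (gsolves_lnull dr h)) => // s w; by rewrite /dj Sz Szm subr0 sub0r.
- have [_ aB _ hB] := null2; split => //.
  + by move=> a; exact: adm0.
  + move=> a c; have := aB c a; congr adm; apply/funext => s; apply/funext => w; exact: mulrC.
  + exact: aeW.
  + move=> H aH; have := hB H aH; apply: filterS2 (Lfun_sym dr aB aH) => w es hs t t0.
    have [s0 e0] := hs t t0; split => //; rewrite -es// in e0; rewrite -[RHS]e0; congr (_ + _).
    congr (_ t w); apply: Lfun_eq => // a c s w'; by rewrite (mulrC (_ == _)%:R).
Qed.

(* [D b] and [DD b] stand for the first and second derivatives of [u_b - pi_ u b], where [pi_]
   is a local retraction onto the driving manifold; [I] localizes to its domain. *)
Lemma tangential_null (I : R -> T -> R) (Fx : 'I_n -> R -> T -> R) (Fxy : 'I_n -> 'I_n -> R -> T -> R)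
   (D : 'I_n -> 'I_n -> R -> T -> R) (DD : 'I_n -> 'I_n -> 'I_n -> R -> T -> R) (dz : 'I_n -> R -> T -> R) :
  adm P F I -> (forall x, adm P F (Fx x)) -> (forall x v, adm P F (Fxy x v)) -> (forall b x, adm P F (D b x)) ->
  (forall b, lnull P F Jz JC (D b) (DD b) (fun s w => - \sum_a D b a s w * dz a s w)) ->
  (forall b b', lnull P F Jz JC (fun _ _ _ => 0) (fun a c s w => D b a s w * (c == b')%:R) (fun _ _ => 0)) ->
  (forall b b', lnull P F Jz JC (fun _ _ _ => 0) (fun a c s w => (a == b')%:R * D b c s w) (fun _ _ => 0)) ->
  (forall s w, I s w != 0 -> (forall x, Fx x s w = \sum_b Fx b s w * D b x s w) /\
     (forall x v, Fxy x v s w = \sum_(q : 'I_n * 'I_n) Fxy q.1 q.2 s w *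
        (D q.1 x s w * (v == q.2)%:R + (x == q.1)%:R * D q.2 v s w - D q.1 x s w * D q.2 v s w)
        + \sum_b Fx b s w * DD b x v s w)) ->
  lnull P F Jz JC (fun x s w => I s w * Fx x s w) (fun x v s w => I s w * Fxy x v s w)
    (fun s w => I s w * - \sum_x Fx x s w * dz x s w).
Proof.
move=> aI aF aFF aD n1 n2 n3 local.
have IF x s w : \sum_b I s w * Fx b s w * D b x s w = I s w * Fx x s w.
  have [I0|/local[h _]] := eqVneq (I s w) 0; last first.
    by rewrite [in RHS]h mulr_sumr; apply: eq_bigr => b _; rewrite mulrA.
  by rewrite I0 mul0r big1// => b _; rewrite !mul0r.
have aIF x : adm P F (fun s w => I s w * Fx x s w) by exact: admM.
have aIFF x v : adm P F (fun s w => I s w * Fxy x v s w) by exact: admM.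
have N1 := lnull_sum dr (index_enum 'I_n) (fun b => lnull_scale dr (n1 b) (aIF b)).
have Nq (q : 'I_n * 'I_n) : lnull P F Jz JC (fun _ _ _ => 0) (fun x v s w => I s w * Fxy q.1 q.2 s w *
    (D q.1 x s w * (v == q.2)%:R + (x == q.1)%:R * D q.2 v s w - D q.1 x s w * D q.2 v s w)) (fun _ _ => 0).
  have n23 := lnull_scale dr (lnull_add dr (n2 q.1 q.2) (n3 q.2 q.1)) (aIFF q.1 q.2).
  have n4 := lnull_sum dr (index_enum 'I_n) (fun b => lnull_scale dr (n2 q.1 b) (admM (admN (aIFF q.1 q.2)) (aD q.2 b))).
  apply: (lnull_eq (lnull_add dr n23 n4)) => [x s w|x v s w|s w].
  - by rewrite addr0 mulr0 big1 ?addr0// => b _; rewrite mulr0.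
  - rewrite (bigD1 v)//= eqxx big1 ?addr0; last by move=> b /negbTE; rewrite eq_sym => ->; rewrite !mulr0.
    by rewrite (_ : true%:R = 1 :> R)//; ring.
  - by rewrite addr0 mulr0 big1 ?addr0// => b _; rewrite mulr0.
have N2 := lnull_sum dr (index_enum ('I_n * 'I_n)%type) Nq.
apply: (lnull_eq (lnull_add dr N1 N2)) => [x s w|x v s w|s w].
- by rewrite [X in _ + X]big1 ?addr0//; exact: IF.
- have [I0|/local[_ h]] := eqVneq (I s w) 0.
    by rewrite I0 mul0r !big1 ?addr0// => b _; rewrite !mul0r.
  rewrite [in RHS]h mulrDr addrC !mulr_sumr; congr (_ + _); apply: eq_bigr => b _; by rewrite mulrA.
- rewrite [X in _ + X]big1 ?addr0// mulrN mulr_sumr.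
  under eq_bigr do rewrite mulrN mulr_sumr.
  rewrite sumrN; congr (- _); rewrite exchange_big/=; apply: eq_bigr => x _.
  by rewrite mulrA -IF mulr_suml; apply: eq_bigr => b _; rewrite mulrA.
Qed.

End slice_calculus.

Lemma extension_slice (R : realType) (M N : atlas_space R) (K : topologicalType)
    (Psi : K -> M -> N -> N -> M) m n (i1 : M -> 'rV[R]_m) (i2 : N -> 'rV[R]_n) Phi x z0 k :
  extends_along Psi i1 i2 Phi -> exists U, [/\ open U, forall z, U (i2 z) &
    forall i, smooth_on U (fun y => Phi (pt3 (i1 x) y (i2 z0)) k 0 i)].
Proof.
move=> [[W [oW Wi sW]] _]; exists [set y | W (pt3 (i1 x) y (i2 z0))]; split.
- exact: open_slice_pt3.
- by move=> z; exact: Wi.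
- by move=> i; exact: (@smooth_slice _ _ _ _ W (fun u k => Phi u k 0 i)).
Qed.

Lemma partialsB (R : realType) n (l : seq 'I_n) (U : set 'rV[R]_n) f h u : open U -> smooth_on U f -> smooth_on U h -> U u ->
  partials l (fun v => f v - h v) u = partials l f u - partials l h u.
Proof.
move=> oU sf sh; elim: l u => [//|a l IH] u Uu /=.
have near : \forall v \near u, partials l (fun v => f v - h v) v = partials l f v - partials l h v.
  by apply: filterS (open_near oU Uu) => v; exact: IH.
have := partials_near [:: a] near; rewrite /= => ->.
exact: (deriveB ((sf l u Uu).1 a) ((sh l u Uu).1 a)).
Qed.

Section composed_equations.
Variables (R : realType) (d : measure_display) (T : measurableType d).
Variables (P : probability T R) (F : filtration R T).
Variables (M N L : manifold R) (K G : topologicalType).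
Variables (Psi1 : K -> M -> L -> L -> M) (Psi2 : G -> L -> N -> N -> L) (Psih : (K * G)%type -> M -> N -> N -> M).
Variables (k : R -> T -> K) (g : R -> T -> G) (X : R -> T -> M) (Y : R -> T -> L) (Z : R -> T -> N).
Hypotheses (sde1 : geometrical_sde P F Psi1 k X Y) (sde2 : geometrical_sde P F Psi2 g Y Z).
Hypotheses (cX : forall w, cadlag (X ^~ w)) (cY : forall w, cadlag (Y ^~ w)) (cZ : forall w, cadlag (Z ^~ w)).
Hypothesis aZ : adapted F Z.
Hypothesis Psi_comp : forall q x y z' z, Psi1 q.1 x (Psi2 q.2 y z' z) y = Psih q x z' z.
Hypotheses (Psi1_id : forall k x y, Psi1 k x y y = x) (Psi2_id : forall g y z, Psi2 g y z z = y).
Variables (m n p : nat) (i1 : M -> 'rV[R]_m) (i2 : N -> 'rV[R]_n) (e : L -> 'rV[R]_p).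
Hypotheses (ei1 : embedding i1) (ei2 : embedding i2) (ee : embedding e).
Variables (Phi1 : 'rV[R]_(m + (p + p)) -> K -> 'rV[R]_m) (Phi2 : 'rV[R]_(p + (n + n)) -> G -> 'rV[R]_p).
Hypotheses (x1 : extends_along Psi1 i1 e Phi1) (x2 : extends_along Psi2 e i2 Phi2).

Let x_ s w := i1 (llim (X ^~ w) s).
Let y_ s w := e (llim (Y ^~ w) s).
Let z_ s w := i2 (llim (Z ^~ w) s).
Let y t w := e (Y t w).
Let z t w := i2 (Z t w).
Let S1 i s w v := Phi1 (pt3 (x_ s w) v (y_ s w)) (k s w) 0 i.
Let phi s w v := Phi2 (pt3 (y_ s w) v (z_ s w)) (g s w).
Let S2 a s w v := phi s w v 0 a.

Let zmE s w : left_lim (z ^~ w) s = z_ s w.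
Proof. exact: (left_lim_rV s (cZ w) (embedding_continuous ei2)). Qed.

Let ymE s w : left_lim (y ^~ w) s = y_ s w.
Proof. exact: (left_lim_rV s (cY w) (embedding_continuous ee)). Qed.

Let cz' w : cadlag (z ^~ w).
Proof. exact: (cadlag_comp (f := i2) (cZ w) (embedding_continuous ei2)). Qed.

Let embedded_coord (A : manifold R) q (f : A -> 'rV[R]_q) j : embedding f -> continuous (fun v => f v 0 j).
Proof. by move=> [sf _ _ _]; exact: smooth_fun_continuous. Qed.

Let yamE a s w : left_lim (fun t => y t w 0 a) s = y_ s w 0 a.
Proof. exact: (left_lim_real s (cY w) (embedded_coord (f := e) (j := a) ee)). Qed.

Let phi_z s w v : phi s w (i2 v) = e (Psi2 (g s w) (llim (Y ^~ w) s) v (llim (Z ^~ w) s)).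
Proof. by have [_ h] := x2; rewrite /phi h. Qed.

Let phi_zm s w : phi s w (z_ s w) = y_ s w.
Proof. by rewrite phi_z Psi2_id. Qed.

Let S1_ym i s w : S1 i s w (y_ s w) = x_ s w 0 i.
Proof. by have [_ h] := x1; rewrite /S1 h Psi1_id. Qed.

Let S1_y i s w v : S1 i s w (e v) = i1 (Psi1 (k s w) (llim (X ^~ w) s) v (llim (Y ^~ w) s)) 0 i.
Proof. by have [_ h] := x1; rewrite /S1 h. Qed.

Variables (Jz : 'I_n -> (R -> T -> R) -> R -> T -> R) (C : 'I_n -> 'I_n -> R -> T -> R).
Variable (JC : 'I_n -> 'I_n -> (R -> T -> R) -> R -> T -> R).
Hypothesis dr : driver P F (fun a t w => z t w 0 a) Jz C JC.
Variables (Jy : 'I_p -> (R -> T -> R) -> R -> T -> R) (C1 : 'I_p -> 'I_p -> R -> T -> R).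
Variable (JC1 : 'I_p -> 'I_p -> (R -> T -> R) -> R -> T -> R).
Hypothesis dr1 : driver P F (fun a t w => y t w 0 a) Jy C1 JC1.
Notation solves S Y := (gsolves P F Jz JC (d1 z S) (d2 z S) (dj z S) Y).

Let solves1 i : gsolves P F Jy JC1 (d1 y (S1 i)) (d2 y (S1 i)) (dj y (S1 i)) (fun t w => i1 (X t w) 0 i).
Proof.
apply: (slice_gsolves dr1); have [[W [oW Wi sW]] eP] := x1; have [si _ _ _] := ei1.
by apply: (coord_sde sde1 cX cY ei1 ee x1 (si i) oW Wi (sW i)) => q x a b; rewrite eP.
Qed.

Let solves2 a : solves (S2 a) (fun t w => y t w 0 a).
Proof.
apply: (slice_gsolves dr); have [[W [oW Wi sW]] eP] := x2; have [se _ _ _] := ee.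
by apply: (coord_sde sde2 cY cZ ee ei2 x2 (se a) oW Wi (sW a)) => q x c b; rewrite eP.
Qed.

Let solves22 a b : solves (fun s w v => S2 a s w v * S2 b s w v) (fun t w => y t w 0 a * y t w 0 b).
Proof.
apply: (slice_gsolves dr); have [[W [oW Wi sW]] eP] := x2; have [se _ _ _] := ee.
have sE : psmooth_on [set q | W q.1] (fun u h => Phi2 u h 0 a * Phi2 u h 0 b).
  apply/psmooth_onP => l; have /psmooth_onP s1 := sW a; have /psmooth_onP s2 := sW b.
  by apply: pCM => //; exact: open_fst.
by apply: (coord_sde sde2 cY cZ ee ei2 x2 (smooth_funM (se a) (se b)) oW Wi sE) => q x c v; rewrite eP.
Qed.

Let az a : adapted F (fun t w => z t w 0 a).
Proof. exact: (adapted_comp (f := fun v => i2 v 0 a) (embedded_coord (j := a) ei2) aZ). Qed.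

Let cz a w : cadlag (fun t => z t w 0 a).
Proof. exact: (cadlag_comp (f := fun v => i2 v 0 a) (cZ w) (embedded_coord (j := a) ei2)). Qed.

Let azz a b : adapted F (fun t w => z t w 0 a * z t w 0 b).
Proof.
have [se _ _ _] := ei2.
exact: (adapted_comp (smooth_fun_continuous (smooth_funM (se a) (se b))) aZ).
Qed.

Let ozz a b : exists J, integral_operator P F (fun t w => z t w 0 a * z t w 0 b) J.
Proof.
have [se _ _ _] := ei2.
exact: (driver_fun sde2 cY cZ ee ei2 x2 (smooth_funM (se a) (se b))).
Qed.

Let smooth_phi s w : exists U, [/\ open U, forall v, U (i2 v) & forall a, smooth_on U (S2 a s w)].
Proof. exact: extension_slice x2. Qed.

Let bracket a b H : adm P F H -> indistinguishable P (JC1 a b H)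
  (Lfun Jz JC (fun _ _ _ => 0) (fun x v t w => d1 z (S2 a) x t w * d1 z (S2 b) v t w
     + d1 z (S2 a) v t w * d1 z (S2 b) x t w) H).
Proof.
move=> aH; have [oy by_ oC1] := dr1.
have cy c w : cadlag (fun t => y t w 0 c) by exact: (cadlag_comp (f := fun v => e v 0 c) (cY w) (embedded_coord (j := c) ee)).
apply: (bracket_operator dr az cz azz ozz (solves2 a) (solves2 b) _ (cy a) (cy b) (oy a) (oy b) (by_ a b) (oC1 a b) aH).
apply: (product_solves _ _ _ (solves22 a b)).
- move=> s w; have [U [oU Ui sU]] := smooth_phi s w; exists U; split => //.
  by rewrite zmE; exact: Ui.
- by move=> s w; rewrite zmE yamE /S2 phi_zm.
- by move=> s w; rewrite zmE yamE /S2 phi_zm.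
Qed.

(** The equation of [y] fixes its jumps by [gsolves_jump], and [phi] at the left limit of [z] is the
    left limit of [y]. At time 0 both sides agree by the convention on left limits. *)
Let jump_formula : {ae P, forall w, forall s, 0 <= s -> y s w = phi s w (z s w)}.
Proof.
have cy c w : cadlag (fun t => y t w 0 c) by exact: (cadlag_comp (f := fun v => e v 0 c) (cY w) (embedded_coord (j := c) ee)).
have h a := gsolves_jump dr az cz azz ozz (solves2 a) (cy a).
apply: filterS (ae_ord h) => w {}h s s0; apply/rowP => a.
have [s00|] := ltP 0 s; last first.
  move=> s00; have -> : s = 0 by apply/eqP; rewrite eq_le s00.
  have -> : z 0 w = z_ 0 w by rewrite /z_ /llim ltxx.
  by rewrite phi_zm /y_ /llim ltxx.
have := h a s s00; rewrite sum_dj /jump yamE zmE /S2 phi_zm => /eqP.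
by rewrite (inj_eq (addIr _)) => /eqP.
Qed.

Let T1 i x s w := \sum_a d1 y (S1 i) a s w * d1 z (S2 a) x s w.
Let T2 i x v s w := \sum_(q : 'I_p * 'I_p) d2 y (S1 i) q.1 q.2 s w * (d1 z (S2 q.1) x s w * d1 z (S2 q.2) v s w)
   + \sum_a d1 y (S1 i) a s w * d2 z (S2 a) x v s w.

(** By [jump_formula] and [Psi_comp] the displacement at a jump is already the intrinsic one given
    by [Psih]; only the first- and second-order coefficients still depend on the composite
    extension. *)
Let solves_comp i : gsolves P F Jz JC (T1 i) (T2 i)
  (fun s w => i1 (Psih (k s w, g s w) (llim (X ^~ w) s) (Z s w) (llim (Z ^~ w) s)) 0 i - x_ s w 0 i
      - \sum_a T1 i a s w * jump (fun t => z t w 0 a) s) (fun t w => i1 (X t w) 0 i).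
Proof.
apply: (gsolves_eq (gsolves_comp dr dr1 (solves1 i) solves2 bracket)) => //.
apply: filterS jump_formula => w h s s0.
have e1 : S1 i s w (y s w) = i1 (Psih (k s w, g s w) (llim (X ^~ w) s) (Z s w) (llim (Z ^~ w) s)) 0 i.
  by rewrite h// phi_z S1_y (Psi_comp (k s w, g s w)).
rewrite /dj e1 ymE S1_ym -addrA; congr (_ + _).
under [X in _ + X = _]eq_bigr => a _.
  rewrite [X in _ * (X - _ - _)](_ : _ = y s w 0 a); last by rewrite h.
  rewrite zmE /S2 phi_zm mulrBr mulr_sumr.
  over.
have ej a : jump (fun t => y t w 0 a) s = y s w 0 a - y_ s w 0 a by rewrite /jump yamE.
rewrite sumrB; under eq_bigr do rewrite ej.
rewrite addrA addNr add0r; congr (- _).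
rewrite exchange_big/=; apply: eq_bigr => x _.
by rewrite /T1 mulr_suml; apply: eq_bigr => a _; rewrite mulrA.
Qed.

Variable Phih : 'rV[R]_(m + (n + n)) -> (K * G)%type -> 'rV[R]_m.
Hypothesis xh : extends_along Psih i1 i2 Phih.
Hypotheses (pkg : predictable F (fun t w => (k t w, g t w))) (bkg : locally_bounded P F (fun t w => (k t w, g t w))).
Let Sh i s w v := Phih (pt3 (x_ s w) v (z_ s w)) (k s w, g s w) 0 i.

Let Sh_z i s w v : Sh i s w (i2 v) = i1 (Psih (k s w, g s w) (llim (X ^~ w) s) v (llim (Z ^~ w) s)) 0 i.
Proof. by have [_ h] := xh; rewrite /Sh h. Qed.

(** The coefficients of the given extension are continuous functions of the left limits of [X] and
    [Z] and of the pair [(k, g)], all predictable and locally bounded. *)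
Let adm_Sh i l : adm P F (fun s w => partials l (Sh i s w) (left_lim (z ^~ w) s)).
Proof.
have [[W [oW Wi sW]] _] := xh.
pose h (q : M * (N * (K * G))) := partials (map (@zp m n) l) (fun u => Phih u q.2.2 0 i)
  (pt3 (i1 q.1) (i2 q.2.1) (i2 q.2.1)).
have ch : continuous h.
  move=> q; have [_ c] := sW i (map (@zp m n) l) (pt3 (i1 q.1) (i2 q.2.1) (i2 q.2.1)) q.2.2 (Wi _ _ _).
  have cq2 : {for q, continuous (fun q : M * (N * (K * G)) => q.2)} by exact: cvg_snd.
  have cz2 : {for q, continuous (fun q : M * (N * (K * G)) => i2 q.2.1)}.
    apply: (continuous_comp (f := fun q : M * (N * (K * G)) => q.2) (g := fun r => i2 r.1)) => //.
    apply: (continuous_comp (f := fun r : N * (K * G) => r.1) (g := i2)); first exact: cvg_fst.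
    exact: embedding_continuous.
  have cq : {for q, continuous (fun q : M * (N * (K * G)) => (pt3 (i1 q.1) (i2 q.2.1) (i2 q.2.1), q.2.2))}.
    apply: continuous_pair; last first.
      by apply: (continuous_comp (f := fun q : M * (N * (K * G)) => q.2) (g := fun r => r.2)) => //; exact: cvg_snd.
    apply: row_mx_continuous; last exact: row_mx_continuous.
    apply: (continuous_comp (f := fun q : M * (N * (K * G)) => q.1) (g := i1)); first exact: cvg_fst.
    exact: embedding_continuous.
  exact: (continuous_comp cq c).
have [pX bX] := llim_state sde1 cX cY ei1 ee x1; have [pZ bZ] := llim_driver sde2 cY cZ ee ei2 x2.
have [_ scM _ _ _] := manifold_axioms M; have [_ scN _ _ _] := manifold_axioms N.
have := adm_continuous ch (predictable_pair scM pX (predictable_pair scN pZ pkg))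
  (locally_bounded2 bX (locally_bounded2 bZ bkg)).
congr (adm P F); apply/funext => s; apply/funext => w.
by rewrite /h /= (partials_pt3 l (fun u => Phih u (k s w, g s w) 0 i)) zmE.
Qed.

Let Fx i x s w := d1 z (Sh i) x s w - T1 i x s w.
Let Fxy i x v s w := d2 z (Sh i) x v s w - T2 i x v s w.

Let adm_Fx i x : adm P F (Fx i x).
Proof. by apply: admB; [exact: (adm_Sh i [:: x])|have [h _ _ _] := solves_comp i; exact: h]. Qed.

Let adm_Fxy i x v : adm P F (Fxy i x v).
Proof. by apply: admB; [exact: (adm_Sh i [:: x; v])|have [_ h _ _] := solves_comp i; exact: h]. Qed.

(** [Fx] and [Fxy] are the derivatives of the given extension minus the composite one. This
    difference vanishes on the image of N because both extend [Psih]. *)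
Let F_slice i s w : exists U f, [/\ open U, U (z_ s w), smooth_on U f,
  forall v, f (i2 v) = 0 & (forall x, partials [:: x] f (z_ s w) = Fx i x s w) /\
   forall x v, partials [:: x; v] f (z_ s w) = Fxy i x v s w].
Proof.
have [U1 [oU1 U1i sU1]] := extension_slice (llim (X ^~ w) s) (llim (Y ^~ w) s) (k s w) x1.
have [U2 [oU2 U2i sU2]] := smooth_phi s w.
have [U3 [oU3 U3i sU3]] := extension_slice (llim (X ^~ w) s) (llim (Z ^~ w) s) (k s w, g s w) xh.
pose U12 := [set v | U2 v /\ U1 (phi s w v)].
have oU12 : open U12.
  apply: (open_preim oU2) => // v Uv; apply: rV_continuous => a.
  exact: (smooth_on_continuous (sU2 a) Uv).
have Uz v : U12 (i2 v) by split => //; rewrite phi_z; exact: U1i.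
have U12U1 v : U12 v -> U1 (phi s w v) by case.
have sphi a : smooth_on U12 (fun v => phi s w v 0 a) by apply: smooth_on_sub (sU2 a) => v [].
have sc : smooth_on U12 (fun v => S1 i s w (phi s w v)) := smooth_on_comp oU12 oU1 U12U1 sphi (sU1 i).
have oU : open (U3 `&` U12) by exact: openI.
have sh' : smooth_on (U3 `&` U12) (Sh i s w) by apply: smooth_on_sub (sU3 i) => v [].
have sc' : smooth_on (U3 `&` U12) (fun v => S1 i s w (phi s w v)) by apply: smooth_on_sub sc => v [].
have Uzm : (U3 `&` U12) (z_ s w) by split; [exact: U3i|exact: Uz].
exists (U3 `&` U12), (fun v => Sh i s w v - S1 i s w (phi s w v)); split => //.
- apply/smooth_onP => l; have /smooth_onP h1 := sh'; have /smooth_onP h2 := sc'.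
  by apply: pCB; [exact: open_fst|exact: h1|exact: h2].
- by move=> v; rewrite Sh_z phi_z S1_y (Psi_comp (k s w, g s w)) subrr.
split=> [x|x v].
- rewrite (partialsB [:: x] oU sh' sc' Uzm) (partials_chain1 x oU12 oU1 U12U1 sphi (sU1 i)); last exact: Uz.
  by rewrite /Fx /T1 /d1 zmE ymE phi_zm.
- rewrite (partialsB [:: x; v] oU sh' sc' Uzm) (partials_chain2 x v oU12 oU1 U12U1 sphi (sU1 i)); last exact: Uz.
  by rewrite /Fxy /T2 /d2 /d1 zmE ymE phi_zm.
Qed.

Let vanishing_solves f : smooth_on setT f -> (forall v, f (i2 v) = 0) -> solves (fun _ _ => f) (fun _ _ => 0).
Proof.
move=> sf f0; apply: (slice_gsolves dr).
have sE : psmooth_on [set q : 'rV[R]_(p + (n + n)) * G | setT q.1] (fun u _ => f (pz' u)).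
  apply: (@smooth_on_psmooth _ _ _ setT (fun u : 'rV[R]_(p + (n + n)) => f (pz' u))).
  apply: (smooth_on_comp (V := setT) (f := f) (phi := @pz' R p n) openT openT) => // j.
  by apply: (smooth_on_coordE (j := rshift _ (lshift _ j)) openT) => u; rewrite /pz' !mxE.
have := vanishing_sde sde2 cY cZ ee ei2 x2 openT (fun _ _ _ => I) sE.
have -> : (fun s w v => f (pz' (pt3 (e (llim (Y ^~ w) s)) v (i2 (llim (Z ^~ w) s))))) = (fun (_ : R) (_ : T) => f).
  by apply/funext => s; apply/funext => w; apply/funext => v; rewrite pz'K.
by apply=> _ x z' z0; rewrite pz'K.
Qed.

Let F_null i : lnull P F Jz JC (Fx i) (Fxy i) (fun s w => - \sum_x Fx i x s w * jump (fun t => z t w 0 x) s).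
Proof.
have [cr [pi_ [cr0 cov spi pi1 pi2]]] := retraction_family ei2.
pose S c : set (R * T) := [set q | ball_dom cr c (z_ q.1 q.2)].
have oS c : open (ball_dom cr c) by exact: open_ball_dom.
have [pZ _] := llim_driver sde2 cY cZ ee ei2 x2.
have mS c : measurable (S c : set (pred_type F)).
  have /predictableE h := predictable_comp (embedding_continuous ei2) pZ; exact: h.
apply: (@lnull_glue _ _ _ _ _ _ _ _ _ _ dr _ _ _ S) => //; last 2 first.
- move=> c; pose I s w : R := \1_(S c) (s, w).
  have aI : adm P F I by exact: adm_indic.
  (* The bump makes the defect of the local retraction smooth on the whole space while keeping it 0
     on the image of N, so the vanishing equation applies to it. On the small ball the bump is 1,
     and the derivatives are those of the defect. *)
  pose E b (v : 'rV[R]_n) := ball_chi cr c v * (v 0 b - pi_ c v 0 b).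
  have sE b : smooth_on setT (E b).
    apply/smooth_onP => l; rewrite /sC.
    have -> : [set q : 'rV[R]_n * R | setT q.1] = setT by apply/seteqP; split.
    apply: pC_chi_mul => // c0 r crc; have oB : open [set q : 'rV[R]_n * R | ball_dom2 cr c q.1].
      by apply: open_fst; exact: open_ball_dom2.
    apply: pCB => //; first exact: pC_coord.
    by have /smooth_onP := spi c b; exact.
  have E0 b v : E b (i2 v) = 0.
    rewrite /E; have [->|/(ball_chi_supp cr0) h] := eqVneq (ball_chi cr c (i2 v)) 0; first by rewrite mul0r.
    by rewrite pi1// subrr mulr0.
  have nE b b' : [/\ lnull P F Jz JC (d1 z (fun _ _ => E b)) (d2 z (fun _ _ => E b)) (fun s w => - \sum_a d1 z (fun _ _ => E b) a s w * jump (fun t => z t w 0 a) s),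
    lnull P F Jz JC (fun _ _ _ => 0) (fun a v t w => d1 z (fun _ _ => E b) a t w * (v == b')%:R) (fun _ _ => 0) &
    lnull P F Jz JC (fun _ _ _ => 0) (fun a v t w => (a == b')%:R * d1 z (fun _ _ => E b) v t w) (fun _ _ => 0)].
    apply: (vanishing_tangent dr (U := setT)) => //.
    + exact: openT.
    + by move=> s w; exact: E0.
    + by move=> s w; rewrite zmE; exact: E0.
    + exact: vanishing_solves.
    + apply: (@vanishing_solves (fun v => v 0 b' * E b v)); last by move=> v; rewrite E0 mulr0.
      by apply: smooth_onM => //; [exact: openT|exact: smooth_on_coord openT].
  pose D b := d1 z (fun _ _ => E b); pose DD b := d2 z (fun _ _ => E b).
  have aD b x : adm P F (D b x) by have [[h _ _ _] _ _] := nE b b; exact: h.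
  have local s w : I s w != 0 -> (forall x, Fx i x s w = \sum_b Fx i b s w * D b x s w) /\
     (forall x v, Fxy i x v s w = \sum_(q : 'I_n * 'I_n) Fxy i q.1 q.2 s w *
        (D q.1 x s w * (v == q.2)%:R + (x == q.1)%:R * D q.2 v s w - D q.1 x s w * D q.2 v s w)
        + \sum_b Fx i b s w * DD b x v s w).
    rewrite /I indicE; case: (boolP ((s, w) \in S c)) => [/set_mem /= Sz _|]; last by rewrite eqxx.
    have [U [f [oU Uz sf f0 [f1 f2]]]] := F_slice i s w.
    have oB : open (ball_dom2 cr c) by exact: open_ball_dom2.
    have Bz : ball_dom2 cr c (z_ s w).
      by apply: (ball_chi_supp cr0); rewrite (ball_chi1 cr0 Sz) oner_neq0.
    have DE b l : partials l (E b) (z_ s w) = partials l (fun v : 'rV[R]_n => v 0 b - pi_ c v 0 b) (z_ s w).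
      apply: partials_near; apply: filterS (open_near (oS c) Sz) => v vB.
      by rewrite /E ball_chi1// mul1r.
    have [] := @vanishing_partials _ _ U (ball_dom2 cr c) f (pi_ c) (z_ s w) oU oB Uz Bz sf (spi c) (pi1 _ _ Bz).
      by move=> v /pi2[v' ->].
    move=> h1 h2; split => [x|x v].
    - rewrite -(f1 x) (h1 x); apply: eq_bigr => b _; rewrite f1 /D /d1 zmE.
      by rewrite (DE b [:: x]).
    - rewrite -(f2 x v) (h2 x v); apply: (congr2 +%R); apply: eq_bigr => b _.
        by rewrite f2 /D /d1 zmE (DE b.1 [:: x]) (DE b.2 [:: v]).
      by rewrite f1 /DD /d2 zmE (DE b [:: x; v]).
  apply: (tangential_null dr (D := D) (DD := DD)) => //.
  + by move=> b; have [h _ _] := nE b b.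
  + by move=> b b'; have [_ h _] := nE b b'.
  + by move=> b b'; have [_ _ h] := nE b b'.
- move=> w t; have [||N0 hN] := left_lim_finite_cover t (cz' w) oS.
  + by move=> s _; exact: cov.
  + by move=> s _; rewrite zmE; exact: cov.
  exists N0 => s s0 st; have [c cN h] := hN s s0 st; exists c => //.
  by rewrite /S /= -zmE.
- by apply: aeW => w; rewrite big1 ?oppr0// => x _; rewrite jump0 mulr0.
Qed.

Lemma composed_sde : euclidean_sde P F Phih (fun t w => (k t w, g t w)) (fun t w => i1 (X t w)) (fun t w => i2 (Z t w)).
Proof.
apply/euclidean_slice => i.
have -> : (fun s w v => Phih (pt3 (left_lim (fun t => i1 (X t w)) s) v (left_lim (fun t => i2 (Z t w)) s)) (k s w, g s w) 0 i) = Sh i.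
  apply/funext => s; apply/funext => w; apply/funext => v.
  by rewrite (left_lim_rV _ (cX w) (embedding_continuous ei1)) (left_lim_rV _ (cZ w) (embedding_continuous ei2)).
apply: (gsolves_slice dr); apply: (gsolves_eq (gsolves_lnull_add dr (solves_comp i) (F_null i))) => [x s w|x v s w|].
- by rewrite /Fx addrC subrK.
- by rewrite /Fxy addrC subrK.
apply: aeW => w s _; rewrite /dj zmE [in RHS]/z !Sh_z.
have -> : i1 (Psih (k s w, g s w) (llim (X ^~ w) s) (llim (Z ^~ w) s) (llim (Z ^~ w) s)) 0 i = x_ s w 0 i.
  rewrite -(Psi_comp (k s w, g s w) _ (llim (Y ^~ w) s)) Psi2_id Psi1_id //.
rewrite -addrA -opprD -big_split/=; congr (_ - _); apply: eq_bigr => x _.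
by rewrite -mulrDl /Fx addrC subrK.
Qed.

End composed_equations.

(** * The equation with transformed noise *)

(** The parameter space [K] of the theorem is an arbitrary metric space, so the countable base has
    to come from the second factor, the Lie group [G]. *)
Lemma predictable_pairC (R : realType) (d : measure_display) (T : measurableType d)
  (F : filtration R T) (E1 E2 : topologicalType) (H1 : R -> T -> E1) (H2 : R -> T -> E2) :
  @second_countable E2 -> predictable F H1 -> predictable F H2 ->
  predictable F (fun t w => (H1 t w, H2 t w)).
Proof.
move=> sc p1 p2; have cs : continuous (fun q : E2 * E1 => (q.2, q.1)).
  by move=> q; apply: continuous_pair; [exact: cvg_snd|exact: cvg_fst].
exact: (predictable_comp cs (predictable_pair sc p2 p1)).
Qed.

Theorem theorem2p9 (R : realType) (d : measure_display) (T : measurableType d)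
  (P : probability T R) (F : filtration R T)
  (M : manifold R) (N Nt G : lie_group R) (K : metricType R)
  (Psi : K -> M -> Nt -> M)
  (Psi_smooth : psmooth_map (M := prod_atlas M Nt) (M' := M)
    (fun (p : M * Nt) (k : K) => Psi k p.1 p.2))
  (Psi_one : forall k x, Psi k x (lone Nt) = x)
  (Xi : G -> N -> Nt)
  (Xi_smooth : smooth_map (M := prod_atlas N G) (M' := Nt)
    (fun p : N * G => Xi p.2 p.1))
  (Xi_one : forall g, Xi g (lone N) = lone Nt)
  (k : R -> T -> K) (k_predictable : predictable F k)
  (k_bounded : locally_bounded P F k)
  (X : R -> T -> M) (X_semimartingale : semimartingale P F X)
  (Zt : R -> T -> Nt) (Zt_semimartingale : semimartingale P F Zt)
  (XZt_solution : canonical_sde P F Psi k X Zt)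
  (Z : R -> T -> N) (Z_semimartingale : semimartingale P F Z)
  (g : R -> T -> G) (g_predictable : predictable F g)
  (g_bounded : locally_bounded P F g)
  (Zt_transformed : transformed_noise P F Xi g Z Zt) :
  canonical_sde P F
    (fun (kg : K * G) (x : M) (z : N) => Psi kg.1 x (Xi kg.2 z))
    (fun t w => (k t w, g t w)) X Z.
Proof.
have [[Zt_semi _ sde2] _] := Zt_transformed.
have [_ cX _] := X_semimartingale; have [_ cZt _] := Zt_semimartingale.
have [aZ cZ _] := Z_semimartingale.
(* The goal provides embeddings of M and N and the extension of the composite map; what has to be
   produced is an embedding of Nt and extensions of the two given equations. *)
move=> m n i1 i2 Phi ei1 ei2 xPhi; have [p [e [_ ee]]] := lie_embedding_exists Nt.
have [Phi1 x1] : exists Phi1, extends_along (fun k x y' y => Psi k x (lmul y' (linv y))) i1 e Phi1.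
  apply: sde_extension_vec => // q W u v y oW su sv sy.
  have sp : ps (M := prod_atlas M Nt) W (fun r k => (u r k, lmul (v r k) (linv (y r k)))).
    by apply: ps_pair => //; apply: ps_lmul => //; exact: ps_linv.
  have ck r k0 : W (r, k0) -> {for k0, continuous (@id K)} by move=> _; exact: cvg_id.
  exact: (ps_psmooth_map oW (prod_chart_atlas (manifold_atlasP M) (manifold_atlasP Nt)) (manifold_atlasP M) Psi_smooth sp ck).
have [Phi2 x2] : exists Phi2, extends_along (fun h y z' z => lmul (Xi h (lmul z' (linv z))) y) e i2 Phi2.
  apply: sde_extension_vec => // q W u v y oW su sv sy; apply: ps_lmul => //.
  have sp : ps (M := prod_atlas N G) W (fun r h => (lmul (v r h) (linv (y r h)), h)).
    apply: ps_pair; first by apply: ps_lmul => //; exact: ps_linv.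
    by apply: (ps_param oW (manifold_atlasP G) (kappa := id)) => h; exact: cvg_id.
  exact: (ps_smooth_map oW (prod_chart_atlas (manifold_atlasP N) (manifold_atlasP G)) (manifold_atlasP Nt) Xi_smooth sp).
have [Jz [C [JC dr]]] := geometrical_driver sde2 cZt cZ ee ei2 x2.
have [Jy [C1 [JC1 dr1]]] := geometrical_driver XZt_solution cX cZt ei1 ee x1.
have [_ scG _ _ _] := manifold_axioms G.
apply: (composed_sde XZt_solution sde2 cX cZt cZ aZ _ _ _ ei1 ei2 ee x1 x2 dr dr1 xPhi) => //.
- by move=> q x y z' z /=; rewrite -lmulA lmulrV lmulr1.
- by move=> k0 x y; rewrite lmulrV Psi_one.
- by move=> h y z; rewrite lmulrV Xi_one lmul1.
- exact: predictable_pairC.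
- exact: locally_bounded2.
Qed.
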